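(* Let $\Omega\subset\mathbb{R}^n$ be a bounded $(\varepsilon,\infty)$-domain with $\varepsilon\in(0,1]$ and $\{\rho_\nu\}_{\nu\in(0,\nu_0)}$ a $\nu_0$-radial decreasing approximation of the identity on $\mathbb{R}^n$ with $\nu_0\in(0,\infty)$. Let $X(\mathbb{R}^n)$ be a ball Banach function space and $p\in[1,\infty)$. Assume that (i) $X(\mathbb{R}^n)$ has an absolutely continuous norm; (ii) $X^{\frac1p}(\mathbb{R}^n)$ is a ball Banach function space; (iii) the Hardy--Littlewood maximal operator $\mathcal{M}$ is bounded on $[X^{\frac1p}(\mathbb{R}^n)]'$. Then, for any $f\in\dot{W}^{1,X}(\Omega)$, $$\lim_{\nu\to0^+}\left\|\left[\int_\Omega\frac{|f(\cdot)-f(y)|^p}{|\cdot-y|^p}\rho_\nu(|\cdot-y|)\,dy\right]^{\frac1p}\right\|_{X(\Omega)}=\left[\kappa(p,n)\right]^{\frac1p}\left\|\,|\nabla f|\,\right\|_{X(\Omega)},$$ where $\kappa(p,n):=\int_{\mathbb{S}^{n-1}}|e\cdot\omega|^p\,d\sigma(\omega)=\frac{2\pi^{\frac{n-1}{2}}\Gamma(\frac{p+1}{2})}{\Gamma(\frac{p+n}{2})}$ with $e$ any unit vector in $\mathbb{R}^n$, $d\sigma$ the surface Lebesgue measure on the unit sphere $\mathbb{S}^{n-1}$, and $\Gamma$ the Gamma function.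
   Context: Ball Banach function spaces. $\mathscr{M}(E)$ is the set of all measurable functions on $E$. A quasi-Banach space $X(\mathbb{R}^n)\subset\mathscr{M}(\mathbb{R}^n)$, with a quasi-norm $\|\cdot\|_{X(\mathbb{R}^n)}$ which makes sense for all functions in $\mathscr{M}(\mathbb{R}^n)$ (values in $[0,\infty]$, $X(\mathbb{R}^n)$ consisting of the functions of finite quasi-norm), is a ball quasi-Banach function space if: (1) $\|f\|_{X(\mathbb{R}^n)}=0$ implies $f=0$ a.e.; (2) $|g|\le|f|$ a.e. implies $\|g\|_{X(\mathbb{R}^n)}\le\|f\|_{X(\mathbb{R}^n)}$; (3) $0\le f_k\uparrow f$ a.e. implies $\|f_k\|_{X(\mathbb{R}^n)}\uparrow\|f\|_{X(\mathbb{R}^n)}$; (4) $\mathbf{1}_B\in X(\mathbb{R}^n)$ for every ball $B$. It is a ball Banach function space if moreover: (5) $\|f+g\|_{X(\mathbb{R}^n)}\le\|f\|_{X(\mathbb{R}^n)}+\|g\|_{X(\mathbb{R}^n)}$ for all $f,g\in X(\mathbb{R}^n)$; (6) for every ball $B$ there is $C_{(B)}>0$ with $\int_B|f(x)|\,dx\le C_{(B)}\|f\|_{X(\mathbb{R}^n)}$ for all $f\in X(\mathbb{R}^n)$. For $q\in(0,\infty)$, the $q$-convexification is $X^q(\mathbb{R}^n):=\{f\in\mathscr{M}(\mathbb{R}^n):|f|^q\in X(\mathbb{R}^n)\}$ with $\|f\|_{X^q(\mathbb{R}^n)}:=\|\,|f|^q\|_{X(\mathbb{R}^n)}^{1/q}$.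 The associate space $Y'(\mathbb{R}^n)$ of a ball Banach function space $Y(\mathbb{R}^n)$ is the set of $f\in\mathscr{M}(\mathbb{R}^n)$ with $\|f\|_{Y'(\mathbb{R}^n)}:=\sup\{\|fg\|_{L^1(\mathbb{R}^n)}:\|g\|_{Y(\mathbb{R}^n)}=1\}<\infty$. $X(\mathbb{R}^n)$ has an absolutely continuous norm if, for any $f\in X(\mathbb{R}^n)$ and any measurable sets $E_j$ with $\mathbf{1}_{E_j}\to0$ a.e., one has $\|f\mathbf{1}_{E_j}\|_{X(\mathbb{R}^n)}\to0$. The Hardy--Littlewood maximal operator is $\mathcal{M}(f)(x):=\sup_{B\ni x}\frac1{|B|}\int_B|f(y)|\,dy$, the supremum over all balls $B$ containing $x$. Restrictive space. For open $\Omega\subset\mathbb{R}^n$, $X(\Omega):=\{f\in\mathscr{M}(\Omega): f=g|_\Omega\text{ for some }g\in X(\mathbb{R}^n)\}$, with $\|f\|_{X(\Omega)}:=\inf\{\|g\|_{X(\mathbb{R}^n)}: f=g|_\Omega,\ g\in X(\mathbb{R}^n)\}$. $\dot{W}^{1,X}(\Omega)$ is the set of $f\in L^1_{\mathrm{loc}}(\Omega)$ whose first-order weak partial derivatives all exist and belong to $X(\Omega)$; $\nabla f$ is the weak gradient. For $\varepsilon\in(0,1]$, an open set $\Omega\subset\mathbb{R}^n$ is an $(\varepsilon,\infty)$-domain if, for any $x,y\in\Omega$ with $x\ne y$, there is a rectifiable curve $\Gamma$ lying in $\Omega$, connecting $x$ and $y$, with Euclidean length $\ell(\Gamma)\le\varepsilon^{-1}|x-y|$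 and $\mathrm{dist}(z,\partial\Omega)\ge\frac{\varepsilon|x-z||y-z|}{|x-y|}$ for any point $z$ on $\Gamma$. A $\nu_0$-radial decreasing approximation of the identity on $\mathbb{R}^n$ is a family $\{\rho_\nu\}_{\nu\in(0,\nu_0)}$ of nonnegative locally integrable functions on $(0,\infty)$ such that each $\rho_\nu$ is decreasing on $(0,\infty)$, $\int_0^\infty\rho_\nu(r)r^{n-1}\,dr=1$ for every $\nu\in(0,\nu_0)$, and $\lim_{\nu\to0^+}\int_\delta^\infty\rho_\nu(r)r^{n-1}\,dr=0$ for every $\delta\in(0,\infty)$. *)

(* Defs.v *)
From HB Require Import structures.
From mathcomp Require Import all_boot all_order all_algebra.
From mathcomp Require Import all_classical all_reals all_analysis.
From mathcomp Require Import measurable_realfun.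

Set Implicit Arguments.
Unset Strict Implicit.
Unset Printing Implicit Defensive.

Import Order.TTheory GRing.Theory Num.Theory.
Import numFieldTopology.Exports numFieldNormedType.Exports.

Local Open Scope classical_set_scope.
Local Open Scope ring_scope.

(* The Euclidean space of dimension n.+1 >= 1 is 'rV[R]_n.+1. The library norm
   on row vectors is the sup norm: it is used only through the topology it
   induces (and the boundedness notion), metric notions use [enorm]. *)

Definition dotv (R : realType) (d : nat) (x y : 'rV[R]_d) : R :=
  \sum_(i < d) x 0 i * y 0 i.

Definition enorm (R : realType) (d : nat) (x : 'rV[R]_d) : R :=
  Num.sqrt (\sum_(i < d) x 0 i ^+ 2).

Definition eball (R : realType) (d : nat) (c : 'rV[R]_d) (r : R)
  : set 'rV[R]_d := [set x | enorm (x - c) < r].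

Section lebesgue_outer.
Context (R : realType) (n : nat).
Local Notation V := 'rV[R]_n.+1.
Local Open Scope ereal_scope.

(* A pair (a, b) encodes the half-open box of all x with a_i < x_i <= b_i for
   every i; it is empty as soon as b_i <= a_i for some i. *)
Definition box (B : V * V) : set V :=
  [set x | forall i, (B.1 0 i < x 0 i <= B.2 0 i)%R].

Definition box_volume (B : V * V) : R :=
  (\prod_(i < n.+1) Num.max 0 (B.2 0 i - B.1 0 i))%R.

Definition box_cover (A : set V) : set (nat -> V * V) :=
  [set B | A `<=` \bigcup_k box (B k)].

Definition lebesgue_outer (A : set V) : \bar R :=
  ereal_inf [set \sum_(k <oo) (box_volume (B k))%:E | B in box_cover A].

Lemma box_volume_ge0 (B : V * V) : 0 <= (box_volume B)%:E.
Proof. by rewrite lee_fin; apply: prodr_ge0 => i _; rewrite le_max lexx. Qed.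

Lemma lebesgue_outer_ge0 (A : set V) : 0 <= lebesgue_outer A.
Proof.
apply: le_ereal_inf_tmp => _ [B _ <-].
by apply: nneseries_ge0 => k _ _; exact: box_volume_ge0.
Qed.

Lemma le_lebesgue_outer :
  {homo lebesgue_outer : A B / A `<=` B >-> A <= B}.
Proof.
move=> A A' AA'; apply: ereal_inf_le_tmp => _ [B A'B <-].
by exists B => //; exact: subset_trans AA' A'B.
Qed.

Lemma lebesgue_outer0 : lebesgue_outer set0 = 0.
Proof.
apply/eqP; rewrite eq_le lebesgue_outer_ge0 andbT.
apply: ereal_inf_lbound; exists (fun=> (0 : V, 0 : V)%R); first exact: sub0set.
rewrite eseries0// => k _ _.
by rewrite /box_volume /= big_ord_recl !mxE subrr maxxx mul0r.
Qed.

Lemma lebesgue_outer_sigma_subadditive : sigma_subadditive lebesgue_outer.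
Proof.
move=> A; have [[i ioo]|] := pselect (exists i, lebesgue_outer (A i) = +oo).
  rewrite (eseries_pinfty _ _ ioo) ?leey// => k _.
  by rewrite -ltNye (lt_le_trans _ (lebesgue_outer_ge0 _)).
rewrite -forallNE => Aoo.
apply/lee_addgt0Pr => e e0.
rewrite (le_trans _ (epsilon_trick _ _ _))//; last 2 first.
  by move=> k; exact: lebesgue_outer_ge0.
  exact: ltW.
have [G PG] : {G : nat -> nat -> V * V & forall k, box_cover (A k) (G k) /\
    \sum_(j <oo) (box_volume (G k j))%:E <=
      lebesgue_outer (A k) + (e / (2 ^ k.+1)%:R)%:E}.
  apply: (@choice _ _ (fun k (B : nat -> V * V) => box_cover (A k) B /\
    \sum_(j <oo) (box_volume (B j))%:E <=
      lebesgue_outer (A k) + (e / (2 ^ k.+1)%:R)%:E)) => k.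
  have fA : lebesgue_outer (A k) \is a fin_num.
    by rewrite ge0_fin_numE ?lebesgue_outer_ge0// ltey; exact/eqP/Aoo.
  have ek : (0 < e / (2 ^ k.+1)%:R)%R.
    by rewrite divr_gt0// ltr0n expn_gt0.
  have [_ [B AB <-] /ltW BA] := lb_ereal_inf_adherent ek fA.
  by exists B.
pose v (jk : nat * nat) := (box_volume (G jk.1 jk.2))%:E.
have v0 jk : 0 <= v jk by exact: box_volume_ge0.
have /card_esym/ppcard_eqP[f] := card_nat2.
apply: (@le_trans _ _ (\sum_(i <oo) v (f i))).
  apply: ereal_inf_lbound; exists (fun i => G (f i).1 (f i).2) => //.
  move=> t [k _ /(PG k).1 [j _ tGkj]].
  by exists (f^-1%FUN (k, j)) => //=; rewrite invK ?inE.
have -> : \sum_(i <oo) v (f i) = \sum_(i <oo) \sum_(j <oo) v (i, j).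
  transitivity (\esum_(i in [set: nat * nat]) v i).
    rewrite -(esum_pred_image v _ xpredT) ?[fun=> _]set_true//.
      by rewrite image_eq.
  pose J : nat -> set (nat * nat) := fun i => [set (i, j) | j in setT].
  rewrite (_ : setT = \bigcup_k J k); last first.
    by rewrite predeqE => -[a b]; split => // _; exists a => //; exists b.
  rewrite esum_bigcupT //=; last first.
    apply/trivIsetP => i j _ _ ij.
    rewrite predeqE => -[k m] /=; split => //= -[] [_] _ [<-{k} _].
    by move=> [m' _] [] /esym/eqP; rewrite (negbTE ij).
  rewrite -(image_id [set: nat]) -fun_true esum_pred_image//; last first.
    by move=> k _; exact: esum_ge0.
  apply: eq_eseriesr => /= j _.
  rewrite -(esum_pred_image v (pair j) predT)//=; last first.
    by move=> ? ? _ _; exact: (@can_inj _ _ _ snd).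
  by congr esum; rewrite predeqE => -[a b]; split; move=> [i _ <-]; exists i.
by apply: lee_nneseries => [k _ _|k _]; [exact: nneseries_ge0|exact: (PG k).2].
Qed.

HB.instance Definition _ := isOuterMeasure.Build R V lebesgue_outer
  lebesgue_outer0 lebesgue_outer_ge0 le_lebesgue_outer
  lebesgue_outer_sigma_subadditive.

End lebesgue_outer.

(* Row vectors carry the Lebesgue (Caratheodory) sigma-algebra, which is
   complete and contains the Borel sets. *)
HB.instance Definition _ (R : realType) (n : nat) :=
  @isMeasurable.Build (caratheodory_display (@lebesgue_outer R n))
    'rV[R]_n.+1 (@lebesgue_outer R n).-caratheodory
    (caratheodory_measurable_set0 (@lebesgue_outer R n))
    (@caratheodory_measurable_setC _ _ (@lebesgue_outer R n))
    (@caratheodory_measurable_bigcup _ _ (@lebesgue_outer R n)).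

Definition lebesgue_rV (R : realType) (n : nat)
  : set 'rV[R]_n.+1 -> \bar R := @lebesgue_outer R n.

HB.instance Definition _ (R : realType) (n : nat) :=
  isMeasure.Build _ 'rV[R]_n.+1 R (@lebesgue_rV R n)
    (caratheodory_measure0 (@lebesgue_outer R n))
    (@caratheodory_measure_ge0 _ _ (@lebesgue_outer R n))
    (@caratheodory_measure_sigma_additive _ _ (@lebesgue_outer R n)).

Section sphere.
Context (R : realType) (n : nat).

Definition usphere : set 'rV[R]_n.+1 := [set w | enorm w = 1].

(* sigma(A) is the dimension times the volume of the truncated cone over A;
   the sphere carries its Borel sigma-algebra, because every subset of the
   sphere is Lebesgue negligible, hence Lebesgue measurable, in the ambient
   space. In dimension 1 this is the counting measure on {-1, 1}. *)
Definition sphere_measure (A : set (g_sigma_algebraType (@open 'rV[R]_n.+1)))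
  : \bar R :=
  ((n.+1%:R)%:E * @lebesgue_rV R n
     [set x | (0 < enorm x <= 1)%R /\ A ((enorm x)^-1 *: x)%R])%E.

Definition kappa (p : R) (e : 'rV[R]_n.+1) : \bar R :=
  (\int[sphere_measure]_(w in usphere) (`|dotv e w| `^ p)%:E)%E.

End sphere.

Definition Gamma (R : realType) (s : R) : R :=
  (\int[@lebesgue_measure R]_(t in `]0%R, +oo[) (t `^ (s - 1) * expR (- t)))%R.

Section ball_Banach_function_spaces.
Context (R : realType) (n : nat).
Local Notation V := 'rV[R]_n.+1.
Local Notation mu := (@lebesgue_rV R n).
Local Open Scope ereal_scope.

(* A space X is given by its quasi-norm N, only ever constrained on measurable
   functions; functions are extended-real-valued, which is needed for N to
   apply to functions defined by integrals and suprema. *)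
Definition in_space (N : (V -> \bar R) -> \bar R) (f : V -> \bar R) : Prop :=
  measurable_fun setT f /\ N f < +oo.

Record ball_quasi_Banach (N : (V -> \bar R) -> \bar R) : Prop := {
  qnorm_ge0 : forall f, measurable_fun setT f -> 0 <= N f ;
  qnorm_homogeneous : forall (c : R) f, in_space N f ->
    N (fun x => c%:E * f x) = `|c|%:E * N f ;
  qnorm_quasi_triangle : exists K : R, forall f g,
    in_space N f -> in_space N g -> N (f \+ g) <= K%:E * (N f + N g) ;
  qnorm_complete : forall f_ : nat -> V -> \bar R,
    (forall k, in_space N (f_ k)) ->
    (forall e : R, (0 < e)%R -> exists K : nat, forall j k,
      (K <= j)%N -> (K <= k)%N -> N (f_ j \- f_ k) <= e%:E) ->
    exists2 f, in_space N f & N (f_ k \- f) @[k --> \oo] --> 0 ;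
  qnorm_eq0 : forall f, measurable_fun setT f -> N f = 0 ->
    \forall x \ae mu, f x = 0 ;
  qnorm_lattice : forall f g,
    measurable_fun setT f -> measurable_fun setT g ->
    (\forall x \ae mu, `|g x| <= `|f x|) -> N g <= N f ;
  qnorm_Fatou : forall (f_ : nat -> V -> \bar R) (f : V -> \bar R),
    (forall k, measurable_fun setT (f_ k)) -> measurable_fun setT f ->
    (\forall x \ae mu, [/\ forall k, 0 <= f_ k x,
       nondecreasing_seq (f_ ^~ x) & f_ k x @[k --> \oo] --> f x]) ->
    nondecreasing_seq (fun k => N (f_ k)) /\ N (f_ k) @[k --> \oo] --> N f ;
  qnorm_ball : forall (c : V) (r : R), (0 < r)%R ->
    in_space N (fun x => (\1_(eball c r) x)%:E) }.

Record ball_Banach (N : (V -> \bar R) -> \bar R) : Prop := {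
  ball_Banach_quasi : ball_quasi_Banach N ;
  norm_triangle : forall f g, in_space N f -> in_space N g ->
    N (f \+ g) <= N f + N g ;
  norm_integral_ball : forall (c : V) (r : R), (0 < r)%R ->
    exists2 C : R, (0 < C)%R & forall f, in_space N f ->
      \int[mu]_(x in eball c r) `|f x| <= C%:E * N f }.

Definition convexification (q : R) (N : (V -> \bar R) -> \bar R)
    (f : V -> \bar R) : \bar R :=
  N (fun x => `|f x| `^ q) `^ q^-1.

Definition associate (N : (V -> \bar R) -> \bar R) (f : V -> \bar R) : \bar R :=
  ereal_sup [set \int[mu]_x `|f x * g x| |
    g in [set g : V -> \bar R | measurable_fun setT g /\ N g = 1]].

Definition absolutely_continuous_norm (N : (V -> \bar R) -> \bar R) : Prop :=
  forall (f : V -> \bar R) (E : nat -> set V), in_space N f ->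
    (forall j, measurable (E j)) ->
    (\forall x \ae mu, (\1_(E j) x : R) @[j --> \oo] --> (0 : R)%R) ->
    N (fun x => f x * (\1_(E j) x)%:E) @[j --> \oo] --> 0.

Definition maximal_rV (f : V -> \bar R) (x : V) : \bar R :=
  ereal_sup [set (fine (mu (eball B.1 B.2)))^-1%:E *
                 \int[mu]_(y in eball B.1 B.2) `|f y| |
    B in [set B : V * R | (0 < B.2)%R /\ eball B.1 B.2 x]].

Definition maximal_bounded (N : (V -> \bar R) -> \bar R) : Prop :=
  exists C : R, forall f, in_space N f -> N (maximal_rV f) <= C%:E * N f.

(* Functions on Omega are represented by functions on the whole space whose
   values outside Omega are irrelevant. *)
Definition restrict_norm (N : (V -> \bar R) -> \bar R) (Omega : set V)
    (f : V -> \bar R) : \bar R :=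
  ereal_inf [set N g |
    g in [set g | in_space N g /\ f = g %[ae mu in Omega]]].

Definition in_restrict_space (N : (V -> \bar R) -> \bar R) (Omega : set V)
    (f : V -> \bar R) : Prop :=
  measurable_fun Omega f /\
  exists2 g, in_space N g & f = g %[ae mu in Omega].

End ball_Banach_function_spaces.

Section weak_derivatives.
Context (R : realType) (n : nat).
Local Notation V := 'rV[R]_n.+1.
Local Notation mu := (@lebesgue_rV R n).

Definition locally_integrable_rV (Omega : set V) (f : V -> R) : Prop :=
  measurable_fun Omega f /\
  forall K : set V, K `<=` Omega -> compact K ->
    (\int[mu]_(x in K) `|f x|%:E < +oo)%E.

Definition partial (i : 'I_n.+1) (f : V -> R) (x : V) : R :=
  'D_(delta_mx 0 i) f x.

Definition smooth (phi : V -> R) : Prop :=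
  forall s : seq 'I_n.+1, let psi := foldr partial phi s in
    continuous psi /\
    forall (i : 'I_n.+1) (x : V), derivable psi x (delta_mx 0 i).

Definition test_function (Omega : set V) (phi : V -> R) : Prop :=
  [/\ smooth phi, compact (closure [set x | phi x != 0]) &
      closure [set x | phi x != 0] `<=` Omega].

Definition weak_partial (Omega : set V) (i : 'I_n.+1) (f g : V -> R) : Prop :=
  locally_integrable_rV Omega g /\
  forall phi, test_function Omega phi ->
    (\int[mu]_(x in Omega) (f x * partial i phi x)%:E =
     - \int[mu]_(x in Omega) (g x * phi x)%:E)%E.

Definition weak_gradient (Omega : set V) (f : V -> R) (G : V -> V) : Prop :=
  forall i, weak_partial Omega i f (fun x => G x 0 i).

Definition homogeneous_Sobolev (N : (V -> \bar R) -> \bar R) (Omega : set V)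
    (f : V -> R) : Prop :=
  locally_integrable_rV Omega f /\
  forall i, exists2 g, weak_partial Omega i f g &
    in_restrict_space N Omega (EFin \o g).

End weak_derivatives.

Section eps_infty_domains.
Context (R : realType) (n : nat).
Local Notation V := 'rV[R]_n.+1.

(* Euclidean counterpart of the library's [variation] and [total_variation]. *)
Definition curve_length (a b : R) (gamma : R -> V) : \bar R :=
  ereal_sup [set (let F := gamma \o nth b (a :: s) in
      \sum_(0 <= k < size s) enorm (F k.+1 - F k))%:E |
    s in itv_partition a b].

(* +oo when A is empty *)
Definition dist_to (A : set V) (z : V) : \bar R :=
  ereal_inf [set (enorm (z - w))%:E | w in A].

Definition eps_infty_domain (eps : R) (Omega : set V) : Prop :=
  open Omega /\
  forall x y, Omega x -> Omega y -> x != y ->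
  exists gamma : R -> V,
    [/\ {within `[0, 1], continuous gamma},
        gamma 0 = x /\ gamma 1 = y,
        forall t, t \in `[0, 1] -> Omega (gamma t),
        (curve_length 0 1 gamma <= (eps^-1 * enorm (x - y))%:E)%E &
        forall t, t \in `[0, 1] ->
          ((eps * enorm (x - gamma t) * enorm (y - gamma t)
             / enorm (x - y))%:E <=
           dist_to (closure Omega `\` interior Omega) (gamma t))%E].

End eps_infty_domains.

Record radial_decreasing_approximation (R : realType) (d : nat) (nu0 : R)
    (rho : R -> R -> R) : Prop := {
  approx_ge0 : forall nu r, 0 < nu < nu0 -> 0 < r -> 0 <= rho nu r ;
  approx_loc : forall nu, 0 < nu < nu0 ->
    locally_integrable `]0, +oo[ (rho nu) ;
  approx_decreasing : forall nu r s, 0 < nu < nu0 -> 0 < r -> r <= s ->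
    rho nu s <= rho nu r ;
  approx_mass : forall nu, 0 < nu < nu0 ->
    (\int[@lebesgue_measure R]_(r in `]0%R, +oo[) (rho nu r * r ^+ d.-1)%:E
       = 1)%E ;
  approx_concentration : forall delta : R, 0 < delta ->
    (\int[@lebesgue_measure R]_(r in `]delta, +oo[) (rho nu r * r ^+ d.-1)%:E
       @[nu --> 0^'+] --> 0)%E }.

Definition nonlocal_gradient (R : realType) (n : nat) (Omega : set 'rV[R]_n.+1)
    (p : R) (rho : R -> R) (f : 'rV[R]_n.+1 -> R) (x : 'rV[R]_n.+1) : \bar R :=
  ((\int[@lebesgue_rV R n]_(y in Omega)
      (`|f x - f y| `^ p / enorm (x - y) `^ p * rho (enorm (x - y)))%:E)
   `^ p^-1)%E.

(* Main.v *)
(* With Y the 1/p-convexification of X, the claim is that the Y-norm of the p-th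
   power of the nonlocal gradient tends to kappa times that of |grad f|^p. Chains
   of balls in the domain bound |f x - f y - G x . (x - y)| by a potential of
   |G - G x|; integrated against rho_nu it becomes a kernel whose transpose is
   dominated by the maximal operator. Boundedness of the latter on Y' and duality
   (Y'' = Y on nonnegative functions) control the remainder by the Y-norm of
   |G - v|^p for Lipschitz fields v, which absolute continuity of the norm makes
   small. The linear part is computed exactly in polar coordinates. *)
From HB Require Import structures.
Require Import Defs.
From mathcomp Require Import all_boot all_order all_algebra.
From mathcomp Require Import all_classical all_reals all_analysis.
From mathcomp Require Import measurable_realfun.
From mathcomp Require Import ring lra.

Set Implicit Arguments.
Unset Strict Implicit.
Unset Printing Implicit Defensive.

Import Order.TTheory GRing.Theory Num.Theory.
Import numFieldTopology.Exports numFieldNormedType.Exports.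

Local Open Scope classical_set_scope.
Local Open Scope ring_scope.


(* Bypasses the hint [measurable_cst], whose unification with an arbitrary
   integrand unfolds definitions without bound. *)
Ltac done ::=
  lazymatch goal with
  | |- measurable_fun _ (fun _ : bool => _) => solve [move=> ? ? ?; trivial]
  | |- measurable_fun _ (fun x => x) => solve [trivial]
  | |- measurable_fun _ (fun _ => ?c) => solve [trivial]
  | |- measurable_fun _ (fun x => @?g x) => solve [trivial with nocore]
  | |- _ =>
    trivial; hnf; intros; solve
    [ do ![ solve [ trivial | simple refine (@sym_equal _ _ _ _); trivial ]
          | discriminate | contradiction | split ]
    | match goal with H : ~ _ |- _ => solve [ case H; trivial ] end ]
  end.

(** The field [G - G x] in the potential changes with [x], so no operator bound applies to it
    directly. Writing [G z - G x = (G z - v z) + (v z - v x) - (G x - v x)] leaves three terms: an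
    operator acting on [|G - v|^p], estimated by duality; a term small near [x] because [v] is
    Lipschitz, and far from [x] because the mass of [rho_nu] concentrates; and [|G x - v x|^p] times
    a bounded mass. Hence [v] is fixed before [nu]. The null set of exceptional points must not
    depend on the vector [G x]: a point good for [f] stays good after any linear function is
    subtracted. Averages use products of one-variable bumps, so that two of them are compared by
    exchanging one factor at a time, each exchange being an integration by parts in a single
    coordinate. The potential has the decay exponent [n + 1/2]: more than [n] for the series over
    the scales [4^-k], less than the dimension [n + 1] for integrability. The lower bound on the
    linear part is lost on a layer along the boundary, negligible by absolute continuity. *)

(** * Lebesgue measure of boxes, and its behaviour under affine maps *)

Section push.
Context d d' (T1 : measurableType d) (T2 : measurableType d') (R : realType).
Context (m : {measure set T1 -> \bar R}) (f : T1 -> T2) (mf : measurable_fun setT f).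

Definition push : {measure set T2 -> \bar R} :=
  measure_function_pushforward__canonical__measure_function_Measure m mf.

Lemma pushE A : push A = m (f @^-1` A). Proof. by []. Qed.

Lemma ge0_integral_push (g : T2 -> \bar R) :
  measurable_fun setT g -> (forall y, 0 <= g y)%E ->
  (\int[push]_y g y = \int[m]_x g (f x))%E.
Proof. by move=> mg g0; rewrite ge0_integral_pushforward. Qed.

End push.

Section boxes.
Context (R : realType) (n : nat).
Local Notation V := 'rV[R]_n.+1.
Local Notation mu := (@lebesgue_rV R n).

Definition upd (x : V) (i : 'I_n.+1) (t : R) : V :=
  \row_j (if j == i then t else x 0 j).

(** A hyperplane orthogonal to a coordinate axis cuts every box of a cover into two boxes whose
    volumes add up, so the outer measure is additive across it. *)
Lemma measurable_half_space (i : 'I_n.+1) (t : R) :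
  measurable [set x : V | x 0 i <= t].
Proof.
apply: le_caratheodory_measurable => X.
apply: le_ereal_inf_tmp => _ [B XB <-].
pose B1 k : V * V := ((B k).1, upd (B k).2 i (Num.min ((B k).2 0 i) t)).
pose B2 k : V * V := (upd (B k).1 i (Num.max ((B k).1 0 i) t), (B k).2).
have volE k : (box_volume (B k))%:E =
    ((box_volume (B1 k))%:E + (box_volume (B2 k))%:E)%E.
  rewrite -EFinD; congr (_%:E); rewrite /box_volume.
  rewrite (bigD1 i)//= [X in _ = X + _](bigD1 i)//= [X in _ = _ + X](bigD1 i)//=.
  rewrite !mxE eqxx.
  rewrite [X in _ = _ * X + _](eq_bigr (fun j => Num.max 0 ((B k).2 0 j - (B k).1 0 j))); last first.
    by move=> j /negbTE ji; rewrite !mxE ji.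
  rewrite [X in _ = _ + _ * X](eq_bigr (fun j => Num.max 0 ((B k).2 0 j - (B k).1 0 j))); last first.
    by move=> j /negbTE ji; rewrite !mxE ji.
  rewrite -mulrDl; congr (_ * _).
  move: ((B k).2 0 i) ((B k).1 0 i) => b a.
  rewrite /Num.max /Num.min.
  by repeat case: ifPn; rewrite -?leNgt; lra.
rewrite (eq_eseriesr (fun k _ => volE k)) nneseriesD; [|by move=> *; exact: box_volume_ge0..].
apply: leeD; apply: ereal_inf_lbound.
- exists B1 => // x [Xx /= xt]; have [k _ Bk] := XB _ Xx; exists k => // j.
  have /andP[h1 h2] := Bk j.
  by rewrite /B1 /= !mxE h1 /=; case: eqP => // ->; rewrite le_min xt (andP (Bk i)).2.
- exists B2 => // x [Xx /= /negP]; rewrite -ltNge => xt.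
  have [k _ Bk] := XB _ Xx; exists k => // j.
  have /andP[h1 h2] := Bk j.
  by rewrite /B2 /= !mxE h2 andbT; case: eqP => // ->; rewrite gt_max xt (andP (Bk i)).1.
Qed.

Lemma measurable_coord (i : 'I_n.+1) : measurable_fun setT (fun x : V => x 0 i).
Proof.
apply: (measurability _ (RGenOInfty.measurableE R)) => _ [_ [a ->] <-].
rewrite setTI [X in measurable X](_ : _ = ~` [set x : V | x 0 i <= a]).
  by apply: measurableC; exact: measurable_half_space.
by apply/seteqP; split => x /=; rewrite in_itv/= andbT ltNge => /negP.
Qed.

Lemma measurable_box (B : V * V) : measurable (box B).
Proof.
rewrite (_ : box B = \bigcap_(i in [set: 'I_n.+1])
    ((fun x : V => x 0 i) @^-1` `]B.1 0 i, B.2 0 i])).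
  apply: fin_bigcap_measurable => // i _.
  by rewrite -[X in measurable X]setTI; apply: measurable_coord => //; exact: measurable_itv.
apply/seteqP; split => [x h i _|x h i] /=; first by rewrite in_itv/=; exact: h.
by have := h i I; rewrite /= in_itv.
Qed.

(* Integrating one coordinate at a time reduces countable subadditivity of the
   volume of boxes to the line. *)
Lemma box_volume_cover (B : V * V) (C : nat -> V * V) :
  box B `<=` \bigcup_k box (C k) ->
  ((box_volume B)%:E <= \sum_(k <oo) (box_volume (C k))%:E)%E.
Proof.
move=> BC.
pose len (D : V * V) i := Num.max 0 (D.2 0 i - D.1 0 i).
pose ind (D : V * V) i (x : V) : R := \1_(`]D.1 0 i, D.2 0 i]%classic) (x 0 i).
(* Interpolates between the indicator of the box [D] ([j = 0]) and its volume ([j = n.+1]);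
   integrating over coordinate [j] turns one indicator factor into a side length. *)
pose m j D (x : V) := \prod_(i < n.+1) (if (i < j)%N then len D i else ind D i x).
have m_ge0 j D x : 0 <= m j D x.
  by apply: prodr_ge0 => i _; case: ifP => _; rewrite ?le_max ?lexx// /ind indicE.
have key j x : (j <= n.+1)%N -> ((m j B x)%:E <= \sum_(k <oo) (m j (C k) x)%:E)%E.
  elim: j x => [x _|j IH x jn].
    have [/= Bx|nBx] := pselect (box B x).
      have [k _ Ckx] := BC _ Bx.
      have mk : m 0%N (C k) x = 1.
        by rewrite /m big1// => i _; rewrite /ind indicE mem_set//= in_itv/=; exact: Ckx.
      apply: (@le_trans _ _ 1%:E).
        rewrite lee_fin -(@big1 _ 1 *%R _ (index_enum 'I_n.+1) xpredT (fun _ => 1)) //.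
        apply: ler_prod => i _ /=.
        by rewrite /ind indicE ler0n lern1 leq_b1.
      rewrite -mk; apply: (@le_trans _ _ (\sum_(i < k.+1) (m 0%N (C i) x)%:E)%E).
        rewrite big_ord_recr/= leeDr// sume_ge0// => i _.
        by rewrite lee_fin.
      rewrite -(big_mkord xpredT (fun i => (m 0%N (C i) x)%:E)).
      by apply: nneseries_lim_ge => i _ _; rewrite lee_fin.
    have [i iB] : exists i, ~ (B.1 0 i < x 0 i <= B.2 0 i) by exact/existsNP.
    rewrite (_ : m 0%N B x = 0); first by apply: nneseries_ge0 => k _ _; rewrite lee_fin.
    by rewrite /m (bigD1 i)//= /ind indicE memNset ?mul0r//=.
  have jn' : (j < n.+1)%N by [].
  pose i0 := Ordinal jn'.
  have mE D t : m j D (upd x i0 t) = \1_(`]D.1 0 i0, D.2 0 i0]%classic) t *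
      \prod_(i < n.+1 | i != i0) (if (i < j)%N then len D i else ind D i x).
    rewrite /m (bigD1 i0)//= ltnn /ind !mxE eqxx; congr (_ * _).
    by apply: eq_bigr => i /negbTE ii0; rewrite !mxE ii0.
  have mS D : (m j.+1 D x)%:E =
      (\int[@lebesgue_measure R]_t (m j D (upd x i0 t))%:E)%E.
    under eq_integral do rewrite mE EFinM muleC.
    rewrite ge0_integralZl//; last 2 first.
    - by apply/measurable_EFinP; exact: measurable_indic.
    - by rewrite lee_fin; apply: prodr_ge0 => i _; case: ifP => _; rewrite ?le_max ?lexx// /ind indicE.
    rewrite (@integral_indic _ _ _ (@lebesgue_measure R))// setIT /= lebesgue_measure_itv/= lte_fin -EFinB.
    have -> : (if D.1 0 i0 < D.2 0 i0 then (D.2 0 i0 - D.1 0 i0)%:E else 0%E) = (len D i0)%:E.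
      by rewrite /len /Num.max subr_gt0; case: ifP.
    rewrite [m j.+1 D x](bigD1 i0)//= ltnSn -EFinM mulrC.
    congr (_ * _)%:E; apply: eq_bigr => i ii0.
    rewrite ltnS leq_eqVlt -(inj_eq val_inj)/= in ii0 *.
    by rewrite (negbTE ii0).
  have mm D : measurable_fun setT (fun t : R => (m j D (upd x i0 t))%:E).
    apply/measurable_EFinP; rewrite (_ : (fun _ => _) = (fun t => \1_(`]D.1 0 i0, D.2 0 i0]%classic) t *
      \prod_(i < n.+1 | i != i0) (if (i < j)%N then len D i else ind D i x))).
      by apply: measurable_funM => //; exact: measurable_indic.
    by apply/funext => t; rewrite mE.
  rewrite mS; under eq_eseriesr do rewrite mS.
  rewrite -integral_nneseries//; last by move=> k t _; rewrite lee_fin.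
  apply: ge0_le_integral => //.
  - by move=> t _; rewrite lee_fin.
  - exact: mm.
  - by apply: ge0_emeasurable_sum => [k t _ _|k _]; [rewrite lee_fin|exact: mm].
  - by move=> t _; apply: IH; exact: ltnW.
  by move=> k; exact: mm.
have mB D : m n.+1 D 0 = box_volume D by apply: eq_bigr => i _; rewrite ltn_ord.
have := key n.+1 0 (leqnn _); rewrite mB.
by under eq_eseriesr do rewrite mB.
Qed.

(** The box itself, followed by empty boxes, is a cover; [box_volume_cover] is the other
    inequality. *)
Lemma lebesgue_rV_box (B : V * V) : mu (box B) = (box_volume B)%:E.
Proof.
apply/eqP; rewrite eq_le; apply/andP; split.
  have vol0 : box_volume ((0, 0) : V * V) = 0.
    by rewrite /box_volume/= big_ord_recl !mxE subrr maxxx mul0r.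
  have := @ereal_inf_lbound _ [set (\sum_(k <oo) (box_volume (C k))%:E)%E | C in box_cover (box B)].
  move=> /(_ (box_volume B)%:E); apply.
  exists (fun k => if k == 0%N then B else (0, 0)).
    by move=> x Bx; exists 0%N.
  rewrite (nneseries_split 0 1); last by move=> k _; exact: box_volume_ge0.
  rewrite add0n big_nat1 eseries0 ?adde0// => -[|k]//= _ _.
  by rewrite vol0.
apply: le_ereal_inf_tmp => _ [C BC <-]; exact: box_volume_cover.
Qed.

Lemma box_empty : box ((0, 0) : V * V) = set0.
Proof.
apply/seteqP; split => // x /= /(_ ord0) /=.
by rewrite mxE => /andP[/lt_le_trans/[apply]]; rewrite ltxx.
Qed.

(** Boxes with rational corners are enumerated by [pickle]; those not contained in [U], and the
    integers that are no code, contribute the empty box [(0, 0)]. *)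
Lemma open_bigcup_box (U : set V) : open U ->
  exists B : nat -> V * V, U = \bigcup_k box (B k).
Proof.
move=> oU.
pose bx (ab : seq rat * seq rat) : V * V :=
  (\row_i ratr (nth 0%Q ab.1 i), \row_i ratr (nth 0%Q ab.2 i)).
pose B (k : nat) : V * V := if (unpickle k : option (seq rat * seq rat)) is Some ab then
  if `[< box (bx ab) `<=` U >] then bx ab else (0, 0) else (0, 0).
exists B; apply/seteqP; split => [x Ux|x [k _]]; last first.
  rewrite /B; case: unpickle => [ab|]; last by rewrite box_empty.
  by case: ifPn => [/asboolP h|_]; [exact: h|rewrite box_empty].
have [e /= e0 eU] : exists2 e : R, 0 < e & ball x e `<=` U.
  by have /nbhs_ballP[e e0 h] := oU _ Ux; exists e.
have /choice[l hl] (i : 'I_n.+1) : exists q : rat, x 0 i - e / 2 < ratr q < x 0 i.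
  have [|q] := @rat_in_itvoo R (x 0 i - e / 2) (x 0 i); first lra.
  by rewrite in_itv/= => h; exists q.
have /choice[u hu] (i : 'I_n.+1) : exists q : rat, x 0 i < ratr q < x 0 i + e / 2.
  have [|q] := @rat_in_itvoo R (x 0 i) (x 0 i + e / 2); first lra.
  by rewrite in_itv/= => h; exists q.
have nE (f : 'I_n.+1 -> rat) (i : 'I_n.+1) : nth 0%Q [seq f i | i <- enum 'I_n.+1] i = f i.
  by rewrite (nth_map ord0) ?size_enum_ord// nth_ord_enum.
pose ab := ([seq l i | i <- enum 'I_n.+1], [seq u i | i <- enum 'I_n.+1]).
exists (pickle ab) => //; rewrite /B pickleK.
have abU : box (bx ab) `<=` U.
  move=> y /= hy; apply: eU; split => // i j; rewrite (ord1 i) /ball/=.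
  have := hy j; rewrite !mxE !nE => /andP[h1 h2].
  have /andP[h3 h4] := hl j; have /andP[h5 h6] := hu j.
  by rewrite ltr_norml; apply/andP; split; lra.
rewrite asboolT// => i; rewrite !mxE !nE.
by have /andP[h3 h4] := hl i; have /andP[h5 h6] := hu i; rewrite h4 ltW.
Qed.

Lemma measurable_open (U : set V) : open U -> measurable U.
Proof.
by move=> /open_bigcup_box[B ->]; apply: bigcupT_measurable => k; exact: measurable_box.
Qed.

(** Open sets are countable unions of boxes, so measurable coordinates suffice for them. For
    arbitrary Lebesgue sets they would not, the sigma-algebra being complete. *)
Lemma measurable_preimage_open d (T : measurableType d) (f : T -> V) (U : set V) :
  (forall i, measurable_fun setT (fun t => f t 0 i)) ->
  open U -> measurable (f @^-1` U).
Proof.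
move=> mf /open_bigcup_box[B ->]; rewrite preimage_bigcup.
apply: bigcupT_measurable => k.
rewrite [X in measurable X](_ : _ = \bigcap_(i in [set: 'I_n.+1])
    ((fun t => f t 0 i) @^-1` `](B k).1 0 i, (B k).2 0 i])).
  apply: fin_bigcap_measurable => // i _.
  by rewrite -[X in measurable X]setTI; apply: mf => //; exact: measurable_itv.
apply/seteqP; split => [x h i _|x h i] /=; first by rewrite in_itv/=; exact: h.
by have := h i I; rewrite /= in_itv.
Qed.

(** Transporting covers by boxes gives one inequality for every positive factor; applied to the
    inverse map it gives the other. *)
Lemma lebesgue_outer_affine (c : R) (h : V) (A : set V) : 0 < c ->
  lebesgue_outer [set x | A (c *: x + h)] =
  ((c^-1 ^+ n.+1)%:E * lebesgue_outer A)%E.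
Proof.
have le_affine (c' : R) (h' : V) (A' : set V) : 0 < c' ->
    ((c' ^+ n.+1)%:E * lebesgue_outer [set x | A' (c' *: x + h')%R] <= lebesgue_outer A')%E.
  move=> c0; apply: le_ereal_inf_tmp => _ [B AB <-].
  pose B' k : V * V := (c'^-1 *: ((B k).1 - h'), c'^-1 *: ((B k).2 - h')).
  have -> : (\sum_(k <oo) (box_volume (B k))%:E =
      (c' ^+ n.+1)%:E * \sum_(k <oo) (box_volume (B' k))%:E)%E.
    rewrite -nneseriesZl; last by move=> *; exact: box_volume_ge0.
    apply: eq_eseriesr => k _; rewrite -EFinM; congr (_%:E).
    have -> : c' ^+ n.+1 = \prod_(i < n.+1) c' by rewrite prodr_const card_ord.
    rewrite /box_volume -big_split/=.
    apply: eq_bigr => i _; rewrite !mxE maxr_pMr ?ltW// mulr0; congr Num.max.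
    by field; rewrite gt_eqF.
  apply: lee_wpmul2l; first by rewrite lee_fin exprn_ge0// ltW.
  apply: ereal_inf_lbound; exists B' => // x /= /AB[k _ Bk]; exists k => // i.
  have := Bk i; rewrite /B'/= !mxE.
  by rewrite ![c'^-1 * _]mulrC ltr_pdivrMr// ler_pdivlMr// [x 0 i * _]mulrC ltrBlDr lerBrDr.
move=> c0; have c1 : 0 < c^-1 by rewrite invr_gt0.
apply/eqP; rewrite eq_le; apply/andP; split.
  have := le_affine c h A c0.
  rewrite -(@lee_pmul2l _ (c^-1 ^+ n.+1)%:E) ?lte_fin ?exprn_gt0//.
  by rewrite muleA -EFinM -exprMn mulVf ?gt_eqF// expr1n mul1e.
have := le_affine c^-1 (- (c^-1 *: h)) [set x | A (c *: x + h)] c1.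
rewrite (_ : [set x | _] = A)//; apply/seteqP; split => x /=;
  by rewrite scalerDr scalerN !scalerA mulfV ?gt_eqF// !scale1r addrNK.
Qed.

(** The Caratheodory criterion is transported by the map, because the outer measure only gets
    multiplied by a constant; an argument through Borel sets would miss the other Lebesgue sets. *)
Lemma measurable_affine (c : R) (h : V) : 0 < c ->
  measurable_fun setT (fun x : V => c *: x + h).
Proof.
move=> c0 _ A mA; rewrite setTI.
suff : caratheodory_measurable (@lebesgue_outer R n) ((fun x : V => c *: x + h) @^-1` A) by [].
move=> X.
pose X' := [set x : V | X (c^-1 *: x + - (c^-1 *: h))].
have XE : X = [set x | X' (c *: x + h)].
  by apply/seteqP; split => x; rewrite /X'/=;
    rewrite scalerDr !scalerA mulVf ?gt_eqF// !scale1r addrK.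
rewrite XE.
have -> : [set x | X' (c *: x + h)] `&` (fun x => c *: x + h) @^-1` A =
  [set x | (X' `&` A) (c *: x + h)] by [].
have -> : [set x | X' (c *: x + h)] `&` ~` ((fun x => c *: x + h) @^-1` A) =
  [set x | (X' `&` ~` A) (c *: x + h)] by [].
rewrite (lebesgue_outer_affine h X' c0) (lebesgue_outer_affine h (X' `&` A) c0).
rewrite (lebesgue_outer_affine h (X' `&` ~` A) c0) (mA X').
by rewrite ge0_muleDr ?lebesgue_outer_ge0.
Qed.

(** The image of the measure under the map is a multiple of it, by the scaling of the outer
    measure. *)
Lemma ge0_integral_affine (c : R) (h : V) (f : V -> \bar R) : 0 < c ->
  measurable_fun setT f -> (forall x, 0 <= f x)%E ->
  (\int[mu]_x f (c *: x + h)%R = (c^-1 ^+ n.+1)%:E * \int[mu]_x f x)%E.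
Proof.
move=> c0 mf f0.
have c1 : 0 <= c^-1 ^+ n.+1 by rewrite exprn_ge0// invr_ge0 ltW.
rewrite -[c^-1 ^+ n.+1]/((NngNum c1)%:num) -ge0_integral_mscale//.
rewrite -(ge0_integral_push mu (measurable_affine h c0))//.
apply: (eq_measure_integral (mscale (NngNum c1) mu)) => A mA _.
by rewrite pushE /mscale/=; exact: lebesgue_outer_affine.
Qed.

Lemma ge0_integral_translate (h : V) (f : V -> \bar R) :
  measurable_fun setT f -> (forall x, 0 <= f x)%E ->
  (\int[mu]_x f (x + h)%R = \int[mu]_x f x)%E.
Proof.
move=> mf f0; have := @ge0_integral_affine 1 h f ltr01 mf f0.
by rewrite invr1 expr1n mul1e => <-; apply: eq_integral => x _; rewrite scale1r.
Qed.

Lemma sigma_finite_lebesgue_rV : sigma_finite setT mu.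
Proof.
exists (fun k : nat => box (const_mx (- k%:R), const_mx k%:R)).
  apply/seteqP; split => // x _.
  have [k hk] : exists k : nat, forall i, `|x 0 i| < k%:R.
    exists (Num.truncn (\sum_i `|x 0 i|)).+1 => i; rewrite (le_lt_trans _ (truncnS_gt _))//.
    by rewrite (bigD1 i)//= lerDl sumr_ge0.
  exists k => // i; rewrite /= !mxE; have := hk i.
  by rewrite ltr_norml => /andP[-> /ltW].
move=> k; split; first exact: measurable_box.
by have := lebesgue_rV_box (const_mx (- k%:R), const_mx k%:R) => ->; rewrite ltry.
Qed.

End boxes.

HB.instance Definition _ (R : realType) (n : nat) :=
  Measure_isSigmaFinite.Build _ _ _ (@lebesgue_rV R n) (@sigma_finite_lebesgue_rV R n).

(** * Measures with a density, and integrals of product functions *)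

Section density.
Context d (T : measurableType d) (R : realType) (mu : {measure set T -> \bar R}).
Variables (f : T -> R) (mf : measurable_fun setT f) (f0 : forall x, 0 <= f x).
Local Open Scope ereal_scope.
Import HBNNSimple.

(** The two proofs are arguments so that the measure structure declared below can be attached to the
    resulting set function. *)
Definition wmeasure_of (_ : measurable_fun setT f) (_ : forall x, (0 <= f x)%R)
  (A : set T) : \bar R := \int[mu]_(x in A) (f x)%:E.
Local Notation wmeasure := (wmeasure_of mf f0).

Let wmeasure0 : wmeasure set0 = 0.
Proof. exact: integral_set0. Qed.

Let wmeasure_ge0 A : 0 <= wmeasure A.
Proof. by apply: integral_ge0 => x _; rewrite lee_fin. Qed.

Let wmeasure_sigma_additive : semi_sigma_additive wmeasure.
Proof.
move=> F mF tF mUF; rewrite [X in _ --> X](_ : _ = \sum_(k <oo) wmeasure (F k)).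
  by apply: is_cvg_nneseries => k _ _; exact: wmeasure_ge0.
apply: ge0_integral_bigcup => //; first by apply/measurable_EFinP; exact: measurable_funTS.
by move=> x _; rewrite lee_fin.
Qed.

HB.instance Definition _ := isMeasure.Build _ _ _ wmeasure
  wmeasure0 wmeasure_ge0 wmeasure_sigma_additive.

(** For simple functions it is additivity over the level sets; monotone convergence does the
    rest. *)
Lemma ge0_integral_wmeasure (g : T -> \bar R) :
  measurable_fun setT g -> (forall x, 0 <= g x) ->
  \int[wmeasure]_x g x = \int[mu]_x (g x * (f x)%:E).
Proof.
move=> mg g0; pose h := nnsfun_approx measurableT mg.
have gE x : g x = limn (fun k => (h k x)%:E).
  by apply/esym/cvg_lim => //; exact: cvg_nnsfun_approx.
have mhf k : measurable_fun setT (fun x => ((h k x)%:E * (f x)%:E)%E).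
  by apply: emeasurable_funM; exact/measurable_EFinP.
transitivity (limn (fun k => \int[wmeasure]_x (h k x)%:E)).
  rewrite -monotone_convergence//.
  - by apply: eq_integral => x _; exact: gE.
  - by move=> k; exact/measurable_EFinP.
  - by move=> k x _; rewrite lee_fin.
  - by move=> x _ a b ab; rewrite lee_fin; exact/lefP/nd_nnsfun_approx.
transitivity (limn (fun k => \int[mu]_x ((h k x)%:E * (f x)%:E))); last first.
  rewrite -monotone_convergence//.
  - apply: eq_integral => x _; apply/cvg_lim => //.
    under eq_fun do rewrite muleC.
    by rewrite muleC; apply: cvgeZl => //; exact: cvg_nnsfun_approx.
  - by move=> k x _; rewrite mule_ge0// lee_fin.
  - by move=> x _ a b ab; rewrite lee_wpmul2r ?lee_fin//; exact/lefP/nd_nnsfun_approx.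
congr (limn _); apply/funext => k.
rewrite [LHS](eq_integral (fun x => \sum_(y \in range (h k)) (y * \1_(h k @^-1` [set y]) x)%:E)); last first.
  by move=> x _; rewrite fimfunE -fsumEFin.
rewrite [RHS](eq_integral (fun x => \sum_(y \in range (h k)) ((y * \1_(h k @^-1` [set y]) x)%:E * (f x)%:E))); last first.
  move=> x _; rewrite fimfunE -fsumEFin// ge0_mule_fsuml//.
  by move=> y; rewrite EFinM nnfun_muleindic_ge0.
rewrite !ge0_integral_fsum//; last 4 first.
- move=> y; apply: emeasurable_funM; last exact/measurable_EFinP.
  by apply/measurable_EFinP; do 2 apply/measurableT_comp => //.
- by move=> y x _; apply: mule_ge0; [rewrite EFinM nnfun_muleindic_ge0|rewrite lee_fin].
- by move=> y; apply/measurable_EFinP; do 2 apply/measurableT_comp => //.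
- by move=> y x _; rewrite EFinM nnfun_muleindic_ge0.
apply: eq_fsbigr => y _.
have [y0|y0] := leP 0%R y; last first.
  have h0 : h k @^-1` [set y] = set0.
    by apply/seteqP; split=> // x /= hx; move: y0; rewrite -hx ltNge// fun_ge0.
  by rewrite !integral0_eq// => x _; rewrite h0 indicE in_set0 mulr0 ?mul0e.
under [RHS]eq_integral do rewrite EFinM -muleA.
rewrite integralZl_indic_nnsfun// integral_indic// setIT ge0_integralZl//; last 2 first.
- by apply: emeasurable_funM; apply/measurable_EFinP => //.
- by move=> x _; rewrite mule_ge0 ?lee_fin.
congr (_ * _); transitivity (\int[mu]_(x in h k @^-1` [set y]) (f x)%:E) => //.
rewrite integral_mkcond; apply: eq_integral => x _.
by rewrite patchE indicE; case: ifP => _; rewrite ?mul1e ?mul0e.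
Qed.

End density.

Section product_integral.
Context (R : realType) (n : nat).
Local Notation V := 'rV[R]_n.+1.
Local Notation mu := (@lebesgue_rV R n).
Local Notation lam := (@lebesgue_measure R).

(** A measure that is finite on the half-open intervals is determined by them: they are stable under
    intersection and exhaust the line. *)
Lemma lebesgue_measure_unique_scale (c : R) (m : {measure set (measurableTypeR R) -> \bar R}) :
  0 <= c -> (forall a b : R, m `]a, b]%classic = (c * Num.max 0 (b - a))%:E) ->
  forall A, measurable A -> m A = (c%:E * lam A)%E.
Proof.
move=> c0 mE A mA.
pose s := mscale (NngNum c0) lam.
have lam_oc a b : (lam `]a, b]%classic = (Num.max 0 (b - a))%:E)%E.
  rewrite lebesgue_measure_itv/= lte_fin -EFinB.
  by rewrite /Num.max subr_gt0; case: ifP.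
apply: (@measure_unique _ R (measurableTypeR R) (@ocitv R) (fun k : nat => `]- k%:R, k%:R]%classic) _ _ _ _ m s) => //.
- exact: ocitvI.
- move=> k; exact: is_ocitv.
- apply/seteqP; split => // x _.
  exists (Num.truncn `|x|).+1 => //=; rewrite in_itv/=.
  by have := truncnS_gt `|x|; rewrite ltr_norml => /andP[-> /ltW].
- by move=> _ [[a b] _ <-]/=; rewrite mE /s /mscale/= lam_oc EFinM.
- by move=> k; rewrite mE ltry.
Qed.

Lemma measurable_fun_bigprod d (T : measurableType d) (I : Type) (s : seq I) (P : pred I)
    (h : I -> T -> R) (D : set T) : (forall i, measurable_fun D (h i)) ->
  measurable_fun D (fun x => \prod_(i <- s | P i) h i x).
Proof.
move=> mh; elim: s => [|i s IH]; last first.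
  under eq_fun do rewrite big_cons; case: (P i) => //.
  exact: measurable_funM.
rewrite (_ : (fun _ => _) = cst 1); last by apply/funext => x; rewrite big_nil.
exact: measurable_cst.
Qed.

(** A form of Tonelli for products of functions of one coordinate, obtained without identifying the
    measure with an iterated product. The number of general factors is raised one by one, the
    remaining factors being indicators of intervals; with no general factor the claim is the volume
    of a box. *)
Lemma ge0_integral_prod (u : 'I_n.+1 -> R -> R) (c : 'I_n.+1 -> R) :
  (forall i, measurable_fun setT (u i)) -> (forall i t, 0 <= u i t) ->
  (forall i, (\int[lam]_t (u i t)%:E = (c i)%:E)%E) ->
  (\int[mu]_x (\prod_i u i (x 0 i))%:E = (\prod_i c i)%:E)%E.
Proof.
move=> mu_ u0 uc.
have c0 i : 0 <= c i.
  by rewrite -lee_fin -uc; apply: integral_ge0 => t _; rewrite lee_fin.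
have mprod (P : pred 'I_n.+1) (v : 'I_n.+1 -> R -> R) : (forall i, measurable_fun setT (v i)) ->
    measurable_fun setT (fun x : V => \prod_(i < n.+1 | P i) v i (x 0 i)).
  move=> mv; apply: measurable_fun_bigprod => i.
  by apply: measurableT_comp; [exact: mv|exact: measurable_coord].
suff key k : (k <= n.+1)%N -> forall (v : 'I_n.+1 -> R -> R) (e : 'I_n.+1 -> R),
    (forall i, measurable_fun setT (v i)) -> (forall i t, 0 <= v i t) ->
    (forall i, (\int[lam]_t (v i t)%:E = (e i)%:E)%E) ->
    (forall i : 'I_n.+1, (k <= i)%N -> exists a b, v i = \1_(`]a, b]%classic)) ->
    (\int[mu]_x (\prod_i v i (x 0 i))%:E = (\prod_i e i)%:E)%E.
  by apply: (key n.+1) => // i; rewrite leqNgt ltn_ord.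
have lam_oc a b : (lam `]a, b]%classic = (Num.max 0 (b - a))%:E)%E.
  rewrite lebesgue_measure_itv/= lte_fin -EFinB.
  by rewrite /Num.max subr_gt0; case: ifP.
elim: k => [_|k IH kn] v e mv v0 ve vk.
  have /choice[a /choice[b vab]] i : exists a b, v i = \1_(`]a, b]%classic) by exact: vk.
  have -> : (\int[mu]_x (\prod_i v i (x 0 i))%:E)%E = mu (box (\row_i a i, \row_i b i)).
    rewrite -[in RHS](setIT (box _)) -[RHS]integral_indic//; last exact: measurable_box.
    apply: eq_integral => x _; congr (_%:E).
    have [h|h] := pselect (box (\row_i a i, \row_i b i) x).
      rewrite indicE mem_set// big1// => i _; rewrite vab indicE mem_set//=.
      by have := h i; rewrite !mxE in_itv.
    rewrite indicE memNset//; have [i hi] : exists i, ~ (a i < x 0 i <= b i).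
      by apply/existsNP; apply: contra_not h => h i; rewrite !mxE; exact: h.
    by rewrite (bigD1 i)//= vab indicE memNset ?mul0r//= in_itv.
  rewrite lebesgue_rV_box /box_volume; congr (_%:E); apply: eq_bigr => i _.
  by rewrite !mxE/=; apply: EFin_inj; rewrite -lam_oc -ve vab integral_indic// setIT.
pose i0 := Ordinal kn.
pose rest (x : V) : R := \prod_(i < n.+1 | i != i0) v i (x 0 i).
pose C := \prod_(i < n.+1 | i != i0) e i.
have e0 i : 0 <= e i.
  by rewrite -lee_fin -ve; apply: integral_ge0 => t _; rewrite lee_fin.
have C0 : 0 <= C by exact: prodr_ge0.
have mrest : measurable_fun setT rest by exact: mprod.
have rest0 x : 0 <= rest x by exact: prodr_ge0.
pose phi (x : V) : measurableTypeR R := x 0 i0.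
have mphi : measurable_fun setT phi by exact: measurable_coord.
(* The image on the axis [i0] of the measure with density [rest] is [C] times Lebesgue measure: on
   intervals this is the induction hypothesis with an indicator as factor [i0]. *)
pose m := push (wmeasure_of mu mrest rest0) mphi.
have mE A : measurable A -> m A = (C%:E * lam A)%E.
  apply: (@lebesgue_measure_unique_scale C m) => // a b.
  pose v' i := if i == i0 then \1_(`]a, b]%classic) : R -> R else v i.
  pose e' i := if i == i0 then Num.max 0 (b - a) else e i.
  rewrite -[LHS]/(wmeasure_of mu mrest rest0 [set x : V | x 0 i0 \in `]a, b]]) /wmeasure_of.
  rewrite integral_mkcond.
  have -> : C * Num.max 0 (b - a) = \prod_i e' i.
    rewrite [RHS](bigD1 i0)//= {1}/e' eqxx mulrC; congr (_ * _).
    by apply: eq_bigr => i /negbTE ii0; rewrite /e' ii0.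
  rewrite -(IH (ltnW kn) v' e').
  - apply: eq_integral => x _; rewrite patchE (bigD1 i0)//= {1}/v' eqxx indicE.
    have -> : (x \in [set x : V | x 0 i0 \in `]a, b]]) = (x 0 i0 \in `]a, b]%classic) by apply/idP/idP; rewrite !inE.
    case: ifP => _; rewrite ?mul0r// mul1r; congr (_%:E).
    by apply: eq_bigr => i /negbTE ii0; rewrite /v' ii0.
  - by move=> i; rewrite /v'; case: ifP => _ //; exact: measurable_indic.
  - by move=> i t; rewrite /v'; case: ifP => _ //; rewrite indicE.
  - move=> i; rewrite /v' /e'; case: ifP => _ //.
    by rewrite -lam_oc -[in RHS](setIT `]a, b]%classic) -[RHS]integral_indic.
  - move=> i; rewrite /v' -(inj_eq val_inj)/= leq_eqVlt => /orP[|ki].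
      by rewrite eq_sym => ->; exists a, b.
    by rewrite gtn_eqF//; exact: vk.
rewrite (bigD1 i0)//= -/C mulrC EFinM -ve.
rewrite -[X in (X * _)%E]/((NngNum C0)%:num%:E) -ge0_integral_mscale//; last 2 first.
- apply/measurable_EFinP; exact: mv.
- by move=> x _; rewrite lee_fin.
transitivity (\int[m]_t (v i0 t)%:E)%E; last by apply: eq_measure_integral => A mA _; exact: mE.
rewrite ge0_integral_push//; last 2 first.
- apply/measurable_EFinP; exact: mv.
- by move=> x; rewrite lee_fin.
rewrite ge0_integral_wmeasure//; last 2 first.
- apply/measurable_EFinP; exact: (measurableT_comp (mv i0) mphi).
- by move=> x; rewrite lee_fin.
by apply: eq_integral => x _; rewrite (bigD1 i0)//= EFinM.
Qed.

End product_integral.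

(** * Euclidean norm, scalar product, and measurability through coordinates *)

Section euclidean.
Context (R : realType) (d : nat).
Local Notation V := 'rV[R]_d.
Implicit Types x y z : V.

Lemma enorm_ge0 x : 0 <= enorm x. Proof. exact: sqrtr_ge0. Qed.

Lemma enorm_sqr x : enorm x ^+ 2 = \sum_(i < d) x 0 i ^+ 2.
Proof. by rewrite sqr_sqrtr// sumr_ge0// => i _; exact: sqr_ge0. Qed.

Lemma enormZ (c : R) x : enorm (c *: x) = `|c| * enorm x.
Proof.
rewrite /enorm -sqrtr_sqr -sqrtrM ?sqr_ge0// mulr_sumr.
by congr Num.sqrt; apply: eq_bigr => i _; rewrite mxE exprMn.
Qed.

Lemma enormN x : enorm (- x) = enorm x.
Proof. by rewrite -scaleN1r enormZ normrN1 mul1r. Qed.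

Lemma enorm0 : enorm (0 : V) = 0.
Proof. by rewrite /enorm big1 ?sqrtr0// => i _; rewrite mxE expr0n. Qed.

Lemma enorm_distC x y : enorm (x - y) = enorm (y - x).
Proof. by rewrite -enormN opprB. Qed.

Lemma coord_le_enorm x i : `|x 0 i| <= enorm x.
Proof.
rewrite -sqrtr_sqr /enorm ler_wsqrtr// (bigD1 i)//= lerDl sumr_ge0// => j _.
exact: sqr_ge0.
Qed.

Lemma enorm_eq0 x : (enorm x == 0) = (x == 0).
Proof.
apply/eqP/eqP => [x0|->]; last exact: enorm0.
apply/rowP => i; rewrite mxE; apply/eqP; rewrite -normr_le0 -x0.
exact: coord_le_enorm.
Qed.

Lemma enorm_gt0 x : (0 < enorm x) = (x != 0).
Proof. by rewrite lt_neqAle eq_sym enorm_eq0 enorm_ge0 andbT. Qed.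

Lemma enorm_le_sum x : enorm x <= \sum_(i < d) `|x 0 i|.
Proof.
rewrite -[leRHS]ger0_norm ?sumr_ge0// -sqrtr_sqr /enorm ler_wsqrtr//.
under eq_bigr do rewrite -real_normK ?num_real//.
elim: (index_enum _) => [|i s IH]; first by rewrite !big_nil expr0n.
rewrite !big_cons sqrrD -addrA lerD2l.
have h : 0 <= \sum_(j <- s) `|x 0 j| by rewrite sumr_ge0.
by rewrite (le_trans IH)// lerDr mulrn_wge0// mulr_ge0.
Qed.

(** Cauchy-Schwarz, from the nonnegative sum of the squares of
    [enorm y * x 0 i - enorm x * y 0 i]. *)
Lemma dotv_le x y : dotv x y <= enorm x * enorm y.
Proof.
have [x0|x0] := eqVneq x 0.
  by rewrite x0 enorm0 mul0r /dotv big1// => i _; rewrite mxE mul0r.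
have [y0|y0] := eqVneq y 0.
  by rewrite y0 enorm0 mulr0 /dotv big1// => i _; rewrite mxE mulr0.
have xy : 0 < enorm x * enorm y by rewrite mulr_gt0// enorm_gt0.
rewrite -(ler_pM2l xy) -subr_ge0.
have : 0 <= \sum_(i < d) (enorm y * x 0 i - enorm x * y 0 i) ^+ 2.
  by apply: sumr_ge0 => i _; exact: sqr_ge0.
under eq_bigr do rewrite sqrrB !exprMn.
rewrite big_split/= sumrB -!mulr_sumr -!enorm_sqr.
rewrite (eq_bigr (fun i => (enorm y * enorm x * (x 0 i * y 0 i)) *+ 2)); last first.
  by move=> i _; ring.
rewrite sumrMnl -mulr_sumr -/(dotv x y).
set a := enorm x; set b := enorm y; set c := dotv x y => h.
nra.
Qed.

Lemma enormD x y : enorm (x + y) <= enorm x + enorm y.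
Proof.
rewrite -(@ler_pXn2r _ 2) ?nnegrE ?addr_ge0 ?enorm_ge0// enorm_sqr sqrrD !enorm_sqr.
rewrite (eq_bigr (fun i => x 0 i ^+ 2 + 2 * (x 0 i * y 0 i) + y 0 i ^+ 2)); last first.
  by move=> i _; rewrite mxE sqrrD mulr_natl.
rewrite !big_split/= lerD2r lerD2l -mulr_sumr -[leRHS]mulr_natl ler_pM2l//.
exact: dotv_le.
Qed.

Lemma enorm_triangle z x y : enorm (x - y) <= enorm (x - z) + enorm (z - y).
Proof. by rewrite (le_trans _ (enormD _ _))// addrA subrK. Qed.

Lemma norm_dotv_le x y : `|dotv x y| <= enorm x * enorm y.
Proof.
rewrite ler_norml dotv_le andbT lerNl.
rewrite (_ : - dotv x y = dotv (- x) y); last first.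
  by rewrite /dotv -sumrN; apply: eq_bigr => i _; rewrite mxE mulNr.
by rewrite (le_trans (dotv_le _ _))// enormN.
Qed.

End euclidean.

Section measurability_of_maps.
Context (R : realType) (n : nat).
Local Notation V := 'rV[R]_n.+1.
Local Notation mu := (@lebesgue_rV R n).
Context (dT : measure_display) (T : measurableType dT).

(** Weaker than measurability into [V], whose sigma-algebra is complete, but stable under vector
    operations and enough for norms and scalar products. *)
Definition mcoord (f : T -> V) := forall i, measurable_fun setT (fun t => f t 0 i).

Lemma mcoordD f g : mcoord f -> mcoord g -> mcoord (f \+ g).
Proof. by move=> mf mg i; under eq_fun do rewrite mxE; exact: measurable_funD. Qed.

Lemma mcoordB f g : mcoord f -> mcoord g -> mcoord (fun t => f t - g t).
Proof. by move=> mf mg i; under eq_fun do rewrite !mxE; exact: measurable_funB. Qed.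

Lemma mcoordZ (c : T -> R) f : measurable_fun setT c -> mcoord f ->
  mcoord (fun t => c t *: f t).
Proof. by move=> mc mf i; under eq_fun do rewrite mxE; exact: measurable_funM. Qed.

Lemma mcoord_cst (v : V) : mcoord (fun=> v).
Proof. by move=> i; exact: measurable_cst. Qed.

Lemma measurable_enorm f : mcoord f -> measurable_fun setT (fun t => enorm (f t)).
Proof.
move=> mf; apply: (@measurableT_comp _ _ _ _ _ _ (@Num.sqrt R)).
  by apply: continuous_measurable_fun; exact: sqrt_continuous.
by apply: measurable_sum => i; exact: measurable_funX.
Qed.

Lemma measurable_dotv f g : mcoord f -> mcoord g ->
  measurable_fun setT (fun t => dotv (f t) (g t)).
Proof. by move=> mf mg; apply: measurable_sum => i; exact: measurable_funM. Qed.

End measurability_of_maps.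

Section measure_facts.
Context (R : realType) (n : nat).
Local Notation V := 'rV[R]_n.+1.
Local Notation mu := (@lebesgue_rV R n).

Lemma mcoord_id : mcoord (@id V).
Proof. by move=> i; exact: measurable_coord. Qed.

Lemma mcoord_comp dT (T : measurableType dT) (f : T -> V) :
  measurable_fun setT f -> mcoord f.
Proof. by move=> mf i; apply: (measurableT_comp (@measurable_coord R n i)). Qed.

Lemma measurable_eball (c : V) (r : R) : measurable (eball c r).
Proof.
have mf : measurable_fun setT (fun x : V => enorm (x - c)).
  by apply: measurable_enorm; apply: mcoordB; [exact: mcoord_id|exact: mcoord_cst].
rewrite (_ : eball c r = setT `&` (fun x => enorm (x - c)) @^-1` `]-oo, r[).
  by apply: mf; [exact: measurableT|exact: measurable_itv].
rewrite setTI; by apply/seteqP; split => x; rewrite /eball/= in_itv.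
Qed.

Lemma eball_sub_box (c : V) (r : R) :
  eball c r `<=` box (c - const_mx r, c + const_mx r).
Proof.
move=> x /= xr i; rewrite !mxE/=.
have := le_lt_trans (coord_le_enorm (x - c) i) xr; rewrite !mxE ltr_norml.
by move=> /andP[h1 h2]; apply/andP; split; lra.
Qed.

Lemma eball_fin (c : V) (r : R) : (mu (eball c r) < +oo)%E.
Proof.
apply: (@le_lt_trans _ _ (mu (box (c - const_mx r, c + const_mx r)))).
  apply: le_measure; rewrite ?inE; [exact: measurable_eball|exact: measurable_box|].
  exact: eball_sub_box.
by rewrite lebesgue_rV_box ltry.
Qed.

Lemma eball_gt0 (c : V) (r : R) : 0 < r -> (0 < mu (eball c r))%E.
Proof.
(* With sides [r / n.+2], the [n.+1] coordinates of a point of the box, taken from the centre, add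
   up to less than [r]. *)
move=> r0; pose s := r / n.+2%:R.
have s0 : 0 < s by rewrite divr_gt0.
apply: (@lt_le_trans _ _ (mu (box (c, c + const_mx s)))).
  rewrite lebesgue_rV_box lte_fin; apply: prodr_gt0 => i _.
  by rewrite !mxE addrAC subrr add0r lt_max s0 orbT.
apply: le_measure; rewrite ?inE; [exact: measurable_box|exact: measurable_eball|].
move=> x /= xB; rewrite /eball/= (le_lt_trans (enorm_le_sum _))//.
apply: (@le_lt_trans _ _ (\sum_(i < n.+1) s)).
  apply: ler_sum => i _; have := xB i; rewrite !mxE => /andP[h1 h2].
  by rewrite ger0_norm; lra.
rewrite big_const_ord iter_addr_0 /s -[_ *+ _]mulr_natr -mulrA gtr_pMr// mulrC.
by rewrite ltr_pdivrMr// mul1r ltr_nat.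
Qed.

(** A Fubini argument in place of a change of variables: the double integral of [g x] times the
    indicator of the unit ball at [x + T y], taken in either order, gives the volume of the ball
    times one of the two sides. It rests on translation invariance and on the ball being preserved
    by the involution [T]. *)
Lemma ge0_integral_isometry (T : V -> V) (g : V -> \bar R) :
  (forall x y, T (x + y) = T x + T y) -> (forall x, T (T x) = x) ->
  (forall x, enorm (T x) = enorm x) -> mcoord T ->
  measurable_fun setT g -> (forall x, 0 <= g x)%E ->
  measurable_fun setT (fun xy : V * V => g (xy.1 - T xy.2)) ->
  (\int[mu]_x g (- T x)%R = \int[mu]_x g x)%E.
Proof.
move=> TD TK Tn mT mg g0 mg2.
pose D : set V := eball 0 1.
have mD : measurable D by exact: measurable_eball.
pose i (x : V) : \bar R := (\1_D x)%:E.
have i0 x : (0 <= i x)%E by rewrite lee_fin.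
have mi : measurable_fun setT i by apply/measurable_EFinP; exact: measurable_indic.
have iE x : i x = (enorm x < 1)%R%:R%:E.
  rewrite /i indicE; congr (_%:R%:E); congr nat_of_bool.
  by apply/idP/idP; rewrite inE /D /eball/= subr0.
have muD : (\int[mu]_x i x)%E = mu D by rewrite integral_indic// setIT.
have D0 : (mu D != 0)%E by rewrite gt_eqF// eball_gt0.
have Dfin : mu D \is a fin_num by rewrite ge0_fin_numE// eball_fin.
have mi2 : measurable_fun setT (fun xy : V * V => i (xy.1 + T xy.2)%R).
  have mm : measurable_fun setT (fun xy : V * V => enorm (xy.1 + T xy.2)%R).
    apply: measurable_enorm; apply: mcoordD; first exact: mcoord_comp.
    by move=> j; apply: (measurableT_comp (mT j)).
  under eq_fun do rewrite iE.
  apply/measurable_EFinP; apply: (measurableT_comp (f := fun b : bool => b%:R : R)); first by move=> ? ? ?.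
  by apply: measurable_fun_ltr; [exact: mm|exact: measurable_cst].
have key : (mu D * \int[mu]_x g x = mu D * \int[mu]_x g (- T x)%R)%E.
  transitivity (\int[mu]_x \int[mu]_y (g x * i (x + T y)%R))%E.
    rewrite -(@ge0_integralZl _ _ _ mu setT measurableT _ mg)//.
    apply: eq_integral => x _.
    have mix := measurableT_comp mi2 (pair1_measurable x).
    rewrite (@ge0_integralZl _ _ _ mu setT measurableT _ mix)//; last first.
      by move=> y _ /=.
    rewrite muleC; congr (_ * _)%E.
    rewrite -muD -(ge0_integral_translate (T x) mi i0).
    by apply: eq_integral => y _ /=; rewrite !iE -(Tn (y + T x)) TD TK addrC.
  rewrite (fubini_tonelli (fun xy : V * V => g xy.1 * i (xy.1 + T xy.2)%R)%E); last 2 first.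
  - by apply: emeasurable_funM mi2; exact: (measurableT_comp mg measurable_fst).
  - by move=> xy; rewrite mule_ge0.
  transitivity (\int[mu]_y \int[mu]_x (g (x - T y)%R * i x))%E.
    apply: eq_integral => y _ /=.
    rewrite -(ge0_integral_translate (- T y)%R); last 2 first.
    - apply: emeasurable_funM mg _.
      exact: (measurableT_comp mi2 (pair2_measurable y)).
    - by move=> x; rewrite mule_ge0.
    by apply: eq_integral => x _; rewrite subrK.
  rewrite -(fubini_tonelli (fun xy : V * V => g (xy.1 - T xy.2)%R * i xy.1)%E); last 2 first.
  - by apply: emeasurable_funM mg2 _; exact: (measurableT_comp mi measurable_fst).
  - by move=> xy; rewrite mule_ge0.
  rewrite -muD -(@ge0_integralZr _ _ _ mu setT measurableT _ mi)//; last first.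
    by apply: integral_ge0.
  apply: eq_integral => x _ /=.
  have mgx : measurable_fun setT (fun y => g (x - T y)%R).
    exact: (measurableT_comp mg2 (pair1_measurable x)).
  rewrite (@ge0_integralZr _ _ _ mu setT measurableT _ mgx)// muleC; congr (_ * _)%E.
  rewrite -(ge0_integral_translate (T x))//.
  by apply: eq_integral => y _; rewrite TD TK opprD addrCA subrr addr0.
have D1 : (fine (mu D) != 0)%R by rewrite fine_eq0.
have := congr1 (fun z => ((fine (mu D))^-1)%:E * z)%E key.
by rewrite -(fineK Dfin) !muleA -!EFinM mulVf// !mul1e => ->.
Qed.

End measure_facts.

(** * Comparison of integrals of decreasing profiles by the layer-cake formula *)

Section layer_cake.
Context (R : realType).
Local Open Scope ereal_scope.
Local Notation lam := (@lebesgue_measure R).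
Context d1 d2 (T1 : measurableType d1) (T2 : measurableType d2).
Context (m1 : {sigma_finite_measure set T1 -> \bar R})
        (m2 : {sigma_finite_measure set T2 -> \bar R}).

Section layer.
Context d (T : measurableType d) (m : {sigma_finite_measure set T -> \bar R}).
Context (w : T -> \bar R) (r : T -> R) (u : R -> R).
Hypotheses (mw : measurable_fun setT w) (w0 : forall x, 0 <= w x)
  (mr : measurable_fun setT r) (mu_ : measurable_fun setT u) (u0 : forall t, (0 <= u t)%R).

Let F (z : T * R) : \bar R := w z.1 * ((0 < z.2) && (z.2 < u (r z.1)))%R%:R%:E.

Let F0 z : 0 <= F z. Proof. by rewrite mule_ge0// lee_fin. Qed.

Let mF : measurable_fun setT F.
Proof.
apply: emeasurable_funM; first exact: (measurableT_comp mw measurable_fst).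
apply/measurable_EFinP.
apply: (measurableT_comp (f := fun b : bool => b%:R : R)) => //.
apply: measurable_and; first exact: measurable_fun_ltr.
apply: measurable_fun_ltr; first exact: measurable_snd.
exact: (measurableT_comp mu_ (measurableT_comp mr measurable_fst)).
Qed.

Let Fsec t : (0 < t)%R -> \int[m]_x F (x, t) = \int[m]_(x in [set x | (t < u (r x))%R]) w x.
Proof.
move=> t0; rewrite [RHS]integral_mkcond; apply: eq_integral => x _; rewrite patchE /F/= t0/=.
rewrite (_ : (x \in _) = (t < u (r x))%R); last by apply/idP/idP; rewrite inE.
by case: ifP => _; rewrite ?mule1 ?mule0.
Qed.

Lemma measurable_layer :
  measurable_fun (`]0%R, +oo[%classic : set R) (fun t => \int[m]_(x in [set x | (t < u (r x))%R]) w x).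
Proof.
apply: (eq_measurable_fun (fun t => \int[m]_x F (x, t))).
  by move=> t; rewrite inE/= in_itv/= andbT => /Fsec.
by apply: measurable_funTS; exact: (measurable_fun_fubini_tonelli_G F).
Qed.

(** The region below the graph of [u \o r], weighted by [w], is integrated in either order. *)
Lemma integral_layer_cake :
  \int[m]_x (w x * (u (r x))%:E) =
  \int[lam]_(t in `]0%R, +oo[) \int[m]_(x in [set x | (t < u (r x))%R]) w x.
Proof.
transitivity (\int[m]_x \int[lam]_t F (x, t)).
  apply: eq_integral => x _.
  have mb : measurable_fun setT (fun t : R => ((0 < t) && (t < u (r x)))%R%:R%:E : \bar R).
    apply/measurable_EFinP; apply: (measurableT_comp (f := fun b : bool => b%:R : R)) => //.
    by apply: measurable_and; exact: measurable_fun_ltr.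
  rewrite [RHS](_ : _ = \int[lam]_t (w x * ((0 < t) && (t < u (r x)))%R%:R%:E))//.
  rewrite (@ge0_integralZl _ _ _ lam setT measurableT _ mb)//.
  congr (_ * _).
  have -> : (u (r x))%:E = lam `]0%R, u (r x)[%classic.
    rewrite lebesgue_measure_itv/= lte_fin; case: ltP => [_|h]; first by rewrite sube0.
    by congr (_%:E); apply/eqP; rewrite eq_le h u0.
  rewrite -[in LHS](setIT `]0%R, u (r x)[%classic) -[LHS]integral_indic//.
  by apply: eq_integral => t _; rewrite indicE mem_setE in_itv.
rewrite (@fubini_tonelli _ _ _ _ _ m lam F mF F0)/= [RHS]integral_mkcond.
apply: eq_integral => t _; rewrite patchE mem_setE in_itv/= andbT.
case: ifP => t0; last by rewrite integral0_eq// => x _; rewrite /F/= t0 mule0.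
exact: Fsec.
Qed.

End layer.

(** A superlevel set of a function decreasing on the positive axis is empty, []0, s[], []0, s]] or
    the whole axis, so it is enough to compare the weights over the sets cut out by such intervals.
    This takes the place of a change to polar coordinates. *)
Lemma decreasing_integral_le (w1 : T1 -> \bar R) (r1 : T1 -> R)
   (w2 : T2 -> \bar R) (r2 : T2 -> R) (u : R -> R) :
  measurable_fun setT w1 -> (forall x, 0 <= w1 x) -> measurable_fun setT r1 ->
  measurable_fun setT w2 -> (forall x, 0 <= w2 x) -> measurable_fun setT r2 ->
  measurable_fun setT u -> (forall t, 0 <= u t)%R -> (forall t, t <= 0 -> u t = 0)%R ->
  (forall s t, 0 < s -> s <= t -> u t <= u s)%R ->
  (forall s, (0 < s)%R -> \int[m1]_(x in [set x | (0 < r1 x < s)%R]) w1 x <=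
   \int[m2]_(x in [set x | (0 < r2 x < s)%R]) w2 x) ->
  (forall s, (0 < s)%R -> \int[m1]_(x in [set x | (0 < r1 x <= s)%R]) w1 x <=
   \int[m2]_(x in [set x | (0 < r2 x <= s)%R]) w2 x) ->
  \int[m1]_x (w1 x * (u (r1 x))%:E) <= \int[m2]_x (w2 x * (u (r2 x))%:E).
Proof.
move=> mw1 w10 mr1 mw2 w20 mr2 mu_ u0 uneg udec hlt hle.
(* The case of the whole positive axis, exhausted by the intervals []0, k + 1[]. *)
have hlty : \int[m1]_(x in [set x | (0 < r1 x)%R]) w1 x <=
            \int[m2]_(x in [set x | (0 < r2 x)%R]) w2 x.
  pose F d (T : measurableType d) (r : T -> R) (k : nat) := [set x : T | (0 < r x < k.+1%:R)%R].
  have FE d (T : measurableType d) (r : T -> R) : [set x | (0 < r x)%R] = \bigcup_k F _ _ r k.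
    apply/seteqP; split => [x /= rx|x [k _ /andP[]]//].
    exists (Num.truncn (r x)) => //=; rewrite /F/= rx/=; exact: truncnS_gt.
  have mF d (T : measurableType d) (r : T -> R) k : measurable_fun setT r -> measurable (F _ _ r k).
    move=> mr; rewrite (_ : F _ _ r k = r @^-1` `]0%R, k.+1%:R[).
      by rewrite -[X in measurable X]setTI; exact: mr.
    by apply/seteqP; split => x; rewrite /F/= in_itv.
  have ndF d (T : measurableType d) (r : T -> R) : nondecreasing_seq (F _ _ r).
    move=> k l kl; rewrite subsetEset => x /andP[rx1 rx2].
    by rewrite /F/= rx1 (lt_le_trans rx2)// ler_nat ltnS.
  rewrite (FE _ _ r1) (FE _ _ r2).
  have c1 := @ge0_nondecreasing_set_cvg_integral _ _ _ (F _ _ r1) w1 m1 (ndF _ _ r1)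
    (fun k => mF _ _ r1 k mr1) (fun k => measurable_funTS mw1) (fun k x _ => w10 x).
  have c2 := @ge0_nondecreasing_set_cvg_integral _ _ _ (F _ _ r2) w2 m2 (ndF _ _ r2)
    (fun k => mF _ _ r2 k mr2) (fun k => measurable_funTS mw2) (fun k x _ => w20 x).
  rewrite -(cvg_lim _ c1)// -(cvg_lim _ c2)//.
  apply: lee_lim; [exact: cvgP c1|exact: cvgP c2|].
  by apply: nearW => k; exact: hlt.
rewrite !integral_layer_cake//.
apply: ge0_le_integral => //.
- by move=> t _; apply: integral_ge0.
- exact: measurable_layer.
- exact: measurable_layer.
move=> t; rewrite /= in_itv/= andbT => t0.
(* A downward closed part of the positive axis: its supremum, and whether it is attained, decide the
   shape of the superlevel set. *)
pose J := [set s | (t < u s)%R].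
have Jpos s : J s -> (0 < s)%R.
  by move=> Js; rewrite ltNge; apply/negP => /uneg us; move: Js; rewrite /J/= us ltNge (ltW t0).
have Jdown s s' : J s -> (0 < s' <= s)%R -> J s'.
  by move=> Js /andP[s'0 s's]; rewrite /J/= (lt_le_trans Js)// udec.
have [J0|/set0P[s0 Js0]] := eqVneq J set0.
  have e d (T : measurableType d) (r : T -> R) : [set x | (t < u (r x))%R] = set0.
    by apply/seteqP; split => // x /= h; have : J (r x) by []; rewrite J0.
  by rewrite !e !integral_set0.
have [Jub|nJub] := pselect (has_ubound J); last first.
  have e d (T : measurableType d) (r : T -> R) : [set x | (t < u (r x))%R] = [set x | (0 < r x)%R].
    apply/seteqP; split => x /= h; first exact: Jpos.
    have [s Js rs] : exists2 s, J s & (r x <= s)%R.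
      apply: contra_notP nJub => /forall2NP hs; exists (r x) => s Js.
      by have [//|/negP] := hs s; rewrite -ltNge => /ltW.
    by apply: (Jdown s) => //; rewrite h.
  by rewrite !e.
have Jsup : has_sup J by split => //; exists s0.
pose s := sup J.
have s_gt0 : (0 < s)%R by rewrite (lt_le_trans (Jpos _ Js0))// ub_le_sup.
have Jlt s' : (0 < s' < s)%R -> J s'.
  move=> /andP[s'0 s's]; have [s1 Js1 s's1] := sup_adherent (eqbLR (esym (subr_gt0 s' s)) s's) Jsup.
  by apply: (Jdown s1) => //; rewrite s'0/= ltW// (le_lt_trans _ s's1)// subKr.
have [Js|nJs] := pselect (J s).
  have e d (T : measurableType d) (r : T -> R) : [set x | (t < u (r x))%R] = [set x | (0 < r x <= s)%R].
    apply/seteqP; split => x /= h; first by rewrite Jpos//= ub_le_sup.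
    exact: (Jdown s).
  by rewrite !e; exact: hle.
have e d (T : measurableType d) (r : T -> R) : [set x | (t < u (r x))%R] = [set x | (0 < r x < s)%R].
  apply/seteqP; split => x /= h; last exact: Jlt.
  rewrite Jpos//= lt_neqAle ub_le_sup// andbT; apply/eqP => rs.
  by apply: nJs; rewrite -rs.
by rewrite !e; exact: hlt.
Qed.

End layer_cake.

(** * Powers on the half-line, and polar coordinates *)

Section powers.
Context (R : realType).
Local Notation lam := (@lebesgue_measure R).

Lemma continuous_powR_gt0 (a t : R) : 0 < t -> {for t, continuous (fun x => x `^ a)}.
Proof.
move=> t0; apply: differentiable_continuous; apply/derivable1_diffP.
by apply: derivable_powR; rewrite in_itv/= t0.
Qed.

Lemma measurable_annulus1 (s : R) (b : bool) :
  measurable [set x : R | (0 < x) && (x < s ?<= if b)].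
Proof.
rewrite (_ : [set x : R | _] = [set` Interval (BRight 0) (BSide (~~ b) s)])//.
by apply/seteqP; split => x /=; rewrite in_itv/= ?negbK.
Qed.

Lemma integral_powR (a s : R) (b : bool) : 0 <= a -> 0 < s ->
  (\int[lam]_(x in [set x : R | (0 < x) && (x < s ?<= if b)]%R) (x `^ a)%:E =
   (s `^ (a + 1) / (a + 1))%:E)%E.
Proof.
move=> a0 s0; have a1 : 0 < a + 1 by rewrite ltr_wpDl.
rewrite (_ : [set x : R | _] = [set` Interval (BRight 0) (BSide (~~ b) s)]); last first.
  by apply/seteqP; split => x /=; rewrite in_itv/= ?negbK.
have mf (D : set R) : measurable_fun D (fun x : R => (x `^ a)%:E).
  by apply/measurable_EFinP; apply: measurable_funTS; exact: measurable_powR.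
rewrite (@integral_itv_bndoo _ _ _ _ false)// -(@integral_itv_bndoo _ _ _ _ true false)//.
rewrite (@continuous_FTC2 _ _ (fun x => x `^ (a + 1) / (a + 1)))//.
- by rewrite powR0 ?gt_eqF// mul0r sube0.
- apply/continuous_within_itvP => //; split.
  + by move=> x; rewrite in_itv/= => /andP[x0 _]; exact: continuous_powR_gt0.
  + have [->|a_neq0] := eqVneq a 0.
      by under eq_fun do rewrite powRr0; rewrite powRr0; exact: cvg_cst.
    by rewrite powR0//; apply: powR_cvg0; rewrite lt_neqAle eq_sym a_neq0.
  + by apply: cvg_at_left_filter; exact: continuous_powR_gt0.
- split.
  + move=> x; rewrite in_itv/= => /andP[x0 _]; apply: derivableM => //.
    by apply: derivable_powR; rewrite in_itv/= x0.
  + rewrite powR0 ?gt_eqF//; apply: cvgMl; exact: powR_cvg0.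
  + by apply: cvg_at_left_filter; apply: cvgMl; exact: continuous_powR_gt0.
- move=> x; rewrite in_itv/= => /andP[x0 _]; rewrite derive1E.
  have := is_derive1_powR (a + 1) x0 => hd.
  rewrite deriveM//= !derive_val scaler0 add0r.
  by rewrite addrK /GRing.scale/= mulrA mulVf ?mul1r// gt_eqF.
Qed.

End powers.

Section decreasing_eq.
Context (R : realType).
Local Open Scope ereal_scope.
Context d1 d2 (T1 : measurableType d1) (T2 : measurableType d2).
Context (m1 : {sigma_finite_measure set T1 -> \bar R})
        (m2 : {sigma_finite_measure set T2 -> \bar R}).

Lemma decreasing_integral_eq (w1 : T1 -> \bar R) (r1 : T1 -> R)
   (w2 : T2 -> \bar R) (r2 : T2 -> R) (u : R -> R) :
  measurable_fun setT w1 -> (forall x, 0 <= w1 x) -> measurable_fun setT r1 ->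
  measurable_fun setT w2 -> (forall x, 0 <= w2 x) -> measurable_fun setT r2 ->
  measurable_fun setT u -> (forall t, 0 <= u t)%R -> (forall t, t <= 0 -> u t = 0)%R ->
  (forall s t, 0 < s -> s <= t -> u t <= u s)%R ->
  (forall s (b : bool), (0 < s)%R ->
    \int[m1]_(x in [set x | (0 < r1 x) && (r1 x < s ?<= if b)]%R) w1 x =
    \int[m2]_(x in [set x | (0 < r2 x) && (r2 x < s ?<= if b)]%R) w2 x) ->
  \int[m1]_x (w1 x * (u (r1 x))%:E) = \int[m2]_x (w2 x * (u (r2 x))%:E).
Proof.
move=> mw1 w10 mr1 mw2 w20 mr2 mu_ u0 uneg udec h; apply/eqP; rewrite eq_le.
apply/andP; split; apply: decreasing_integral_le => // s s0.
- by rewrite (h s false s0).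
- by rewrite (h s true s0).
- by rewrite -(h s false s0).
- by rewrite -(h s true s0).
Qed.

End decreasing_eq.

Section polar.
Context (R : realType) (n : nat).
Local Notation V := 'rV[R]_n.+1.
Local Notation mu := (@lebesgue_rV R n).
Local Notation lam := (@lebesgue_measure R).

(** The origin is left out and the flag [b] closes the outer boundary, to match the two families of
    sets in [decreasing_integral_eq]. *)
Definition annulus (b : bool) (s : R) : set V :=
  [set x | (0 < enorm x) && (enorm x < s ?<= if b)].

Lemma measurable_enorm_id : measurable_fun setT (@enorm R n.+1).
Proof. by apply: measurable_enorm; exact: mcoord_id. Qed.

Lemma measurable_annulus b s : measurable (annulus b s).
Proof.
rewrite (_ : annulus b s = setT `&` @enorm R n.+1 @^-1` [set` Interval (BRight 0) (BSide (~~ b) s)]).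
  by apply: measurable_enorm_id; [exact: measurableT|exact: measurable_itv].
by rewrite setTI; apply/seteqP; split => x /=; rewrite in_itv/= ?negbK.
Qed.

Section homogeneous.
Variables (w : V -> R) (q : R).
Hypotheses (mw : measurable_fun setT w) (w0 : forall x, 0 <= w x).
Hypothesis wq : forall c x, 0 < c -> w (c *: x) = c `^ q * w x.

(** The substitution is a dilation by [s]: homogeneity contributes the power [q], the volume the
    power [n.+1]. *)
Lemma homogeneous_annulus b s : 0 < s ->
  (\int[mu]_(x in annulus b s) (w x)%:E =
   (s `^ (q + n.+1%:R))%:E * \int[mu]_(x in annulus b 1) (w x)%:E)%E.
Proof.
move=> s0; have s1 : 0 < s^-1 by rewrite invr_gt0.
pose f (x : V) : \bar R := ((w \_ (annulus b 1)) x)%:E.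
have mf : measurable_fun setT f.
  by apply/measurable_EFinP; apply: (measurable_restrictT w (measurable_annulus b 1)).1; exact: measurable_funTS.
have f0 x : (0 <= f x)%E by rewrite lee_fin /patch; case: ifP.
have <- : (\int[mu]_x f x = \int[mu]_(x in annulus b 1) (w x)%:E)%E.
  by rewrite [RHS]integral_mkcond; apply: eq_integral => x _; rewrite /f /patch; case: ifP.
have annE x : (s^-1 *: x \in annulus b 1) = (x \in annulus b s).
  apply/idP/idP; rewrite !inE /annulus/= enormZ (ger0_norm (ltW s1)) pmulr_rgt0//;
    by move=> /andP[->]/=; case: b f mf f0 => _ _ _ /=;
    rewrite mulrC ?ler_pdivrMr ?ltr_pdivrMr// mul1r.
have fE x : f (s^-1 *: x) = ((s `^ (- q))%:E * ((w \_ (annulus b s)) x)%:E)%E.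
  rewrite /f /patch annE; case: ifP => _; last by rewrite mule0.
  by rewrite wq// -EFinM -powR_inv1 ?ltW// -powRrM mulN1r.
have := @ge0_integral_affine R n s^-1 0 f s1 mf f0.
under eq_integral do rewrite addr0 fE.
rewrite invrK ge0_integralZl//; last 3 first.
- by apply/measurable_EFinP; apply: (measurable_restrictT w (measurable_annulus b s)).1; exact: measurable_funTS.
- by move=> x _; rewrite lee_fin /patch; case: ifP.
- by rewrite lee_fin powR_ge0.
move=> h; have sn : s != 0 by rewrite gt_eqF.
rewrite powRD ?sn ?implybT// powR_mulrn ?ltW// EFinM -muleA -h muleA -EFinM.
rewrite -powRD ?sn ?implybT// subrr powRr0 mul1e [LHS]integral_mkcond.
by apply: eq_integral => x _; rewrite /patch; case: ifP.
Qed.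

(** The unit sphere carries no mass: the closed annulus lies in the open one of radius [l > 1],
    whose mass is [K] times a power of [l], and [l] may be taken close to 1. *)
Lemma homogeneous_annulus_closed (K : R) : 0 <= q ->
  (\int[mu]_(x in annulus false 1) (w x)%:E = K%:E)%E ->
  (\int[mu]_(x in annulus true 1) (w x)%:E = K%:E)%E.
Proof.
move=> q0 wK; have K0 : 0 <= K.
  by rewrite -lee_fin -wK; apply: integral_ge0 => x _; rewrite lee_fin.
have m0 : 0 < q + n.+1%:R by rewrite ltr_wpDl.
have mono (A B : set V) : measurable A -> measurable B -> A `<=` B ->
    (\int[mu]_(x in A) (w x)%:E <= \int[mu]_(x in B) (w x)%:E)%E.
  move=> mA mB AB; apply: ge0_subset_integral => //.
    by apply/measurable_EFinP; exact: measurable_funTS.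
  by move=> x _; rewrite lee_fin.
apply/eqP; rewrite eq_le; apply/andP; split; last first.
  rewrite -wK; apply: mono; [exact: measurable_annulus|exact: measurable_annulus|].
  by move=> x /= /andP[x0 x1]; rewrite /annulus/= x0 ltW.
apply/lee_addgt0Pr => e e0.
(* Its power of exponent [q + n.+1] is [1 + e / (K + 1)]; the [+ 1] in the denominator covers
   [K = 0]. *)
pose l := (1 + e / (K + 1)) `^ (q + n.+1%:R)^-1.
have l0 : 0 < 1 + e / (K + 1) by rewrite addr_gt0// divr_gt0// ltr_wpDl.
have l1 : 1 < l.
  have e1 : 1 `^ (q + n.+1%:R)^-1 = 1 :> R by rewrite powR1.
  rewrite -{1}e1; apply: gt0_ltr_powR.
  - by rewrite invr_gt0.
  - by rewrite nnegrE.
  - by rewrite nnegrE ltW.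
  - by rewrite ltrDl divr_gt0// ltr_wpDl.
have lgt0 : 0 < l by rewrite (lt_trans _ l1).
apply: (@le_trans _ _ (\int[mu]_(x in annulus false l) (w x)%:E)%E).
  apply: mono; [exact: measurable_annulus|exact: measurable_annulus|].
  by move=> x /= /andP[x0 x1]; rewrite /annulus/= x0 (le_lt_trans x1).
rewrite homogeneous_annulus// wK -EFinM -EFinD lee_fin -powRrM mulVf ?gt_eqF// (powRr1 (ltW l0)).
rewrite mulrDl mul1r lerD2l -mulrA ger_pMr// mulrC ler_pdivrMr ?mul1r ?lerDl//.
by rewrite ltr_wpDl.
Qed.

(** By homogeneity the mass of an annulus of radius [s] is [K] times [s] to the power [q + n.+1],
    which is also the mass of []0, s[] under the radial density on the right. Weights that agree on
    these sets give the same integral to every decreasing profile. *)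
Lemma polar (K : R) (u : R -> R) : 0 <= q ->
  (\int[mu]_(x in annulus false 1) (w x)%:E = K%:E)%E ->
  measurable_fun setT u -> (forall t, 0 <= u t) -> (forall t, t <= 0 -> u t = 0) ->
  (forall s t, 0 < s -> s <= t -> u t <= u s) ->
  (\int[mu]_x ((w x)%:E * (u (enorm x))%:E) =
   ((q + n.+1%:R) * K)%:E * \int[lam]_r ((r `^ (q + n%:R))%:E * (u r)%:E))%E.
Proof.
move=> q0 wK mu_ u0 uneg udec.
have m0 : 0 < q + n.+1%:R by rewrite ltr_wpDl.
have K0 : 0 <= K.
  by rewrite -lee_fin -wK; apply: integral_ge0 => x _; rewrite lee_fin.
have C0 : (0 <= ((q + n.+1%:R) * K)%:E)%E by rewrite lee_fin mulr_ge0// ltW.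
have mp D : measurable_fun D (fun r : R => (r `^ (q + n%:R))%:E).
  by apply/measurable_EFinP; apply: measurable_funTS; exact: measurable_powR.
rewrite -ge0_integralZl//; last 2 first.
- by apply: emeasurable_funM; [exact: mp|apply/measurable_EFinP; exact: mu_].
- by move=> r _; rewrite mule_ge0 ?lee_fin ?powR_ge0.
under [RHS]eq_integral do rewrite muleA.
apply: (@decreasing_integral_eq _ _ _ _ _ mu lam (EFin \o w) (@enorm R n.+1)
  (fun r => ((q + n.+1%:R) * K)%:E * (r `^ (q + n%:R))%:E)%E id) => //.
- exact/measurable_EFinP.
- exact: measurable_enorm_id.
- by apply: emeasurable_funM; [exact: measurable_cst|exact: mp].
- by move=> r; rewrite mule_ge0// lee_fin powR_ge0.
move=> s b s0; rewrite [LHS](homogeneous_annulus b s0).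
rewrite [X in (_ * X)%E = _](_ : _ = K%:E); last by case: b => //; exact: homogeneous_annulus_closed.
have mD := measurable_annulus1 s b.
rewrite ge0_integralZl//; [|exact: mp|by move=> r _; rewrite lee_fin powR_ge0].
rewrite integral_powR// ?addr_ge0//.
have -> : q + n%:R + 1 = q + n.+1%:R by rewrite -addrA -natr1.
by rewrite -!EFinM [in RHS]mulrC mulrA divfK// gt_eqF.
Qed.

End homogeneous.

End polar.

(** * Continuity, restricted measures, and the surface measure of the sphere *)

Section continuity.
Context (R : realType) (d : nat).
Local Notation V := 'rV[R]_d.

Lemma continuous_big_sum (T : topologicalType) (I : Type) (s : seq I) (f : I -> T -> R) :
  (forall i, continuous (f i)) -> continuous (fun x => \sum_(i <- s) f i x).
Proof.
move=> cf; elim: s => [|i s IH] x.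
  by rewrite (_ : (fun _ => _) = cst 0); [exact: cvg_cst|apply/funext => y; rewrite big_nil].
rewrite (_ : (fun _ => _) = (fun y => f i y + \sum_(j <- s) f j y)); last first.
  by apply/funext => y; rewrite big_cons.
by apply: cvgD; [exact: cf|exact: IH].
Qed.

Lemma continuous_coord (i : 'I_d) : continuous (fun x : V => x 0 i).
Proof. exact: coord_continuous. Qed.

Lemma continuous_dotv (e : V) : continuous (dotv e).
Proof.
apply: (@continuous_big_sum V 'I_d (index_enum _) (fun i x => e 0 i * x 0 i)) => i x.
exact: (continuousM (@cst_continuous _ _ (e 0 i) x) (@continuous_coord i x)).
Qed.

Lemma continuous_enorm : continuous (@enorm R d).
Proof.
move=> x; apply: continuous_comp; last exact: sqrt_continuous.
apply: continuous_big_sum => i y.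
exact: (continuous_comp (@continuous_coord i y) (@exprn_continuous R 2 _)).
Qed.

End continuity.

Section restriction.
Context d (T : measurableType d) (R : realType) (m : {measure set T -> \bar R}).
Variables (D : set T) (mD : measurable D).

Lemma ge0_integral_mrestr (f : T -> \bar R) :
  measurable_fun setT f -> (forall x, 0 <= f x)%E ->
  (\int[mrestr m mD]_x f x = \int[m]_(x in D) f x)%E.
Proof.
move=> mf f0.
have m1 : measurable_fun setT (\1_D : T -> R) by exact: measurable_indic.
have p1 x : 0 <= (\1_D x : R) by rewrite indicE.
transitivity (\int[wmeasure_of m m1 p1]_x f x)%E.
  apply: eq_measure_integral => A mA _.
  by rewrite /= /wmeasure_of integral_indic// setIC.
rewrite ge0_integral_wmeasure// [RHS]integral_mkcond; apply: eq_integral => x _.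
by rewrite patchE indicE; case: ifP => _; rewrite ?mule1 ?mule0.
Qed.

End restriction.

Section sphere_integral.
Context (R : realType) (n : nat).
Local Notation V := 'rV[R]_n.+1.
Local Notation mu := (@lebesgue_rV R n).
Local Notation lam := (@lebesgue_measure R).
Local Notation S := (g_sigma_algebraType (@open V)).

Let proj (x : V) : S := (enorm x)^-1 *: x.

Lemma measurable_proj : measurable_fun setT proj.
Proof.
apply: (@measurability _ _ _ S setT proj (@open V)) => // _ [U oU <-]; rewrite setTI.
apply: (measurable_preimage_open (f := fun x : V => (enorm x)^-1 *: x)); last exact: oU.
apply: mcoordZ; last exact: mcoord_id.
rewrite (_ : (fun _ => _) = (fun x : V => enorm x `^ (-1))).
  by apply: (measurableT_comp (measurable_powR (-1)) (@measurable_enorm_id R n)).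
by apply/funext => x; rewrite powR_inv1// enorm_ge0.
Qed.

(** The surface measure as a structured measure: the dimension times the image of Lebesgue measure
    on the punctured closed unit ball under radial projection. *)
Let sph := mscale (n.+1%:R%:nng) (push (mrestr mu (@measurable_annulus R n true 1)) measurable_proj).

Lemma measurable_usphere : measurable (@usphere R n : set S).
Proof.
rewrite -[X in measurable X]setCK; apply: measurableC; apply: sub_sigma_algebra.
rewrite (_ : ~` @usphere R n = @enorm R n.+1 @^-1` (~` [set 1]))//.
apply: open_comp; first exact: (in1W (@continuous_enorm R n.+1)).
by rewrite openC; exact/accessible_closed_set1/hausdorff_accessible/Rhausdorff.
Qed.

Lemma sphere_measureE : @sphere_measure R n = sph.
Proof.
apply/funext => A; rewrite /sphere_measure.
rewrite (_ : [set x | _] = proj @^-1` A `&` annulus true 1)//.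
by apply/seteqP; split => x /= [h1 h2]; split.
Qed.

(** Integration over the sphere is integration, over the punctured ball, of the extension that is
    constant along rays. *)
Lemma ge0_integral_sphere (g : S -> R) : measurable_fun setT g -> (forall w, 0 <= g w) ->
  (\int[@sphere_measure R n]_(w in @usphere R n) (g w)%:E =
   n.+1%:R%:E * \int[mu]_(x in annulus true 1) (g (proj x))%:E)%E.
Proof.
move=> mg g0; rewrite sphere_measureE integral_mkcond.
pose F : S -> \bar R := (fun w : S => (g w)%:E) \_ (@usphere R n : set S).
have mF : measurable_fun setT F.
  apply: (measurable_restrictT (fun w : S => (g w)%:E) measurable_usphere).1.
  by apply/measurable_EFinP; exact: measurable_funTS.
have F0 w : (0 <= F w)%E by rewrite /F /patch; case: ifP; rewrite // lee_fin.
have -> : (\int[sph]_w F w = n.+1%:R%:E *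
    \int[push (mrestr mu (@measurable_annulus R n true 1)) measurable_proj]_w F w)%E.
  by rewrite /sph ge0_integral_mscale.
rewrite (ge0_integral_push _ measurable_proj mF F0); congr (_ * _)%E.
rewrite (ge0_integral_mrestr _ _ (measurableT_comp mF measurable_proj) (fun x => F0 _)).
apply: eq_integral => x; rewrite inE => /andP[x0 _]; rewrite /comp /F patchE mem_set//=.
by rewrite /usphere/= enormZ ger0_norm ?invr_ge0 ?enorm_ge0// mulVf// gt_eqF.
Qed.

Lemma continuous_measurable_sphere (g : S -> R) : continuous (g : V -> R) ->
  measurable_fun setT g.
Proof.
move=> cg; apply: (measurability _ (RGenOInfty.measurableE R)) => _ [_ [a ->] <-].
rewrite setTI; apply: sub_sigma_algebra.
by apply: open_comp; [exact: (in1W cg)|exact: interval_open].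
Qed.

(** * The constant kappa in polar coordinates *)

Section kappa.
Variables (p : R) (p1 : 1 <= p).

Let p0 : 0 < p. Proof. exact: lt_le_trans p1. Qed.

Lemma dotvZl (c : R) (x y : V) : dotv (c *: x) y = c * dotv x y.
Proof. by rewrite /dotv mulr_sumr; apply: eq_bigr => i _; rewrite mxE mulrA. Qed.

Lemma dotvC (x y : V) : dotv x y = dotv y x.
Proof. by apply: eq_bigr => i _; rewrite mulrC. Qed.

Lemma dotvZr (c : R) (x y : V) : dotv x (c *: y) = c * dotv x y.
Proof. by rewrite dotvC dotvZl dotvC. Qed.

(* [|e . x|^p / |x|^p], homogeneous of degree 0 (and 0 at the origin) *)
Definition dirw (e x : V) : R := `|dotv e x| `^ p / enorm x `^ p.

Lemma dirw_ge0 e x : 0 <= dirw e x.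
Proof. by rewrite divr_ge0// powR_ge0. Qed.

Lemma dotv_measurable e : measurable_fun setT (fun x : V => `|dotv e x| `^ p).
Proof.
apply: (measurableT_comp (measurable_powR p)); apply: (measurableT_comp (@normr_measurable _ _)).
by apply: measurable_dotv; [exact: mcoord_cst|exact: mcoord_id].
Qed.

Lemma dirw_measurable e : measurable_fun setT (dirw e).
Proof.
rewrite (_ : dirw e = (fun x => `|dotv e x| `^ p * enorm x `^ (- p))); last first.
  by apply/funext => x; rewrite powRN.
apply: measurable_funM; first exact: dotv_measurable.
exact: (measurableT_comp (measurable_powR (- p)) (@measurable_enorm_id R n)).
Qed.

Lemma dirwZ e (c : R) x : 0 < c -> dirw e (c *: x) = c `^ 0 * dirw e x.
Proof.
move=> c0; rewrite powRr0 mul1r /dirw dotvZr enormZ normrM.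
rewrite !powRM ?normr_ge0 ?enorm_ge0//.
by rewrite -mulf_div divff ?mul1r// gt_eqF// powR_gt0// normr_gt0 gt_eqF.
Qed.

Lemma dirw_le e x : dirw e x <= enorm e `^ p.
Proof.
have [->|x0] := eqVneq x 0.
  by rewrite /dirw enorm0 powR0 ?gt_eqF// invr0 mulr0 powR_ge0.
rewrite /dirw ler_pdivrMr ?powR_gt0 ?enorm_gt0// -powRM ?enorm_ge0//.
apply: ge0_ler_powR; rewrite ?nnegrE ?mulr_ge0 ?enorm_ge0 ?normr_ge0 ?(ltW p0)//.
exact: norm_dotv_le.
Qed.

Lemma kappaE (e : V) : kappa p e = (n.+1%:R%:E * \int[mu]_(x in annulus true 1) (dirw e x)%:E)%E.
Proof.
rewrite /kappa (@ge0_integral_sphere (fun w => `|dotv e w| `^ p)); last 2 first.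
- apply: (measurableT_comp (measurable_powR p)); apply: (measurableT_comp (@normr_measurable _ _)).
  by apply: continuous_measurable_sphere; exact: continuous_dotv.
- by move=> w; exact: powR_ge0.
congr (_ * _)%E; apply: eq_integral => x; rewrite inE => /andP[x0 _].
rewrite /proj dotvZr normrM powRM// /dirw mulrC (ger0_norm (x := (enorm x)^-1)) ?invr_ge0 ?enorm_ge0//.
by rewrite -powR_inv1 ?enorm_ge0// -powRrM mulN1r powRN.
Qed.

Lemma annulus_fin b s : (mu (annulus b s) < +oo)%E.
Proof.
apply: (@le_lt_trans _ _ (mu (eball 0 (s + 1)))); last exact: eball_fin.
apply: le_measure; rewrite ?inE; [exact: measurable_annulus|exact: measurable_eball|].
by move=> x /= /andP[_ /lteifW xs]; rewrite /eball/= subr0 (le_lt_trans xs)// ltrDl.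
Qed.

Lemma bounded_annulus_fin (w : V -> R) M b s : measurable_fun setT w ->
  (forall x, 0 <= w x <= M) -> (\int[mu]_(x in annulus b s) (w x)%:E)%E \is a fin_num.
Proof.
move=> mw wM; rewrite ge0_fin_numE; last first.
  by apply: integral_ge0 => x _; rewrite lee_fin; have /andP[] := wM x.
apply: (@le_lt_trans _ _ (\int[mu]_(x in annulus b s) (cst M%:E x))%E).
  apply: ge0_le_integral => //.
  - exact: measurable_annulus.
  - by move=> x _; rewrite lee_fin; have /andP[] := wM x.
  - by apply/measurable_EFinP; exact: measurable_funTS.
  - by move=> x _; rewrite lee_fin; have /andP[] := wM x.
rewrite integral_cst; last exact: measurable_annulus.
have M0 : 0 <= M by have /andP[/le_trans h /h] := wM 0.
rewrite lte_mul_pinfty//; exact: annulus_fin.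
Qed.

Lemma kappa_fin (e : V) : kappa p e \is a fin_num.
Proof.
rewrite kappaE fin_numM// (@bounded_annulus_fin _ (enorm e `^ p))//.
  exact: dirw_measurable.
by move=> x; rewrite dirw_ge0 dirw_le.
Qed.

Lemma kappa_annulus (e : V) b : (\int[mu]_(x in annulus b 1) (dirw e x)%:E = (fine (kappa p e) / n.+1%:R)%:E)%E.
Proof.
have bnd x : 0 <= dirw e x <= enorm e `^ p by rewrite dirw_ge0 dirw_le.
have fin b' := bounded_annulus_fin b' 1 (dirw_measurable e) bnd.
pose K := fine (\int[mu]_(x in annulus false 1) (dirw e x)%:E)%E.
have KE : (\int[mu]_(x in annulus false 1) (dirw e x)%:E = K%:E)%E by rewrite /K fineK.
have KE' := homogeneous_annulus_closed (dirw_measurable e) (dirw_ge0 e) (dirwZ e) (lexx 0) KE.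
have -> : fine (kappa p e) = n.+1%:R * K by rewrite kappaE KE'.
rewrite mulrAC divff// mul1r.
by case: b.
Qed.

Lemma polar_kappa (e : V) (u : R -> R) :
  measurable_fun setT u -> (forall t, 0 <= u t) -> (forall t, t <= 0 -> u t = 0) ->
  (forall s t, 0 < s -> s <= t -> u t <= u s) ->
  (\int[mu]_x ((dirw e x)%:E * (u (enorm x))%:E) =
   kappa p e * \int[lam]_r ((r `^ n%:R)%:E * (u r)%:E))%E.
Proof.
move=> mu_ u0 uneg udec.
rewrite (polar (dirw_measurable e) (dirw_ge0 e) (dirwZ e) (lexx 0) (kappa_annulus e false) mu_ u0 uneg udec).
rewrite !add0r mulrCA divff// mulr1 fineK ?kappa_fin//.
Qed.

(** What is missing is the mass of [|e . x|^p] on the unit annulus in terms of [kappa]. The profile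
    [r^p] is increasing and cannot be used in [polar_kappa]; its complement [1 - r^p] on []0, 1[] is
    decreasing, and testing with it gives the mass by subtraction. *)
Lemma polar_kappa_hom (e : V) (u : R -> R) :
  measurable_fun setT u -> (forall t, 0 <= u t) -> (forall t, t <= 0 -> u t = 0) ->
  (forall s t, 0 < s -> s <= t -> u t <= u s) ->
  (\int[mu]_x ((`|dotv e x| `^ p)%:E * (u (enorm x))%:E) =
   kappa p e * \int[lam]_r ((r `^ (p + n%:R))%:E * (u r)%:E))%E.
Proof.
move=> mu_ u0 uneg udec.
have wm := dotv_measurable e.
have w0 x : 0 <= `|dotv e x| `^ p by exact: powR_ge0.
have wZ c x : 0 < c -> `|dotv e (c *: x)| `^ p = c `^ p * `|dotv e x| `^ p.
  by move=> c0; rewrite dotvZr normrM powRM// ger0_norm// ltW.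
pose k := fine (kappa p e).
pose m := p + n.+1%:R.
have m0 : 0 < m by rewrite addr_gt0.
have kE : kappa p e = k%:E by rewrite fineK// kappa_fin.
pose v (r : R) : R := if (0 < r) && (r < 1) then 1 - r `^ p else 0.
have r1 r : 0 < r -> r < 1 -> r `^ p <= 1.
  move=> r0 r1; rewrite -[leRHS](_ : 1 `^ p = 1); last by rewrite powR1.
  by apply: ge0_ler_powR; rewrite ?nnegrE ?(ltW p0)// ltW.
have mv : measurable_fun setT v.
  apply: measurable_fun_ifT => //; last first.
    by apply: measurable_funB => //; exact: measurable_powR.
  by apply: measurable_and; exact: measurable_fun_ltr.
have v0 r : 0 <= v r by rewrite /v; case: ifP => // /andP[? ?]; rewrite subr_ge0 r1.
have vdec s t : 0 < s -> s <= t -> v t <= v s.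
  move=> s0 st; rewrite /v; have [t1|t1] := ltP t 1; last by rewrite andbF; exact: v0.
  rewrite s0 (lt_le_trans s0 st) (le_lt_trans st t1)/= lerB//.
  by apply: ge0_ler_powR; rewrite ?nnegrE ?(ltW p0)// ltW// (lt_le_trans s0 st).
have vneg t : t <= 0 -> v t = 0 by move=> t0; rewrite /v ltNge t0.
pose K := k / m.
suff KE : (\int[mu]_(x in annulus false 1) (`|dotv e x| `^ p)%:E = K%:E)%E.
  rewrite (polar wm w0 wZ (ltW p0) KE)// -/m kE; congr (_%:E * _)%E.
  by rewrite /K mulrC divfK// gt_eqF.
pose I1 := (\int[lam]_r ((r `^ n%:R)%:E * (v r)%:E))%E.
have I1E : I1 = (n.+1%:R^-1 - m^-1)%:E.
  have b0 : (\int[lam]_(x in [set x : R | (0 < x) && (x < 1 ?<= if false)]%R) (x `^ n%:R)%:E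
     = I1 + (m^-1)%:E)%E.
    have -> : (m^-1)%:E = (\int[lam]_(x in [set x : R | (0 < x) && (x < 1 ?<= if false)]%R) (x `^ (p + n%:R))%:E)%E.
      by rewrite integral_powR ?addr_ge0// ?(ltW p0)// powR1 -addrA natr1 div1r.
    rewrite [LHS]integral_mkcond [X in _ = (_ + X)%E]integral_mkcond /I1 -ge0_integralD//; last 4 first.
    - by move=> x _; rewrite mule_ge0// lee_fin ?powR_ge0.
    - by apply: emeasurable_funM; apply/measurable_EFinP => //; exact: measurable_powR.
    - by move=> x _; rewrite patchE; case: ifP => // _; rewrite lee_fin powR_ge0.
    - apply: (measurable_restrictT (fun x : R => (x `^ (p + n%:R))%:E) (measurable_annulus1 1 false)).1.
      by apply/measurable_EFinP; apply: measurable_funTS; exact: measurable_powR.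
    apply: eq_integral => x _; rewrite !patchE /v.
    rewrite (_ : (x \in _) = (0 < x) && (x < 1)); last by apply/idP/idP; rewrite inE.
    case: ifPn => [/andP[x0 x1]|_]; last by rewrite mule0 adde0.
    rewrite -EFinM -EFinD mulrBr mulr1 addrC [p + _]addrC powRD ?addrK//.
      by rewrite addrC subrK.
    by rewrite (gt_eqF x0) implybT.
  move: b0; rewrite integral_powR// powR1 natr1 div1r => /eqP.
  by rewrite -sube_eq ?fin_num_adde_defl// => /eqP <-; rewrite EFinB.
have h := polar_kappa e mv v0 vneg vdec.
have : (\int[mu]_(x in annulus false 1) (dirw e x)%:E =
   \int[mu]_x ((dirw e x)%:E * (v (enorm x))%:E) + \int[mu]_(x in annulus false 1) (`|dotv e x| `^ p)%:E)%E.
  rewrite [LHS]integral_mkcond [X in _ = (_ + X)%E]integral_mkcond -ge0_integralD//; last 4 first.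
  - by move=> x _; rewrite mule_ge0// lee_fin ?dirw_ge0.
  - apply: emeasurable_funM; apply/measurable_EFinP; first exact: dirw_measurable.
    exact: (measurableT_comp mv (@measurable_enorm_id R n)).
  - by move=> x _; rewrite patchE; case: ifP => // _; rewrite lee_fin powR_ge0.
  - apply: (measurable_restrictT (fun x => (`|dotv e x| `^ p)%:E) (measurable_annulus false 1)).1.
    by apply/measurable_EFinP; exact: measurable_funTS.
  apply: eq_integral => x _; rewrite !patchE /v.
  rewrite (_ : (x \in _) = (0 < enorm x) && (enorm x < 1)); last by apply/idP/idP; rewrite inE.
  case: ifPn => [/andP[x0 x1]|_]; last by rewrite mule0 adde0.
  rewrite -EFinM -EFinD mulrBr mulr1 {3}/dirw divfK ?subrK// gt_eqF// powR_gt0//.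
rewrite h kappa_annulus -/k kE -/I1 I1E => /eqP.
rewrite addeC -sube_eq; [|by []|by rewrite -EFinM fin_num_adde_defl] => /eqP <-.
by rewrite -EFinM -EFinB /K mulrBr opprB addrCA subrr addr0.
Qed.

End kappa.
End sphere_integral.

(** * The Gamma function, Gaussian integrals, and the closed form of kappa *)

Section gamma.
Context (R : realType).
Local Notation lam := (@lebesgue_measure R).

Definition gamma_integral (s : R) : \bar R :=
  (\int[lam]_(t in `]0%R, +oo[) (t `^ (s - 1) * expR (- t))%:E)%E.

Lemma measurable_gamma_fun (s : R) (D : set R) :
  measurable_fun D (fun t : R => (t `^ (s - 1) * expR (- t))%:E).
Proof.
apply/measurable_EFinP; apply: measurable_funTS; apply: measurable_funM.
  exact: measurable_powR.
by apply: measurableT_comp => //; exact: measurable_expR.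
Qed.

(** Half of the exponential absorbs the power: the integrand is at most a constant times the
    exponential density of rate 1/2. *)
Lemma gamma_integral_fin (s : R) : 1 <= s -> gamma_integral s \is a fin_num.
Proof.
move=> s1; have s0 : 0 <= s - 1 by rewrite subr_ge0.
rewrite ge0_fin_numE; last first.
  by apply: integral_ge0 => t _; rewrite lee_fin mulr_ge0 ?powR_ge0 ?expR_ge0.
pose N := (Num.truncn (s - 1)).+1.
have sN : s - 1 <= N%:R by rewrite ltW// truncnS_gt.
have N0 : 0 < N%:R :> R by [].
pose C : R := (2 * N%:R) ^+ N.
have C0 : 0 <= C by rewrite exprn_ge0// mulr_ge0.
(* Since [N >= s - 1], the power is at most [(2N + t)^N = (2N)^N (1 + t/(2N))^N], and the last
   factor is at most [exp(t/2)]. *)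
have bound t : 0 < t -> t `^ (s - 1) * expR (- t) <= 2 * C * (2^-1 * expR (- 2^-1 * t)).
  move=> t0; rewrite (_ : 2 * C * (2^-1 * _) = C * expR (- 2^-1 * t)); last by field.
  have -> : expR (- t) = expR (- 2^-1 * t) * expR (- 2^-1 * t).
    by rewrite -expRD; congr expR; lra.
  rewrite mulrA ler_pM2r ?expR_gt0//.
  have t1 : 1 <= 2 * N%:R + t.
    have : 1 <= N%:R :> R by rewrite ler1n.
    lra.
  apply: (@le_trans _ _ ((2 * N%:R + t) ^+ N * expR (- 2^-1 * t))).
    rewrite ler_pM2r ?expR_gt0// -powR_mulrn; last by rewrite (le_trans _ t1).
    apply: (@le_trans _ _ ((2 * N%:R + t) `^ (s - 1))); last exact: ler_powR.
    by apply: ge0_ler_powR; rewrite ?nnegrE; lra.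
  have -> : expR (- 2^-1 * t) = (expR (2^-1 * t))^-1 by rewrite mulNr expRN.
  rewrite ler_pdivrMr ?expR_gt0//.
  have -> : 2 * N%:R + t = (2 * N%:R) * (1 + t / (2 * N%:R)).
    by field; rewrite gt_eqF.
  rewrite exprMn ler_wpM2l//.
  have -> : 2^-1 * t = N%:R * (t / (2 * N%:R)) by field; rewrite gt_eqF.
  rewrite mulr_natl expRM_natl lerXn2r ?nnegrE ?expR_ge0 ?expR_ge1Dx//.
  by rewrite addr_ge0// divr_ge0 ?mulr_ge0// ltW.
apply: (@le_lt_trans _ _ (\int[lam]_t ((2 * C)%:E * (exponential_pdf 2^-1 t)%:E))%E); last first.
  rewrite ge0_integralZl//; last 3 first.
  - by apply/measurable_EFinP; exact: measurable_exponential_pdf.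
  - by move=> t _; rewrite lee_fin exponential_pdf_ge0.
  - by rewrite lee_fin mulr_ge0.
  by rewrite integral_exponential_pdf// mule1 ltry.
rewrite /gamma_integral [leLHS]integral_mkcond; apply: ge0_le_integral => //.
- by move=> t _; rewrite patchE; case: ifP => // _; rewrite lee_fin mulr_ge0 ?powR_ge0 ?expR_ge0.
- apply: (measurable_restrictT (fun t : R => (t `^ (s - 1) * expR (- t))%:E) _).1 => //.
  exact: measurable_gamma_fun.
- by apply: emeasurable_funM => //; apply/measurable_EFinP; exact: measurable_exponential_pdf.
move=> t _; rewrite patchE mem_setE in_itv/= andbT; case: ifPn => t0; last first.
  by rewrite mule_ge0// lee_fin ?mulr_ge0// exponential_pdf_ge0.
rewrite -EFinM lee_fin /exponential_pdf patchE mem_set/= ?bound//.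
by rewrite in_itv/= andbT ltW.
Qed.

Lemma gamma_integral_gt0 (s : R) : 1 <= s -> (0 < gamma_integral s)%E.
Proof.
move=> s1; have s0 : 0 <= s - 1 by rewrite subr_ge0.
have D := measurable_annulus1 (1 : R) false.
apply: (@lt_le_trans _ _ (\int[lam]_(x in [set x : R | (0 < x) && (x < 1 ?<= if false)]%R) ((expR (-1))%:E * (x `^ (s - 1))%:E))%E).
  have mp : measurable_fun [set x : R | (0 < x) && (x < 1 ?<= if false)] (fun x : R => (x `^ (s - 1))%:E).
    by apply/measurable_EFinP; apply: measurable_funTS; exact: measurable_powR.
  have p0 (x : R) : (0 <= (x `^ (s - 1))%:E)%E by rewrite lee_fin powR_ge0.
  rewrite (@ge0_integralZl _ _ _ lam _ D _ mp)// ?lee_fin ?expR_ge0//.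
  by rewrite integral_powR// mule_gt0 ?lte_fin ?expR_gt0// subrK powR1 div1r invr_gt0 (lt_le_trans _ s1).
apply: (@le_trans _ _ (\int[lam]_(t in [set x : R | (0 < x) && (x < 1 ?<= if false)]%R) (t `^ (s - 1) * expR (- t))%:E)%E).
  apply: ge0_le_integral => //.
  - by move=> t _; rewrite mule_ge0// lee_fin ?expR_ge0 ?powR_ge0.
  - apply: emeasurable_funM => //.
    by apply/measurable_EFinP; apply: measurable_funTS; exact: measurable_powR.
  - exact: measurable_gamma_fun.
  move=> t /andP[t0 t1]; rewrite -EFinM lee_fin mulrC ler_wpM2l ?powR_ge0// ler_expR.
  by rewrite lerN2 ltW.
apply: ge0_subset_integral => //.
- exact: measurable_gamma_fun.
- by move=> t _; rewrite lee_fin mulr_ge0 ?powR_ge0 ?expR_ge0.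
- by move=> t /= /andP[t0 _]; rewrite in_itv/= t0.
Qed.

Lemma GammaE (s : R) : 1 <= s -> (Gamma s)%:E = gamma_integral s.
Proof. by move=> s1; rewrite -[RHS]fineK// gamma_integral_fin. Qed.

(** Set to 0 at nonpositive arguments, as the radial profiles of the polar formulas are required to
    be. *)
Definition gauss_pos (r : R) : R := if 0 < r then expR (- r ^+ 2) else 0.

Lemma measurable_gauss_pos : measurable_fun setT gauss_pos.
Proof.
apply: measurable_fun_ifT => //; first exact: measurable_fun_ltr.
exact: measurable_gauss_fun.
Qed.

Lemma gauss_pos_ge0 r : 0 <= gauss_pos r.
Proof. by rewrite /gauss_pos; case: ifP => // _; exact: expR_ge0. Qed.

Lemma gauss_pos_neg r : r <= 0 -> gauss_pos r = 0.
Proof. by move=> r0; rewrite /gauss_pos ltNge r0. Qed.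

Lemma gauss_pos_dec s t : 0 < s -> s <= t -> gauss_pos t <= gauss_pos s.
Proof.
move=> s0 st; rewrite /gauss_pos s0 (lt_le_trans s0 st) ler_expR lerN2.
by rewrite ler_pXn2r// nnegrE ltW// (lt_le_trans s0 st).
Qed.

(* The substitution [t = r^2], obtained by comparing the two sides on [0 < r < s]. *)
Lemma integral_powR_gauss (q : R) : 1 <= q ->
  (\int[lam]_r ((r `^ q)%:E * (gauss_pos r)%:E) =
   2^-1%:E * gamma_integral ((q + 1) / 2))%E.
Proof.
move=> q1; have q0 : 0 <= q by rewrite (le_trans _ q1).
pose a := (q + 1) / 2 - 1.
have a0 : 0 <= a by rewrite /a; lra.
have mw D : measurable_fun D (fun t : R => (2^-1 * t `^ a)%:E).
  by apply/measurable_EFinP; apply: measurable_funTS; apply: measurable_funM => //; exact: measurable_powR.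
rewrite (@decreasing_integral_eq _ _ _ _ _ lam lam (fun r => (r `^ q)%:E) id
  (fun t => (2^-1 * t `^ a)%:E) Num.sqrt gauss_pos) => //.
- rewrite /gamma_integral -ge0_integralZl//; last 2 first.
  + exact: measurable_gamma_fun.
  + by move=> t _; rewrite lee_fin mulr_ge0 ?powR_ge0 ?expR_ge0.
  rewrite [RHS]integral_mkcond; apply: eq_integral => t _.
  rewrite patchE mem_setE in_itv/= andbT /gauss_pos sqrtr_gt0; case: ifP => t0; last by rewrite mule0.
  by rewrite sqr_sqrtr ?ltW// -!EFinM mulrA.
- by apply/measurable_EFinP; exact: measurable_powR.
- by move=> r; rewrite lee_fin powR_ge0.
- exact: mw.
- by move=> r; rewrite lee_fin mulr_ge0// powR_ge0.
- by apply: continuous_measurable_fun; exact: sqrt_continuous.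
- exact: measurable_gauss_pos.
- exact: gauss_pos_ge0.
- exact: gauss_pos_neg.
- exact: gauss_pos_dec.
move=> s b s0; rewrite integral_powR//.
rewrite (_ : [set x | _] = [set x : R | (0 < x) && (x < s ^+ 2 ?<= if b)]%R); last first.
  have sqr_lt (x : R) : 0 < x -> (Num.sqrt x < s ?<= if b) = (x < s ^+ 2 ?<= if b).
    move=> x0; rewrite -[in RHS](sqr_sqrtr (ltW x0)).
    by case: b => /=; rewrite ?ler_pXn2r ?ltr_pXn2r ?nnegrE ?sqrtr_ge0// ltW.
  by apply/seteqP; split => x /=; rewrite sqrtr_gt0 => /andP[x0 xs]; rewrite x0/= -?sqr_lt ?sqr_lt in xs *.
under eq_integral do rewrite EFinM.
rewrite ge0_integralZl//; last 3 first.
- exact: measurable_annulus1.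
- by apply/measurable_EFinP; apply: measurable_funTS; exact: measurable_powR.
- by move=> t _; rewrite lee_fin powR_ge0.
rewrite integral_powR ?exprn_gt0// -EFinM /a subrK; congr (_%:E).
rewrite -powR_mulrn ?ltW// -powRrM.
rewrite (_ : 2%:R * ((q + 1) / 2) = q + 1); last by field.
by field; lra.
Qed.

Lemma integral_norm_powR_gauss (p : R) : 1 <= p ->
  (\int[lam]_t (`|t| `^ p * expR (- t ^+ 2))%:E = gamma_integral ((p + 1) / 2))%E.
Proof.
move=> p1; pose f (t : R) : \bar R := (`|t| `^ p * expR (- t ^+ 2))%:E.
have mf D : measurable_fun D f.
  apply/measurable_EFinP; apply: measurable_funTS; apply: measurable_funM.
    by apply: (measurableT_comp (measurable_powR p)); exact: normr_measurable.
  exact: measurable_gauss_fun.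
have f0 t : (0 <= f t)%E by rewrite lee_fin mulr_ge0 ?powR_ge0 ?expR_ge0.
have half : (\int[lam]_(t in `[0%R, +oo[) f t = 2^-1%:E * gamma_integral ((p + 1) / 2))%E.
  rewrite -(@integral_itv_obnd_cbnd R 0 +oo%O f (mf _)).
  rewrite -integral_powR_gauss//.
  transitivity (\int[lam]_t ((f \_ (`]0%R, +oo[%classic : set R)) t))%E; first exact: integral_mkcond.
  apply: eq_integral => t _; rewrite patchE mem_setE in_itv/= andbT /gauss_pos; case: ifP => t0; last by rewrite mule0.
  by rewrite /f gtr0_norm.
have half' := ge0_integration_by_substitution0 (mf setT) f0.
rewrite -[LHS]/(\int[lam]_t f t)%E -(setUv `]-oo, (0:R)]%classic) ge0_integral_setU//; last 2 first.
- exact: mf.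
- exact: (introT disj_setPCl (@subset_refl _ _)).
rewrite setCitvl.
have -> : (\int[lam]_(x in `]-oo, 0%R]) f x = \int[lam]_(x in `[0%R, +oo[) f x)%E.
  by rewrite half'; apply: eq_integral => t _; rewrite /f normrN sqrrN.
rewrite (@integral_itv_obnd_cbnd R 0 +oo%O f (mf _)).
rewrite half -ge0_muleDl ?lee_fin// -EFinD.
  by rewrite (_ : 2^-1 + 2^-1 = 1 :> R) ?mul1e//; lra.
exact: measurableC.
Qed.

End gamma.

Lemma half_ge1 (R : realType) (a b : R) : 1 <= a -> 1 <= b -> 1 <= (a + b) / 2.
Proof. by move=> *; lra. Qed.

Section kappa_formula.
Context (R : realType) (n : nat).
Local Notation V := 'rV[R]_n.+1.
Local Notation mu := (@lebesgue_rV R n).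
Local Notation lam := (@lebesgue_measure R).
Variables (p : R) (p1 : 1 <= p).

Let p0 : 0 < p. Proof. exact: lt_le_trans p1. Qed.

Let gau (e x : V) : \bar R := (`|dotv e x| `^ p * expR (- enorm x ^+ 2))%:E.

(** For a coordinate direction the integrand is a product of functions of one coordinate each. *)
Lemma gaussian_coord : (\int[mu]_x gau (delta_mx 0 0)%R x =
  gamma_integral ((p + 1) / 2) * (pi `^ (n%:R / 2))%:E)%E.
Proof.
pose u (i : 'I_n.+1) (t : R) := (if i == ord0 then `|t| `^ p else 1) * expR (- t ^+ 2).
have gf : gamma_integral ((p + 1) / 2) \is a fin_num by apply: gamma_integral_fin; exact: half_ge1.
pose c (i : 'I_n.+1) := if i == ord0 then fine (gamma_integral ((p + 1) / 2)) else Num.sqrt pi.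
rewrite (eq_integral (fun x : V => (\prod_i u i (x 0 i))%:E)); last first.
  move=> x _; rewrite /gau big_split/= -expR_sum big_ord_recl/= big1 ?mulr1//.
  rewrite enorm_sqr sumrN /dotv big_ord_recl/= big1 ?addr0 ?mxE/= ?eqxx ?mul1r//.
  by move=> i _; rewrite mxE/= mul0r.
rewrite (@ge0_integral_prod R n u c).
- rewrite big_ord_recl/= /c/= EFinM fineK//; congr (_ * _%:E)%E.
  rewrite prodr_const card_ord -powR12_sqrt ?pi_ge0// -powR_mulrn ?powR_ge0// -powRrM.
  by congr (_ `^ _); rewrite mulrC.
- move=> i; apply: measurable_funM; last exact: measurable_gauss_fun.
  case: (i == ord0) => //; apply: (measurableT_comp (measurable_powR p)).
  exact: normr_measurable.
- by move=> i t; rewrite mulr_ge0 ?expR_ge0//; case: ifP; rewrite ?powR_ge0.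
- move=> i; rewrite /u /c; case: (i == ord0).
    by rewrite fineK// integral_norm_powR_gauss.
  by under eq_integral do rewrite mul1r; exact: integralT_gauss.
Qed.

(** The Householder reflection exchanging [e] and the first basis vector is an isometric involution;
    the minus sign in [ge0_integral_isometry] is harmless for an even integrand. *)
Lemma gaussian_unit (e : V) : enorm e = 1 ->
  (\int[mu]_x gau e x = \int[mu]_x gau (delta_mx 0 0)%R x)%E.
Proof.
move=> e1; pose e0 : V := delta_mx 0 0.
have [->//|ee0] := eqVneq e e0.
pose v := e - e0; pose vv := dotv v v.
have dotDr (a b c : V) : dotv a (b + c) = dotv a b + dotv a c.
  by rewrite /dotv -big_split; apply: eq_bigr => i _; rewrite mxE mulrDr.
have dotNr (a b : V) : dotv a (- b) = - dotv a b.
  by rewrite /dotv -sumrN; apply: eq_bigr => i _; rewrite mxE mulrN.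
have dotDl (a b c : V) : dotv (a + b) c = dotv a c + dotv b c.
  by rewrite !(dotvC _ c) dotDr.
have dotNl (a b : V) : dotv (- a) b = - dotv a b by rewrite dotvC dotNr dotvC.
have dotE (a : V) : dotv a a = enorm a ^+ 2.
  by rewrite enorm_sqr; apply: eq_bigr => i _; rewrite expr2.
have e00 : dotv e0 e0 = 1.
  rewrite /dotv big_ord_recl big1 ?addr0 ?mxE/= ?eqxx ?mulr1//.
  by move=> i _; rewrite !mxE/= mul0r.
have ee : dotv e e = 1 by rewrite dotE e1 expr1n.
have vv0 : vv != 0 by rewrite /vv dotE sqrf_eq0 enorm_eq0 subr_eq0.
have ve : dotv v e = vv / 2.
  by rewrite /vv /v !(dotDr, dotNr, dotDl, dotNl) ee e00 (dotvC e0 e); field.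
pose T (x : V) : V := x - (2 * dotv v x / vv) *: v.
have TD x y : T (x + y) = T x + T y.
  by rewrite /T dotDr mulrDr mulrDl scalerDl opprD addrACA.
have dvT x : dotv v (T x) = - dotv v x.
  by rewrite /T dotDr dotNr dotvZr -/vv; field.
have TK x : T (T x) = x.
  by rewrite {1}/T dvT mulrN mulNr scaleNr opprK /T subrK.
have Tn x : enorm (T x) = enorm x.
  apply/eqP; rewrite -(@eqrXn2 _ 2) ?enorm_ge0// -!dotE; apply/eqP.
  rewrite {1}/T dotDl dotNl dotvZl dvT /T dotDr dotNr dotvZr (dotvC x v).
  by field.
have eT x : dotv e (T x) = dotv e0 x.
  rewrite /T dotDr dotNr dotvZr (dotvC e v) ve /v dotDl dotNl.
  by field.
have mT : mcoord T.
  apply: mcoordB; first exact: mcoord_id.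
  apply: mcoordZ; last exact: mcoord_cst.
  apply: measurable_funM => //; apply: measurable_funM => //.
  by apply: measurable_dotv; [exact: mcoord_cst|exact: mcoord_id].
have mgau d (T' : measurableType d) (h : T' -> V) : mcoord h -> measurable_fun setT (fun t => gau e (h t)).
  move=> mh; apply/measurable_EFinP; apply: measurable_funM.
    apply: (measurableT_comp (measurable_powR p)); apply: (measurableT_comp (@normr_measurable _ _)).
    by apply: measurable_dotv; [exact: mcoord_cst|].
  by apply: (measurableT_comp measurable_gauss_fun); exact: measurable_enorm.
rewrite -(@ge0_integral_isometry R n T (gau e) TD TK Tn mT).
- by apply: eq_integral => x _; rewrite /gau dotNr eT enormN Tn normrN.
- by apply: mgau; exact: mcoord_id.
- by move=> x; rewrite lee_fin mulr_ge0 ?powR_ge0 ?expR_ge0.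
- apply: mgau; apply: mcoordB; first exact: mcoord_comp.
  by move=> j; apply: (measurableT_comp (mT j)).
Qed.

(** The integral of [|e . x|^p] against the Gaussian is computed twice: as a product of
    one-dimensional integrals after reflecting [e] onto an axis, and in polar coordinates, where
    [kappa] appears. *)
Lemma kappa_formula (e : V) : enorm e = 1 ->
  kappa p e = (2 * pi `^ ((n.+1%:R - 1) / 2) * Gamma ((p + 1) / 2)
                 / Gamma ((p + n.+1%:R) / 2))%:E.
Proof.
move=> e1; have := gaussian_unit e1; rewrite gaussian_coord.
rewrite (eq_integral (fun x : V => ((`|dotv e x| `^ p)%:E * (gauss_pos (enorm x))%:E)%E)); last first.
  move=> x _; rewrite /gau -EFinM /gauss_pos enorm_gt0; case: eqVneq => [->|//].
  by rewrite /dotv big1 ?normr0 ?powR0 ?mul0r ?gt_eqF// => i _; rewrite mxE mulr0.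
rewrite (@polar_kappa_hom R n p p1); last 4 first.
- exact: measurable_gauss_pos.
- exact: gauss_pos_ge0.
- exact: gauss_pos_neg.
- exact: gauss_pos_dec.
rewrite integral_powR_gauss; last by rewrite ler_wpDr.
have -> : p + n%:R + 1 = p + n.+1%:R by rewrite -addrA natr1.
have n1 : 1 <= n.+1%:R :> R by rewrite ler1n.
have s1 : 1 <= (p + n.+1%:R) / 2 by exact: half_ge1.
have G0 : Gamma ((p + n.+1%:R) / 2) != 0.
  by rewrite gt_eqF// -lte_fin GammaE// gamma_integral_gt0.
rewrite -!GammaE//; last exact: half_ge1.
rewrite -(fineK (kappa_fin p1 e)) -!EFinM => h0; have h := EFin_inj h0; congr (_%:E); clear h0.
have -> : (n.+1%:R - 1) / 2 = n%:R / 2 :> R by rewrite -natr1 addrK.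
move: h G0; move: (fine _) (Gamma _) (Gamma _) (pi `^ _) => k G2 G1 P h G0.
by rewrite (_ : 2 * P * G2 = 2 * (G2 * P)); [rewrite -h; field|ring].
Qed.

End kappa_formula.

(** * Smooth functions and mollifiers on the line *)

Section smooth_line.
Context (R : realType).
Local Notation lam := (@lebesgue_measure R).

(** Smoothness is witnessed by an explicit sequence of derivatives, which makes the iterated partial
    derivatives of products explicit as well. *)
Definition smooth1 (u : R -> R) := exists2 U : nat -> R -> R, U 0%N = u &
  forall k (t : R), is_derive t 1 (U k) (U k.+1 t).

Lemma smooth1_derive (u u' : R -> R) : smooth1 u ->
  (forall t : R, is_derive t 1 u (u' t)) -> smooth1 u'.
Proof.
move=> [U U0 dU] du; exists (fun k => U k.+1) => //; apply/funext => t.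
have := dU 0%N t; rewrite U0 => h1.
by rewrite -(@derive_val _ _ _ _ _ _ _ (du t)) -(@derive_val _ _ _ _ _ _ _ h1).
Qed.

Lemma is_derive_affine (u : R -> R) (a h t du : R) :
  is_derive ((t - a) / h) 1 u du -> is_derive t 1 (fun x => u ((x - a) / h)) (h^-1 * du).
Proof.
move=> hu; rewrite mulrC; apply: (@is_derive1_comp _ u (fun x => (x - a) / h)) => //.
have -> : (fun x : R => (x - a) / h) = h^-1 \*: (id - cst a) :> (R -> R).
  by apply/funext => x /=; rewrite mulrC.
by apply: is_derive_eq; rewrite subr0 /GRing.scale/= mulr1.
Qed.

Lemma smooth1_affine (u : R -> R) (a h : R) :
  smooth1 u -> smooth1 (fun x => u ((x - a) / h)).
Proof.
move=> [U U0 dU]; exists (fun k x => h^-1 ^+ k * U k ((x - a) / h)).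
  by apply/funext => x; rewrite expr0 mul1r U0.
move=> k t; rewrite exprSr -mulrA.
exact: (is_deriveZ _ (is_derive_affine (dU k ((t - a) / h)))).
Qed.

Lemma smooth1Z (u : R -> R) (c : R) : smooth1 u -> smooth1 (fun x => c * u x).
Proof.
move=> [U U0 dU]; exists (fun k x => c * U k x); first by rewrite U0.
by move=> k t; exact: (is_deriveZ c (dU k t)).
Qed.

Lemma smooth1B (u v : R -> R) : smooth1 u -> smooth1 v -> smooth1 (fun x => u x - v x).
Proof.
move=> [U U0 dU] [V V0 dV]; exists (fun k x => U k x - V k x); first by rewrite U0 V0.
by move=> k t; exact: is_deriveB.
Qed.

Lemma smooth1_continuous (u : R -> R) : smooth1 u -> continuous u.
Proof.
move=> [U <- dU] t; apply: differentiable_continuous; apply/derivable1_diffP.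
exact: ex_derive.
Qed.

(** The family [q(t) (1 - t^2)^(-m) exp(-1/(1 - t^2))] on []-1, 1[], extended by 0, is closed under
    differentiation, so a single derivative formula yields smoothness. *)
Definition bump (m : nat) (q : {poly R}) (t : R) : R :=
  if `|t| < 1 then q.[t] * (1 - t ^+ 2)^-1 ^+ m * expR (- (1 - t ^+ 2)^-1) else 0.

(** Numerator of the derivative over the denominator [(1 - t^2)^(m + 2)], the exponential set
    aside. *)
Definition bump_next (m : nat) (q : {poly R}) : {poly R} :=
  q^`() * (1 - 'X^2) ^+ 2 + (2 * m%:R) *: ('X * q * (1 - 'X^2)) - 2 *: ('X * q).

(** From the term of degree [N.+1] in the exponential series at [s^-1]. *)
Lemma expR_inv_le (N : nat) (s : R) : 0 < s ->
  expR (- s^-1) <= N.+1`!%:R * s ^+ N.+1.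
Proof.
move=> s0; have si0 : 0 <= s^-1 by rewrite invr_ge0 ltW.
rewrite expRN -[leRHS]invrK lef_pV2 ?posrE ?expR_gt0//; last first.
  by rewrite invr_gt0 mulr_gt0 ?exprn_gt0// ltr0n fact_gt0.
rewrite (le_trans _ (expR_ge1Dxn N si0))// invfM exprVn mulrC.
by rewrite lerDr.
Qed.

(** The exponential beats the pole, so the function is quadratically small at every [t0] on or
    outside the boundary; this forces the derivative 0 there. *)
Lemma bump_quadratic m q (t0 : R) : 1 <= `|t0| ->
  exists2 C, 0 <= C & forall t, `|bump m q t| <= C * (t - t0) ^+ 2.
Proof.
move=> t01.
pose S : R := \sum_(i < size q) `|q`_i|.
have qS t : `|t| < 1 -> `|q.[t]| <= S.
  move=> t1; rewrite horner_coef (le_trans (ler_norm_sum _ _ _))//.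
  apply: ler_sum => i _; rewrite normrM ler_piMr// normrX.
  by rewrite exprn_ile1// ltW.
have S0 : 0 <= S by exact: sumr_ge0.
exists (S * (m.+2)`!%:R * (`|t0| + 1) ^+ 2).
  by rewrite mulr_ge0 ?sqr_ge0// mulr_ge0.
move=> t; rewrite /bump; case: ifPn => [t1|_]; last first.
  by rewrite normr0 mulr_ge0 ?sqr_ge0// mulr_ge0 ?sqr_ge0// mulr_ge0.
set s := 1 - t ^+ 2.
have s0 : 0 < s by rewrite subr_gt0 -real_normK ?num_real// exprn_ilt1.
(* The degree [m + 2] cancels the pole of order [m] and leaves the square of [s], where [s] is at
   most [(|t0| + 1) |t - t0|]. *)
have e1 := expR_inv_le m.+1 s0.
rewrite !normrM (ger0_norm (expR_ge0 _)) [X in _ * X * _]ger0_norm ?exprn_ge0 ?invr_ge0 ?(ltW s0)//.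
apply: (@le_trans _ _ (S * s^-1 ^+ m * ((m.+2)`!%:R * s ^+ m.+2))).
  apply: ler_pM => //; rewrite ?mulr_ge0 ?exprn_ge0 ?invr_ge0 ?expR_ge0 ?(ltW s0)//.
  by rewrite ler_wpM2r ?qS// exprn_ge0// invr_ge0 ltW.
have -> : S * s^-1 ^+ m * ((m.+2)`!%:R * s ^+ m.+2) = S * (m.+2)`!%:R * s ^+ 2.
  rewrite -[m.+2]addn2 exprD exprVn; field.
  by rewrite expf_eq0 gt_eqF ?andbF.
rewrite -[leRHS]mulrA ler_wpM2l ?mulr_ge0// -exprMn.
rewrite -[leRHS]real_normK ?num_real// ler_pXn2r ?nnegrE ?(ltW s0)//.
rewrite normrM (ger0_norm (x := _ + _)) ?addr_ge0//.
have t0t : s <= `|t0| ^+ 2 - `|t| ^+ 2.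
  by rewrite [`|t| ^+ 2]real_normK ?num_real// /s lerB// exprn_ege1.
rewrite (le_trans t0t)// subr_sqr [leRHS]mulrC; apply: ler_pM.
- by rewrite subr_ge0 (le_trans (ltW t1)).
- by rewrite addr_ge0.
- by rewrite distrC (le_trans (ler_norm _))// ler_dist_dist.
- by rewrite lerD2l ltW.
Qed.

Lemma is_derive_quadratic (g : R -> R) (t0 C : R) : g t0 = 0 ->
  (forall t, `|g t| <= C * (t - t0) ^+ 2) -> is_derive t0 1 g 0.
Proof.
move=> g0 gC.
have lim0 : (fun h => h^-1 *: ((g \o shift t0) (h *: 1) - g t0)) h @[h --> 0^'] --> (0 : R).
  apply/cvgrPdist_le => e e0.
  have C1 : 0 < `|C| + 1 by rewrite ltr_wpDl.
  have eC : 0 < e / (`|C| + 1) by rewrite divr_gt0.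
  near=> h.
  have h0 : h != 0 by near: h; exact: nbhs_dnbhs_neq.
  rewrite sub0r normrN g0 subr0 /= /shift/= /GRing.scale/= mulr1 normrM normfV.
  rewrite ler_pdivrMl ?normr_gt0// (le_trans (gC _))// addrK.
  rewrite -real_normK ?num_real// expr2 mulrCA ler_pM2l ?normr_gt0//.
  have hC : `|h| <= e / (`|C| + 1) by near: h; exact: dnbhs0_le.
  rewrite (@le_trans _ _ ((`|C| + 1) * `|h|))//.
    by rewrite ler_wpM2r// (le_trans (ler_norm _))// lerDl.
  by rewrite mulrC -ler_pdivlMr.
by apply: DeriveDef; [apply/cvg_ex; exists 0|exact/cvg_lim].
Unshelve. all: by end_near. Qed.

(** Inside the interval by the rules of calculus; elsewhere, end points included, by quadratic
    smallness. *)
Lemma is_derive_bump m q (t : R) : is_derive t 1 (bump m q) (bump m.+2 (bump_next m q) t).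
Proof.
have [t1|t1] := ltP `|t| 1; last first.
  rewrite {2}/bump ltNge t1/=; have [C C0 bC] := bump_quadratic m q t1.
  by apply: (@is_derive_quadratic _ t C) => //; rewrite /bump ltNge t1.
have near1 : \near t, `|t| < 1.
  exact: (cvgr_lt _ (@norm_continuous _ R t) _ t1).
pose w (x : R) := 1 - x ^+ 2.
have s0 : w t != 0.
  by rewrite gt_eqF// subr_gt0 -real_normK ?num_real// exprn_ilt1.
apply: (@near_eq_is_derive _ _ _ (fun x => q.[x] * (w x)^-1 ^+ m * expR (- (w x)^-1))).
  by near=> x; rewrite /bump; case: ifPn => //; near: x; move: near1; apply: filterS => x ->.
have dw : is_derive t 1 w (- (2 * t)).
  have -> : w = cst 1 - (fun x : R => x) ^+ 2 by apply/funext => x; rewrite /w !fctE.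
  by apply: is_derive_eq; rewrite sub0r /GRing.scale/= expr1 mulr1 mulr_natl.
have dv : is_derive t 1 (fun x => (w x)^-1) (2 * t * (w t)^-1 ^+ 2).
  apply: (is_derive_eq (is_deriveV s0 dw)).
  by rewrite /GRing.scale/= mulrNN mulrC exprVn.
pose v x := (w x)^-1.
have dvm : is_derive t 1 (fun x => v x ^+ m) (m%:R * (2 * t) * v t ^+ m.+1).
  have dvX := @is_deriveX _ _ v m t 1 _ dv.
  have -> : (fun x => v x ^+ m) = v ^+ m by apply/funext => x; rewrite fctE.
  apply: (is_derive_eq dvX); rewrite /GRing.scale/= -/(v t).
  by case: m {q dvX} => [|m]; [rewrite !mul0r|rewrite /= !exprS; ring].
have de : is_derive t 1 (fun x => expR (- v x)) (- (2 * t * v t ^+ 2) * expR (- v t)).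
  have dnv : is_derive t 1 (fun x => - v x) (- (2 * t * v t ^+ 2)) := is_deriveN dv.
  rewrite mulrC; exact: (@is_derive1_comp _ expR (fun x => - v x) _ _ _ (is_derive_expR _) dnv).
rewrite /bump t1 -/(w t) -/(v t).
have wv : w t * v t = 1 by rewrite /v mulfV.
have -> : (bump_next m q).[t] = q^`().[t] * w t ^+ 2 + 2 * m%:R * (t * q.[t] * w t) - 2 * (t * q.[t]).
  by rewrite /bump_next !hornerE.
apply: (is_derive_eq (is_deriveM (is_deriveM (is_derive_poly q t) dvm) de)).
rewrite ?fctE /GRing.scale/=.
have -> : v t ^+ m.+2 = v t ^+ m * v t ^+ 2 by rewrite -addn2 exprD.
have -> : v t ^+ m.+1 = v t ^+ m * v t by rewrite exprSr.
have e2 : w t ^+ 2 * v t ^+ 2 = 1 by rewrite -exprMn wv expr1n.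
set E := expR _; set vm := v t ^+ m; set q' := q^`().[t]; set qt := q.[t].
transitivity ((q' * (w t ^+ 2 * v t ^+ 2) + 2 * m%:R * t * qt * (w t * v t) * v t - 2 * t * qt * v t ^+ 2) * vm * E).
  by rewrite e2 wv; ring.
by ring.
Unshelve. all: by end_near. Qed.

(** [eta] is an even smooth probability density on [[-1, 1]] and [P] its primitive, rising from 0 to
    1. Differences of rescaled copies of [P] are the compactly supported test factors of the chain
    argument. One constant [c] bounds [eta] and the Lipschitz constant of [P]. *)
Record mollifier (P eta : R -> R) (c : R) : Prop := {
  moll_smooth : smooth1 P ;
  moll_derive : forall t : R, is_derive t 1 P (eta t) ;
  moll_ge0 : forall t, 0 <= eta t ;
  moll_le : forall t, eta t <= c ;
  moll_supp : forall t, 1 <= `|t| -> eta t = 0 ;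
  moll_even : forall t, eta (- t) = eta t ;
  moll_int : (\int[lam]_t (eta t)%:E = 1)%E ;
  moll_left : forall t, t <= -1 -> P t = 0 ;
  moll_right : forall t, 1 <= t -> P t = 1 ;
  moll_lip : forall s t, `|P s - P t| <= c * `|s - t| ;
  moll_c : 1 <= c }.

Let eta0 : R -> R := bump 0 1.

Lemma exists_mollifier : exists P eta c, mollifier P eta c.
Proof.
have eta0E t : eta0 t = if `|t| < 1 then expR (- (1 - t ^+ 2)^-1) else 0.
  by rewrite /eta0 /bump hornerC expr0 !mul1r.
have eta00 t : 0 <= eta0 t by rewrite eta0E; case: ifP => // _; exact: expR_ge0.
have eta01 t : eta0 t <= 1.
  rewrite eta0E; case: ifPn => // t1; rewrite -[leRHS]expR0 ler_expR oppr_le0 invr_ge0.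
  by rewrite subr_ge0 -real_normK ?num_real// exprn_ile1// ltW.
have ceta0 : continuous eta0.
  move=> t; apply: differentiable_continuous; apply/derivable1_diffP.
  by have [] := is_derive_bump 0 1 t.
have meta0 D : measurable_fun D eta0.
  by apply: measurable_funTS; exact: continuous_measurable_fun.
have eta0_out t : 1 <= `|t| -> eta0 t = 0 by move=> t1; rewrite eta0E ltNge t1.
have i1 : lam.-integrable setT (fun t => (\1_(`[-1, 1]%classic : set R) t)%:E).
  exact: integrable_indic_itv.
have ieta0 (D : set R) : measurable D -> lam.-integrable D (EFin \o eta0).
  move=> mD; apply: (@integrableS _ _ _ lam setT) => //.
  apply: (le_integrable measurableT _ _ i1).
  - by apply/measurable_EFinP; exact: meta0.
  - move=> t _; rewrite /= lee_fin !ger0_norm//.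
    have [t1|t1] := leP 1 `|t|; first by rewrite eta0_out.
    rewrite indicE mem_set//= in_itv/=; move: t1; rewrite ltr_norml => /andP[? ?].
    by rewrite !ltW.
pose F t := (\int[lam]_(x in `]-oo, t]) eta0 x)%R.
have dF (t : R) : is_derive t 1 F (eta0 t).
  have t1 : t < t + 1 by rewrite ltrDl.
  have [||h1 h2] := @continuous_FTC1 _ eta0 -oo%O t (t + 1) t1 _ _ (ceta0 t).
  - exact: ieta0.
  - by rewrite /= ltNyr.
  by apply: DeriveDef; [exact: h1|rewrite -derive1E].
pose Z := F 1.
have FZ t : 1 <= t -> F t = Z.
  move=> t1; rewrite /Z /F [LHS]Rintegral_mkcond [RHS]Rintegral_mkcond.
  apply: eq_Rintegral => x _; rewrite !patchE !mem_setE !in_itv/=.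
  have [x1|x1] := leP x 1; first by rewrite (le_trans x1 t1).
  by case: ifP => // _; rewrite eta0_out// (le_trans (ltW x1))// ler_norm.
have F0 t : t <= -1 -> F t = 0.
  move=> t1; rewrite /F /Rintegral integral0_eq// => x/=; rewrite in_itv/= => xt.
  by rewrite eta0_out// -normrN (le_trans _ (ler_norm _))// lerNr (le_trans xt).
have cF : continuous F.
  by move=> x; apply: differentiable_continuous; apply/derivable1_diffP; have [] := dF x.
(* By the mean value theorem [F] increases strictly across [[-1/2, 1/2]], where the bump is
   positive, and does not decrease on either side. *)
have Z0 : 0 < Z.
  have mvt (a b : R) : a <= b -> exists c, F b - F a = eta0 c * (b - a) /\ a <= c <= b.
    move=> ab; have [r rI hr] := MVT_segment ab (fun x _ => dF x) (continuous_subspaceT cF).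
    by exists r; move: rI; rewrite in_itv.
  have [|c1 [h1 _]] := mvt (-1) (- 2^-1); first lra.
  have [|c2 [h2 c2b]] := mvt (- 2^-1) 2^-1; first lra.
  have [|c3 [h3 _]] := mvt 2^-1 1; first lra.
  have c2p : 0 < eta0 c2.
    by rewrite eta0E; case: ifPn => [_|]; [exact: expR_gt0|rewrite ltr_norml; lra].
  have := F0 (-1) (lexx _); have := eta00 c1; have := eta00 c3.
  rewrite /Z; nra.
have etaT : (\int[lam]_t (eta0 t)%:E = Z%:E)%E.
  rewrite /Z /F /Rintegral fineK; last exact: integrable_fin_num (ieta0 _ _).
  rewrite [RHS]integral_mkcond; apply: eq_integral => t _.
  rewrite patchE mem_setE in_itv/=; case: leP => // t1.
  by rewrite eta0_out// (le_trans (ltW t1))// ler_norm.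
pose c := Num.max 1 Z^-1.
have cZ : Z^-1 <= c by rewrite le_max lexx orbT.
pose P t := Z^-1 * F t.
have dP (t : R) : is_derive t 1 P (Z^-1 * eta0 t) by exact: is_deriveZ.
exists P, (fun t => Z^-1 * eta0 t), c; split => //.
(* The derivative of order [k + 1] of [P] is, up to the normalising factor, a bump with a pole of
   order [2 k]. *)
- pose q := fix q k : {poly R} := if k is k'.+1 then bump_next (k'.*2) (q k') else 1.
  exists (fun k => if k is k'.+1 then (fun t => Z^-1 * bump k'.*2 (q k') t) else P) => //.
  case=> [|k] t //.
  by apply: is_deriveZ; exact: is_derive_bump.
- by move=> t; rewrite mulr_ge0// invr_ge0 ltW.
- move=> t; rewrite (le_trans _ cZ)// ler_piMr// invr_ge0 ltW//.
- by move=> t t1; rewrite eta0_out// mulr0.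
- by move=> t; rewrite !eta0E normrN sqrrN.
- under eq_integral do rewrite EFinM.
  rewrite ge0_integralZl//; last 3 first.
  + by apply/measurable_EFinP; exact: meta0.
  + by move=> t _; rewrite lee_fin.
  + by rewrite lee_fin invr_ge0 ltW.
  by rewrite etaT -EFinM mulVf// gt_eqF.
- by move=> t t1; rewrite /P F0// mulr0.
- by move=> t t1; rewrite /P FZ// mulVf// gt_eqF.
- move=> s t; wlog st : s t / s <= t.
    by move=> h; case: (leP s t) => [|/ltW] /h//; rewrite distrC [X in _ <= _ * X]distrC.
  have cP : continuous P.
    by move=> x; apply: differentiable_continuous; apply/derivable1_diffP; have [] := dP x.
  have [r _ hr] := MVT_segment st (fun x _ => dP x) (continuous_subspaceT cP).
  rewrite distrC [X in _ <= _ * X]distrC hr normrM ler_wpM2r// ger0_norm ?mulr_ge0 ?invr_ge0 ?(ltW Z0)//.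
  by rewrite (le_trans _ cZ)// ler_piMr// invr_ge0 ltW.
- by rewrite le_max lexx.
Qed.

End smooth_line.

(** * Products of one-variable functions as test functions *)

Section products.
Context (R : realType) (n : nat).
Local Notation d := n.+1.
Local Notation V := 'rV[R]_d.
Local Notation mu := (@lebesgue_rV R n).
Local Notation lam := (@lebesgue_measure R).

Definition prodfun (u : 'I_d -> R -> R) (z : V) : R := \prod_i u i (z 0 i).

Definition subst (u : 'I_d -> R -> R) (i : 'I_d) (v : R -> R) (j : 'I_d) : R -> R :=
  if j == i then v else u j.

Definition cube (a b : V) : set V := [set z | forall i, a 0 i <= z 0 i <= b 0 i].

Lemma compact_cube (a b : V) : compact (cube a b).
Proof.
have := @rV_compact R d (fun i => `[a 0 i, b 0 i]%classic) (fun i => @segment_compact _ _ _).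
by congr compact; apply/seteqP; split => z /= h i; have := h i; rewrite in_itv.
Qed.

Lemma closed_cube (a b : V) : closed (cube a b).
Proof. by apply: compact_closed; [exact: norm_hausdorff|exact: compact_cube]. Qed.

Lemma continuous_measurable_rV (g : V -> R) : continuous g -> measurable_fun setT g.
Proof.
move=> cg; apply: (measurability _ (RGenOInfty.measurableE R)) => _ [_ [a ->] <-].
rewrite setTI; apply: measurable_open.
by apply: open_comp; [exact: (in1W cg)|exact: interval_open].
Qed.

Lemma measurable_cube (a b : V) : measurable (cube a b).
Proof.
by rewrite -[cube a b]setCK; apply: measurableC; apply: measurable_open; rewrite openC; exact: closed_cube.
Qed.

Lemma measurable_compact (K : set V) : compact K -> measurable K.
Proof.
move=> cK; rewrite -[K]setCK; apply: measurableC; apply: measurable_open; rewrite openC.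
by apply: compact_closed => //; exact: norm_hausdorff.
Qed.

Lemma cube_fin (a b : V) : (mu (cube a b) < +oo)%E.
Proof.
apply: (@le_lt_trans _ _ (mu (box (a - const_mx 1, b)))).
  apply: le_measure; rewrite ?inE; [exact: measurable_cube|exact: measurable_box|].
  move=> z /= h i; have /andP[h1 h2] := h i; rewrite !mxE h2 andbT.
  by rewrite (lt_le_trans _ h1)// ltrBlDr ltrDl.
by rewrite lebesgue_rV_box ltry.
Qed.

Lemma prodfun_subst (u : 'I_d -> R -> R) i v (z : V) :
  prodfun (subst u i v) z = v (z 0 i) * \prod_(j | j != i) u j (z 0 j).
Proof.
rewrite /prodfun (bigD1 i)//= /subst eqxx; congr (_ * _).
by apply: eq_bigr => j /negbTE ->.
Qed.

Lemma subst_id (u : 'I_d -> R -> R) i : subst u i (u i) = u.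
Proof. by apply/funext => j; rewrite /subst; case: eqP => // ->. Qed.

Lemma continuous_prodfun (u : 'I_d -> R -> R) :
  (forall i, continuous (u i)) -> continuous (prodfun u).
Proof.
move=> cu; rewrite /prodfun; elim: (index_enum _) => [|i s IH] z.
  by under eq_fun do rewrite big_nil; exact: cst_continuous.
rewrite (_ : (fun _ => _) = (fun y : V => u i (y 0 i) * \prod_(j <- s) u j (y 0 j))); last first.
  by apply/funext => y; rewrite big_cons.
have ci : {for z, continuous (u i \o (fun y : V => y 0 i))}.
  by apply: continuous_comp; [exact: continuous_coord|exact: cu].
exact: (continuousM ci (IH z)).
Qed.

Lemma is_derive_prodfun (u : 'I_d -> R -> R) i (z : V) (du : R) :
  is_derive (z 0 i) 1 (u i) du ->
  is_derive z (delta_mx 0 i) (prodfun u) (du * \prod_(j | j != i) u j (z 0 j)).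
Proof.
move=> [du1 du2]; set C := \prod_(j | _) _.
have q h : h^-1 *: ((prodfun u \o shift z) (h *: delta_mx 0 i) - prodfun u z) =
    h^-1 *: ((u i \o shift (z 0 i)) (h *: 1) - u i (z 0 i)) * C.
  rewrite /= /shift/= /GRing.scale/= -mulrA; congr (_ * _).
  rewrite -[u in prodfun u _](subst_id u i) prodfun_subst.
  rewrite -[u in X in _ - X](subst_id u i) prodfun_subst -/C !mxE !eqxx mulrBl; congr (_ * _ - _).
  by apply: eq_bigr => j ji; rewrite !mxE (negbTE ji) andbF mulr0 add0r.
have lim : (fun h => h^-1 *: ((prodfun u \o shift z) (h *: delta_mx 0 i) - prodfun u z)) h
    @[h --> 0^'] --> du * C.
  rewrite (funext q); apply: cvgM; last exact: cvg_cst.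
  by move: du1; rewrite -du2 => /cvg_ex[l hl]; rewrite /derive (cvg_lim _ hl).
by apply: DeriveDef; [apply/cvg_ex; exists (du * C)|exact/cvg_lim].
Qed.

Lemma partial_prodfun (u : 'I_d -> R -> R) i (u' : R -> R) :
  (forall t : R, is_derive t 1 (u i) (u' t)) ->
  partial i (prodfun u) = prodfun (subst u i u').
Proof.
move=> du; apply/funext => z; rewrite prodfun_subst /partial.
by have /@derive_val := is_derive_prodfun (du (z 0 i)).
Qed.

(** Every iterated partial derivative is again a product, recorded by the order [m i] of the
    derivative in each factor. *)
Lemma smooth_prodfun (u : 'I_d -> R -> R) : (forall i, smooth1 (u i)) -> smooth (prodfun u).
Proof.
move=> su.
have /choice[U HU] : forall i, exists Ui : nat -> R -> R, Ui 0%N = u i /\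
    forall k (t : R), is_derive t 1 (Ui k) (Ui k.+1 t).
  by move=> i; have [Ui ? ?] := su i; exists Ui.
pose PF (m : 'I_d -> nat) := prodfun (fun i => U i (m i)).
have step m i : partial i (PF m) = PF (fun j => (j == i) + m j)%N.
  rewrite /PF (@partial_prodfun (fun j => U j (m j)) i _ ((HU i).2 (m i))).
  by congr prodfun; apply/funext => j; rewrite /subst; case: eqP => [->|].
have gen s : exists m, foldr (@partial R n) (prodfun u) s = PF m.
  elim: s => [|i s [m IH]] /=; last by rewrite IH step; eexists.
  by exists (fun=> 0%N); congr prodfun; apply/funext => i; rewrite (HU i).1.
move=> s /=; have [m ->] := gen s; split.
  apply: continuous_prodfun => i t; apply: differentiable_continuous; apply/derivable1_diffP.
  by have [] := (HU i).2 (m i) t.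
by move=> i z; have [] := is_derive_prodfun (u := fun i => U i (m i)) ((HU i).2 (m i) (z 0 i)).
Qed.

Lemma prodfun_out (u : 'I_d -> R -> R) (a b z : V) :
  (forall i t, ~~ (a 0 i <= t <= b 0 i) -> u i t = 0) -> ~ cube a b z -> prodfun u z = 0.
Proof.
move=> u0 /existsNP[i /negP zi]; rewrite /prodfun (bigD1 i)//=.
by rewrite u0 ?mul0r.
Qed.

Lemma test_prodfun (Om : set V) (u : 'I_d -> R -> R) (a b : V) :
  (forall i, smooth1 (u i)) -> (forall i t, ~~ (a 0 i <= t <= b 0 i) -> u i t = 0) ->
  cube a b `<=` Om -> test_function Om (prodfun u).
Proof.
move=> su u0 abO.
have sub : closure [set z | prodfun u z != 0] `<=` cube a b.
  rewrite [X in _ `<=` X](closure_id _).1; last exact: closed_cube.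
  apply: closure_subset => z /= h; apply: contrapT => zc.
  by move: h; rewrite (prodfun_out u0 zc) eqxx.
split; [exact: smooth_prodfun| |exact: subset_trans abO].
apply: subclosed_compact sub; [exact: closed_closure|exact: compact_cube].
Qed.

Lemma smooth1_bounded (v : R -> R) (a b : R) : continuous v ->
  (forall t, ~~ (a <= t <= b) -> v t = 0) -> exists2 M, 0 <= M & forall t, `|v t| <= M.
Proof.
move=> cv v0; have [ab|ba] := leP a b; last first.
  by exists 0 => // t; rewrite v0 ?normr0//; apply/negP => /andP[/le_trans h /h]; rewrite leNgt ba.
have [c _ hc] := EVT_max ab (continuous_subspaceT (f := fun t => `|v t|)
  (fun t => continuous_comp (cv t) (@norm_continuous _ R (v t)))).
exists `|v c| => // t; have [tab|tab] := boolP (a <= t <= b); last by rewrite (v0 _ tab) normr0.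
by apply: hc; rewrite in_itv.
Qed.

Lemma norm_prodfun_le (u : 'I_d -> R -> R) (M : 'I_d -> R) z :
  (forall i t, `|u i t| <= M i) -> `|prodfun u z| <= \prod_i M i.
Proof.
by move=> uM; rewrite /prodfun normr_prod; apply: ler_prod => i _; rewrite normr_ge0 uM.
Qed.

Lemma derive_out (v v' : R -> R) (a b : R) : (forall t : R, is_derive t 1 v (v' t)) ->
  (forall t, ~~ (a <= t <= b) -> v t = 0) -> forall t, ~~ (a <= t <= b) -> v' t = 0.
Proof.
move=> dv v0 t tab.
have near0 : \near t, v t = 0.
  have : open (~` `[a, b]%classic : set R) by rewrite openC; exact: itv_closed.
  move=> /(_ t); rewrite /= in_itv/= => /(_ (elimN idP tab)).
  by apply: filterS => s /=; rewrite in_itv/= => /negP; exact: v0.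
have h : is_derive t 1 v 0.
  apply: (@near_eq_is_derive _ _ _ (cst 0)).
  by apply: filterS near0 => s ->.
by rewrite -(@derive_val _ _ _ _ _ _ _ (dv t)) (@derive_val _ _ _ _ _ _ _ h).
Qed.

Section locally_integrable.
Variables (Om : set V) (mOm : measurable Om).

Lemma locally_integrable_mul (f phi : V -> R) (a b : V) (M : R) :
  locally_integrable_rV Om f -> continuous phi -> (forall z, `|phi z| <= M) ->
  cube a b `<=` Om -> (forall z, ~ cube a b z -> phi z = 0) ->
  mu.-integrable Om (EFin \o (fun z => f z * phi z)) /\
  (\int[mu]_(z in Om) `|f z * phi z|%:E <= M%:E * \int[mu]_(z in cube a b) `|f z|%:E)%E.
Proof.
move=> [mf fK] cphi phiM abO phi0.
have M0 : 0 <= M by rewrite (le_trans _ (phiM 0)).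
have mfphi : measurable_fun Om (fun z => f z * phi z).
  by apply: measurable_funM => //; apply: measurable_funTS; exact: continuous_measurable_rV.
have mfc : measurable_fun (cube a b) f by exact: measurable_funS abO mf.
have le : (\int[mu]_(z in Om) `|f z * phi z|%:E <= M%:E * \int[mu]_(z in cube a b) `|f z|%:E)%E.
  have mafc : measurable_fun (cube a b) (fun z => `|f z|%:E).
    by apply/measurable_EFinP; exact: measurableT_comp.
  rewrite -(@ge0_integralZl _ _ _ mu _ (measurable_cube a b) _ mafc)//.
  rewrite [leLHS](_ : _ = \int[mu]_(z in cube a b) `|f z * phi z|%:E)%E; last first.
    rewrite [LHS]integral_mkcond [RHS]integral_mkcond; apply: eq_integral => z _.
    rewrite !patchE; case: ifPn => [zO|zO].
      case: ifPn => // /negP; rewrite inE => zc; first by rewrite phi0 ?mulr0 ?normr0.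
    case: ifPn => //; rewrite inE => /abO zO'; move: zO; by rewrite mem_set.
  have mfpc : measurable_fun (cube a b) (fun z => `|f z * phi z|%:E).
    apply/measurable_EFinP; apply: measurableT_comp => //.
    exact: measurable_funS mOm abO mfphi.
  have mMf : measurable_fun (cube a b) (fun z => M%:E * `|f z|%:E)%E by exact: measurable_funeM mafc.
  apply: (ge0_le_integral _ (measurable_cube a b) _ mfpc mMf) => [z _|z _].
    by rewrite lee_fin.
  by rewrite lee_fin normrM mulrC ler_wpM2r.
split=> //; apply/integrableP; split; first exact/measurable_EFinP.
rewrite (le_lt_trans le)//.
have := fK _ abO (@compact_cube a b).
by move=> h; apply: lte_mul_pinfty; rewrite ?lee_fin.
Qed.

Lemma le_Rintegral_locally (f phi : V -> R) (a b : V) (M : R) :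
  locally_integrable_rV Om f -> continuous phi -> (forall z, `|phi z| <= M) ->
  cube a b `<=` Om -> (forall z, ~ cube a b z -> phi z = 0) ->
  (`|\int[mu]_(z in Om) (f z * phi z)|%R%:E <= M%:E * \int[mu]_(z in cube a b) `|f z|%:E)%E.
Proof.
move=> lf cphi phiM abO phi0.
have [i1 i2] := locally_integrable_mul lf cphi phiM abO phi0.
apply: le_trans i2; rewrite EFin_normr_Rintegral//.
by apply: le_abse_integral => //; have /integrableP[] := i1.
Qed.

Lemma locally_integrable_rVB (f g : V -> R) :
  locally_integrable_rV Om f -> locally_integrable_rV Om g ->
  locally_integrable_rV Om (fun z => f z - g z).
Proof.
move=> [mf lf] [mg lg]; split; first exact: measurable_funB.
move=> K KO cK; have mK := measurable_compact cK.
have maf : measurable_fun K (fun x => `|f x|%:E).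
  by apply/measurable_EFinP; apply: measurableT_comp => //; exact: (measurable_funS mOm KO mf).
have mag : measurable_fun K (fun x => `|g x|%:E).
  by apply/measurable_EFinP; apply: measurableT_comp => //; exact: (measurable_funS mOm KO mg).
have mab : measurable_fun K (fun x => `|f x - g x|%:E).
  apply/measurable_EFinP; apply: measurableT_comp => //.
  exact: (measurable_funS mOm KO (measurable_funB mf mg)).
apply: (@le_lt_trans _ _ (\int[mu]_(x in K) (`|f x|%:E + `|g x|%:E))%E); last first.
  rewrite (@ge0_integralD _ _ _ mu _ mK _ _ _ maf _ mag)//.
  by rewrite lte_add_pinfty ?lf ?lg.
have mD : measurable_fun K (fun x => `|f x|%:E + `|g x|%:E)%E by exact: emeasurable_funD.
apply: (ge0_le_integral _ mK _ mab mD) => x _; first by rewrite lee_fin.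
by rewrite -EFinD lee_fin ler_normB.
Qed.

Lemma locally_integrable_continuous (f : V -> R) : continuous f -> locally_integrable_rV Om f.
Proof.
move=> cf; have mf := continuous_measurable_rV cf.
split; first exact: measurable_funTS.
move=> K KO cK.
have mK := measurable_compact cK.
have [M M0 KM] : exists2 M : R, 0 <= M & forall z, K z -> `|f z| <= M /\ forall i, `|z 0 i| <= M.
  have cfK : compact (f @` K) by apply: continuous_compact => //; exact: continuous_subspaceT.
  have [M1 [_ h1]] := compact_bounded cfK; have [M2 [_ h2]] := compact_bounded cK.
  exists (`|M1| + `|M2| + 1) => // z Kz; split.
    apply: (h1 (`|M1| + `|M2| + 1)); last by exists z.
    by rewrite (le_lt_trans (ler_norm M1))// -addrA ltrDl ltr_wpDl.
  move=> i; apply: le_trans (h2 (`|M1| + `|M2| + 1) _ z Kz).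
    by rewrite [leRHS]mx_normrE; apply: (le_trans _ (le_bigmax _ _ (0, i))).
  by rewrite (le_lt_trans (ler_norm M2))// addrAC addrC ltrDl ltr_wpDl.
apply: (@le_lt_trans _ _ (\int[mu]_(x in K) M%:E)%E).
  have mafK : measurable_fun K (fun x => `|f x|%:E).
    by apply/measurable_EFinP; apply: measurableT_comp => //; exact: measurable_funTS.
  apply: (ge0_le_integral _ mK _ mafK (measurable_cst _)) => x Kx; first by rewrite lee_fin.
  by rewrite lee_fin; have [] := KM x Kx.
rewrite integral_cst// lte_mul_pinfty ?lee_fin//.
apply: le_lt_trans (cube_fin (const_mx (- M)) (const_mx M)).
apply: le_measure; rewrite ?inE//; first exact: measurable_cube.
by move=> x Kx i; have [_ /(_ i)] := KM x Kx; rewrite !mxE ler_norml.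
Qed.

End locally_integrable.

Lemma integral_translate (h : V) (f : V -> \bar R) : measurable_fun setT f ->
  (\int[mu]_x f (x + h)%R = \int[mu]_x f x)%E.
Proof.
move=> mf; rewrite integralE [RHS]integralE; congr (_ - _)%E.
  rewrite -(ge0_integral_translate h (measurable_funepos mf) (funepos_ge0 f)).
  by apply: eq_integral => x _; rewrite !funeposE.
rewrite -(ge0_integral_translate h (measurable_funeneg mf) (funeneg_ge0 f)).
by apply: eq_integral => x _; rewrite !funenegE.
Qed.

End products.

(** * Weak derivatives tested against product functions *)

Section weak_pairs.
Context (R : realType) (n : nat).
Local Notation d := n.+1.
Local Notation V := 'rV[R]_d.
Local Notation mu := (@lebesgue_rV R n).
Implicit Types (u : 'I_d -> R -> R) (a b z : V).

Lemma EFin_Rintegral (D : set V) (f : V -> R) : measurable D -> mu.-integrable D (EFin \o f) ->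
  (\int[mu]_(x in D) (f x)%:E)%E = ((\int[mu]_(x in D) f x)%R)%:E.
Proof.
by move=> mD fi; rewrite /Rintegral fineK//; exact: integrable_fin_num fi.
Qed.

Lemma integrable_subr (D : set V) (f g : V -> R) : measurable D ->
  mu.-integrable D (EFin \o f) -> mu.-integrable D (EFin \o g) ->
  mu.-integrable D (EFin \o (fun z => f z - g z)).
Proof.
by move=> mD fi gi; apply: eq_integrable (integrableB mD fi gi) => // z _.
Qed.

Lemma integrable_scaler (D : set V) (c : R) (f : V -> R) : measurable D ->
  mu.-integrable D (EFin \o f) -> mu.-integrable D (EFin \o (fun z => c * f z)).
Proof.
by move=> mD fi; apply: eq_integrable (integrableZl mD c fi) => // z _.
Qed.

Definition supp_in u a b := forall i t, ~~ (a 0 i <= t <= b 0 i) -> u i t = 0.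

Lemma prodfun_bounded u a b : (forall i, continuous (u i)) -> supp_in u a b ->
  exists2 M, 0 <= M & forall z, `|prodfun u z| <= M.
Proof.
move=> cu u0.
have /choice[M HM] : forall i, exists M, 0 <= M /\ forall t, `|u i t| <= M.
  by move=> i; have [M ? ?] := smooth1_bounded (cu i) (u0 i); exists M.
exists (\prod_i M i); first by apply: prodr_ge0 => i _; exact: (HM i).1.
by move=> z; apply: norm_prodfun_le => i t; exact: (HM i).2.
Qed.

Lemma integrable_prodfun (Om : set V) (f : V -> R) u a b : measurable Om ->
  locally_integrable_rV Om f -> (forall i, continuous (u i)) -> supp_in u a b ->
  cube a b `<=` Om -> mu.-integrable Om (EFin \o (fun z => f z * prodfun u z)).
Proof.
move=> mOm lf cu u0 abO; have [M M0 uM] := prodfun_bounded cu u0.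
have [] // := locally_integrable_mul mOm lf (continuous_prodfun cu) uM abO.
by move=> z; exact: prodfun_out.
Qed.

Lemma Rintegral_support (Om : set V) (f phi : V -> R) a b : cube a b `<=` Om ->
  (forall z, ~ cube a b z -> phi z = 0) ->
  (\int[mu]_(z in Om) (f z * phi z) = \int[mu]_z (f z * phi z))%R.
Proof.
move=> abO phi0; rewrite /Rintegral; congr fine; rewrite [LHS]integral_mkcond.
apply: eq_integral => z _; rewrite patchE; case: ifPn => // zO.
by rewrite phi0 ?mulr0// => /abO zO'; move: zO; rewrite mem_set.
Qed.

(** Only product test functions occur, and the integrals are real. This is all that the chain
    argument uses, and it is linear in the pair, so an affine function can be subtracted from
    [f]. *)
Definition weak_pair (Om : set V) (f : V -> R) (G : V -> V) :=
  forall i u (u' : R -> R) a b, (forall j, smooth1 (u j)) ->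
    (forall t : R, is_derive t 1 (u i) (u' t)) -> supp_in u a b -> cube a b `<=` Om ->
    (\int[mu]_(z in Om) (f z * prodfun (subst u i u') z) =
     - \int[mu]_(z in Om) (G z 0 i * prodfun u z))%R.

Lemma weak_pair_gradient (Om : set V) f G : weak_gradient Om f G -> weak_pair Om f G.
Proof.
move=> wG i u u' a b su du u0 abO.
have [_ /(_ _ (test_prodfun su u0 abO))] := wG i.
rewrite (partial_prodfun du) /Rintegral => ->.
by rewrite fineN.
Qed.

Lemma smooth1_subst u i (u' : R -> R) : (forall j, smooth1 (u j)) ->
  (forall t : R, is_derive t 1 (u i) (u' t)) -> forall j, smooth1 (subst u i u' j).
Proof.
move=> su du j; rewrite /subst; case: eqP => [_|//].
exact: smooth1_derive (su i) du.
Qed.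

Lemma supp_in_subst u i (u' : R -> R) a b : supp_in u a b ->
  (forall t : R, is_derive t 1 (u i) (u' t)) -> supp_in (subst u i u') a b.
Proof.
move=> u0 du j t; rewrite /subst; case: eqP => [->|_]; last exact: u0.
exact: (derive_out du (u0 i)).
Qed.

Lemma weak_pairB (Om : set V) (f1 : V -> R) (G1 : V -> V) (f2 : V -> R) (G2 : V -> V) : measurable Om ->
  locally_integrable_rV Om f1 -> locally_integrable_rV Om f2 ->
  (forall i, locally_integrable_rV Om (fun z => G1 z 0 i)) ->
  (forall i, locally_integrable_rV Om (fun z => G2 z 0 i)) ->
  weak_pair Om f1 G1 -> weak_pair Om f2 G2 ->
  weak_pair Om (fun z => f1 z - f2 z) (fun z => G1 z - G2 z).
Proof.
move=> mOm l1 l2 lG1 lG2 w1 w2 i u u' a b su du u0 abO.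
have cu j : continuous (u j) := smooth1_continuous (su j).
have cs j : continuous (subst u i u' j) := smooth1_continuous (smooth1_subst su du j).
have s0 := supp_in_subst u0 du.
transitivity (\int[mu]_(z in Om) (f1 z * prodfun (subst u i u') z - f2 z * prodfun (subst u i u') z))%R.
  by apply: eq_Rintegral => z _; rewrite mulrBl.
rewrite RintegralB//; [|exact: integrable_prodfun abO|exact: integrable_prodfun abO].
rewrite (w1 _ _ _ _ _ su du u0 abO) (w2 _ _ _ _ _ su du u0 abO) -opprD; congr (- _).
rewrite -RintegralB//; [|exact: (integrable_prodfun mOm (lG1 i)) abO|exact: (integrable_prodfun mOm (lG2 i)) abO].
by apply: eq_Rintegral => z _; rewrite !mxE mulrBl.
Qed.

Lemma norm_diff_le (v v' : R -> R) (M s t : R) : (forall t : R, is_derive t 1 v (v' t)) ->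
  (forall t, `|v' t| <= M) -> s <= t -> `|v t - v s| <= M * (t - s).
Proof.
move=> dv vM st.
have cv : continuous v.
  by move=> x; apply: differentiable_continuous; apply/derivable1_diffP; have [] := dv x.
have [r _ ->] := MVT_segment st (fun x _ => dv x) (continuous_subspaceT cv).
by rewrite normrM [X in _ * X]ger0_norm ?subr_ge0// ler_wpM2r ?subr_ge0.
Qed.

(** Integration by parts as a limit of difference quotients: a translation of the test function
    along the axis is moved onto [dotv e], which then changes by a constant. *)
Lemma weak_pair_affine (Om : set V) (e : V) : weak_pair Om (dotv e) (fun=> e).
Proof.
move=> i u u' a b su du u0 abO.
have cu j : continuous (u j) := smooth1_continuous (su j).
have ss := smooth1_subst su du.
have cs j : continuous (subst u i u' j) := smooth1_continuous (ss j).
have s0 := supp_in_subst u0 du.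
rewrite (Rintegral_support _ abO (fun z => prodfun_out s0)).
rewrite (Rintegral_support (fun=> e 0 i) abO (fun z => prodfun_out u0)).
have le : locally_integrable_rV setT (dotv e : V -> R).
  by apply: locally_integrable_continuous => //; exact: continuous_dotv.
have l1 : locally_integrable_rV setT (fun _ : V => e 0 i).
  have h : continuous (fun _ : V => e 0 i) by move=> z; exact: cst_continuous.
  exact: (locally_integrable_continuous _ h).
set ei : V := delta_mx 0 i.
pose t (k : nat) : R := k.+1%:R^-1.
have t0 k : 0 < t k by rewrite invr_gt0.
have t1 k : t k <= 1 by rewrite invf_le1// ler1n.
pose ut k := subst u i (fun s => u i (s + t k)).
have utE k z : prodfun (ut k) z = prodfun u (z + t k *: ei).
  rewrite prodfun_subst -[u in RHS](subst_id u i) prodfun_subst !mxE !eqxx mulr1; congr (_ * _).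
  by apply: eq_bigr => j ji; rewrite !mxE (negbTE ji) andbF mulr0 addr0.
have cut k j : continuous (ut k j).
  rewrite /ut /subst; case: eqP => // _ s.
  apply: (@continuous_comp _ _ _ (fun s => s + t k) (u i)); last exact: cu.
  exact: (cvgD cvg_id (cvg_cst _)).
(* The lower corner moves down by one unit along the axis, so that one cube contains the supports of
   all translates, the steps being at most 1. *)
pose a1 := a - ei.
have ut0 k : supp_in (ut k) a1 b.
  move=> j s; rewrite !mxE /= /ut /subst; case: eqP => [->|/eqP ji].
    move=> h; apply: u0; apply: contra h => /andP[h1 h2].
    by rewrite mulr1n lerBlDr (le_trans h1) ?lerD2l// (le_trans _ h2)// lerDl ltW.
  by rewrite mulr0n subr0; exact: u0.
have u01 : supp_in u a1 b.
  move=> j s h; apply: u0; apply: contra h => /andP[h1 ->].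
  by rewrite !mxE/= andbT lerBlDr (le_trans h1)// lerDl ler0n.
have s01 : supp_in (subst u i u') a1 b.
  move=> j s h; apply: s0; apply: contra h => /andP[h1 ->].
  by rewrite !mxE/= andbT lerBlDr (le_trans h1)// lerDl ler0n.
have subT : cube a1 b `<=` setT by [].
pose q k z := (t k)^-1 * (prodfun (ut k) z - prodfun u z).
have iu := integrable_prodfun measurableT le cu u01 subT.
have i1 := integrable_prodfun measurableT l1 cu u01 subT.
have iut k := integrable_prodfun measurableT le (cut k) (ut0 k) subT.
have step k : (\int[mu]_z (dotv e z * q k z) = - \int[mu]_z (e 0 i * prodfun u z))%R.
  transitivity (\int[mu]_z ((t k)^-1 * (dotv e z * prodfun (ut k) z - dotv e z * prodfun u z)))%R.
    by apply: eq_Rintegral => z _; rewrite mulrCA mulrBr.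
  rewrite (RintegralZl _ measurableT (integrable_subr measurableT (iut k) iu)).
  rewrite (RintegralB measurableT (iut k) iu).
  have -> : (\int[mu]_z (dotv e z * prodfun (ut k) z) =
             \int[mu]_z (dotv e z * prodfun u z - t k * (e 0 i * prodfun u z)))%R.
    rewrite /Rintegral; congr fine.
    have mF : measurable_fun setT (fun z : V => (dotv e z * prodfun u z - t k * (e 0 i * prodfun u z))%:E).
      apply/measurable_EFinP; apply: measurable_funB.
        by have /integrableP[/measurable_EFinP] := iu.
      by apply: measurable_funM => //; have /integrableP[/measurable_EFinP] := i1.
    rewrite -(integral_translate (t k *: ei) mF); apply: eq_integral => z _.
    rewrite utE mulrA -mulrBl; congr (_ * _)%:E.
    rewrite /dotv [in RHS](eq_bigr (fun j => e 0 j * z 0 j + e 0 j * (t k *: ei) 0 j)); last first.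
      by move=> j _; rewrite !mxE mulrDr.
    rewrite big_split/= [X in _ = _ + X - _](bigD1 i)//= [X in _ = _ + (_ + X) - _]big1; last first.
      by move=> j ji; rewrite !mxE (negbTE ji) andbF !mulr0.
    by rewrite !mxE !eqxx mulr1 addr0 mulrC addrK.
  rewrite (RintegralB measurableT iu (integrable_scaler (t k) measurableT i1)).
  rewrite (RintegralZl _ measurableT i1) addrAC subrr add0r mulrN mulrA mulVf ?mul1r// gt_eqF//.
(* The mean value theorem bounds the quotients uniformly in [k], for dominated convergence. *)
have [M M0 uM] : exists2 M, 0 <= M & forall k z, `|q k z| <= M.
  have /choice[N HN] : forall j, exists M, 0 <= M /\ forall t, `|u j t| <= M.
    by move=> j; have [N ? ?] := smooth1_bounded (cu j) (u0 j); exists N.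
  have [N' N'0 HN'] : exists2 M, 0 <= M & forall t, `|u' t| <= M.
    have := smooth1_bounded (cs i) (s0 i); rewrite /subst eqxx; apply.
  have prod0 : 0 <= \prod_(j | j != i) N j by apply: prodr_ge0 => j _; exact: (HN j).1.
  exists (N' * \prod_(j | j != i) N j); first exact: mulr_ge0.
  move=> k z; rewrite /q -[u in X in _ - X](subst_id u i) !prodfun_subst -mulrBl mulrA normrM.
  apply: ler_pM => //; last first.
    by rewrite normr_prod; apply: ler_prod => j _; rewrite normr_ge0 (HN j).2.
  rewrite normrM ger0_norm ?invr_ge0 ?(ltW (t0 k))// ler_pdivrMl// mulrC.
  apply: le_trans (norm_diff_le du HN' _) _; first by rewrite lerDl ltW.
  by rewrite addrAC subrr add0r.
have cvg : (\int[mu]_z (dotv e z * q k z)%:E)%E @[k --> \oo] -->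
    (\int[mu]_z (dotv e z * prodfun (subst u i u') z)%:E)%E.
  have mcst : measurable_fun setT (fun z : V => M * `|dotv e z| * \1_(cube a1 b) z).
    apply: measurable_funM; last by apply: measurable_indic; exact: measurable_cube.
    apply: measurable_funM => //; apply: measurableT_comp => //.
    exact: continuous_measurable_rV (@continuous_dotv _ _ e).
  apply: (@dominated_cvg _ _ _ mu setT measurableT _ _ (fun z => (M * `|dotv e z| * \1_(cube a1 b) z)%:E)) => //.
  - move=> k; apply/measurable_EFinP; apply: measurable_funM.
      exact: continuous_measurable_rV (@continuous_dotv _ _ e).
    apply: measurable_funM => //; apply: measurable_funB; apply: continuous_measurable_rV.
      exact: continuous_prodfun.
    exact: continuous_prodfun.
  - move=> z _; apply: cvg_EFin; first exact: nearW.
    rewrite /=; apply: cvgMr.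
    have [dq1 dq2] := is_derive_prodfun (du (z 0 i)).
    have qE k : q k z = (t k)^-1 *: ((prodfun u \o shift z) (t k *: ei) - prodfun u z).
      by rewrite /q utE /= /shift/= [z + _]addrC.
    rewrite (funext qE) prodfun_subst -dq2.
    have ct : t k @[k --> \oo] --> (0 : R)^'.
      have h0 : t k @[k --> \oo] --> (0 : R) by exact: cvg_harmonic.
      move=> A /h0 [N _ hN]; exists N => // k /hN; apply.
      by rewrite gt_eqF.
    have /cvg_ex[l hl] := dq1.
    rewrite /derive (cvg_lim _ hl)//.
    exact: (cvg_comp _ _ ct hl).
  - apply/integrableP; split; first exact/measurable_EFinP.
    rewrite (_ : (\int[mu]_z _)%E = (M%:E * \int[mu]_(z in cube a1 b) `|dotv e z|%:E)%E); last first.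
      rewrite -(@ge0_integralZl _ _ _ mu _ (measurable_cube a1 b))//; last first.
        apply/measurable_EFinP; apply: measurableT_comp => //; apply: measurable_funTS.
        exact: continuous_measurable_rV (@continuous_dotv _ _ e).
      rewrite [RHS]integral_mkcond; apply: eq_integral => z _.
      rewrite patchE indicE; case: ifP => _; rewrite ?mulr1 ?mulr0 /= ?normr0// ger0_norm ?mulr_ge0//.
    apply: lte_mul_pinfty; rewrite ?lee_fin//.
    exact: le.2 _ subT (@compact_cube _ _ a1 b).
  - move=> k z _; rewrite /= lee_fin normrM indicE.
    have [zc|zc] := pselect (cube a1 b z).
      by rewrite mem_set// mulr1 mulrC ler_wpM2r.
    by rewrite /q (prodfun_out (ut0 k) zc) (prodfun_out u01 zc) subrr mulr0 normr0 mulr0 mulr_ge0// mulr_ge0.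
have is1 := integrable_prodfun measurableT le cs s01 subT.
have iq k : mu.-integrable setT (EFin \o (fun z => dotv e z * q k z)).
  have := integrable_scaler (t k)^-1 measurableT (integrable_subr measurableT (iut k) iu).
  by apply: eq_integrable => // z _; rewrite /= -mulrBr mulrCA.
move: cvg; rewrite (EFin_Rintegral measurableT is1) => cvg.
apply/EFin_inj; apply/esym; apply: cvg_unique cvg => //.
rewrite (_ : (fun k => _) = cst (- \int[mu]_z (e 0 i * prodfun u z))%R%:E); first exact: cvg_cst.
by apply/funext => k; rewrite (EFin_Rintegral measurableT (iq k)) step.
Qed.

End weak_pairs.

(** * Comparison of smooth averages at two centres and two scales *)

Section links.
Context (R : realType) (n : nat).
Local Notation d := n.+1.
Local Notation V := 'rV[R]_d.
Local Notation mu := (@lebesgue_rV R n).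
Variables (P eta : R -> R) (c : R).
Hypothesis mP : mollifier P eta c.
Implicit Types (a b x z : V) (h : R).

Let c0 : 0 <= c. Proof. exact: le_trans ler01 (moll_c mP). Qed.

Definition mol h (a : R) (t : R) : R := h^-1 * eta ((t - a) / h).

Lemma mol_smooth h (a : R) : smooth1 (mol h a).
Proof.
by apply: smooth1Z; apply: smooth1_affine; exact: smooth1_derive (moll_smooth mP) (moll_derive mP).
Qed.

Lemma mol_derive h (a t : R) : is_derive t 1 (fun s : R => P ((s - a) / h)) (mol h a t).
Proof. exact: is_derive_affine (moll_derive mP _). Qed.

Lemma mol_out h (a t : R) : 0 < h -> h <= `|t - a| -> mol h a t = 0.
Proof.
move=> h0 ht; rewrite /mol (moll_supp mP) ?mulr0// normrM normfV (gtr0_norm h0).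
by rewrite ler_pdivlMr// mul1r.
Qed.

Lemma mol_ge0 h (a t : R) : 0 < h -> 0 <= mol h a t.
Proof. by move=> h0; rewrite mulr_ge0 ?invr_ge0 ?(ltW h0)// (moll_ge0 mP). Qed.

Lemma mol_le h hm (a t : R) : 0 < hm -> hm <= h -> `|mol h a t| <= c / hm.
Proof.
move=> hm0 hmh; have h0 := lt_le_trans hm0 hmh.
rewrite ger0_norm ?mol_ge0// /mol mulrC; apply: ler_pM.
- exact: moll_ge0 mP _.
- by rewrite invr_ge0 ltW.
- exact: moll_le mP _.
- by rewrite lef_pV2 ?posrE.
Qed.

Lemma moll_primitive_le (s t : R) : `|P s - P t| <= 4 * c.
Proof.
have h (r : R) : `|P r| <= 2 * c.
  have [r1|r1] := leP r (-1); first by rewrite (moll_left mP)// normr0 mulr_ge0.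
  have [r2|r2] := leP 1 r.
    by rewrite (moll_right mP)// normr1; have := moll_c mP; nra.
  have := moll_lip mP r (-1); rewrite (moll_left mP (lexx _)) subr0 => /le_trans; apply.
  rewrite mulrC ler_wpM2r// ger0_norm; lra.
by rewrite (le_trans (ler_normB _ _))//; have := h s; have := h t; lra.
Qed.

Definition phi h a : V -> R := prodfun (fun i => mol h (a 0 i)).

Lemma continuous_mol h (a : R) : continuous (mol h a).
Proof. exact: smooth1_continuous (mol_smooth h a). Qed.

Lemma supp_mol h a : 0 < h ->
  supp_in (fun i => mol h (a 0 i)) (a - const_mx h) (a + const_mx h).
Proof.
move=> h0 i t; rewrite !mxE => ht; apply: mol_out => //; rewrite leNgt; apply: contra ht.
by rewrite ltr_norml => /andP[h1 h2]; lra.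
Qed.

Section potential.
Variables (Om : set V) (oOm : open Om) (u : V -> R) (G : V -> V).
Hypotheses (lu : locally_integrable_rV Om u)
  (lG : forall i, locally_integrable_rV Om (fun z => G z 0 i)) (wp : weak_pair Om u G).

Let mOm : measurable Om. Proof. exact: measurable_open. Qed.

Definition smooth_avg h a : R := (\int[mu]_(z in Om) (u z * phi h a z))%R.

Definition gsum z : R := \sum_i `|G z 0 i|.

Lemma gsum_ge0 z : 0 <= gsum z. Proof. exact: sumr_ge0. Qed.

Lemma measurable_gsum (D : set V) : D `<=` Om -> measurable_fun D gsum.
Proof.
move=> DO; apply: measurable_sum => i; apply: measurableT_comp => //.
exact: measurable_funS mOm DO (lG i).1.
Qed.

(** The factors of the product density are exchanged one coordinate at a time. Each exchange alters
    a single factor by the derivative of a difference of two copies of [P], a difference that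
    vanishes outside [[lo, hi]], so the weak derivative applies. In the bound [delta] stands for
    that difference and [c / hm] for each of the [n] other factors. *)
Lemma smooth_avg_link (h h' hm delta : R) (a b lo hi : V) :
  0 < hm -> hm <= h -> hm <= h' ->
  (forall i, [/\ lo 0 i <= a 0 i - h, a 0 i + h <= hi 0 i,
                 lo 0 i <= b 0 i - h' & b 0 i + h' <= hi 0 i]) ->
  cube lo hi `<=` Om ->
  (forall i t, `|P ((t - a 0 i) / h) - P ((t - b 0 i) / h')| <= delta) ->
  (`|smooth_avg h a - smooth_avg h' b|%:E <=
   ((c / hm) ^+ n * delta)%:E * \int[mu]_(z in cube lo hi) (gsum z)%:E)%E.
Proof.
move=> hm0 hmh hmh' lohi cO Pd.
have h0 := lt_le_trans hm0 hmh; have h'0 := lt_le_trans hm0 hmh'.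
have d0 : 0 <= delta by rewrite (le_trans _ (Pd 0 0)).
(* The factors of index below [k] are already those of the second average. *)
pose Ak (k : nat) (j : 'I_d) : R -> R := if (j < k)%N then mol h' (b 0 j) else mol h (a 0 j).
pose Q (k : 'I_d) (t : R) := P ((t - a 0 k) / h) - P ((t - b 0 k) / h').
pose w (k : 'I_d) : 'I_d -> R -> R := subst (Ak k) k (Q k).
have sAk k j : smooth1 (Ak k j) by rewrite /Ak; case: ifP => _; exact: mol_smooth.
have cAk k j : continuous (Ak k j) := smooth1_continuous (sAk k j).
have dQ k (t : R) : is_derive t 1 (Q k) (mol h (a 0 k) t - mol h' (b 0 k) t).
  exact: (is_deriveB (mol_derive h (a 0 k) t) (mol_derive h' (b 0 k) t)).
have sP := smooth1_affine _ _ (moll_smooth mP).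
have sw k j : smooth1 (w k j).
  by rewrite /w /subst; case: eqP => // _; apply: smooth1B; exact: sP.
have cw k j : continuous (w k j) := smooth1_continuous (sw k j).
have Ak0 k : supp_in (Ak k) lo hi.
  move=> j t; have [h1 h2 h3 h4] := lohi j; rewrite /Ak => ht.
  by case: ifP => _; apply: mol_out => //; rewrite leNgt; apply: contra ht;
    rewrite ltr_norml => /andP[? ?]; lra.
have w0 k : supp_in (w k) lo hi.
  move=> j t; rewrite /w /subst; case: eqP => [->{j} ht|_]; last exact: Ak0.
  have [h1 h2 h3 h4] := lohi k; rewrite /Q.
  have [tl|tl] := ltP t (lo 0 k).
    rewrite !(moll_left mP) ?subrr// ler_pdivrMr//; lra.
  have th : hi 0 k < t by rewrite ltNge; apply: contra ht => ->; rewrite tl.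
  rewrite !(moll_right mP) ?subrr// ler_pdivlMr//; lra.
have iA k := integrable_prodfun mOm lu (cAk k) (Ak0 k) cO.
pose T k := (\int[mu]_(z in Om) (u z * prodfun (Ak k) z))%R.
have T0 : T 0%N = smooth_avg h a.
  by rewrite /T /smooth_avg /phi; congr Rintegral; apply/funext => z; congr (_ * _).
have Td : T d = smooth_avg h' b.
  rewrite /T /smooth_avg /phi; congr Rintegral; apply/funext => z; congr (_ * _).
  by congr prodfun; apply/funext => j; rewrite /Ak ltn_ord.
have step (k : 'I_d) : T k - T k.+1 = - (\int[mu]_(z in Om) (G z 0 k * prodfun (w k) z))%R.
  rewrite /T -(RintegralB mOm (iA k) (iA k.+1)).
  have dw (t : R) : is_derive t 1 (w k k) (mol h (a 0 k) t - mol h' (b 0 k) t).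
    by rewrite /w /subst eqxx; exact: dQ.
  rewrite -(wp (sw k) dw (w0 k) cO); apply: eq_Rintegral => z _.
  rewrite -mulrBr; congr (_ * _); rewrite prodfun_subst.
  rewrite -[Ak k in LHS](subst_id _ k) -[Ak k.+1 in LHS](subst_id _ k) !prodfun_subst.
  rewrite /Ak ltnn ltnSn mulrBl; congr (_ * _ - _ * _); apply: eq_bigr => j jk.
    by rewrite /w /subst (negbTE jk) /Ak.
  by rewrite /w /subst (negbTE jk) /Ak ltnS leq_eqVlt (inj_eq val_inj) (negbTE jk).
pose M := (c / hm) ^+ n * delta.
have M0 : 0 <= M by rewrite mulr_ge0// exprn_ge0// divr_ge0// ltW.
have wM k z : `|prodfun (w k) z| <= M.
  rewrite /w prodfun_subst normrM mulrC; apply: ler_pM => //; last exact: Pd.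
  rewrite normr_prod (_ : _ ^+ n = \prod_(j | j != k) (c / hm)); last first.
    rewrite prodr_const; congr (_ ^+ _).
    by rewrite -[LHS]/(d.-1) -[d in LHS]card_ord -(cardC1 k).
  apply: ler_prod => j _; rewrite normr_ge0 /Ak.
  by case: ifP => _; exact: mol_le.
have bound k := le_Rintegral_locally mOm (lG k) (continuous_prodfun (cw k)) (wM k) cO (fun z => prodfun_out (w0 k)).
have -> : smooth_avg h a - smooth_avg h' b = \sum_(k < d) (T k - T k.+1).
  rewrite -T0 -Td -opprB -(telescope_sumr T (leq0n d)) big_mkord -sumrN.
  by apply: eq_bigr => k _; rewrite opprB.
apply: (@le_trans _ _ (\sum_(k < d) `|T k - T k.+1|%:E)%E).
  by rewrite sumEFin lee_fin ler_norm_sum.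
have mc : measurable (cube lo hi) := measurable_cube _ _.
have mG k : measurable_fun (cube lo hi) (fun z => `|G z 0 k|%:E).
  by apply/measurable_EFinP; apply: measurableT_comp => //; exact: measurable_funS mOm cO (lG k).1.
have -> : (\int[mu]_(z in cube lo hi) (gsum z)%:E = \sum_(k < d) \int[mu]_(z in cube lo hi) `|G z 0 k|%:E)%E.
  rewrite -(@ge0_integral_sum _ _ _ mu _ mc _ (fun k z => `|G z 0 k|%:E))//.
  by apply: eq_integral => z _; rewrite sumEFin.
rewrite ge0_sume_distrr; last by move=> k _; exact: integral_ge0.
by apply: lee_sum => k _; rewrite step normrN.
Qed.

Lemma cube_sub_eball x (tau r : R) : d%:R * tau < r ->
  cube (x - const_mx tau) (x + const_mx tau) `<=` eball x r.
Proof.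
move=> tr z zc; rewrite /eball/=; apply: le_lt_trans tr.
apply: (le_trans (enorm_le_sum _)).
apply: (@le_trans _ _ (\sum_(i < d) tau)); last by rewrite sumr_const card_ord mulr_natl.
apply: ler_sum => i _; have := zc i; rewrite !mxE ler_norml; lra.
Qed.

Lemma smooth_avg_link_ball (h h' hm delta : R) (a b x : V) (tau r : R) :
  0 < hm -> hm <= h -> hm <= h' ->
  enorm (a - x) + h <= tau -> enorm (b - x) + h' <= tau -> d%:R * tau < r ->
  eball x r `<=` Om ->
  (forall i t, `|P ((t - a 0 i) / h) - P ((t - b 0 i) / h')| <= delta) ->
  (`|smooth_avg h a - smooth_avg h' b|%:E <=
   ((c / hm) ^+ n * delta)%:E * \int[mu]_(z in eball x r) (gsum z)%:E)%E.
Proof.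
move=> hm0 hmh hmh' ha hb tr xO Pd.
have cB := cube_sub_eball (x := x) tr.
have d0 : 0 <= delta by rewrite (le_trans _ (Pd 0 0)).
apply: le_trans (smooth_avg_link (lo := x - const_mx tau) (hi := x + const_mx tau) hm0 hmh hmh' _ (subset_trans cB xO) Pd) _.
  move=> i; rewrite !mxE.
  have h1 := coord_le_enorm (a - x) i; have h2 := coord_le_enorm (b - x) i.
  by move: h1 h2; rewrite !mxE !ler_norml => /andP[? ?] /andP[? ?]; split; lra.
apply: lee_wpmul2l; first by rewrite lee_fin mulr_ge0// exprn_ge0// divr_ge0// ltW.
apply: ge0_subset_integral => //.
- exact: measurable_cube.
- exact: measurable_eball.
- by apply/measurable_EFinP; exact: measurable_gsum.
- by move=> z _; rewrite lee_fin gsum_ge0.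
Qed.

(** At a common scale the Lipschitz bound on [P] brings out the factor [enorm (a - b)]; along a
    subdivided curve these costs add up to the length. *)
Lemma smooth_avg_move h a b (r : R) : 0 < h -> enorm (a - b) <= h ->
  2 * d%:R * h < r -> eball a r `<=` Om ->
  (`|smooth_avg h a - smooth_avg h b|%:E <=
   ((c / h) ^+ d * enorm (a - b))%:E * \int[mu]_(z in eball a r) (gsum z)%:E)%E.
Proof.
move=> h0 ab hr aO.
rewrite exprSr -[_ * _ * enorm _]mulrA.
apply: (smooth_avg_link_ball (tau := 2 * h)) => //.
- by rewrite subrr enorm0; lra.
- by rewrite enorm_distC; lra.
- by rewrite mulrA [_ * 2]mulrC.
move=> i t; apply: le_trans (moll_lip mP _ _) _.
rewrite -mulrBl normrM normfV (gtr0_norm h0) -mulrA [_^-1 * _]mulrC ler_wpM2l//.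
have -> : t - a 0 i - (t - b 0 i) = - (a - b) 0 i by rewrite !mxE; ring.
by rewrite normrN ler_wpM2r ?invr_ge0 ?(ltW h0)// coord_le_enorm.
Qed.

(** Between different scales the uniform bound [4 * c] on differences of [P] is used, rewritten as
    the cost of a displacement by [4 * s]. *)
Lemma smooth_avg_scale (h h' : R) (a b x : V) (r s : R) : 0 < s -> s <= h -> s <= h' ->
  enorm (a - x) + h <= r -> enorm (b - x) + h' <= r -> eball x (2 * d%:R * r) `<=` Om ->
  (`|smooth_avg h a - smooth_avg h' b|%:E <=
   ((c / s) ^+ d * (4 * s))%:E * \int[mu]_(z in eball x (2 * d%:R * r)) (gsum z)%:E)%E.
Proof.
move=> s0 sh sh' ha hb xO.
have -> : (c / s) ^+ d * (4 * s) = (c / s) ^+ n * (4 * c).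
  by rewrite exprSr; field; rewrite gt_eqF.
have r0 : 0 < r by have := enorm_ge0 (a - x); lra.
apply: (smooth_avg_link_ball (tau := r)) => //.
  by rewrite -mulrA ltr_pMl ?mulr_gt0 ?ltr0n// ltr1n.
by move=> i t; exact: moll_primitive_le.
Qed.

End potential.

End links.

(** * Balls and subdivided curves in the domain *)

Section fine_paths.
Context (R : realType) (n : nat).
Local Notation V := 'rV[R]_n.+1.

(** Along the segment from [z] to [w] the trace of [Om] is open and closed: a point of the closure
    outside [Om] would be a boundary point closer than [r]. The segment is connected. *)
Lemma ball_in_dist (Om : set V) (z : V) (r : R) : open Om -> Om z ->
  (r%:E <= dist_to (closure Om `\` interior Om) z)%E -> eball z r `<=` Om.
Proof.
move=> oOm Omz rd w wz.
pose g (t : R) : V := z + t *: (w - z).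
have cg : continuous g.
  by move=> t; apply: cvgD; [exact: cvg_cst|apply: cvgZl; exact: cvg_id].
have og : open (g @^-1` Om) by apply: open_comp => // t _; exact: cg.
have cl : closed (g @^-1` closure Om).
  by apply: closed_comp => [t _|]; [exact: cg|exact: closed_closure].
suff h : `[0, 1]%classic `&` g @^-1` Om = `[0, 1]%classic.
  have : `[0, 1]%classic (1 : R) by rewrite /= in_itv/= ler01 lexx.
  by rewrite -h => -[_]; rewrite /g/= scale1r addrC subrK.
apply: (@segment_connected R 0 1).
- by exists 0; split; [rewrite /= in_itv/= ler01 lexx|rewrite /g/= scale0r addr0].
- by exists (g @^-1` Om).
exists (g @^-1` closure Om) => //; apply/seteqP; split => t [t01 h]; split => //.
  exact: subset_closure.
apply: contrapT => ngt; have : (dist_to (closure Om `\` interior Om) z < r%:E)%E; last first.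
  by rewrite ltNge rd.
apply: (@le_lt_trans _ _ (enorm (z - g t))%:E).
  apply: ereal_inf_lbound; exists (g t) => //; split => //.
  by move: oOm => /interior_id ->.
rewrite lte_fin /g opprD addrA subrr add0r enormN enormZ.
move: t01; rewrite /= in_itv/= => /andP[t0 t1]; rewrite ger0_norm//.
apply: le_lt_trans wz; rewrite ler_piMl ?enorm_ge0//.
Qed.

(** A supremum argument: continuity at the supremum of the reachable parameters allows one more step
    beyond it, unless it is 1. *)
Lemma fine_path (gamma : R -> V) (e : R) : {within `[0, 1], continuous gamma} -> 0 < e ->
  exists s : seq R,
    path (fun a b => (a < b) && (enorm (gamma b - gamma a) <= e)) 0 s /\ last 0 s = 1.
Proof.
move=> cg e0; set rel := fun a b : R => _.
pose S := [set t : R | 0 <= t <= 1 /\ exists s, path rel 0 s /\ last 0 s = t].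
have S0 : S 0 by split; [rewrite lexx ler01|exists [::]].
have supS : has_sup S by split; [exists 0|exists 1 => t [/andP[]]].
set m := sup S.
have m0 : 0 <= m by exact: sup_upper_bound.
have m1 : m <= 1 by apply: sup_le_ub => [|t [/andP[]]//]; exists 0.
have [del del0 hdel] : exists2 del, 0 < del & forall t, 0 <= t <= 1 -> `|t - m| < del ->
    enorm (gamma t - gamma m) <= e / 2.
  have cg' : {within `[0, 1], continuous (fun t => enorm (gamma t - gamma m))}.
    move=> t; apply: (@continuous_comp _ _ _ _ (fun v : V => enorm (v - gamma m))); first exact: cg.
    apply: (@continuous_comp _ _ _ (fun v : V => v - gamma m)); last exact: continuous_enorm.
    exact: (cvgB cvg_id (cvg_cst _)).
  have mI : `[0, 1]%classic m by rewrite /= in_itv/= m0.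
  have e2 : 0 < e / 2 by rewrite divr_gt0.
  have /subspace_continuousP /(_ m mI) /cvgrPdist_le /(_ _ e2) := cg'.
  move=> -[del /= del0 hd].
  exists del => // t t01 tm; have := hd t; rewrite /from_subspace/= subrr enorm0 sub0r normrN (ger0_norm (enorm_ge0 _)).
  by apply; rewrite ?in_itv//= distrC.
have [t' St' mt'] := sup_adherent del0 supS.
have t'm : t' <= m by exact: sup_upper_bound.
have [/andP[t'0 t'1] [s [ps ls]]] := St'.
(* A parameter beyond the supremum [m], capped at the end of the interval. *)
pose t2 := Num.min 1 (m + del / 2).
have t21 : t2 <= 1 by rewrite ge_min lexx.
have [t2t'|t't2] := leP t2 t'.
  exists s; split => //; rewrite ls; apply/eqP; rewrite eq_le t'1/=.
  by move: t2t'; rewrite /t2 ge_min => /orP[//|]; move: mt' del0; rewrite -/m; lra.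
have t20 : 0 <= t2 by rewrite (le_trans t'0)// ltW.
have St2 : S t2.
  split; first by rewrite t20.
  exists (rcons s t2); rewrite rcons_path last_rcons ps ls; split => //.
  rewrite /rel t't2/= (le_trans (enorm_triangle (gamma m) _ _))//.
  rewrite [leRHS](splitr e) lerD//.
    apply: hdel; first by rewrite t20.
    rewrite ltr_norml; apply/andP; split; last first.
      by rewrite /t2 ltrBlDr gt_min; apply/orP; right; lra.
    by move: t't2 mt'; rewrite -/m; lra.
  rewrite enorm_distC; apply: hdel; first by rewrite t'0.
  by rewrite ltr_norml; move: mt'; rewrite -/m; lra.
have t2m : t2 <= m by exact: sup_upper_bound.
have t2E : t2 = 1.
  have [m2|m2] := leP 1 (m + del / 2); first exact/min_idPl.
  have t2E : t2 = m + del / 2 by apply/min_idPr; exact: ltW.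
  by move: t2m; rewrite t2E leNgt ltrDl divr_gt0.
by move: St2; rewrite t2E => -[_ [s2 ?]]; exists s2.
Qed.

(** A cube of side at most 1 and at most [e] contains the point and has volume at most [e]. *)
Lemma lebesgue_rV_set1 (x : V) : @lebesgue_rV R n [set x] = 0.
Proof.
apply/eqP; rewrite eq_le measure_ge0 andbT; apply/lee_addgt0Pr => e e0; rewrite add0e.
pose del := Num.min 1 e.
have del0 : 0 < del by rewrite lt_min ltr01.
apply: (@le_trans _ _ (@lebesgue_rV R n (box (x - const_mx del, x)))).
  apply: le_measure; rewrite ?inE; [|exact: measurable_box|].
    rewrite (_ : [set x] = cube x x); first exact: measurable_cube.
    apply/seteqP; split => z /= => [-> i|h]; first by rewrite lexx.
    by apply/rowP => i; apply/eqP; rewrite eq_le andbC.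
  by move=> z -> i /=; rewrite !mxE lexx andbT ltrBlDr ltrDl.
rewrite lebesgue_rV_box lee_fin /box_volume.
rewrite (eq_bigr (fun=> del)); last first.
  move=> i _ /=; rewrite !mxE opprB addrC subrK; apply/max_idPr; exact: ltW.
rewrite prodr_const card_ord exprS (le_trans (ler_piMr (ltW del0) _))//.
  by rewrite exprn_ile1 ?(ltW del0)// ge_min lexx.
by rewrite ge_min lexx orbT.
Qed.

Lemma ae_neq (x : V) : {ae @lebesgue_rV R n, forall z, z != x}.
Proof.
exists [set x]; split; [|exact: lebesgue_rV_set1|].
  rewrite (_ : [set x] = cube x x); first exact: measurable_cube.
  apply/seteqP; split => z /= => [-> i|h]; first by rewrite lexx.
  by apply/rowP => i; apply/eqP; rewrite eq_le andbC.
by move=> z /= /negP; rewrite negbK => /eqP.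
Qed.

End fine_paths.

(** * Averages linked along a curve of the domain *)

Section curves.
Context (R : realType) (n : nat).
Local Notation d := n.+1.
Local Notation V := 'rV[R]_d.
Local Notation mu := (@lebesgue_rV R n).
Variables (P eta : R -> R) (c : R).
Hypothesis mP : mollifier P eta c.
Variables (Om : set V) (eps : R).
Hypotheses (heps : 0 < eps <= 1) (dom : eps_infty_domain eps Om).
Variables (u : V -> R) (G : V -> V).
Hypotheses (lu : locally_integrable_rV Om u)
  (lG : forall i, locally_integrable_rV Om (fun z => G z 0 i)) (wp : weak_pair Om u G).
Local Notation avg := (smooth_avg eta Om u).

Let oOm : open Om. Proof. by case: dom. Qed.
Let mOm : measurable Om. Proof. exact: measurable_open. Qed.
Let eps0 : 0 < eps. Proof. by case/andP: heps. Qed.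
Let eps1 : eps <= 1. Proof. by case/andP: heps. Qed.
Let c0 : 0 < c. Proof. exact: lt_le_trans ltr01 (moll_c mP). Qed.
Let d0 : (0 : R) < d%:R. Proof. by rewrite ltr0n. Qed.

Definition gint (x : V) (r : R) : \bar R := (\int[mu]_(z in Om `&` eball x r) (gsum G z)%:E)%E.

Lemma gint_ge0 x r : (0 <= gint x r)%E.
Proof. by apply: integral_ge0 => z _; rewrite lee_fin gsum_ge0. Qed.

Lemma eball_sub (x y : V) (r s : R) : enorm (x - y) + r <= s -> eball x r `<=` eball y s.
Proof.
move=> rs z; rewrite /eball/= => zx; apply: le_lt_trans (enorm_triangle x _ _) _; lra.
Qed.

Lemma le_gint (x y : V) (r s : R) : eball x r `<=` Om -> enorm (x - y) + r <= s ->
  (\int[mu]_(z in eball x r) (gsum G z)%:E <= gint y s)%E.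
Proof.
move=> xO rs; apply: ge0_subset_integral.
- exact: measurable_eball.
- by apply: measurableI => //; exact: measurable_eball.
- apply/measurable_EFinP; apply: (measurable_gsum oOm lG) => z []//.
- by move=> w _; rewrite lee_fin gsum_ge0.
- by move=> w zx; split; [exact: xO|exact: eball_sub zx].
Qed.

Lemma le_gint2 (x y : V) (r s : R) : enorm (x - y) + r <= s -> (gint x r <= gint y s)%E.
Proof.
move=> rs; apply: ge0_subset_integral.
- by apply: measurableI => //; exact: measurable_eball.
- by apply: measurableI => //; exact: measurable_eball.
- apply/measurable_EFinP; apply: (measurable_gsum oOm lG) => z []//.
- by move=> w _; rewrite lee_fin gsum_ge0.
- by move=> w [zO zx]; split => //; exact: eball_sub zx.
Qed.

(** The average at a fixed scale [h] is moved along a fine subdivision of the curve; each cost is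
    proportional to the step, and the steps add up to at most the length. The relation between [h]
    and [D] gives [2 d h = eps * D / 8], so the averages fit into balls of radius [eps * D / 4]
    about the points of the curve. *)
Lemma curve_link (a b : V) (D L h : R) : h = eps * D / (16 * d%:R) -> Om a -> Om b -> a != b -> 0 < D -> D <= L ->
  eball a D `<=` Om -> eball b D `<=` Om -> enorm (a - b) <= L ->
  (`|avg h a - avg h b|%:E <= ((c / h) ^+ d * (L / eps))%:E * gint a (2 * L / eps))%E.
Proof.
move=> hE Oa Ob ab D0 DL aO bO abL.
have L0 : 0 < L := lt_le_trans D0 DL.
have h0 : 0 < h by rewrite hE divr_gt0 ?mulr_gt0.
have [_ /(_ a b Oa Ob ab) [ga [cga [ga0 ga1] gaO glen gdist]]] := dom.
have C0 : 0 < enorm (a - b) by rewrite enorm_gt0 subr_eq0.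
have LE : L <= L / eps by rewrite ler_pdivlMr// ler_piMr// ltW.
(* Within [D / 2] of an end point the ball given there is used. Elsewhere the bound on the distance
   to the boundary applies: both distances exceed [D / 2], and the larger is at least half of
   [enorm (a - b)]. *)
have gball t : t \in `[0, 1] -> eball (ga t) (eps * D / 4) `<=` Om.
  move=> t01; have eD : eps * D <= D by rewrite ler_piMl// ltW.
  have [hA|hA] := leP (enorm (a - ga t)) (D / 2).
    by apply: subset_trans aO; apply: eball_sub; rewrite enorm_distC; lra.
  have [hB|hB] := leP (enorm (b - ga t)) (D / 2).
    by apply: subset_trans bO; apply: eball_sub; rewrite enorm_distC; lra.
  apply: ball_in_dist => //; first exact: gaO.
  apply: le_trans (gdist t t01); rewrite lee_fin ler_pdivlMr//.
  have tri := enorm_triangle (ga t) a b; rewrite (enorm_distC (ga t) b) in tri.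
  rewrite -!mulrA ler_pM2l//.
  by have [?|?] := leP (enorm (a - ga t)) (enorm (b - ga t)); nra.
have glenE s : itv_partition 0 1 s ->
    \sum_(0 <= k < size s) enorm (ga (nth 1 (0 :: s) k.+1) - ga (nth 1 (0 :: s) k)) <= L / eps.
  move=> hs; rewrite -lee_fin; apply: (@le_trans _ _ (curve_length 0 1 ga)).
    by apply: ereal_sup_ubound; exists s.
  by apply: le_trans glen _; rewrite lee_fin mulrC ler_wpM2r// invr_ge0 ltW.
have gnear t : t \in `[0, 1] -> enorm (ga t - a) <= L / eps.
  rewrite in_itv/= => /andP[]; rewrite le_eqVlt => /predU1P[<- _|t0].
    by rewrite ga0 subrr enorm0 divr_ge0 ?ltW.
  rewrite le_eqVlt => /predU1P[->|t1].
    by rewrite ga1 enorm_distC (le_trans abL).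
  have pt : itv_partition 0 1 [:: t; 1] by split; rewrite /= ?t0 ?t1.
  have := glenE _ pt; rewrite /= !big_nat_recr//= big_geq// add0r ga0.
  by apply: le_trans; rewrite lerDl enorm_ge0.
have [s [ps ls]] := fine_path cga h0.
have ips : itv_partition 0 1 s.
  split; last by rewrite ls.
  by apply: sub_path ps => x y /andP[].
pose t k := nth 1 (0 :: s) k.
have t01 k : (k < (size s).+1)%N -> t k \in `[0, 1].
  by move=> ks; rewrite in_itv/=; apply/andP; split; [apply: itv_partition_nth_ge ips|apply: itv_partition_nth_le ips].
have tE : t 0%N = 0 /\ t (size s) = 1.
  by split => //; rewrite /t -last_nth.
set I := gint a _.
have I0 : (0 <= I)%E := gint_ge0 _ _.
have link k : (k < size s)%N -> (`|avg h (ga (t k)) - avg h (ga (t k.+1))|%:E <=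
    ((c / h) ^+ d * enorm (ga (t k.+1) - ga (t k)))%:E * I)%E.
  move=> ks; have tk := t01 k (ltnW ks).
  have /(pathP 1)/(_ k ks)/andP[_ fk] := ps.
  rewrite enorm_distC; apply: le_trans (smooth_avg_move mP oOm lu lG wp (r := eps * D / 4) h0 _ _ (gball _ tk)) _.
  - by rewrite enorm_distC.
  - rewrite hE (_ : 2 * d%:R * _ = eps * D / 8); last by field; rewrite gt_eqF.
    by have := mulr_gt0 eps0 D0; lra.
  apply: lee_wpmul2l; first by rewrite lee_fin mulr_ge0 ?enorm_ge0// exprn_ge0// divr_ge0 ?ltW.
  apply: le_gint; first exact: gball.
  have := gnear _ tk; have eD : eps * D <= D by rewrite ler_piMl// ltW.
  by rewrite mulrAC -mulrA; lra.
have K0 : 0 < (c / h) ^+ d by rewrite exprn_gt0// divr_gt0.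
have [Ioo|Ifin] := eqVneq I +oo%E.
  by rewrite Ioo gt0_muley ?leey// lte_fin mulr_gt0// divr_gt0.
have If : I \is a fin_num by rewrite ge0_fin_numE// ltey.
rewrite -(fineK If) -EFinM lee_fin.
have Ige : 0 <= fine I by exact: fine_ge0.
rewrite -ga0 -ga1 -[in ga 0]tE.1 -[in ga 1]tE.2.
have -> : avg h (ga (t 0%N)) - avg h (ga (t (size s))) =
    \sum_(0 <= k < size s) (avg h (ga (t k)) - avg h (ga (t k.+1))).
  rewrite -opprB -(telescope_sumr (fun k => avg h (ga (t k))) (leq0n _)) -sumrN.
  by apply: eq_bigr => k _; rewrite opprB.
apply: le_trans (ler_norm_sum _ _ _) _.
apply: (@le_trans _ _ (\sum_(0 <= k < size s) ((c / h) ^+ d * fine I) * enorm (ga (t k.+1) - ga (t k)))).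
  rewrite big_nat_cond [leRHS]big_nat_cond; apply: ler_sum => k /andP[/andP[_ ks] _].
  by have := link k ks; rewrite -(fineK If) -EFinM lee_fin mulrAC.
rewrite -mulr_sumr mulrAC ler_wpM2r// ler_wpM2l ?(ltW K0)//.
exact: glenE.
Qed.

End curves.

(** * Chains of averages shrinking to a point *)

Section chains.
Context (R : realType) (n : nat).
Local Notation d := n.+1.
Local Notation V := 'rV[R]_d.
Local Notation mu := (@lebesgue_rV R n).

Lemma open_eball (U : set V) (x : V) : open U -> U x ->
  exists2 r, 0 < r & eball x r `<=` U.
Proof.
move=> oU Ux; have : nbhs x U by exact: open_nbhs_nbhs.
move=> /nbhs_ballP[r /= r0 hr]; exists r => // z zx; apply: hr; split => // i j.
rewrite (ord1 i) /ball/=; have := coord_le_enorm (z - x) j; rewrite !mxE distrC.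
by move=> /le_lt_trans; apply.
Qed.

Lemma small_pow4 (A B : R) : 0 <= A -> 0 < B -> exists k, A / 4 ^+ k < B.
Proof.
move=> A0 B0; have M0 : 0 <= A / B by rewrite divr_ge0// ltW.
exists (Num.bound (A / B)); rewrite ltr_pdivrMr ?exprn_gt0// mulrC -ltr_pdivrMr//.
by apply: lt_le_trans (archi_boundP M0) _; rewrite -natrX ler_nat ltnW// ltn_expl.
Qed.

(** Majorant of the sum over [k] of [4^(k n)] times the indicator of [t < Lam / 4^k]. The exponent
    lies between [n], above which a geometric series remains, and the dimension [n.+1], below which
    the kernel is integrable near the origin. *)
Definition wfun (Lam t : R) : R :=
  if 0 < t < Lam then 2 * (Lam / t) `^ (n%:R + 2^-1) else 0.

Lemma wfun_ge0 Lam t : 0 <= wfun Lam t.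
Proof. by rewrite /wfun; case: ifP => // _; rewrite mulr_ge0// powR_ge0. Qed.

(** On [t < Lam / 4^k] the extra half power in [W] pays for a factor [2^k], so the terms are at most
    [W 2^(-k)] and add up to at most [2 W]. *)
Lemma wfun_sum (Lam t : R) (K : nat) : 0 < Lam -> 0 < t ->
  \sum_(k < K) (4 ^+ k) ^+ n * (t < Lam / 4 ^+ k)%R%:R <= wfun Lam t.
Proof.
move=> L0 t0; have p4 k : 0 < (4 : R) ^+ k by rewrite exprn_gt0.
rewrite /wfun t0/=; have [tL|Lt] := ltP t Lam; last first.
  rewrite big1// => k _; rewrite ltNge (le_trans _ Lt) ?mulr0//.
  by rewrite ler_pdivrMr// ler_peMr ?(ltW L0)// exprn_ege1// ler1n.
pose W := (Lam / t) `^ (n%:R + 2^-1).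
have W0 : 0 <= W by exact: powR_ge0.
apply: (@le_trans _ _ (\sum_(k < K) W * (2^-1) ^+ k)).
  apply: ler_sum => k _; case: ltP => [h|_]; last by rewrite mulr0 mulr_ge0// exprn_ge0// invr_ge0.
  have kt : 4 ^+ k <= Lam / t by rewrite ler_pdivlMr// mulrC -ler_pdivlMr// ltW.
  rewrite mulr1 exprVn ler_pdivlMr ?exprn_gt0//.
  have -> : (4 ^+ k) ^+ n * 2 ^+ k = ((4 : R) ^+ k) `^ (n%:R + 2^-1).
    rewrite powRD; last by rewrite gt_eqF ?implybT.
    rewrite powR_mulrn ?(ltW (p4 k))// powR12_sqrt ?(ltW (p4 k))//; congr (_ * _).
    have -> : (4 : R) = 2 ^+ 2 by rewrite -natrX.
    by rewrite exprAC sqrtr_sqr ger0_norm// exprn_ge0.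
  apply: ge0_ler_powR => //; rewrite ?nnegrE ?(ltW (p4 k))//.
  by rewrite divr_ge0 ?ltW.
rewrite -mulr_sumr mulrC ler_wpM2r//.
suff -> : \sum_(k < K) (2^-1 : R) ^+ k = 2 - 2 * 2^-1 ^+ K.
  by rewrite lerBlDr lerDl mulr_ge0// exprn_ge0// invr_ge0.
elim: K => [|K IH]; first by rewrite big_ord0 expr0; lra.
by rewrite big_ord_recr/= IH exprS; lra.
Qed.

Variables (P eta : R -> R) (c : R).
Hypothesis mP : mollifier P eta c.
Variables (Om : set V) (eps : R).
Hypotheses (heps : 0 < eps <= 1) (dom : eps_infty_domain eps Om).

Let oOm : open Om. Proof. by case: dom. Qed.
Let mOm : measurable Om. Proof. exact: measurable_open. Qed.
Let eps0 : 0 < eps. Proof. by case/andP: heps. Qed.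
Let eps1 : eps <= 1. Proof. by case/andP: heps. Qed.
Let c0 : 0 < c. Proof. exact: lt_le_trans ltr01 (moll_c mP). Qed.
Let d0 : (0 : R) < d%:R. Proof. by rewrite ltr0n. Qed.
Let d1 : (1 : R) <= d%:R. Proof. by rewrite ler1n. Qed.

(** Radius, relative to the distance at one level of the chain, of a ball about [x] large enough for
    all the integrals met at that level. *)
Definition chain_Lam : R := 5 * d%:R / eps.
(** Ratio of the mollification scale to the distance. With this value the scale at level [k.+1] is
    [eps * D / (16 * d)] for [D = eps * s / 2], [s] being the distance at the level after it, as
    [curve_link] requires. *)
Definition chain_kap : R := eps ^+ 2 / (128 * d%:R).
(** The bracket adds the cost of a change of scale and that of a curve between consecutive centres;
    [chain_constE] carries out the arithmetic. *)
Definition chain_C : R := (4 * c / chain_kap) ^+ d * (chain_kap + (2 * eps)^-1).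

Let Lam5 : 5 / eps <= chain_Lam.
Proof. by rewrite ler_wpM2r ?invr_ge0 ?(ltW eps0)// ler_peMr. Qed.
Let Lamd : 5 * d%:R <= chain_Lam.
Proof. by rewrite /chain_Lam ler_pdivlMr// ler_piMr// mulr_ge0. Qed.
Let eps_inv : 1 <= eps^-1. Proof. by rewrite invf_ge1. Qed.
Let kap_gt0 : 0 < chain_kap. Proof. by rewrite divr_gt0 ?exprn_gt0 ?mulr_gt0. Qed.
Let kapE : 128 * d%:R * chain_kap = eps ^+ 2.
Proof. by rewrite /chain_kap mulrC divfK// gt_eqF// mulr_gt0. Qed.
Let eps2 : eps ^+ 2 <= eps.
Proof. by rewrite expr2 ler_piMr// ltW. Qed.
Let kapd : d%:R * chain_kap <= 1 / 128.
Proof. by have := kapE; have := eps2; have := eps1; rewrite -mulrA; lra. Qed.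
Let kap1 : chain_kap <= 1 / 128.
Proof. by apply: le_trans kapd; rewrite ler_peMl// ltW. Qed.
Lemma chain_C_ge0 : 0 <= chain_C.
Proof.
rewrite mulr_ge0// ?exprn_ge0 ?divr_ge0 ?mulr_ge0 ?addr_ge0 ?invr_ge0 ?mulr_ge0 ?ltW//.
Qed.

Section one_function.
Variables (u : V -> R) (G : V -> V).
Hypotheses (lu : locally_integrable_rV Om u)
  (lG : forall i, locally_integrable_rV Om (fun z => G z 0 i)) (wp : weak_pair Om u G).
Local Notation avg := (smooth_avg eta Om u).
Local Notation gint := (gint Om G).

(** Substitute for a Lebesgue point, required only for some arbitrarily small scales. The centre is
    shifted to [x - (H, ..., H)] so that the average sees only points smaller than [x] in every
    coordinate: on such points close to [x] the indicator of a half-open box, closed above, is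
    constant. *)
Definition good_point (x : V) := forall e : R, 0 < e ->
  exists2 H, 0 < H < e & `|avg H (x - const_mx H) - u x| <= e.

Definition chain_term (x : V) (s : R) : \bar R :=
  ((chain_C * (s ^+ n)^-1)%:E * gint x (chain_Lam * s))%E.

Lemma chain_constE (s : R) : 0 < s ->
  (c / (chain_kap * (s / 4))) ^+ d * (4 * (chain_kap * (s / 4))) +
  (c / (chain_kap * (s / 4))) ^+ d * (s / (2 * eps)) = chain_C * (s ^+ n)^-1.
Proof.
move=> s0; rewrite -mulrDr.
have -> : c / (chain_kap * (s / 4)) = 4 * c / chain_kap / s.
  by field; rewrite ?gt_eqF// ?mulr_gt0.
rewrite exprMn /chain_C exprVn [s ^+ d]exprS; field.
by rewrite !gt_eqF// ?exprn_gt0 ?mulr_gt0.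
Qed.

Lemma enorm_const (H : R) : 0 <= H -> enorm (const_mx H : V) <= d%:R * H.
Proof.
move=> H0; apply: le_trans (enorm_le_sum _) _.
rewrite (eq_bigr (fun=> H)); last by move=> i _; rewrite mxE ger0_norm.
by rewrite sumr_const card_ord mulr_natl.
Qed.

(** By the intermediate value theorem the curve from [x] to [y] contains points [q k] at distance
    [r / 4^(k + 1)] from [x], well inside the domain. Consecutive averages are compared by a change
    of scale at [q k] and along a curve from [q k] to [q k.+1], until the scale reaches that of a
    good average at [x]. The starting point [p = q 0] does not depend on the accuracy [e]. *)
Lemma half_chain (x y : V) : Om x -> Om y -> x != y -> good_point x ->
  exists p, [/\ Om p, eball p (eps * (enorm (x - y) / 4) / 2) `<=` Om, enorm (x - p) = enorm (x - y) / 4 &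
    forall e, 0 < e -> exists K, (`|avg (chain_kap * enorm (x - y)) p - u x|%:E <=
      \sum_(k < K) chain_term x (enorm (x - y) / 4 ^+ k) + e%:E)%E].
Proof.
move=> Ox Oy xy gx; set r := enorm (x - y).
have r0 : 0 < r by rewrite enorm_gt0 subr_eq0.
pose s (k : nat) : R := r / 4 ^+ k.
have p4 k : 0 < (4 : R) ^+ k by rewrite exprn_gt0.
have s0 k : 0 < s k by rewrite divr_gt0.
have sS k : s k.+1 = s k / 4 by rewrite /s exprS invfM mulrCA mulrC.
have s00 : s 0%N = r by rewrite /s expr0 divr1.
have sr k : s k.+1 <= r / 4.
  rewrite sS ler_wpM2r ?invr_ge0// /s ler_pdivrMr// ler_peMr ?(ltW r0)// exprn_ege1// ler1n//.
have [_ /(_ x y Ox Oy xy) [ga [cga [ga0 ga1] gaO _ gdist]]] := dom.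
have /choice[q Hq] : forall k, exists q, [/\ Om q, enorm (x - q) = s k.+1 &
    eball q (eps * s k.+1 / 2) `<=` Om].
  move=> j.
  have cg : {within `[0, 1], continuous (fun t => enorm (x - ga t))}.
    move=> t; apply: (@continuous_comp _ _ _ _ (fun v : V => enorm (x - v))); first exact: cga.
    apply: (@continuous_comp _ _ _ (fun v : V => x - v)); last exact: continuous_enorm.
    exact: (cvgB (cvg_cst _) cvg_id).
  have [|t t01 ht] := IVT ler01 cg (v := s j.+1).
    rewrite ga0 ga1 subrr enorm0 -/r (min_idPl (ltW r0)) (max_idPr (ltW r0)) (ltW (s0 _))/=.
    by have := sr j; lra.
  exists (ga t); split => //; first exact: gaO.
  apply: ball_in_dist => //; first exact: gaO.
  apply: le_trans (gdist t t01); rewrite lee_fin ler_pdivlMr// ht.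
  rewrite (_ : eps * s j.+1 / 2 * r = eps * s j.+1 * (r / 2)); last by ring.
  rewrite ler_pM2l ?mulr_gt0//.
  have := enorm_triangle (ga t) x y; rewrite -/r ht (enorm_distC (ga t)).
  by have := sr j; lra.
have Oq k : Om (q k) by have [] := Hq k.
have dq k : enorm (x - q k) = s k.+1 by have [] := Hq k.
have bq k : eball (q k) (eps * s k.+1 / 2) `<=` Om by have [] := Hq k.
pose h k := chain_kap * s k.
have h0 k : 0 < h k by rewrite mulr_gt0.
have hS k : h k.+1 = h k / 4 by rewrite /h sS mulrA.
have hle k : h k.+1 <= h k by rewrite hS; have := h0 k; lra.
have dh k : 2 * d%:R * h k = eps ^+ 2 * s k / 64 by rewrite -kapE /h; field.
have Ls k : 5 * (s k / eps) <= chain_Lam * s k.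
  by rewrite mulrCA mulrC ler_wpM2r ?(ltW (s0 k)).
have se k : s k <= s k / eps by rewrite ler_peMr// ltW.
have pw k : 0 <= (c / h k.+1) ^+ d by rewrite exprn_ge0// divr_ge0 ?(ltW c0) ?(ltW (h0 _)).
have cB k : 0 <= (c / h k.+1) ^+ d * (4 * h k.+1).
  by rewrite mulr_ge0 ?pw// mulr_ge0// ltW.
have cA k : 0 <= (c / h k.+1) ^+ d * (s k / (2 * eps)).
  by rewrite mulr_ge0 ?pw// divr_ge0 ?(ltW (s0 _))// mulr_ge0// ltW.
have stepB k : (`|avg (h k) (q k) - avg (h k.+1) (q k)|%:E <=
    ((c / h k.+1) ^+ d * (4 * h k.+1))%:E * gint x (chain_Lam * s k))%E.
  have bO : eball (q k) (2 * d%:R * h k) `<=` Om.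
    apply: subset_trans (bq k); apply: eball_sub; rewrite subrr enorm0 add0r dh sS.
    by have := ler_wpM2r (ltW (s0 k)) eps2; have := mulr_gt0 eps0 (s0 k); lra.
  apply: le_trans (smooth_avg_scale mP oOm lu lG wp (x := q k) (h0 k.+1) (hle k) (lexx _) _ _ bO) _.
  - by rewrite subrr enorm0 add0r.
  - by rewrite subrr enorm0 add0r.
  apply: lee_wpmul2l; first by rewrite lee_fin cB.
  apply: (le_gint dom lG) => //; rewrite enorm_distC dq sS dh.
  have := Ls k; have := se k; have := ler_wpM2r (ltW (s0 k)) eps2; have := ler_wpM2r (ltW (s0 k)) eps1; have := s0 k; lra.
have stepA k : (`|avg (h k.+1) (q k) - avg (h k.+1) (q k.+1)|%:E <=
    ((c / h k.+1) ^+ d * (s k / (2 * eps)))%:E * gint x (chain_Lam * s k))%E.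
  have D0 : 0 < eps * s k.+2 / 2 by rewrite divr_gt0// mulr_gt0.
  have hE : h k.+1 = eps * (eps * s k.+2 / 2) / (16 * d%:R).
    by rewrite /h /chain_kap !sS; field; rewrite gt_eqF.
  have qq : q k != q k.+1.
    by apply/negP => /eqP E; have := dq k; rewrite E dq sS; have := s0 k.+1; lra.
  have DL : eps * s k.+2 / 2 <= 2 * s k.+1.
    by rewrite sS; have := ler_wpM2r (ltW (s0 k.+1)) eps1; have := s0 k.+1; lra.
  have bk : eball (q k) (eps * s k.+2 / 2) `<=` Om.
    apply: subset_trans (bq k); apply: eball_sub; rewrite subrr enorm0 add0r sS.
    by have := mulr_gt0 eps0 (s0 k.+1); lra.
  have ql : enorm (q k - q k.+1) <= 2 * s k.+1.
    apply: le_trans (enorm_triangle x _ _) _; rewrite dq enorm_distC dq.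
    by have := s0 k; have := sS k; have := sS k.+1; lra.
  have := curve_link mP heps dom lu lG wp hE (Oq k) (Oq k.+1) qq D0 DL bk (bq k.+1) ql.
  have -> : 2 * s k.+1 / eps = s k / (2 * eps) by rewrite sS; field; rewrite gt_eqF.
  move=> /le_trans; apply; apply: lee_wpmul2l.
    by rewrite lee_fin cA.
  apply: (le_gint2 dom lG); rewrite enorm_distC dq sS.
  have -> : 2 * (2 * (s k / 4)) / eps = s k / eps by field; rewrite gt_eqF.
  by have := Ls k; have := se k; have := s0 k; lra.
have hk1 k : h k.+1 = chain_kap * (s k / 4) by rewrite /h sS.
have cT k : (((c / h k.+1) ^+ d * (4 * h k.+1))%:E * gint x (chain_Lam * s k) +
    ((c / h k.+1) ^+ d * (s k / (2 * eps)))%:E * gint x (chain_Lam * s k) = chain_term x (s k))%E.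
  rewrite /chain_term -ge0_muleDl ?lee_fin ?cA ?cB//.
  by rewrite -EFinD hk1 chain_constE.
have chain K : (`|avg (h 0%N) (q 0%N) - avg (h K) (q K)|%:E <= \sum_(k < K) chain_term x (s k))%E.
  elim: K => [|K IH]; first by rewrite subrr normr0 big_ord0.
  rewrite big_ord_recr/= -cT.
  apply: (@le_trans _ _ (`|avg (h 0%N) (q 0%N) - avg (h K) (q K)|%:E +
      (`|avg (h K) (q K) - avg (h K.+1) (q K)|%:E + `|avg (h K.+1) (q K) - avg (h K.+1) (q K.+1)|%:E))%E).
    rewrite -!EFinD lee_fin (le_trans (ler_distD (avg (h K) (q K)) _ _))// lerD2l ler_distD//.
  by apply: leeD => //; apply: leeD.
exists (q 0%N); split; [exact: Oq| | |].
- by have := bq 0%N; rewrite sS s00.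
- by rewrite dq sS s00.
move=> e e0.
have [rho rho0 rhoO] := open_eball oOm Ox.
(* From level [K0] on, the balls of radius [2 d s] about [x] lie in the domain. *)
have [K0 hK0] : exists K0, 2 * d%:R * s K0 <= rho.
  have A0 : 0 <= 2 * d%:R * r by rewrite !mulr_ge0// ltW.
  by have [k hk] := small_pow4 A0 rho0; exists k; rewrite /s mulrA ltW.
have eh0 : 0 < Num.min e (h K0) by rewrite lt_min e0/=.
have [H /andP[H0 HK] Hu] := gx _ eh0.
have He : `|avg H (x - const_mx H) - u x| <= e by rewrite (le_trans Hu)// ge_min lexx.
have {}HK : H < h K0 by rewrite (lt_le_trans HK)// ge_min lexx orbT.
have exK : exists k, h k.+1 < H.
  have [k hk] := small_pow4 (ltW (h0 0%N)) H0; exists k.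
  by apply: le_lt_trans (hle k) _; rewrite /h /s mulrA -s00.
(* The last level whose scale is at least [H]. *)
pose K := ex_minn exK.
have [KH KHmin] : h K.+1 < H /\ H <= h K.
  rewrite /K; case: ex_minnP => k hk kmin; split => //.
  case: k hk kmin => [_ _|k hk kmin].
    rewrite (le_trans (ltW HK))//; elim: K0 {hK0 HK eh0 Hu} => // k IH.
    exact: le_trans (hle _) IH.
  by rewrite leNgt; apply/negP => /kmin; rewrite ltnn.
have hmono i j : (i <= j)%N -> h j <= h i.
  by move=> /subnK <-; elim: (j - i)%N => // m IH; rewrite addSn; exact: le_trans (hle _) IH.
have KK0 : (K0 <= K)%N.
  rewrite leqNgt; apply/negP => /hmono h1.
  by move: (lt_trans KH HK); rewrite ltNge h1.
have sK : s K <= s K0.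
  by have := hmono _ _ KK0; rewrite /h ler_pM2l.
have xO : eball x (2 * d%:R * s K) `<=` Om.
  apply: subset_trans rhoO; apply: eball_sub; rewrite subrr enorm0 add0r.
  by apply: le_trans hK0; rewrite ler_pM2l// mulr_gt0.
have dhK := dh K.
have dH : d%:R * H <= s K / 4.
  have h1 : d%:R * H <= d%:R * h K by rewrite ler_pM2l.
  have := ler_wpM2r (ltW (s0 K)) eps2; have := ler_wpM2r (ltW (s0 K)) eps1.
  by have := s0 K; rewrite -mulrA in dhK; lra.
have HdH : H <= d%:R * H by rewrite ler_peMl// ltW.
have hKs : h K <= s K / 4.
  by have := ler_wpM2r (ltW (s0 K)) kap1; have := s0 K; rewrite /h; lra.
(* The closing link goes from [q K] to the shifted centre near [x], inside a ball about [x], with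
   [h K.+1] as a lower bound for both scales. *)
have final : (`|avg (h K) (q K) - avg H (x - const_mx H)|%:E <= chain_term x (s K))%E.
  apply: le_trans (smooth_avg_scale mP oOm lu lG wp (x := x) (r := s K) (h0 K.+1) (hle K) (ltW KH) _ _ xO) _.
  - by rewrite enorm_distC dq sS; have := s0 K; lra.
  - rewrite addrAC subrr add0r enormN; have := enorm_const (ltW H0); have := s0 K; lra.
  apply: (@le_trans _ _ (((c / h K.+1) ^+ d * (4 * h K.+1))%:E * gint x (chain_Lam * s K))%E).
    apply: lee_wpmul2l; first by rewrite lee_fin cB.
    apply: (le_gint dom lG) => //; rewrite subrr enorm0 add0r ler_wpM2r ?(ltW (s0 K))//.
    by apply: le_trans Lamd; rewrite ler_wpM2r ?(ltW d0)//; lra.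
  rewrite -cT leeDl// mule_ge0 ?gint_ge0// lee_fin cA//.
exists K.+1; rewrite big_ord_recr/=.
have -> : chain_kap * r = h 0%N by rewrite /h s00.
apply: (@le_trans _ _ (`|avg (h 0%N) (q 0%N) - avg (h K) (q K)|%:E +
  `|avg (h K) (q K) - avg H (x - const_mx H)|%:E + `|avg H (x - const_mx H) - u x|%:E)%E).
  rewrite -!EFinD lee_fin (le_trans (ler_distD (avg H (x - const_mx H)) _ _))// lerD2r ler_distD//.
by apply: leeD; [apply: leeD; [exact: chain|exact: final]|rewrite lee_fin].
Qed.

End one_function.

End chains.

(** * The pointwise potential estimate *)

Lemma double_muleDr (R : realDomainType) (C : R) (a b : \bar R) :
  0 <= C -> (0 <= a -> 0 <= b ->
  (2 * C)%R%:E * (a + b) = C%:E * a + C%:E * a + (C%:E * b + C%:E * b))%E.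
Proof.
move=> C0 a0 b0; rewrite ge0_muleDr// mulr_natl mulr2n EFinD.
by rewrite !ge0_muleDl// lee_fin.
Qed.

Section potential_estimate.
Context (R : realType) (n : nat).
Local Notation d := n.+1.
Local Notation V := 'rV[R]_d.
Local Notation mu := (@lebesgue_rV R n).
Local Notation wfun := (wfun n).

Lemma wfunE (Lam t : R) : 0 < Lam -> wfun Lam t =
  2 * Lam `^ (n%:R + 2^-1) * (t `^ (- (n%:R + 2^-1)) * \1_(`]0, Lam[%classic : set R) t).
Proof.
move=> L0; rewrite /Defs.kappa /wfun indicE; case: ifPn => [/andP[t0 tL]|h].
  rewrite mem_set; last by rewrite /= in_itv/= t0 tL.
  rewrite mulr1 powRM ?(ltW L0) ?invr_ge0 ?(ltW t0)// mulrA; congr (_ * _).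
  by rewrite powRN -powR_inv1 ?(ltW t0)// -powRrM mulN1r powRN.
by rewrite memNset ?mulr0// /= in_itv/=; apply/negP.
Qed.

Lemma measurable_wfun (Lam : R) : 0 < Lam -> measurable_fun setT (wfun Lam).
Proof.
move=> L0; rewrite (funext (fun t => wfunE t L0)).
apply: (measurable_funM (measurable_cst _)); apply: measurable_funM; first exact: measurable_powR.
exact: measurable_indic.
Qed.

Lemma wfun_decr (Lam s t : R) : 0 < s -> s <= t -> wfun Lam t <= wfun Lam s.
Proof.
move=> s0 st; rewrite /wfun; have t0 := lt_le_trans s0 st.
rewrite s0 t0/=; case: ltP => [tL|_]; last by case: ifP => // _; rewrite mulr_ge0// powR_ge0.
rewrite (le_lt_trans st tL) ler_wpM2l// ge0_ler_powR ?nnegrE//.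
- by rewrite divr_ge0 ?ltW// (lt_trans t0 tL).
- by rewrite divr_ge0 ?ltW// (lt_trans t0 tL).
- by rewrite ler_wpM2l ?lef_pV2 ?posrE// ltW// (lt_trans t0 tL).
Qed.

Lemma wfun_le0 (Lam t : R) : t <= 0 -> wfun Lam t = 0.
Proof. by move=> t0; rewrite /wfun ltNge t0. Qed.

Lemma wfun_out (Lam t : R) : Lam <= t -> wfun Lam t = 0.
Proof. by move=> t0; rewrite /wfun [t < _]ltNge t0 andbF. Qed.

Variables (P eta : R -> R) (c : R).
Hypothesis mP : mollifier P eta c.
Variables (Om : set V) (eps : R).
Hypotheses (heps : 0 < eps <= 1) (dom : eps_infty_domain eps Om).

Let oOm : open Om. Proof. by case: dom. Qed.
Let mOm : measurable Om. Proof. exact: measurable_open. Qed.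
Let eps0 : 0 < eps. Proof. by case/andP: heps. Qed.
Let eps1 : eps <= 1. Proof. by case/andP: heps. Qed.
Let c0 : 0 < c. Proof. exact: lt_le_trans ltr01 (moll_c mP). Qed.
Let d0 : (0 : R) < d%:R. Proof. by rewrite ltr0n. Qed.
Let d1 : (1 : R) <= d%:R. Proof. by rewrite ler1n. Qed.
Local Notation Lam := (chain_Lam n eps).
Local Notation C := (chain_C n c eps).
Lemma chain_Lam_gt0 : 0 < Lam.
Proof. by rewrite divr_gt0 ?mulr_gt0. Qed.

Variables (u : V -> R) (G : V -> V).
Hypotheses (lu : locally_integrable_rV Om u)
  (lG : forall i, locally_integrable_rV Om (fun z => G z 0 i)) (wp : weak_pair Om u G).

Definition potential (r : R) (x : V) : \bar R :=
  (\int[mu]_(z in Om) ((gsum G z) * ((r ^+ n)^-1 * wfun Lam (enorm (z - x) / r)))%:E)%E.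

Lemma measurable_wfun_enorm (r : R) (x : V) :
  measurable_fun setT (fun z : V => wfun Lam (enorm (z - x) / r)).
Proof.
apply: (measurableT_comp (measurable_wfun chain_Lam_gt0)).
apply: (measurable_funM _ (measurable_cst _)); apply: measurable_enorm.
by apply: mcoordB; [exact: mcoord_id|exact: mcoord_cst].
Qed.

(** The sum over the scales is taken inside the integral, where [wfun_sum] bounds it away from the
    null set consisting of [x]. *)
Lemma chain_sum_le (x : V) (r : R) (K : nat) : 0 < r ->
  (\sum_(k < K) chain_term c Om eps G x (r / 4 ^+ k) <= C%:E * potential r x)%E.
Proof.
move=> r0; have p4 k : 0 < (4 : R) ^+ k by rewrite exprn_gt0.
have C0 : 0 <= C := chain_C_ge0 n mP heps.
have mg : measurable_fun Om (gsum G) := measurable_gsum oOm lG (@subset_refl _ Om).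
pose b (k : nat) (z : V) : R := (r / 4 ^+ k) ^- n * \1_(eball x (Lam * (r / 4 ^+ k))) z.
have b0 k z : 0 <= b k z.
  by rewrite mulr_ge0// ?invr_ge0 ?exprn_ge0// divr_ge0// ltW.
have mb k : measurable_fun setT (b k).
  by apply: (measurable_funM (measurable_cst _)); apply: measurable_indic; exact: measurable_eball.
have mgb k : measurable_fun Om (fun z => (gsum G z * b k z)%:E).
  by apply/measurable_EFinP; apply: (measurable_funM mg); exact: measurable_funTS.
have termE k : chain_term c Om eps G x (r / 4 ^+ k) =
    (C%:E * \int[mu]_(z in Om) (gsum G z * b k z)%:E)%E.
  rewrite /chain_term EFinM -muleA; congr (_ * _)%E; rewrite /gint.
  have mOe : measurable (Om `&` eball x (Lam * (r / 4 ^+ k))).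
    by apply: measurableI => //; exact: measurable_eball.
  rewrite -(@ge0_integralZl _ _ _ mu _ mOe); last 3 first.
  - by apply/measurable_EFinP; apply: (measurable_gsum oOm lG) => z [].
  - by move=> z _; rewrite lee_fin gsum_ge0.
  - by rewrite lee_fin invr_ge0 exprn_ge0// divr_ge0// ltW.
  rewrite [RHS]integral_mkcond [LHS]integral_mkcond; apply: eq_integral => z _.
  rewrite !patchE in_setI; case: (z \in Om) => //=; rewrite /b indicE.
  by case: (z \in _); rewrite ?mulr1 ?mulr0// -EFinM mulrC.
rewrite (eq_bigr _ (fun (k : 'I_K) _ => termE k)) -ge0_sume_distrr; last first.
  by move=> k _; apply: integral_ge0 => z _; rewrite lee_fin mulr_ge0 ?gsum_ge0.
apply: lee_wpmul2l => //.
rewrite -(@ge0_integral_sum _ _ _ mu _ mOm _ (fun (k : 'I_K) z => (gsum G z * b k z)%:E)); last 2 first.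
- by move=> k; exact: mgb.
- by move=> k z _; rewrite lee_fin mulr_ge0 ?gsum_ge0.
apply: (ae_ge0_le_integral mOm).
- by move=> z _; apply: sume_ge0 => k _; rewrite lee_fin mulr_ge0 ?gsum_ge0.
- by apply: emeasurable_sum => k; exact: mgb.
- by move=> z _; rewrite lee_fin !mulr_ge0 ?gsum_ge0 ?wfun_ge0// invr_ge0 exprn_ge0// ltW.
- apply/measurable_EFinP; apply: (measurable_funM mg).
  apply: (measurable_funM (measurable_cst _)).
  by apply: measurable_funTS; exact: measurable_wfun_enorm.
apply: filterS (ae_neq x) => z zx _.
rewrite sumEFin lee_fin -mulr_sumr ler_wpM2l ?gsum_ge0//.
have zx0 : 0 < enorm (z - x) / r by rewrite divr_gt0// enorm_gt0 subr_eq0.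
apply: le_trans (ler_wpM2l _ (wfun_sum n K chain_Lam_gt0 zx0)); last first.
  by rewrite invr_ge0 exprn_ge0// ltW.
rewrite mulr_sumr; apply: ler_sum => k _; rewrite /b indicE [leRHS]mulrA.
have -> : (r / 4 ^+ k) ^- n = (r ^+ n)^-1 * (4 ^+ k) ^+ n by rewrite expr_div_n invf_div mulrC.
apply: ler_wpM2l; first by rewrite mulr_ge0 ?invr_ge0 ?exprn_ge0// ltW.
rewrite ler_nat; case: (boolP (z \in _)) => // /set_mem; rewrite /eball/= => zb.
by rewrite ltr_pdivrMr// mulrAC -mulrA zb.
Qed.

Lemma le_chain_potential (a b : R) (x : V) (r : R) : 0 < r ->
  (forall e, 0 < e -> exists K, (`|a - b|%:E <=
     \sum_(k < K) chain_term c Om eps G x (r / 4 ^+ k) + e%:E)%E) ->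
  (`|a - b|%:E <= C%:E * potential r x)%E.
Proof.
move=> r0 h; apply/lee_addgt0Pr => e e0; have [K hK] := h e e0.
by apply: le_trans hK _; rewrite leeD2r// chain_sum_le.
Qed.

(** Half chains from [x] and from [y] end at points [p] and [q] with averages of the same scale, and
    one more curve joins these. The two points are distinct because each lies at distance [r / 4]
    from its own end. *)
Lemma potential_estimate (x y : V) : Om x -> Om y -> x != y ->
  good_point eta Om u x -> good_point eta Om u y ->
  (`|u x - u y|%:E <= (2 * C)%:E *
     (potential (enorm (x - y)) x + potential (enorm (x - y)) y))%E.
Proof.
move=> Ox Oy xy gx gy; set r := enorm (x - y).
have r0 : 0 < r by rewrite enorm_gt0 subr_eq0.
have C0 : 0 <= C := chain_C_ge0 n mP heps.
have [p [Op pO xp hp]] := half_chain mP heps dom lu lG wp Ox Oy xy gx.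
have yx : y != x by rewrite eq_sym.
have [q [Oq qO yq hq]] := half_chain mP heps dom lu lG wp Oy Ox yx gy.
rewrite enorm_distC -/r in qO yq hq; rewrite -/r in pO xp hp.
have Jp := le_chain_potential r0 hp; have Jq := le_chain_potential r0 hq.
have pot0 z : (0 <= potential r z)%E.
  by apply: integral_ge0 => w _; rewrite lee_fin !mulr_ge0 ?gsum_ge0 ?wfun_ge0// invr_ge0 exprn_ge0// ltW.
set h := chain_kap n eps * r in hp hq Jp Jq.
have D0 : 0 < eps * (r / 4) / 2 by rewrite !divr_gt0 ?mulr_gt0 ?divr_gt0.
have DL : eps * (r / 4) / 2 <= 2 * r by have := ler_wpM2r (ltW r0) eps1; lra.
have hE : h = eps * (eps * (r / 4) / 2) / (16 * d%:R).
  by rewrite /h /chain_kap; field; rewrite gt_eqF.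
have pq : p != q.
  apply/negP => /eqP E; have := enorm_triangle p x y; rewrite -/r xp [enorm (p - y)]enorm_distC E yq; lra.
have pql : enorm (p - q) <= 2 * r.
  have := enorm_triangle x p q; have := enorm_triangle y x q; rewrite -/r yq enorm_distC.
  by rewrite [enorm (p - x)]enorm_distC xp; lra.
have mid := curve_link mP heps dom lu lG wp hE Op Oq pq D0 DL pO qO pql.
have h0 : 0 < h.
  by rewrite /h /chain_kap mulr_gt0// divr_gt0// ?mulr_gt0// exprn_gt0.
(* The cost of the middle curve is absorbed by the level 0 term of the chain at [x]. *)
have {}mid : (`|smooth_avg eta Om u h p - smooth_avg eta Om u h q|%:E <= C%:E * potential r x)%E.
  apply: le_trans mid _; apply: le_trans (chain_sum_le x 1 r0).
  rewrite big_ord1 expr0 divr1 /chain_term.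
  apply: (@le_trans _ _ (((c / h) ^+ d * (2 * r / eps))%:E * gint Om G x (Lam * r))%E).
    apply: lee_wpmul2l.
      by rewrite lee_fin mulr_ge0// ?exprn_ge0 ?divr_ge0 ?mulr_ge0 ?(ltW c0) ?(ltW h0) ?(ltW r0) ?(ltW eps0).
    apply: (le_gint2 dom lG); rewrite enorm_distC xp.
    have L5 : 5 * (r / eps) <= Lam * r.
      rewrite /chain_Lam (_ : 5 * d%:R / eps * r = 5 * (r / eps) * d%:R); last by field; rewrite gt_eqF.
      by rewrite ler_peMr// mulr_ge0// divr_ge0 ?ltW.
    have re : r <= r / eps by rewrite ler_pdivlMr// ler_piMr// ltW.
    have -> : 2 * (2 * r) / eps = 4 * (r / eps) by field; rewrite gt_eqF.
    by lra.
  apply: lee_wpmul2r; first exact: gint_ge0.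
  rewrite lee_fin /chain_C.
  have k0 : 0 < chain_kap n eps by rewrite divr_gt0 ?exprn_gt0 ?mulr_gt0.
  have -> : (c / h) ^+ d * (2 * r / eps) = (c / chain_kap n eps) ^+ d * (2 / eps) * (r ^+ n)^-1.
    have -> : c / h = c / chain_kap n eps / r by rewrite /h invfM mulrA.
    rewrite exprMn exprVn [r ^+ d]exprS; field.
    by rewrite !gt_eqF// ?exprn_gt0.
  rewrite ler_wpM2r ?invr_ge0 ?exprn_ge0 ?(ltW r0)//.
  have -> : (4 * c / chain_kap n eps) ^+ d = (c / chain_kap n eps) ^+ d * 4 ^+ d.
    by rewrite -exprMn; congr (_ ^+ _); rewrite [RHS]mulrC mulrA.
  rewrite -mulrA; apply: ler_wpM2l; first by rewrite exprn_ge0// divr_ge0 ?(ltW c0) ?(ltW k0).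
  apply: (@le_trans _ _ (4 * (2 * eps)^-1)).
    by rewrite le_eqVlt; apply/orP; left; apply/eqP; field; rewrite gt_eqF.
  apply: ler_pM => //.
  - by rewrite invr_ge0 mulr_ge0// ltW.
  - by rewrite exprS ler_peMr// exprn_ege1// ler1n.
  - by rewrite lerDr ltW.
rewrite (double_muleDr C0 (pot0 x) (pot0 y)).
apply: (@le_trans _ _ (`|smooth_avg eta Om u h p - u x|%:E +
    `|smooth_avg eta Om u h p - smooth_avg eta Om u h q|%:E +
    `|smooth_avg eta Om u h q - u y|%:E)%E).
  rewrite -!EFinD lee_fin (le_trans (ler_distD (smooth_avg eta Om u h q) _ _))// lerD2r.
  by rewrite (le_trans (ler_distD (smooth_avg eta Om u h p) _ _))// lerD2r distrC.
apply: (leeD (leeD Jp mid)); apply: (le_trans Jq).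
by apply: leeDl; apply: mule_ge0; [rewrite lee_fin|exact: pot0].
Qed.

End potential_estimate.

(** * Convergence in mean of the one-sided averages *)

Section approximate_identity.
Context (R : realType) (n : nat).
Local Notation d := n.+1.
Local Notation V := 'rV[R]_d.
Local Notation mu := (@lebesgue_rV R n).
Local Notation lam := (@lebesgue_measure R).
Local Notation mu2 := (mu \x mu)%E.
Variables (P eta : R -> R) (c : R).
Hypothesis mP : mollifier P eta c.

Let measurable_eta : measurable_fun setT eta.
Proof.
apply: continuous_measurable_fun; apply: smooth1_continuous.
exact: smooth1_derive (moll_smooth mP) (moll_derive mP).
Qed.

Lemma phi_ge0 (h : R) (a z : V) : 0 < h -> 0 <= phi eta h a z.
Proof. by move=> h0; apply: prodr_ge0 => i _; exact: (mol_ge0 mP). Qed.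

Lemma phi_neq0 (h : R) (a z : V) : 0 < h -> phi eta h a z != 0 ->
  forall i, `|z 0 i - a 0 i| < h.
Proof.
move=> h0 + i; apply: contraNT; rewrite -leNgt => hz.
by rewrite /phi /prodfun (bigD1 i)//= (mol_out mP)// mul0r.
Qed.

(** Evenness of [eta] makes the kernel [aker] a probability density in either variable. *)
Lemma phi_swap (h : R) (x z : V) : 0 < h ->
  phi eta h (x - const_mx h) z = phi eta h (z + const_mx h) x.
Proof.
move=> h0; apply: eq_bigr => i _; rewrite /mol !mxE; congr (_ * _).
by rewrite -(moll_even mP) -mulNr; congr (eta (_ / _)); ring.
Qed.

Lemma continuous_phi (h : R) (a : V) : continuous (phi eta h a).
Proof. by apply: continuous_prodfun => i; exact: (continuous_mol mP). Qed.

Lemma integral_phi (h : R) (a : V) : 0 < h -> (\int[mu]_z (phi eta h a z)%:E = 1)%E.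
Proof.
move=> h0; have hi0 : 0 < h^-1 by rewrite invr_gt0.
have m1 : measurable_fun setT (fun z : V => (\prod_i eta (z 0 i))%:E).
  apply/measurable_EFinP; apply: measurable_fun_bigprod => i.
  by apply: (measurableT_comp measurable_eta); exact: mcoord_id.
have e0 (z : V) : (0 <= (\prod_i eta (z 0 i))%:E)%E.
  by rewrite lee_fin; apply: prodr_ge0 => i _; exact: moll_ge0 mP _.
have := ge0_integral_affine (- (h^-1 *: a)) hi0 m1 e0.
rewrite (@ge0_integral_prod _ _ (fun=> eta) (fun=> 1)); last 3 first.
- by move=> i; exact: measurable_eta.
- by move=> i t; exact: moll_ge0 mP _.
- by move=> i; exact: moll_int mP.
rewrite big1// mule1 invrK => I.
transitivity ((h^-1 ^+ d)%:E * \int[mu]_z (\prod_i eta ((h^-1 *: z - h^-1 *: a) 0 i))%:E)%E; last first.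
  by rewrite I -EFinM -exprMn mulVf ?expr1n// gt_eqF.
rewrite -(@ge0_integralZl _ _ _ mu _ measurableT); last 3 first.
- apply/measurable_EFinP; apply: measurable_fun_bigprod => i.
  apply: (measurableT_comp measurable_eta).
  have mi := measurable_affine (- (h^-1 *: a)) hi0.
  exact: (mcoord_comp mi).
- by move=> z _; exact: e0.
- by rewrite lee_fin exprn_ge0// ltW.
apply: eq_integral => z _; rewrite -EFinM; congr (_%:E).
rewrite /phi /prodfun -[d in _ ^+ d]card_ord -prodr_const -big_split; apply: eq_bigr => i _ /=.
by rewrite /mol !mxE; congr (_ * eta _); rewrite -mulrBr mulrC.
Qed.

Definition aker (h : R) (w : V * V) : R := phi eta h (w.1 - const_mx h) w.2.

Lemma measurable_aker (h : R) : measurable_fun setT (aker h).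
Proof.
apply: measurable_fun_bigprod => i.
apply: (measurable_funM (measurable_cst _)); apply: (measurableT_comp measurable_eta).
apply: (measurable_funM _ (measurable_cst _)).
apply: measurable_funB; first exact: (mcoord_comp measurable_snd).
by apply: (mcoordB (mcoord_comp measurable_fst) (mcoord_cst _)).
Qed.

Lemma aker_ge0 (h : R) w : 0 < h -> 0 <= aker h w.
Proof. by move=> h0; exact: phi_ge0. Qed.

Definition dev (h : R) (g : V -> R) (w : V * V) : \bar R :=
  (`|g w.2 - g w.1| * aker h w)%:E.

Lemma measurable_dev (h : R) (g : V -> R) : measurable_fun setT g ->
  measurable_fun setT (dev h g).
Proof.
move=> mg; apply/measurable_EFinP; apply: (measurable_funM _ (measurable_aker h)).
apply: measurableT_comp => //; apply: measurable_funB.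
  exact: (measurableT_comp mg measurable_snd).
exact: (measurableT_comp mg measurable_fst).
Qed.

Lemma dev_ge0 (h : R) g w : 0 < h -> (0 <= dev h g w)%E.
Proof. by move=> h0; rewrite lee_fin mulr_ge0// aker_ge0. Qed.

(** Smallness of the whole double integral yields, along a subsequence, that of the inner integral
    for almost every [x]. *)
Definition total_dev (h : R) (g : V -> R) : \bar R := (\int[mu2]_w dev h g w)%E.

Lemma total_devE (h : R) g : 0 < h -> measurable_fun setT g ->
  (total_dev h g = \int[mu]_x \int[mu]_z dev h g (x, z))%E.
Proof.
move=> h0 mg; apply: (fubini_tonelli1 (dev h g)); first exact: measurable_dev.
by move=> w; exact: dev_ge0.
Qed.

Lemma integral_aker1 (h : R) (v : V -> R) : 0 < h -> measurable_fun setT v ->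
  (forall x, 0 <= v x) ->
  (\int[mu2]_w (v w.1 * aker h w)%:E = \int[mu]_x (v x)%:E)%E.
Proof.
move=> h0 mv v0.
have mF : measurable_fun setT (fun w : V * V => (v w.1 * aker h w)%:E).
  apply/measurable_EFinP; apply: (measurable_funM _ (measurable_aker h)).
  exact: (measurableT_comp mv measurable_fst).
have F0 w : (0 <= (v w.1 * aker h w)%:E)%E by rewrite lee_fin mulr_ge0// aker_ge0.
rewrite (fubini_tonelli1 _ mF F0); apply: eq_integral => x _; rewrite /fubini_F.
have mA : measurable_fun setT (fun z => (aker h (x, z))%:E).
  apply/measurable_EFinP; apply: (measurableT_comp (measurable_aker h)).
  exact: measurable_pair1.
transitivity ((v x)%:E * \int[mu]_z (aker h (x, z))%:E)%E; last by rewrite /aker/= integral_phi// mule1.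
rewrite -(@ge0_integralZl _ _ _ mu _ measurableT _ mA); first by apply: eq_integral => z _.
  by move=> z _; rewrite lee_fin aker_ge0.
by rewrite lee_fin.
Qed.

Lemma integral_aker2 (h : R) (v : V -> R) : 0 < h -> measurable_fun setT v ->
  (forall x, 0 <= v x) ->
  (\int[mu2]_w (v w.2 * aker h w)%:E = \int[mu]_x (v x)%:E)%E.
Proof.
move=> h0 mv v0.
have mF : measurable_fun setT (fun w : V * V => (v w.2 * aker h w)%:E).
  apply/measurable_EFinP; apply: (measurable_funM _ (measurable_aker h)).
  exact: (measurableT_comp mv measurable_snd).
have F0 w : (0 <= (v w.2 * aker h w)%:E)%E by rewrite lee_fin mulr_ge0// aker_ge0.
rewrite (fubini_tonelli2 _ mF F0); apply: eq_integral => z _; rewrite /fubini_G.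
have mA : measurable_fun setT (fun x => (aker h (x, z))%:E).
  apply/measurable_EFinP; apply: (measurableT_comp (measurable_aker h)).
  exact: measurable_pair2.
transitivity ((v z)%:E * \int[mu]_x (aker h (x, z))%:E)%E; last first.
  rewrite [X in (_ * X)%E](_ : _ = 1%E) ?mule1//.
  by rewrite -(integral_phi (z + const_mx h) h0); apply: eq_integral => x _; rewrite /aker/= phi_swap.
rewrite -(@ge0_integralZl _ _ _ mu _ measurableT _ mA); first by apply: eq_integral => x _.
  by move=> x _; rewrite lee_fin aker_ge0.
by rewrite lee_fin.
Qed.

(** The kernel has mass 1 in each variable, so the difference [g - g1] is counted once at [x] and
    once at [z]. *)
Lemma total_dev_le (h : R) (g g1 : V -> R) : 0 < h ->
  measurable_fun setT g -> measurable_fun setT g1 ->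
  (total_dev h g <= total_dev h g1 + 2%:E * \int[mu]_x `|g x - g1 x|%:E)%E.
Proof.
move=> h0 mg mg1; pose v x := `|g x - g1 x|.
have mv : measurable_fun setT v by apply: measurableT_comp => //; exact: measurable_funB.
have v0 x : 0 <= v x by rewrite /v.
have mF1 : measurable_fun setT (fun w : V * V => (v w.1 * aker h w)%:E).
  apply/measurable_EFinP; apply: (measurable_funM _ (measurable_aker h)).
  exact: (measurableT_comp mv measurable_fst).
have mF2 : measurable_fun setT (fun w : V * V => (v w.2 * aker h w)%:E).
  apply/measurable_EFinP; apply: (measurable_funM _ (measurable_aker h)).
  exact: (measurableT_comp mv measurable_snd).
have F10 w : (0 <= (v w.1 * aker h w)%:E)%E by rewrite lee_fin mulr_ge0// aker_ge0.
have F20 w : (0 <= (v w.2 * aker h w)%:E)%E by rewrite lee_fin mulr_ge0// aker_ge0.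
have D0 w : (0 <= dev h g1 w)%E := dev_ge0 g1 w h0.
have mD := measurable_dev h mg1.
have -> : (2%:E * \int[mu]_x `|g x - g1 x|%:E = \int[mu]_x (v x)%:E + \int[mu]_x (v x)%:E)%E.
  by rewrite -mule2n mule_natl.
rewrite -[X in (_ + (X + _))%E](integral_aker2 h0 mv v0) -[X in (_ + (_ + X))%E](integral_aker1 h0 mv v0).
rewrite -(@ge0_integralD _ _ _ mu2 _ measurableT _ _ _ mF2 _ mF1)//.
have mF12 := emeasurable_funD mF2 mF1.
rewrite -(@ge0_integralD _ _ _ mu2 _ measurableT _ _ _ mD _ mF12)//; last first.
  by move=> w _; rewrite adde_ge0.
apply: (ge0_le_integral _ measurableT _ (measurable_dev h mg)).
- by move=> w _; exact: dev_ge0.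
- exact: emeasurable_funD.
move=> w _; rewrite /dev -!EFinD lee_fin -!mulrDl ler_wpM2r ?aker_ge0//.
rewrite /v addrA.
have -> : g w.2 - g w.1 = (g1 w.2 - g1 w.1) + (g w.2 - g1 w.2) - (g w.1 - g1 w.1) by ring.
by rewrite (le_trans (ler_normB _ _))// lerD2r ler_normD.
Qed.

Definition harm (k : nat) : R := k.+1%:R^-1.
Lemma harm_gt0 k : 0 < harm k. Proof. by rewrite invr_gt0. Qed.
Lemma harm_le1 k : harm k <= 1. Proof. by rewrite invf_le1// ler1n. Qed.
Lemma harm_small (e : R) : 0 < e -> exists N, forall k, (N <= k)%N -> harm k <= e.
Proof.
move=> e0; have e1 : 0 <= e^-1 by rewrite invr_ge0 ltW.
exists (Num.bound e^-1) => k Nk; rewrite /harm -[leRHS]invrK lef_pV2 ?posrE ?invr_gt0//.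
by rewrite (le_trans (ltW (archi_boundP e1)))// ler_nat ltnW.
Qed.

Definition approximable (g : V -> R) : Prop := measurable_fun setT g /\
  forall e : R, 0 < e -> exists N, forall k, (N <= k)%N -> (total_dev (harm k) g <= e%:E)%E.

Lemma approximable_closed (g : V -> R) : measurable_fun setT g ->
  (forall e : R, 0 < e -> exists2 g1, approximable g1 & (\int[mu]_x `|g x - g1 x|%:E <= e%:E)%E) ->
  approximable g.
Proof.
move=> mg h; split=> // e e0.
have e4 : 0 < e / 4 by rewrite divr_gt0. have e2 : 0 < e / 2 by rewrite divr_gt0.
have [g1 [mg1 ag1] gg1] := h _ e4; have [N hN] := ag1 _ e2; exists N => k /hN hk.
apply: le_trans (total_dev_le (harm_gt0 k) mg mg1) _.
have -> : (e%:E = (e / 2)%:E + 2%:E * (e / 4)%:E)%E.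
  by rewrite -EFinM -EFinD; congr (_%:E); field.
by apply: leeD => //; exact: lee_wpmul2l.
Qed.

Lemma approximableD (g1 g2 : V -> R) : approximable g1 -> approximable g2 ->
  approximable (fun x => g1 x + g2 x).
Proof.
move=> [m1 a1] [m2 a2]; split=> [|e e0]; first exact: measurable_funD.
have e2 : 0 < e / 2 by rewrite divr_gt0.
have [N1 h1] := a1 _ e2; have [N2 h2] := a2 _ e2; exists (maxn N1 N2) => k.
rewrite geq_max => /andP[/h1 k1 /h2 k2]; rewrite [e]splitr EFinD.
apply: le_trans (leeD k1 k2); have h0 := harm_gt0 k.
have md1 := measurable_dev (harm k) m1; have md2 := measurable_dev (harm k) m2.
rewrite /total_dev -(@ge0_integralD _ _ _ mu2 _ measurableT _ _ _ md1 _ md2); last 2 first.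
- by move=> w _; exact: dev_ge0.
- by move=> w _; exact: dev_ge0.
apply: (ge0_le_integral _ measurableT _ (measurable_dev _ (measurable_funD m1 m2))).
- by move=> w _; exact: dev_ge0.
- exact: emeasurable_funD.
move=> w _; rewrite /dev -EFinD lee_fin -mulrDl ler_wpM2r ?aker_ge0//.
have -> : (g1 \+ g2) w.2 - (g1 \+ g2) w.1 = (g1 w.2 - g1 w.1) + (g2 w.2 - g2 w.1).
  by rewrite /=; ring.
exact: ler_normD.
Qed.

Lemma approximableZ (a : R) (g : V -> R) : approximable g -> approximable (fun x => a * g x).
Proof.
move=> [m1 a1]; split=> [|e e0]; first exact: measurable_funM.
have a0 : 0 < `|a| + 1 by rewrite ltr_wpDl.
have ea : 0 < e / (`|a| + 1) by rewrite divr_gt0.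
have [N h1] := a1 _ ea; exists N => k /h1 hk; have h0 := harm_gt0 k.
rewrite -[e in leRHS](divfK (lt0r_neq0 a0)) mulrC EFinM.
apply: le_trans (lee_wpmul2l _ hk); last by rewrite lee_fin ltW.
have md1 := measurable_dev (harm k) m1.
rewrite /total_dev -(@ge0_integralZl _ _ _ mu2 _ measurableT _ md1); last 2 first.
- by move=> w _; exact: dev_ge0.
- by rewrite lee_fin ltW.
apply: (ge0_le_integral _ measurableT _ (measurable_dev _ (measurable_funM (measurable_cst a) m1))).
- by move=> w _; exact: dev_ge0.
- exact: measurable_funeM.
move=> w _; rewrite /dev -EFinM lee_fin mulrA ler_wpM2r ?aker_ge0//.
by rewrite -mulrBr normrM ler_wpM2r// lerDl.
Qed.

Lemma approximable0 : approximable (fun=> 0).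
Proof.
split=> // e e0; exists 0%N => k _; rewrite /total_dev integral0_eq ?lee_fin ?ltW//.
by move=> w _; rewrite /dev subrr normr0 mul0r.
Qed.

Lemma approximable_sum (I : Type) (s : seq I) (g : I -> V -> R) :
  (forall i, approximable (g i)) -> approximable (fun x => \sum_(i <- s) g i x).
Proof.
move=> ag; elim: s => [|i s IH].
  by under eq_fun do rewrite big_nil; exact: approximable0.
by under eq_fun do rewrite big_cons; exact: approximableD.
Qed.

(** The reason for one-sided averages: an interval open below and closed above is stable under small
    moves to the left at every point, its end points included. *)
Lemma left_interval_stable (lo hi x : R) : exists N, forall k, (N <= k)%N ->
  forall t, x - 2 * harm k < t -> t < x -> (lo < t <= hi) = (lo < x <= hi).
Proof.
pose e := Num.min (if lo < x then x - lo else 1) (if hi < x then x - hi else 1).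
have e0 : 0 < e.
  by rewrite lt_min; apply/andP; split; case: ifPn => // ?; rewrite subr_gt0.
have e2 : 0 < e / 2 by rewrite divr_gt0.
have [N hN] := harm_small e2; exists N => k /hN hk t t1 t2.
have te : x - t < e by have := harm_gt0 k; lra.
move: te; rewrite /e lt_min => /andP[te1 te2].
have -> : (lo < t) = (lo < x).
  move: te1; case: (ltP lo x) => [lx te1|xl _]; first by lra.
  by apply/negbTE; rewrite -leNgt (le_trans (ltW t2)).
have -> // : (t <= hi) = (x <= hi).
move: te2; case: (ltP hi x) => [hx te2|xh _]; last by rewrite (le_trans (ltW t2) xh).
by apply/negbTE; rewrite -ltNge; lra.
Qed.

(** At each point the deviation is 0 for all small scales, since every side of the box is stable
    under moves to the left; dominated convergence gives the integral. *)
Lemma approximable_box (B : V * V) : approximable (fun x => \1_(box B) x).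
Proof.
have mB := measurable_box B.
have m1 : measurable_fun setT (fun x : V => \1_(box B) x : R) by exact: measurable_indic.
split=> // e e0.
pose f k x := (\int[mu]_z dev (harm k) (fun x => \1_(box B) x : R) (x, z))%E.
have f0 k x : (0 <= f k x)%E by apply: integral_ge0 => z _; exact: dev_ge0 (harm_gt0 k).
(* The kernel reaches at most 2 to the left, so the deviation vanishes outside the box enlarged
   upwards by 2, whose indicator dominates. *)
pose B2 : V * V := (B.1, B.2 + const_mx 2).
have near_left k x z : aker (harm k) (x, z) != 0 -> forall i, x 0 i - 2 * harm k < z 0 i /\ z 0 i < x 0 i.
  move=> /(phi_neq0 (harm_gt0 k)) h i; have := h i; rewrite /= !mxE ltr_norml; lra.
have fle k x : (f k x <= (\1_(box B2) x)%:E)%E.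
  have [xB2|xB2] := pselect (box B2 x).
    rewrite indicE mem_set//.
    apply: (@le_trans _ _ (\int[mu]_z (phi eta (harm k) (x - const_mx (harm k)) z)%:E)%E).
      apply: (ge0_le_integral _ measurableT).
      - by move=> z _; exact: dev_ge0 (harm_gt0 k).
      - exact: (measurableT_comp (measurable_dev _ m1) (measurable_pair1 _)).
      - by apply/measurable_EFinP; exact: (continuous_measurable_rV (@continuous_phi (harm k) (x - const_mx (harm k)))).
      move=> z _; rewrite /dev lee_fin ler_piMl ?phi_ge0 ?harm_gt0// !indicE.
      by case: (_ \in _); case: (_ \in _); rewrite /= ?subrr ?subr0 ?sub0r ?normrN ?normr1 ?normr0.
    by rewrite integral_phi ?harm_gt0.
  rewrite indicE memNset// /f integral0_eq// => z _; rewrite /dev/=.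
  have [->|kn] := eqVneq (aker (harm k) (x, z)) 0; first by rewrite mulr0.
  have nl := near_left _ _ _ kn; have h1 := harm_le1 k.
  have [i xi] : exists i, ~~ (B.1 0 i < x 0 i <= B2.2 0 i).
    by move/existsNP : xB2 => [i /negP]; exists i.
  have nz : ~ box B z.
    move=> /(_ i) /andP[z1 z2]; move/negP : xi; apply; have [n1 n2] := nl i.
    by rewrite (lt_trans z1 n2)/= !mxE; lra.
  have nx : ~ box B x.
    move=> /(_ i) /andP[z1 z2]; move/negP : xi; apply.
    by rewrite z1/= !mxE; lra.
  by rewrite !indicE !memNset// subrr normr0 mul0r.
have fcvg x : f k x @[k --> \oo] --> 0%E.
  have /choice[N HN] : forall i, exists N, forall k, (N <= k)%N ->
      forall t, x 0 i - 2 * harm k < t -> t < x 0 i -> (B.1 0 i < t <= B.2 0 i) = (B.1 0 i < x 0 i <= B.2 0 i).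
    by move=> i; exact: left_interval_stable.
  apply: (@cvg_trans _ (cst 0%E @ \oo)); last exact: cvg_cst.
  apply: near_eq_cvg; exists (\max_i N i)%N => // k /= Nk; rewrite /f integral0_eq// => z _.
  rewrite /dev/=; have [->|kn] := eqVneq (aker (harm k) (x, z)) 0; first by rewrite mulr0.
  have nl := near_left _ _ _ kn.
  have zx i : (B.1 0 i < z 0 i <= B.2 0 i) = (B.1 0 i < x 0 i <= B.2 0 i).
    have [n1 n2] := nl i; apply: HN n1 n2.
    exact: leq_trans (leq_bigmax_cond _ _) Nk.
  have -> : \1_(box B) z = \1_(box B) x :> R.
    rewrite !indicE; suff -> : (z \in box B) = (x \in box B) by []; apply/idP/idP => /set_mem h; apply/mem_set => i.
      by rewrite -zx; exact: h.
    by rewrite zx; exact: h.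
  by rewrite subrr normr0 mul0r.
have cv : (\int[mu]_x f k x)%E @[k --> \oo] --> (\int[mu]_x (cst 0 x))%E.
  apply: (@dominated_cvg _ _ _ mu setT measurableT f (cst 0%E) (fun x => (\1_(box B2) x)%:E)) => //.
  - move=> k; apply: (measurable_fun_fubini_tonelli_F (dev (harm k) (fun x => \1_(box B) x : R))).
      exact: measurable_dev.
    by move=> w; exact: dev_ge0 (harm_gt0 k).
  - apply/integrableP; split.
      by apply/measurable_EFinP; apply: measurable_indic; exact: measurable_box.
    rewrite (_ : (\int[mu]_x _)%E = mu (box B2)); first by rewrite lebesgue_rV_box ltry.
    rewrite -[in RHS](setIT (box B2)) -(integral_indic mu measurableT (measurable_box B2)).
    by apply: eq_integral => x _; rewrite /= ger0_norm.
  - by move=> k x _; rewrite gee0_abs.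
rewrite integral0 in cv.
have /fine_cvgP[[N1 _ finN] /cvgrPdist_le /(_ _ e0) [N2 _ hN]] := cv.
exists (maxn N1 N2) => k; rewrite geq_max => /andP[k1 k2].
rewrite total_devE ?harm_gt0// -/(f k).
have := hN _ k2; rewrite /= sub0r normrN ger0_norm; last first.
  by apply: fine_ge0; exact: integral_ge0.
by rewrite -lee_fin fineK//; exact: finN.
Qed.

End approximate_identity.

(** * Almost everywhere convergence along subsequences *)

Section subsequences.
Context d (T : measurableType d) (R : realType) (m : {measure set T -> \bar R}).
Local Open Scope ereal_scope.

Lemma summable_integral_ae (f : nat -> T -> \bar R) :
  (forall k, measurable_fun setT (f k)) -> (forall k x, 0 <= f k x) ->
  \sum_(k <oo) \int[m]_x f k x < +oo ->
  {ae m, forall x, \sum_(k <oo) f k x < +oo /\ f k x @[k --> \oo] --> 0}.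
Proof.
move=> mf f0 fs.
have mS : measurable_fun setT (fun x => \sum_(k <oo) f k x).
  by apply: ge0_emeasurable_sum => // k x _ _; exact: f0.
have S0 x : 0 <= \sum_(k <oo) f k x by apply: nneseries_ge0.
have iS : m.-integrable setT (fun x => \sum_(k <oo) f k x).
  apply/integrableP; split => //.
  rewrite (eq_integral (fun x => \sum_(k <oo) f k x)); last by move=> x _; rewrite gee0_abs.
  by rewrite integral_nneseries// => k x _; exact: f0.
apply: filterS (integrable_ae measurableT iS) => x /(_ I); rewrite ge0_fin_numE// => Sx.
split=> //; have tail := nneseries_tail_cvg Sx (fun k _ => f0 k x).
apply: (@squeeze_cvge _ _ _ _ (cst 0) _ (fun N => \sum_(N <= k <oo) f k x)) => //; last exact: cvg_cst.
apply: nearW => N; rewrite f0/=.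
have := @nneseries_lim_ge R (f ^~ x) xpredT N N.+1 (fun k _ _ => f0 k x).
by rewrite big_nat1.
Qed.

(** Indices whose integrals are at most [2^-(j + 1)] give a series with finite integral, hence with
    terms tending to 0 almost everywhere. *)
Lemma ae_subsequence (f : nat -> T -> \bar R) :
  (forall k, measurable_fun setT (f k)) -> (forall k x, 0 <= f k x) ->
  (forall e : R, (0 < e)%R -> exists N, forall k, (N <= k)%N -> \int[m]_x f k x <= e%:E) ->
  exists2 s : nat -> nat, (forall j, j <= s j)%N &
    {ae m, forall x, f (s j) x @[j --> \oo] --> 0}.
Proof.
move=> mf f0 fe.
have /choice[s Hs] : forall j, exists k, (j <= k)%N /\
    \int[m]_x f k x <= (1 / (2 ^ j.+1)%:R)%:E.
  move=> j; have e0 : (0 < 1 / (2 ^ j.+1)%:R :> R)%R by rewrite divr_gt0// ltr0n expn_gt0.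
  have [N hN] := fe _ e0; exists (maxn j N); split; first exact: leq_maxl.
  by apply: hN; exact: leq_maxr.
exists s; first by move=> j; have [] := Hs j.
have fin : \sum_(k <oo) \int[m]_x f (s k) x < +oo.
  apply: (@le_lt_trans _ _ (\sum_(k <oo) (0 + (1 / (2 ^ k.+1)%:R)%:E))).
    apply: lee_nneseries => [k _ _|k _]; first exact: integral_ge0.
    by rewrite add0e; have [] := Hs k.
  apply: (@le_lt_trans _ _ (\sum_(k <oo) 0 + 1%:E)); last by rewrite eseries0// add0e ltry.
  exact: epsilon_trick.
by apply: filterS (summable_integral_ae (fun k => mf (s k)) (fun k => f0 (s k)) fin) => x [].
Qed.

End subsequences.

Import HBSimple.

(** * Good points, and uniqueness of weak derivatives *)

Section lebesgue_points.
Context (R : realType) (n : nat).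
Local Notation d := n.+1.
Local Notation V := 'rV[R]_d.
Local Notation mu := (@lebesgue_rV R n).
Variables (P eta : R -> R) (c : R).
Hypothesis mP : mollifier P eta c.

(** A cover by boxes of nearly minimal volume, cut to finitely many boxes, approximates the
    indicator in the integral norm; overlaps need no care because the excess of the total volume
    already counts them. *)
Lemma approximable_set (A : set V) : measurable A -> (mu A < +oo)%E ->
  approximable eta (fun x => \1_A x).
Proof.
move=> mA Afin.
have m1 : measurable_fun setT (fun x : V => \1_A x : R) by exact: measurable_indic.
apply: (approximable_closed mP m1) => e e0.
have e2 : 0 < e / 2 by rewrite divr_gt0.
have fA : mu A \is a fin_num by rewrite ge0_fin_numE.
have [_ [B AB <-] Bs] := lb_ereal_inf_adherent e2 fA.
pose t := (\sum_(k <oo) (box_volume (B k))%:E)%E.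
have vol0 k : (0 <= (box_volume (B k))%:E :> \bar R)%E := box_volume_ge0 _.
have t0 : (0 <= t)%E by apply: nneseries_ge0.
have {}Bs : (t < mu A + (e / 2)%:E)%E := Bs.
have tfin : (t < +oo)%E by rewrite (lt_le_trans Bs)// leey.
have /fine_cvgP[[N1 _ finN] /cvgrPdist_le /(_ _ e2) [N2 _ hN]] :=
  nneseries_tail_cvg tfin (fun k _ => vol0 k).
pose N := maxn N1 N2.
pose tail := (\sum_(N <= k <oo) (box_volume (B k))%:E)%E.
have tail0 : (0 <= tail)%E by apply: nneseries_ge0.
have tailN : (tail <= (e / 2)%:E)%E.
  have := hN N (leq_maxr _ _); rewrite /= sub0r normrN ger0_norm; last exact: fine_ge0.
  by rewrite -lee_fin fineK//; apply: (finN N); exact: leq_maxl.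
pose g (x : V) : R := \sum_(0 <= k < N) \1_(box (B k)) x.
exists g; first by apply: (approximable_sum mP) => k; exact: (approximable_box mP).
have mb k : measurable_fun setT (fun x : V => (\1_(box (B k)) x)%:E : \bar R).
  by apply/measurable_EFinP; apply: measurable_indic; exact: measurable_box.
have volE k : (\int[mu]_x (\1_(box (B k)) x)%:E = (box_volume (B k))%:E)%E.
  by have := integral_indic mu measurableT (measurable_box (B k)); rewrite setIT => ->; exact: lebesgue_rV_box.
have b0 k (x : V) : (0 <= (\1_(box (B k)) x)%:E :> \bar R)%E by rewrite lee_fin.
have mg : measurable_fun setT g.
  by apply: measurable_sum => k; apply/measurable_EFinP; exact: mb.
have g0 x : 0 <= g x by apply: sumr_ge0.
have mdiff : measurable_fun setT (fun x => `|\1_A x - g x|%:E).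
  by apply/measurable_EFinP; apply: measurableT_comp => //; exact: measurable_funB.
have mA1 : measurable_fun setT (fun x : V => (\1_A x)%:E : \bar R) by apply/measurable_EFinP.
have mg1 : measurable_fun setT (fun x : V => (g x)%:E) by apply/measurable_EFinP.
pose Sx x := (\sum_(k <oo) (\1_(box (B k)) x)%:E : \bar R)%E.
have mS : measurable_fun setT Sx by apply: ge0_emeasurable_sum.
have S0 x : (0 <= Sx x)%E by apply: nneseries_ge0.
have gE x : ((g x)%:E = \sum_(0 <= k < N) (\1_(box (B k)) x)%:E)%E by rewrite -sumEFin.
have gS x : ((g x)%:E <= Sx x)%E by rewrite gE; exact: nneseries_lim_ge.
have AS x : ((\1_A x)%:E <= Sx x)%E.
  have [Ax|Ax] := pselect (A x); last by rewrite indicE memNset.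
  have [j _ jx] := AB x Ax; rewrite indicE mem_set//.
  apply: (@le_trans _ _ (\sum_(0 <= k < j.+1) (\1_(box (B k)) x)%:E)%E); last exact: nneseries_lim_ge.
  rewrite big_nat_recr//= [X in (_ + X)%E](_ : _ = 1%E); last by rewrite indicE mem_set.
  by rewrite leeDr// sume_ge0.
(* Pointwise, [|a - g| + a + g] is twice the larger of [a] and [g], and both are at most the sum
   [Sx] of the indicators of the whole cover. *)
have main : (\int[mu]_x `|\1_A x - g x|%:E + (mu A + \int[mu]_x (g x)%:E) <= t + t)%E.
  have muA : (mu A = \int[mu]_x (\1_A x)%:E)%E by rewrite integral_indic// setIT.
  have tE : (t = \int[mu]_x Sx x)%E.
    by rewrite integral_nneseries//; apply: eq_eseriesr => k _; rewrite volE.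
  rewrite {1}muA {1 2}tE.
  rewrite -(@ge0_integralD _ _ _ mu _ measurableT _ _ _ mA1 _ mg1)//; last by move=> x _; rewrite lee_fin.
  have mAg := emeasurable_funD mA1 mg1.
  rewrite -(@ge0_integralD _ _ _ mu _ measurableT _ _ _ mdiff _ mAg)//; last first.
    by move=> x _; rewrite adde_ge0// lee_fin.
  rewrite -(@ge0_integralD _ _ _ mu _ measurableT _ _ _ mS _ mS)//.
  apply: (ge0_le_integral _ measurableT).
  - by move=> x _; rewrite !adde_ge0// lee_fin.
  - exact: emeasurable_funD.
  - exact: emeasurable_funD.
  move=> x _; have [gA|gA] := leP (g x) (\1_A x).
    apply: le_trans (leeD (AS x) (AS x)); rewrite -!EFinD lee_fin.
    by rewrite ger0_norm ?subr_ge0//; lra.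
  apply: le_trans (leeD (gS x) (gS x)); rewrite -!EFinD lee_fin.
  by rewrite ltr0_norm ?subr_lt0//; lra.
have SN : (t = \int[mu]_x (g x)%:E + tail)%E.
  rewrite /t (nneseries_split 0 N)// add0n; congr (_ + _)%E.
  under [RHS]eq_integral do rewrite gE.
  rewrite (@ge0_integral_sum _ _ _ mu _ measurableT _ (fun k x => (\1_(box (B k)) x)%:E))//.
  by apply: eq_bigr => k _; rewrite volE.
have G0 : (0 <= \int[mu]_x (g x)%:E)%E by apply: integral_ge0 => x _; rewrite lee_fin.
have D0 : (0 <= \int[mu]_x `|\1_A x - g x|%:E)%E by apply: integral_ge0 => x _; rewrite lee_fin.
have Gfin : (\int[mu]_x (g x)%:E)%E \is a fin_num.
  by rewrite ge0_fin_numE// (le_lt_trans _ tfin)// SN leeDl.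
have tf : t \is a fin_num by rewrite ge0_fin_numE.
have tlf : tail \is a fin_num by rewrite ge0_fin_numE// (le_lt_trans tailN)// ltry.
have Df : (\int[mu]_x `|\1_A x - g x|%:E)%E \is a fin_num.
  rewrite ge0_fin_numE// (@le_lt_trans _ _ (t + t)%E)//; last by rewrite lte_add_pinfty.
  by apply: le_trans main; rewrite leeDl// adde_ge0// measure_ge0.
move: main SN Bs tailN; have := fine_ge0 tail0.
rewrite -(fineK Df) -(fineK Gfin) -(fineK fA) -(fineK tf) -(fineK tlf).
rewrite -!EFinD !lee_fin lte_fin /= => tl main [SN] Bs tle; lra.
Qed.

(** Through simple functions: by integrability the level set of a nonzero value has finite
    measure. *)
Lemma approximable_integrable (g : V -> R) : mu.-integrable setT (EFin \o g) ->
  approximable eta g.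
Proof.
move=> ig; have mg : measurable_fun setT g by have /integrableP[/measurable_EFinP] := ig.
apply: (approximable_closed mP mg) => e e0.
have [s [is_ _ cs]] := approximation_sfun_integrable measurableT ig.
have /fine_cvgP[[N1 _ finN] /cvgrPdist_le /(_ _ e0) [N2 _ hN]] := cs.
pose N := maxn N1 N2; pose f := s N.
suff af : @approximable R n eta f.
  exists (f : V -> R); first exact: af.
  have := hN N (leq_maxr _ _).
  rewrite /= sub0r normrN ger0_norm; last by apply: fine_ge0; exact: integral_ge0.
  by rewrite -lee_fin fineK//; apply: (finN N); exact: leq_maxl.
have fE x : f x = \sum_(y <- finmap.enum_fset (fset_set (range f))) y * \1_(f @^-1` [set y]) x.
  by rewrite [LHS]fimfunE fsbig_finite.
rewrite (_ : approximable eta f = approximable eta (fun x => \sum_(y <- finmap.enum_fset (fset_set (range f))) y * \1_(f @^-1` [set y]) x)); last first.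
  by congr approximable; apply/funext.
apply: (approximable_sum mP) => y; have [->|y0] := eqVneq y 0.
  have -> : (fun x : V => 0 * \1_(f @^-1` [set 0]) x) = (fun=> 0 : R).
    by apply/funext => x; rewrite mul0r.
  exact: approximable0.
apply: (approximableZ mP); apply: approximable_set; first exact: measurable_sfunP.
have my : measurable (f @^-1` [set y]) by exact: measurable_sfunP.
have /integrableP[mf ff] := is_ N.
have h : (`|y|%:E * mu (f @^-1` [set y]) <= \int[mu]_x `|(f x)%:E|)%E.
  rewrite -integral_cst//.
  apply: (@le_trans _ _ (\int[mu]_(x in f @^-1` [set y]) `|(f x)%:E|)%E).
    rewrite le_eqVlt; apply/orP; left; apply/eqP; apply: eq_integral => x; rewrite inE => /= ->//.
  apply: ge0_subset_integral => //.
  exact: measurableT_comp.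
have : (`|y|%:E * mu (f @^-1` [set y]) < +oo)%E by rewrite (le_lt_trans h).
by rewrite !ltey; apply: contra => /eqP ->; rewrite gt0_muley// lte_fin normr_gt0.
Qed.

(** For a bounded open [Om], an exhaustion by compact sets, over which a locally integrable function
    is integrable. *)
Definition inner (Om : set V) (m : nat) : set V := [set x | eball x (harm R m) `<=` Om].

Lemma harm_lt (e : R) : 0 < e -> exists m, harm R m < e.
Proof.
move=> e0; have e2 : 0 < e / 2 by rewrite divr_gt0.
by have [N /(_ N (leqnn _)) hN] := harm_small e2; exists N; lra.
Qed.

Lemma inner_sub (Om : set V) m : inner Om m `<=` Om.
Proof. by move=> x; apply; rewrite /eball/= subrr enorm0 harm_gt0. Qed.

Lemma closed_inner (Om : set V) m : closed (inner Om m).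
Proof.
rewrite -[inner Om m]setCK closedC.
rewrite (_ : ~` inner Om m = \bigcup_(w in ~` Om) eball w (harm R m)).
  apply: bigcup_open => w _.
  have -> : eball w (harm R m) = (fun x => enorm (x - w)) @^-1` [set t | t < harm R m] by [].
  apply: open_comp; last exact: open_lt.
  move=> x _; apply: (@continuous_comp _ _ _ (fun v : V => v - w)); last exact: continuous_enorm.
  exact: (cvgB cvg_id (cvg_cst _)).
apply/seteqP; split => x /=.
  move=> /existsNP[w /not_implyP[xw wO]]; exists w => //.
  by move: xw; rewrite /eball/= enorm_distC.
by move=> [w wO]; rewrite /eball/= enorm_distC => xw h; apply: wO; exact: h.
Qed.

Lemma bounded_sub_cube (Om : set V) : bounded_set Om -> exists M : R, Om `<=` cube (const_mx (- M)) (const_mx M).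
Proof.
move=> [M0 [_ hM]]; exists (`|M0| + 1) => z Oz i; rewrite !mxE -ler_norml.
apply: le_trans (hM (`|M0| + 1) _ z Oz); last by rewrite (le_lt_trans (ler_norm M0))// ltrDl.
by rewrite [leRHS]mx_normrE; apply: (le_trans _ (le_bigmax _ _ (0, i))).
Qed.

Lemma compact_inner (Om : set V) m : bounded_set Om -> compact (inner Om m).
Proof.
move=> /bounded_sub_cube[M hM].
have h := subset_trans (@inner_sub Om m) hM.
exact: (subclosed_compact (closed_inner (Om := Om) (m := m)) (@compact_cube _ _ _ _) h).
Qed.

(** Cutting [u] off to the compact sets [inner Om m] makes it integrable, so for every [m] the
    deviations tend to 0 almost everywhere along a subsequence. At a given point some [inner Om m]
    contains a neighbourhood, on which the cut-off is invisible. *)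
Lemma ae_good_point (Om : set V) (u : V -> R) : open Om -> bounded_set Om ->
  locally_integrable_rV Om u -> {ae mu, forall x, Om x -> good_point eta Om u x}.
Proof.
move=> oOm bOm lu; have mOm := measurable_open oOm.
pose g m : V -> R := u \_ (inner Om m).
have mi m : measurable (inner Om m) by apply: measurable_compact; exact: compact_inner.
have ig m : mu.-integrable setT (EFin \o g m).
  have i1 : mu.-integrable (inner Om m) (EFin \o u).
    apply/integrableP; split.
      by apply/measurable_EFinP; exact: measurable_funS mOm (@inner_sub Om m) lu.1.
    by apply: lu.2; [exact: inner_sub|exact: compact_inner].
  have := (integrable_mkcond (EFin \o u) (mi m)).1 i1.
  by apply: eq_integrable => // x _; rewrite /g/= !patchE; case: ifP.
have ag m := approximable_integrable (ig m).
pose f m k x := (\int[mu]_z dev eta (harm R k) (g m) (x, z))%E.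
have subs m : exists2 s : nat -> nat, (forall j, j <= s j)%N &
    {ae mu, forall x, f m (s j) x @[j --> \oo] --> 0%E}.
  have [mg gm] := ag m.
  apply: ae_subsequence => [k|k x|e e0].
  - apply: (measurable_fun_fubini_tonelli_F (dev eta (harm R k) (g m))).
      exact: (measurable_dev mP).
    by move=> w; exact: (dev_ge0 mP) (harm_gt0 R k).
  - by apply: integral_ge0 => z _; exact: (dev_ge0 mP) (harm_gt0 R k).
  have [N hN] := gm e e0; exists N => k /hN.
  by rewrite (total_devE mP) ?harm_gt0.
have /choice[s Hs] : forall m, exists s : nat -> nat, (forall j, j <= s j)%N /\
    {ae mu, forall x, f m (s j) x @[j --> \oo] --> 0%E}.
  by move=> m; have [s ? ?] := subs m; exists s.
have := ae_foralln (fun m => (Hs m).2); apply: filterS => x hx Ox e e0.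
have [rho rho0 rhoO] := open_eball oOm Ox.
have rho2 : 0 < rho / 2 by rewrite divr_gt0.
have [m hm] := harm_lt rho2.
have d0 : (0 : R) < d%:R by rewrite ltr0n.
have near_inner z : enorm (z - x) < rho / 2 -> inner Om m z.
  move=> zx w wz; apply: rhoO; rewrite /eball/= in wz *.
  by apply: le_lt_trans (enorm_triangle z _ _) _; lra.
(* The scale has to be below [e] and to keep the support of the kernel, of size [2 d H], within
   [rho / 2] of [x]. *)
pose e1 := Num.min (e / 2) (rho / (8 * d%:R)).
have e10 : 0 < e1 by rewrite lt_min !divr_gt0// mulr_gt0.
have [N1 hN1] := harm_small e10.
have /fine_cvgP[[N2 _ finN] /cvgrPdist_le /(_ _ e0) [N3 _ hN]] := hx m.
pose j := maxn N1 (maxn N2 N3); pose k := s m j; pose H := harm R k.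
have H0 : 0 < H := harm_gt0 R k.
have He1 : H <= e1 by apply: hN1; apply: leq_trans ((Hs m).1 j); exact: leq_maxl.
have He : H < e by move: He1; rewrite /e1 le_min => /andP[? _]; lra.
have Hr : 2 * d%:R * H < rho / 2.
  have : H <= rho / (8 * d%:R) by move: He1; rewrite /e1 le_min => /andP[].
  rewrite ler_pdivlMr ?mulr_gt0// => h.
  have -> : 2 * d%:R * H = H * (8 * d%:R) / 4 by field.
  lra.
exists H; first by rewrite H0.
have fj : (f m k x <= e%:E)%E.
  have := hN j; rewrite /= sub0r normrN ger0_norm; last first.
    by apply: fine_ge0; apply: integral_ge0 => z _; exact: (dev_ge0 mP).
  rewrite -lee_fin fineK; last by apply: (finN j); rewrite /= /j !leq_max leqnn orbT.
  by apply; rewrite /= /j !leq_max leqnn !orbT.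
set a := x - const_mx H; set F := phi eta H a.
have cF : continuous F := continuous_phi mP (h := H) (a := a).
have F0 z : 0 <= F z := phi_ge0 mP a z H0.
have Fx z : F z != 0 -> enorm (z - x) < rho / 2.
  move=> /(phi_neq0 mP H0) h; apply: le_lt_trans Hr.
  apply: le_trans (enorm_le_sum _) _; apply: (@le_trans _ _ (\sum_(i < d) 2 * H)).
    by apply: ler_sum => i _; have := h i; rewrite !mxE ltr_norml ler_norml; lra.
  by rewrite sumr_const card_ord mulrAC mulr_natr.
have supF : supp_in (fun i => mol eta H (a 0 i)) (a - const_mx H) (a + const_mx H).
  exact: (supp_mol mP).
have cO : cube (a - const_mx H) (a + const_mx H) `<=` Om.
  apply: subset_trans rhoO => z zc; rewrite /eball/=.
  apply: (@le_lt_trans _ _ (2 * d%:R * H)); last by lra.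
  apply: le_trans (enorm_le_sum _) _; apply: (@le_trans _ _ (\sum_(i < d) 2 * H)).
    by apply: ler_sum => i _; have := zc i; rewrite !mxE ler_norml; lra.
  by rewrite sumr_const card_ord mulrAC mulr_natr.
have cm i : continuous (mol eta H (a 0 i)) by exact: (continuous_mol mP).
have iu : mu.-integrable Om (EFin \o (fun z => u z * F z)).
  exact: (integrable_prodfun mOm lu cm supF cO).
have lc : locally_integrable_rV Om (fun _ : V => u x).
  by apply: locally_integrable_continuous => z; exact: cst_continuous.
have ic : mu.-integrable Om (EFin \o (fun z => u x * F z)).
  exact: (integrable_prodfun mOm lc cm supF cO).
have uxE : u x = (\int[mu]_(z in Om) (u x * F z))%R.
  have F_out z : ~ cube (a - const_mx H) (a + const_mx H) z -> F z = 0 := prodfun_out supF.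
  rewrite (Rintegral_support (fun=> u x) cO F_out) RintegralZl//; last first.
    have l1 : locally_integrable_rV setT (fun _ : V => 1 : R).
      by apply: locally_integrable_continuous => z; exact: cst_continuous.
    have := integrable_prodfun measurableT l1 cm supF (fun=> fun=> I).
    by apply: eq_integrable => // z _; rewrite /= mul1r.
  by rewrite /Rintegral (integral_phi mP a H0)/= mulr1.
rewrite /smooth_avg -/a -/F uxE -(RintegralB mOm iu ic).
apply: le_trans (le_normr_Rintegral mOm (integrable_subr mOm iu ic)) _.
rewrite -lee_fin -EFin_Rintegral//; last first.
  by have := integrable_norm (integrable_subr mOm iu ic); apply.
apply: le_trans fj; rewrite [leLHS]integral_mkcond.
have mint : measurable_fun setT ((fun z => `|u z * F z - u x * F z|%:E) \_ Om).
  apply/(measurable_restrictT _ mOm).1.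
  have /integrableP[] := integrable_subr mOm iu ic => /measurable_EFinP h _.
  by apply/measurable_EFinP; exact: measurableT_comp.
apply: (ge0_le_integral _ measurableT _ mint).
- by move=> z _; rewrite patchE; case: ifP => // _; rewrite lee_fin.
- apply: (measurableT_comp (measurable_dev mP _ (ag m).1)); exact: measurable_pair1.
move=> z _; rewrite patchE; case: ifPn => [zO|_]; last exact: (dev_ge0 mP).
rewrite /dev lee_fin -mulrBl normrM (ger0_norm (F0 z)).
have [->|Fz] := eqVneq (F z) 0; first by rewrite mulr0 mulr_ge0 ?(aker_ge0 mP).
rewrite /aker/= -/a -/F ler_wpM2r// /g !patchE !mem_set//.
  by apply: near_inner; rewrite subrr enorm0.
by apply: near_inner; exact: Fx.
Qed.

Lemma good_point_eq0 (Om : set V) (u : V -> R) (x : V) : open Om -> Om x ->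
  (forall H a, 0 < H -> cube (a - const_mx H) (a + const_mx H) `<=` Om ->
     smooth_avg eta Om u H a = 0) ->
  good_point eta Om u x -> u x = 0.
Proof.
move=> oOm Ox u0 gx; have [rho rho0 rhoO] := open_eball oOm Ox.
have d0 : (0 : R) < d%:R by rewrite ltr0n.
apply/eqP; rewrite -normr_le0; apply/ler_addgt0Pr => e e0; rewrite add0r.
have e1 : 0 < Num.min e (rho / (4 * d%:R)) by rewrite lt_min e0/= divr_gt0// mulr_gt0.
have [H /andP[H0 He] hu] := gx _ e1.
have Hr : 2 * d%:R * H < rho.
  have : H < rho / (4 * d%:R) by move: He; rewrite lt_min => /andP[].
  rewrite ltr_pdivlMr ?mulr_gt0// => h.
  have -> : 2 * d%:R * H = H * (4 * d%:R) / 2 by field.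
  lra.
move: hu; rewrite u0//; first by rewrite sub0r normrN => /le_trans; apply; rewrite ge_min lexx.
apply: subset_trans rhoO => z zc; rewrite /eball/=; apply: le_lt_trans Hr.
apply: le_trans (enorm_le_sum _) _; apply: (@le_trans _ _ (\sum_(i < d) 2 * H)).
  by apply: ler_sum => i _; have := zc i; rewrite !mxE ler_norml; lra.
by rewrite sumr_const card_ord mulrAC mulr_natr.
Qed.

(** All averages of the difference vanish, hence so does the difference at its good points. This
    identifies a given weak gradient with the derivatives provided by membership in the Sobolev
    space. *)
Lemma weak_partial_unique (Om : set V) (i : 'I_d) (f g1 g2 : V -> R) :
  open Om -> bounded_set Om -> weak_partial Om i f g1 -> weak_partial Om i f g2 ->
  {ae mu, forall x, Om x -> g1 x = g2 x}.
Proof.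
move=> oOm bOm [l1 w1] [l2 w2]; have mOm := measurable_open oOm.
have lB := locally_integrable_rVB mOm l1 l2.
apply: filterS (ae_good_point oOm bOm lB) => x gx Ox.
apply/eqP; rewrite -subr_eq0; apply/eqP.
apply: (good_point_eq0 oOm Ox (u := fun z => g1 z - g2 z)) (gx Ox) => H a H0 cO.
have cm j : continuous (mol eta H (a 0 j)) by exact: (continuous_mol mP).
have supF : supp_in (fun j => mol eta H (a 0 j)) (a - const_mx H) (a + const_mx H).
  exact: (supp_mol mP).
have tF : test_function Om (phi eta H a).
  by apply: (test_prodfun _ supF cO) => j; exact: (mol_smooth mP).
have i1 := integrable_prodfun mOm l1 cm supF cO.
have i2 := integrable_prodfun mOm l2 cm supF cO.
transitivity (\int[mu]_(z in Om) (g1 z * phi eta H a z - g2 z * phi eta H a z))%R.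
  by apply: eq_Rintegral => z _; rewrite mulrBl.
rewrite (RintegralB mOm i1 i2); apply/eqP; rewrite subr_eq0; apply/eqP.
rewrite /Rintegral; congr fine; apply: oppe_inj.
by rewrite -(w1 _ tF) -(w2 _ tF).
Qed.

End lebesgue_points.

(** * The maximal function and radially decreasing kernels *)

Section half_line.
Context (R : realType).
Local Notation lam := (@lebesgue_measure R).

(** The power may be singular at 0: the integral is a limit over the intervals [[s / (k + 2), s]],
    on which the fundamental theorem of calculus applies. *)
Lemma integral_powR_fin (a s : R) : -1 < a -> 0 < s ->
  (\int[lam]_(x in `]0%R, s]%classic) (x `^ a)%:E < +oo)%E.
Proof.
move=> a1 s0; have a10 : 0 < a + 1 by rewrite -ltrBlDr sub0r.
pose e k := s * harm R k.+1.
have e0 k : 0 < e k by rewrite mulr_gt0// harm_gt0.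
have es k : e k < s.
  by rewrite /e gtr_pMr// invf_lt1// ltr1n.
pose F := fun k => `[e k, s]%classic.
have FU : (`]0, s]%classic : set R) = \bigcup_k F k.
  apply/seteqP; split => [x /=|x [k _]]; rewrite /F/= !in_itv/= => /andP[x1 x2]; last first.
    by rewrite x2 (lt_le_trans (e0 k)).
  have xs : 0 < x / s by rewrite divr_gt0.
  have [N /(_ N.+1 (leqnSn _)) hN] := harm_small xs; exists N => //=.
  by rewrite in_itv/= x2 andbT /e mulrC -ler_pdivlMr.
have mf (D : set R) : measurable_fun D (fun x : R => (x `^ a)%:E).
  by apply/measurable_EFinP; apply: measurable_funTS; exact: measurable_powR.
have Fnd : nondecreasing_seq F.
  move=> i j ij; rewrite subsetEset => x; rewrite /F/= !in_itv/= => /andP[x1 ->]; rewrite andbT.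
  apply: le_trans x1; rewrite /e ler_pM2l// /harm lef_pV2 ?posrE//.
  by rewrite ler_nat !ltnS.
have f0 k (x : R) : F k x -> (0 <= (x `^ a)%:E)%E by rewrite lee_fin powR_ge0.
have cv := @ge0_nondecreasing_set_cvg_integral _ (measurableTypeR R) R F (fun x => (x `^ a)%:E) lam Fnd
  (fun k => measurable_itv _) (fun k => mf _) f0.
rewrite FU; apply: (@le_lt_trans _ _ (s `^ (a + 1) / (a + 1))%:E); last by rewrite ltry.
rewrite -(cvg_lim (@ereal_hausdorff R) cv); apply: lime_le; first exact: cvgP cv.
apply: nearW => k; rewrite /F (@continuous_FTC2 _ _ (fun x => x `^ (a + 1) / (a + 1)))//.
- rewrite -EFinB lee_fin gerBl divr_ge0 ?powR_ge0// ltW//.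
- apply: continuous_in_subspaceT => x; rewrite inE/= in_itv/= => /andP[x0 _].
  by apply: continuous_powR_gt0; exact: lt_le_trans x0.
- split.
  + move=> x; rewrite in_itv/= => /andP[x0 _]; apply: derivableM => //.
    by apply: derivable_powR; rewrite in_itv/= (lt_trans (e0 k) x0).
  + by apply: cvg_at_right_filter; apply: cvgMl; exact: continuous_powR_gt0.
  + by apply: cvg_at_left_filter; apply: cvgMl; exact: continuous_powR_gt0.
move=> x; rewrite in_itv/= => /andP[x0 _]; rewrite derive1E.
have xp := lt_trans (e0 k) x0.
have := is_derive1_powR (a + 1) xp => hd.
rewrite deriveM//= !derive_val scaler0 add0r.
by rewrite addrK /GRing.scale/= mulrA mulVf ?mul1r// gt_eqF.
Qed.

End half_line.

Section radial.
Context (R : realType) (n : nat).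
Local Notation d := n.+1.
Local Notation V := 'rV[R]_d.
Local Notation mu := (@lebesgue_rV R n).

Lemma eball_volume (z : V) (s : R) : 0 < s ->
  (mu (eball z s) = (s ^+ d)%:E * mu (eball (0%R : V) 1))%E.
Proof.
move=> s0; have := lebesgue_outer_affine z (eball z s) s0.
rewrite (_ : [set x | eball z s (s *: x + z)] = eball (0 : V) 1); last first.
  apply/seteqP; split => x; rewrite /eball/= addrK subr0 enormZ gtr0_norm//.
    by rewrite -ltr_pdivlMl// mulVf// gt_eqF.
  by move=> x1; rewrite -ltr_pdivlMl// mulVf// gt_eqF.
rewrite -/(lebesgue_rV _) -/(lebesgue_rV _) => ->; rewrite muleA -EFinM -exprMn mulfV ?gt_eqF//.
by rewrite expr1n mul1e.
Qed.

Lemma integral_scaled (u : R -> R) (z : V) (s : R) : 0 < s ->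
  measurable_fun setT u -> (forall t, 0 <= u t) ->
  (\int[mu]_x (u (enorm (x - z) / s))%:E = (s ^+ d)%:E * \int[mu]_x (u (enorm x))%:E)%E.
Proof.
move=> s0 mu_ u0; have si0 : 0 < s^-1 by rewrite invr_gt0.
have mU : measurable_fun setT (fun x : V => (u (enorm x))%:E).
  by apply/measurable_EFinP; apply: (measurableT_comp mu_); exact: measurable_enorm_id.
have U0 (x : V) : (0 <= (u (enorm x))%:E)%E by rewrite lee_fin.
have := ge0_integral_affine (- (s^-1 *: z)) si0 mU U0; rewrite invrK => <-.
by apply: eq_integral => x _; rewrite -scalerBr enormZ (gtr0_norm si0) mulrC.
Qed.

(** A superlevel set is a union of open balls, because the balls in the supremum are only required
    to contain the point. *)
Lemma measurable_maximal (w : V -> \bar R) : measurable_fun setT (maximal_rV w).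
Proof.
apply: (measurability _ (ErealGenOInfty.measurableE R)) => _ [_ [a ->] <-].
rewrite setTI; apply: measurable_open.
pose avg (B : V * R) := ((fine (mu (eball B.1 B.2)))^-1%:E * \int[mu]_(y in eball B.1 B.2) `|w y|)%E.
rewrite (_ : _ @^-1` _ = \bigcup_(B in [set B | 0 < B.2 /\ (a%:E < avg B)%E]) eball B.1 B.2).
  apply: bigcup_open => B _.
  have -> : eball B.1 B.2 = (fun x => enorm (x - B.1)) @^-1` [set t | t < B.2] by [].
  apply: open_comp; last exact: open_lt.
  move=> x _; apply: (@continuous_comp _ _ _ (fun v : V => v - B.1)); last exact: continuous_enorm.
  exact: (cvgB cvg_id (cvg_cst _)).
apply/seteqP; split => x /=.
  rewrite in_itv/= andbT => /ereal_sup_gt[_ [B [B0 Bx] <-] aB].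
  by exists B.
move=> [B [B0 aB] Bx]; rewrite in_itv/= andbT; apply: lt_le_trans aB _.
by apply: ereal_sup_ubound; exists B.
Qed.

Lemma maximal_ge0 (w : V -> \bar R) z : (0 <= maximal_rV w z)%E.
Proof.
apply: (@le_trans _ _ ((fine (mu (eball z 1)))^-1%:E * \int[mu]_(y in eball z 1) `|w y|)%E).
  by rewrite mule_ge0// ?integral_ge0// lee_fin invr_ge0 fine_ge0.
by apply: ereal_sup_ubound; exists (z, 1) => //=; rewrite /eball/= subrr enorm0.
Qed.

Lemma integral_eball_maximal (w : V -> \bar R) (z : V) (s : R) : 0 < s ->
  (forall x, 0 <= w x)%E ->
  (\int[mu]_(x in eball z s) w x <= maximal_rV w z * mu (eball z s))%E.
Proof.
move=> s0 w0; have fm : mu (eball z s) \is a fin_num by rewrite ge0_fin_numE ?eball_fin.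
have m0 : 0 < fine (mu (eball z s)) by apply: fine_gt0; rewrite eball_gt0// eball_fin.
rewrite -(fineK fm) muleC -lee_pdivrMl//; apply: ereal_sup_ubound.
exists (z, s) => /=; first by rewrite /eball/= subrr enorm0.
by congr (_ * _)%E; apply: eq_integral => x _; rewrite gee0_abs.
Qed.

(* Doubling the radius absorbs the difference between open and closed balls. *)
Lemma radial_maximal_le (w : V -> \bar R) (u : R -> R) (z : V) :
  measurable_fun setT w -> (forall x, 0 <= w x)%E ->
  measurable_fun setT u -> (forall t, 0 <= u t) -> (forall t, t <= 0 -> u t = 0) ->
  (forall s t, 0 < s -> s <= t -> u t <= u s) ->
  (\int[mu]_x (w x * (u (enorm (x - z)))%:E) <=
   (2 ^+ d)%:E * maximal_rV w z * \int[mu]_x (u (enorm x))%:E)%E.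
Proof.
move=> mw w0 mu_ u0 un ud.
set M := ((2 ^+ d)%:E * maximal_rV w z)%E.
have M0 : (0 <= M)%E by rewrite mule_ge0 ?maximal_ge0// lee_fin exprn_ge0.
have mr1 : measurable_fun setT (fun x : V => enorm (x - z)).
  by apply: measurable_enorm; apply: mcoordB; [exact: mcoord_id|exact: mcoord_cst].
have mU : measurable_fun setT (fun x : V => (u (enorm x))%:E).
  by apply/measurable_EFinP; apply: (measurableT_comp mu_); exact: measurable_enorm_id.
rewrite -(@ge0_integralZl _ _ _ mu _ measurableT _ mU)//; last by move=> x _; rewrite lee_fin.
have key (s : R) (S1 S2 : set V) : 0 < s -> measurable S1 -> measurable S2 ->
    S1 `<=` eball z (2 * s) -> eball 0 s `\ 0 `<=` S2 ->
    (\int[mu]_(x in S1) w x <= \int[mu]_(x in S2) M)%E.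
  move=> s0 mS1 mS2 S1s S2s; have s20 : 0 < 2 * s by rewrite mulr_gt0.
  apply: (@le_trans _ _ (\int[mu]_(x in eball z (2 * s)) w x)%E).
    apply: ge0_subset_integral => //; [exact: measurable_eball|exact: measurable_funTS].
  apply: le_trans (integral_eball_maximal z s20 w0) _.
  rewrite integral_cst// (eball_volume z s20) exprMn EFinM -muleA -(eball_volume 0 s0).
  rewrite muleCA muleA; apply: lee_wpmul2l; first by rewrite mule_ge0 ?maximal_ge0// lee_fin exprn_ge0.
  apply: (@le_trans _ _ (mu (S2 `|` [set 0]))).
    apply: le_measure; rewrite ?inE; [exact: measurable_eball| |].
      by apply: measurableU => //; rewrite (_ : [set 0] = cube 0 0);
        [exact: measurable_cube|apply/seteqP; split => x /= => [-> i|h]; [rewrite lexx|apply/rowP => i; apply/eqP; rewrite eq_le andbC]].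
    move=> x xs; have [->|x0] := eqVneq x 0; first by right.
    by left; apply: S2s; split => //; exact/eqP.
  apply: le_trans (measureU2 _ _ _) _ => //.
    rewrite (_ : [set 0] = cube 0 0); first exact: measurable_cube.
    by apply/seteqP; split => x /= => [-> i|h]; [rewrite lexx|apply/rowP => i; apply/eqP; rewrite eq_le andbC].
  by rewrite [X in (_ + X)%E]lebesgue_rV_set1 adde0.
have msets (r : V -> R) (s : R) : measurable_fun setT r ->
    measurable [set x | 0 < r x < s] /\ measurable [set x | 0 < r x <= s].
  move=> mr; split.
    rewrite (_ : [set x | _] = r @^-1` `]0, s[%classic).
      by rewrite -[X in measurable X]setTI; exact: (mr measurableT _ (measurable_itv _)).
    by apply/seteqP; split => x /=; rewrite in_itv.
  rewrite (_ : [set x | _] = r @^-1` `]0, s]%classic).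
    by rewrite -[X in measurable X]setTI; exact: (mr measurableT _ (measurable_itv _)).
  by apply/seteqP; split => x /=; rewrite in_itv.
apply: (decreasing_integral_le mw w0 mr1 (measurable_cst M) (fun=> M0) (@measurable_enorm_id R n) mu_ u0 un ud).
- move=> s s0; apply: (key s) => //; [exact: (msets _ _ mr1).1|exact: (msets _ _ (@measurable_enorm_id R n)).1| |].
    by move=> x /= /andP[_]; rewrite /eball/=; lra.
  by move=> x [/=]; rewrite /eball/= subr0 => xs /eqP x0; rewrite xs enorm_gt0 x0.
- move=> s s0; apply: (key s) => //; [exact: (msets _ _ mr1).2|exact: (msets _ _ (@measurable_enorm_id R n)).2| |].
    by move=> x /= /andP[_]; rewrite /eball/=; lra.
  by move=> x [/=]; rewrite /eball/= subr0 => xs /eqP x0; rewrite (ltW xs) enorm_gt0 x0.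
Qed.

(** In polar coordinates the factor of power [n] leaves the singularity [r^(-1/2)], integrable at
    0. *)
Lemma wfun_integrable (Lam : R) : 0 < Lam ->
  exists2 C : R, 0 <= C & (\int[mu]_z (wfun n Lam (enorm z))%:E = C%:E)%E.
Proof.
move=> L0; have mW := measurable_wfun n L0.
have W0 t : 0 <= wfun n Lam t := wfun_ge0 n Lam t.
suff fin : (\int[mu]_z (wfun n Lam (enorm z))%:E < +oo)%E.
  have ge0 : (0 <= \int[mu]_z (wfun n Lam (enorm z))%:E)%E.
    by apply: integral_ge0 => z _; rewrite lee_fin.
  exists (fine (\int[mu]_z (wfun n Lam (enorm z))%:E)); first exact: fine_ge0.
  by rewrite fineK// ge0_fin_numE.
have hom (c : R) (x : V) : 0 < c -> (1 : R) = c `^ 0 * 1 by rewrite powRr0 mulr1.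
have m1 : measurable_fun setT (fun _ : V => 1 : R) by exact: measurable_cst.
have annE : (\int[mu]_(x in annulus false 1) 1%:E = (fine (mu (@annulus R n false 1)))%:E)%E.
  rewrite integral_cst ?mul1e; last exact: measurable_annulus.
  by rewrite fineK// ge0_fin_numE// annulus_fin.
have := @polar R n (fun=> 1) 0 m1 (fun=> ler01) hom _ (wfun n Lam) (lexx _) annE mW W0
  (fun t => @wfun_le0 R n Lam t) (fun s t => @wfun_decr R n Lam s t).
under eq_integral do rewrite mul1e.
move=> ->; apply: lte_mul_pinfty.
- by rewrite lee_fin mulr_ge0 ?fine_ge0// addr_ge0.
- by [].
apply: (@le_lt_trans _ _ (\int[@lebesgue_measure R]_(r in `]0%R, Lam]%classic) ((2 * Lam `^ (n%:R + 2^-1))%:E * (r `^ (- 2^-1))%:E))%E).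
  rewrite [leLHS](_ : _ = \int[@lebesgue_measure R]_(r in `]0%R, Lam]%classic)
      ((r `^ (0 + n%:R))%:E * (wfun n Lam r)%:E))%E; last first.
    rewrite [RHS]integral_mkcond; apply: eq_integral => r _.
    rewrite patchE; case: ifPn => // rL.
    rewrite /wfun; case: ifPn => [/andP[r0 rL']|_]; last by rewrite mule0.
    by move: rL; rewrite mem_set//= in_itv/= r0 ltW.
  apply: ge0_le_integral => //.
  - by move=> r _; rewrite mule_ge0// lee_fin ?powR_ge0.
  - by apply: emeasurable_funM; apply/measurable_EFinP; apply: measurable_funTS; [exact: measurable_powR|exact: mW].
  - apply: emeasurable_funM; apply/measurable_EFinP; first exact: measurable_cst.
    by apply: measurable_funTS; exact: measurable_powR.
  move=> r; rewrite /= in_itv/= => /andP[r0 rL]; rewrite wfunE// -!EFinM lee_fin add0r.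
  rewrite mulrCA ler_wpM2l ?mulr_ge0 ?powR_ge0// mulrA -powRD; last by rewrite (gt_eqF r0) implybT.
  rewrite opprD addrA subrr add0r ler_piMr ?powR_ge0// indicE; case: (boolP (_ \in _)) => _ //=.
rewrite ge0_integralZl//; last 3 first.
- by apply/measurable_EFinP; apply: measurable_funTS; exact: measurable_powR.
- by move=> r _; rewrite lee_fin powR_ge0.
- by rewrite lee_fin mulr_ge0// powR_ge0.
apply: lte_mul_pinfty => //; first by rewrite lee_fin mulr_ge0// powR_ge0.
by apply: integral_powR_fin => //; lra.
Qed.

End radial.

(** * Measurability and exchange of iterated integrals *)

Section iterated_integrals.
Context (R : realType) (n : nat).
Local Notation V := 'rV[R]_n.+1.
Local Notation mu := (@lebesgue_rV R n).
Local Open Scope ereal_scope.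

Lemma measurable_slice d (T : measurableType d) (F : T -> V -> \bar R) (x : T) :
  measurable_fun setT (fun xy : T * V => F xy.1 xy.2) -> measurable_fun setT (F x).
Proof. by move=> mF; exact: (measurableT_comp mF (pair1_measurable x)). Qed.

Lemma measurable_integral d (T : measurableType d) (F : T -> V -> \bar R) :
  measurable_fun setT (fun xy : T * V => F xy.1 xy.2) -> (forall x y, 0 <= F x y) ->
  measurable_fun setT (fun x => \int[mu]_y F x y).
Proof.
move=> mF F0.
exact: (@measurable_fun_fubini_tonelli_F _ _ _ _ _ mu (fun xy : T * V => F xy.1 xy.2)).
Qed.

Lemma integral_swap (F : V -> V -> \bar R) :
  measurable_fun setT (fun xy : V * V => F xy.1 xy.2) -> (forall x y, 0 <= F x y) ->
  \int[mu]_x \int[mu]_y F x y = \int[mu]_y \int[mu]_x F x y.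
Proof.
move=> mF F0.
exact: (@fubini_tonelli _ _ _ _ _ mu mu (fun xy : V * V => F xy.1 xy.2)).
Qed.

Lemma le_ge0_integral (f g : V -> \bar R) : measurable_fun setT f -> measurable_fun setT g ->
  (forall x, 0 <= f x) -> (forall x, f x <= g x) -> \int[mu]_x f x <= \int[mu]_x g x.
Proof.
by move=> mf mg f0 fg; apply: (ge0_le_integral mu measurableT _ mf mg) => x _.
Qed.

Lemma ge0_integralcM (f : V -> \bar R) (c : \bar R) : measurable_fun setT f ->
  (forall x, 0 <= f x) -> 0 <= c -> \int[mu]_x (c * f x) = c * \int[mu]_x f x.
Proof. by move=> mf f0 c0; exact: (ge0_integralZl mu measurableT mf (fun x _ => f0 x) c0). Qed.

Lemma ge0_integral_add (f g : V -> \bar R) : measurable_fun setT f -> measurable_fun setT g ->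
  (forall x, 0 <= f x) -> (forall x, 0 <= g x) ->
  \int[mu]_x (f x + g x) = \int[mu]_x f x + \int[mu]_x g x.
Proof. by move=> mf mg f0 g0; exact: (ge0_integralD mu measurableT (fun x _ => f0 x) mf (fun x _ => g0 x) mg). Qed.

Lemma measurable_invr : measurable_fun setT (fun x : R => x^-1)%R.
Proof.
rewrite (_ : (fun x : R => _)%R = (fun x => x * (x ^+ 2) `^ (- 1))%R).
  apply: measurable_funM => //; apply: (measurableT_comp (measurable_powR _)).
  exact: measurable_funX.
apply/funext => x; rewrite powR_inv1 ?sqr_ge0// expr2.
by have [->|x0] := eqVneq x 0%R; [rewrite !mulr0 invr0 mul0r|rewrite invfM mulrA mulfV// mul1r].
Qed.

End iterated_integrals.

(** * The averaged kernel: mass, tail and transpose *)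

Section kernel.
Context (R : realType) (n : nat).
Local Notation d := n.+1.
Local Notation V := 'rV[R]_d.
Local Notation mu := (@lebesgue_rV R n).
Implicit Types x y z : V.

Variables (rho W : R -> R) (Lam CW A : R).
Hypotheses (mrho : measurable_fun setT rho) (rho_ge0 : forall t, 0 <= rho t)
  (rho_le0 : forall t, t <= 0 -> rho t = 0)
  (rho_decr : forall s t, 0 < s -> s <= t -> rho t <= rho s)
  (rho_mass : (\int[mu]_x (rho (enorm x))%:E = A%:E)%E).
Hypotheses (mW : measurable_fun setT W) (W_ge0 : forall t, 0 <= W t)
  (W_le0 : forall t, t <= 0 -> W t = 0) (W_out : forall t, Lam <= t -> W t = 0)
  (W_decr : forall s t, 0 < s -> s <= t -> W t <= W s)
  (W_mass : (\int[mu]_x (W (enorm x))%:E = CW%:E)%E) (L0 : 0 < Lam).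

(** Kernel of the potential at distance [r] between [x] and [y], weighted by [rho]. The power is [d]
    rather than [n] because the difference quotient divides by one more [r]; the kernel then has
    mass [rho r * CW] in [z]. *)
Definition kpart (t r : R) : R := rho r * ((r ^+ d)^-1 * W (t / r)).

Lemma kpart_ge0 t r : 0 <= kpart t r.
Proof.
have [r0|r0] := leP r 0; first by rewrite /kpart rho_le0// mul0r.
by rewrite /kpart !mulr_ge0// invr_ge0 exprn_ge0// ltW.
Qed.

Lemma kpart_le0 t r : r <= 0 -> kpart t r = 0.
Proof. by move=> r0; rewrite /kpart rho_le0// mul0r. Qed.

Lemma measurable_kpart dT (T : measurableType dT) (a b : T -> R) :
  measurable_fun setT a -> measurable_fun setT b ->
  measurable_fun setT (fun t => kpart (a t) (b t)).
Proof.
move=> ma mb; have mi (c : T -> R) : measurable_fun setT c -> measurable_fun setT (fun t => (c t)^-1).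
  by move=> mc; exact: (measurableT_comp (@measurable_invr R) mc).
apply: (measurable_funM (measurableT_comp mrho mb)); apply: measurable_funM.
  by apply: mi; exact: measurable_funX.
by apply: (measurableT_comp mW); apply: (measurable_funM ma); exact: mi.
Qed.

Lemma measurable_dist dT (T : measurableType dT) (a b : T -> V) :
  measurable_fun setT a -> measurable_fun setT b ->
  measurable_fun setT (fun t => enorm (a t - b t)).
Proof. by move=> ma mb; apply: measurable_enorm; apply: mcoordB; exact: mcoord_comp. Qed.

Definition krn x z y : \bar R :=
  ((kpart (enorm (z - x)) (enorm (x - y)))%:E + (kpart (enorm (z - y)) (enorm (x - y)))%:E)%E.

Definition Qrn x z : \bar R := (\int[mu]_y krn x z y)%E.

Lemma krn_ge0 x z y : (0 <= krn x z y)%E.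
Proof. by rewrite adde_ge0// lee_fin kpart_ge0. Qed.

Lemma Qrn_ge0 x z : (0 <= Qrn x z)%E.
Proof. by apply: integral_ge0 => y _; exact: krn_ge0. Qed.

Lemma measurable_krn dT (T : measurableType dT) (a b c : T -> V) :
  measurable_fun setT a -> measurable_fun setT b -> measurable_fun setT c ->
  measurable_fun setT (fun t => krn (a t) (b t) (c t)).
Proof.
move=> ma mb mc; apply: emeasurable_funD; apply/measurable_EFinP; apply: measurable_kpart;
  exact: measurable_dist.
Qed.

Lemma measurable_Qrn dT (T : measurableType dT) (a b : T -> V) :
  measurable_fun setT a -> measurable_fun setT b ->
  measurable_fun setT (fun t => Qrn (a t) (b t)).
Proof.
move=> ma mb.
apply: (@measurable_integral _ _ _ _ (fun t y => krn (a t) (b t) y)) => [|t y]; last exact: krn_ge0.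
apply: measurable_krn; last exact: measurable_snd.
- exact: (measurableT_comp ma measurable_fst).
- exact: (measurableT_comp mb measurable_fst).
Qed.

Lemma integral_rev (u : R -> R) x : measurable_fun setT u -> (forall t, 0 <= u t) ->
  (\int[mu]_y (u (enorm (x - y)))%:E = \int[mu]_y (u (enorm y))%:E)%E.
Proof.
move=> mu_ u0; under eq_integral do rewrite enorm_distC.
have := integral_scaled x ltr01 mu_ u0; rewrite expr1n mul1e => <-.
by under [RHS]eq_integral do rewrite divr1.
Qed.

Lemma kpart_mass x r : (\int[mu]_z (kpart (enorm (z - x)) r)%:E = (rho r * CW)%:E)%E.
Proof.
have [r0|r0] := leP r 0.
  by under eq_integral do rewrite kpart_le0//; rewrite integral0 rho_le0// mul0r.
have c0 : 0 <= rho r * (r ^+ d)^-1 by rewrite mulr_ge0// invr_ge0 exprn_ge0// ltW.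
under eq_integral do rewrite /kpart mulrA EFinM.
rewrite ge0_integralZl//; last first.
- by move=> y _; rewrite lee_fin.
- apply/measurable_EFinP; apply: (measurableT_comp mW); apply: measurable_funM; last exact: measurable_cst.
  by apply: measurable_dist => //; exact: measurable_cst.
rewrite (integral_scaled x r0 mW W_ge0) W_mass -!EFinM; congr (_%:E).
by rewrite mulrA -(mulrA (rho r)) mulVf ?mulr1// gt_eqF// exprn_gt0.
Qed.

Lemma measurable_step (a : R) : measurable_fun setT (fun t : R => (a <= t)%R%:R : R).
Proof.
rewrite (_ : (fun t => _) = (\1_(`[a, +oo[%classic) : R -> R)); first exact: measurable_indic.
by apply/funext => t; rewrite indicE mem_setE in_itv/= andbT.
Qed.

Let CW0 : 0 <= CW.
Proof. by rewrite -lee_fin -W_mass; apply: integral_ge0 => z _; rewrite lee_fin. Qed.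

Let mdist (z : V) : measurable_fun setT (fun x : V => enorm (x - z)).
Proof. by apply: measurable_dist => //; exact: measurable_cst. Qed.

Let mkp (z : V) r : measurable_fun setT (fun x => (kpart (enorm (x - z)) r)%:E).
Proof. by apply/measurable_EFinP; apply: measurable_kpart => //; exact: measurable_cst. Qed.

(** [W] vanishes beyond [Lam], so a point at distance at least [delta] from [x] is reached only if
    [delta <= (Lam + 1) * r], the [+ 1] coming from the part centred at [y]. What remains is a tail
    of [rho]. *)
Lemma Qrn_tail (delta : R) x :
  (\int[mu]_z ((delta <= enorm (z - x))%R%:R%:E * Qrn x z) <=
   (2 * CW)%:E * \int[mu]_h (rho (enorm h) * (delta <= (Lam + 1) * enorm h)%R%:R)%:E)%E.
Proof.
pose ind z : \bar R := ((delta <= enorm (z - x))%R%:R%:E)%E.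
have ind0 z : (0 <= ind z)%E by rewrite lee_fin.
have mind : measurable_fun setT ind.
  by apply/measurable_EFinP; exact: (measurableT_comp (measurable_step delta) (mdist x)).
have mF : measurable_fun setT (fun w : V * V => ind w.1 * krn x w.1 w.2)%E.
  apply: emeasurable_funM; first exact: (measurableT_comp mind measurable_fst).
  by apply: measurable_krn => //; exact: measurable_cst.
have F0 z y : (0 <= ind z * krn x z y)%E by rewrite mule_ge0// krn_ge0.
pose u t := rho t * (delta <= (Lam + 1) * t)%R%:R.
have u0 t : 0 <= u t by rewrite mulr_ge0.
have mu_ : measurable_fun setT u.
  apply: (measurable_funM mrho); apply: (measurableT_comp (measurable_step delta)).
  by apply: measurable_funM => //; exact: measurable_cst.
rewrite [leLHS](_ : _ = \int[mu]_z \int[mu]_y (ind z * krn x z y))%E; last first.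
  apply: eq_integral => z _; rewrite ge0_integralcM//; last by move=> y; exact: krn_ge0.
  by apply: measurable_krn => //; exact: measurable_cst.
have mux : measurable_fun setT (fun y => (u (enorm (x - y)))%:E).
  apply/measurable_EFinP; apply: (measurableT_comp mu_).
  by apply: measurable_dist => //; exact: measurable_cst.
have c0 : (0 <= (2 * CW)%:E)%E by rewrite lee_fin mulr_ge0.
rewrite (integral_swap mF F0) -(integral_rev x mu_ u0) -(ge0_integralcM mux _ c0); last by move=> y; rewrite lee_fin.
have mG : measurable_fun setT (fun y => \int[mu]_z (ind z * krn x z y))%E.
  apply: (@measurable_integral _ _ _ _ (fun y z => ind z * krn x z y)%E) => // .
  apply: emeasurable_funM; first exact: (measurableT_comp mind measurable_snd).
  by apply: measurable_krn => //; exact: measurable_cst.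
have mc : measurable_fun setT (fun y => (2 * CW)%:E * (u (enorm (x - y)))%:E)%E.
  by apply: emeasurable_funM => //; exact: measurable_cst.
apply: (le_ge0_integral mG mc) => [y|y]; first exact: integral_ge0.
rewrite /u; set r := enorm (x - y).
have [dr|dr] := leP delta ((Lam + 1) * r).
  apply: (@le_trans _ _ (\int[mu]_z krn x z y)%E).
    have mk : measurable_fun setT (fun z => krn x z y).
      by apply: measurable_krn => //; exact: measurable_cst.
    apply: (le_ge0_integral (emeasurable_funM mind mk) mk) => [//|z]; rewrite /ind.
    by case: (delta <= _); rewrite ?mul1e ?mul0e ?krn_ge0.
  rewrite /krn (@ge0_integralD _ _ _ mu _ measurableT _ _ _ (mkp x r) _ (mkp y r)); last 2 first.
  - by move=> z _; rewrite lee_fin kpart_ge0.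
  - by move=> z _; rewrite lee_fin kpart_ge0.
  by rewrite !kpart_mass -EFinD lee_fin mulr1; lra.
rewrite -EFinM !mulr0 integral0_eq// => z _.
rewrite /ind; have [dz|_] := leP delta (enorm (z - x)); last by rewrite mul0e.
rewrite mul1e /krn -/r; have [r0|r0] := leP r 0; first by rewrite !kpart_le0// adde0.
have := enorm_triangle y z x; rewrite (enorm_distC y x) -/r => tr.
rewrite /kpart !W_out ?mulr0 ?adde0//; rewrite ler_pdivlMr//; lra.
Qed.

Lemma Qrn_mass x : (\int[mu]_z Qrn x z <= (2 * CW * A)%:E)%E.
Proof.
have := Qrn_tail 0 x.
under eq_integral do rewrite enorm_ge0 mul1e.
under [X in (_ * X)%E]eq_integral do rewrite mulr_ge0 ?enorm_ge0 ?addr_ge0 ?(ltW L0)// mulr1.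
by rewrite rho_mass -EFinM.
Qed.

Lemma kpart_scaled_mass x r s : 0 < s ->
  (\int[mu]_z (kpart (enorm (z - x) / s) r)%:E = (s ^+ d * (rho r * CW))%:E)%E.
Proof.
move=> s0; have mk : measurable_fun setT (kpart ^~ r).
  by apply: (@measurable_kpart _ _ id (fun=> r)) => //; exact: measurable_cst.
rewrite (integral_scaled x s0 mk (fun t => kpart_ge0 t r)) EFinM; congr (_ * _)%E.
by rewrite -(kpart_mass 0 r); apply: eq_integral => z _; rewrite subr0.
Qed.

(** Once [y] is replaced by the difference [h] of [x] and [y], the kernel for fixed [h] is radially
    decreasing in [x - z] and controlled by the maximal function; its masses are integrated over [h]
    afterwards. *)
Lemma kpart_maximal (w : V -> \bar R) z s : measurable_fun setT w -> (forall x, 0 <= w x)%E ->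
  0 < s ->
  (\int[mu]_x (w x * \int[mu]_y (kpart (enorm (x - z) / s) (enorm (x - y)))%:E) <=
   (2 ^+ d)%:E * maximal_rV w z * (s ^+ d * (CW * A))%:E)%E.
Proof.
move=> mw w0 s0; have M0 := maximal_ge0 w z.
have mk r : measurable_fun setT (kpart ^~ r).
  by apply: (@measurable_kpart _ _ id (fun=> r)) => //; exact: measurable_cst.
have mk2 t : measurable_fun setT (kpart t).
  by apply: (@measurable_kpart _ _ (fun=> t) id) => //; exact: measurable_cst.
have mks (r : R) : measurable_fun setT (fun t : R => kpart (t / s) r).
  by apply: (measurableT_comp (mk r)); apply: measurable_funM => //; exact: measurable_cst.
have mF : measurable_fun setT (fun v : V * V => w v.1 * (kpart (enorm (v.1 - z) / s) (enorm v.2))%:E)%E.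
  apply: emeasurable_funM; first exact: (measurableT_comp mw measurable_fst).
  apply/measurable_EFinP; apply: measurable_kpart.
    apply: measurable_funM; last exact: measurable_cst.
    exact: (measurableT_comp (mdist z) measurable_fst).
  exact: (measurableT_comp (@measurable_enorm_id R n) measurable_snd).
have F0 x (h : V) : (0 <= w x * (kpart (enorm (x - z) / s) (enorm h))%:E)%E.
  by rewrite mule_ge0// lee_fin kpart_ge0.
rewrite [leLHS](_ : _ = \int[mu]_x \int[mu]_h (w x * (kpart (enorm (x - z) / s) (enorm h))%:E))%E; last first.
  apply: eq_integral => x _.
  rewrite (integral_rev x (mk2 _) (kpart_ge0 _)) ge0_integralcM//.
  - apply/measurable_EFinP; apply: (measurableT_comp (mk2 _)); exact: measurable_enorm_id.
  - by move=> y; rewrite lee_fin kpart_ge0.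
rewrite (integral_swap mF F0).
have mG : measurable_fun setT (fun h : V => \int[mu]_x (w x * (kpart (enorm (x - z) / s) (enorm h))%:E))%E.
  apply: (@measurable_integral _ _ _ _ (fun h x : V => w x * (kpart (enorm (x - z) / s) (enorm h))%:E)%E) => //.
  have := measurableT_comp mF (@measurable_swap _ _ V V); exact.
set M := ((2 ^+ d)%:E * maximal_rV w z)%E.
have MM0 : (0 <= M)%E by rewrite mule_ge0// lee_fin exprn_ge0.
have mr : measurable_fun setT (fun h : V => (s ^+ d * (rho (enorm h) * CW))%:E).
  apply/measurable_EFinP; apply: (measurable_funM (measurable_cst _)); apply: measurable_funM.
    exact: (measurableT_comp mrho (@measurable_enorm_id R n)).
  exact: measurable_cst.
have r0 (h : V) : (0 <= (s ^+ d * (rho (enorm h) * CW))%:E)%E.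
  by rewrite lee_fin !mulr_ge0// exprn_ge0// ltW.
apply: (@le_trans _ _ (\int[mu]_h (M * (s ^+ d * (rho (enorm h) * CW))%:E))%E).
  have mc : measurable_fun setT (fun h : V => M * (s ^+ d * (rho (enorm h) * CW))%:E)%E.
    by apply: emeasurable_funM => //; exact: measurable_cst.
  apply: (le_ge0_integral mG mc) => h; first exact: integral_ge0.
  rewrite -(kpart_scaled_mass 0 (enorm h) s0).
  under [X in (_ <= _ * X)%E]eq_integral do rewrite subr0.
  have [h0|h0] := leP (enorm h) 0.
    rewrite [leLHS]integral0_eq => [|x _]; last by rewrite kpart_le0// mule0.
    by rewrite mule_ge0// integral_ge0// => x _; rewrite lee_fin kpart_ge0.
  apply: (radial_maximal_le z mw w0 (mks _)); first by move=> t; exact: kpart_ge0.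
  - move=> t t0; rewrite /kpart W_le0 ?mulr0//.
    by rewrite pmulr_lle0 ?invr_gt0// pmulr_lle0 ?invr_gt0.
  - move=> a b a0 ab; rewrite /kpart ler_wpM2l// ler_wpM2l ?invr_ge0 ?exprn_ge0 ?(ltW h0)//.
    by rewrite W_decr ?divr_gt0// !ler_pM2r ?invr_gt0.
have mrh : measurable_fun setT (fun h : V => (rho (enorm h))%:E).
  by apply/measurable_EFinP; exact: (measurableT_comp mrho (@measurable_enorm_id R n)).
rewrite (ge0_integralcM mr r0 MM0); apply: lee_wpmul2l => //.
under eq_integral do rewrite mulrCA mulrC EFinM.
rewrite ge0_integralcM//; last 2 first.
- by move=> h; rewrite lee_fin.
- by rewrite lee_fin !mulr_ge0// exprn_ge0// ltW.
by rewrite rho_mass -!EFinM mulrA.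
Qed.

(* Where |z - y| > |x - y| / 2 the y-centred potential is dominated by the x-centred one,
   elsewhere |x - y| is comparable to |x - z|. *)
Lemma kpart_split x y z : x != z ->
  kpart (enorm (z - y)) (enorm (x - y)) <=
  kpart (enorm (x - z) / 3) (enorm (x - y)) +
  rho (enorm (x - z) / (3 / 2)) * ((enorm (x - z) / (3 / 2)) ^+ d)^-1 *
    W (enorm (y - z) / (2 * enorm (x - z))).
Proof.
move=> xz; set r := enorm (x - y); set t := enorm (x - z); set s := enorm (y - z).
rewrite (enorm_distC z y) -/s.
have t0 : 0 < t by rewrite enorm_gt0 subr_eq0.
have t3 : 0 < t / (3 / 2) by rewrite divr_gt0.
have s0 : 0 <= s := enorm_ge0 _.
have b0 : 0 <= rho (t / (3 / 2)) * ((t / (3 / 2)) ^+ d)^-1 * W (s / (2 * t)).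
  by rewrite !mulr_ge0// invr_ge0 exprn_ge0// ltW.
have [r0|r0] := leP r 0; first by rewrite !kpart_le0// add0r.
have tri1 : t <= r + s by exact: enorm_triangle.
have tri2 : r <= t + s by rewrite /s (enorm_distC y z); exact: enorm_triangle.
have [sr|sr] := leP s (r / 2); last first.
  apply: ler_wpDr => //; rewrite /kpart ler_wpM2l// ler_wpM2l ?invr_ge0 ?exprn_ge0 ?(ltW r0)//.
  apply: W_decr; first by rewrite !divr_gt0.
  by rewrite ler_pM2r ?invr_gt0//; lra.
apply: ler_wpDl; first exact: kpart_ge0.
have [sz|s1] := leP s 0; first by rewrite /kpart (@W_le0 (s / r)) ?mulr0// pmulr_lle0 ?invr_gt0.
rewrite /kpart mulrA; apply: ler_pM => //; first by rewrite mulr_ge0// invr_ge0 exprn_ge0// ltW.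
  apply: ler_pM => //; [by rewrite invr_ge0 exprn_ge0// ltW|by apply: rho_decr => //; lra|].
  rewrite lef_pV2 ?posrE ?exprn_gt0// lerXn2r ?nnegrE ?(ltW r0) ?(ltW t3)//; lra.
apply: W_decr; first by rewrite divr_gt0// mulr_gt0.
by rewrite ler_pM2l// lef_pV2 ?posrE ?mulr_gt0//; lra.
Qed.

(** The last term of [kpart_split] integrates in [y] to a multiple of [rho], a function of
    [enorm (x - z)] alone. *)
Lemma Qrn_split x z : x != z -> (Qrn x z <=
  \int[mu]_y (kpart (enorm (x - z) / 1) (enorm (x - y)))%:E +
  \int[mu]_y (kpart (enorm (x - z) / 3) (enorm (x - y)))%:E +
  (3 ^+ d * CW * rho (enorm (x - z) / (3 / 2)))%:E)%E.
Proof.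
move=> xz; set t := enorm (x - z); have t0 : 0 < t by rewrite enorm_gt0 subr_eq0.
have t2 : 0 < 2 * t by rewrite mulr_gt0.
have mp a : measurable_fun setT (fun y => (kpart a (enorm (x - y)))%:E).
  apply/measurable_EFinP; apply: measurable_kpart; first exact: measurable_cst.
  by apply: measurable_dist => //; exact: measurable_cst.
have mp2 : measurable_fun setT (fun y => (kpart (enorm (z - y)) (enorm (x - y)))%:E).
  by apply/measurable_EFinP; apply: measurable_kpart; apply: measurable_dist => //; exact: measurable_cst.
have p0 a b : (0 <= (kpart a b)%:E)%E by rewrite lee_fin kpart_ge0.
rewrite /Qrn /krn (@ge0_integralD _ _ _ mu _ measurableT _ _ _ (mp _) _ mp2)//.
rewrite divr1 (enorm_distC z x) -addeA; apply: leeD2l.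
pose c1 := rho (t / (3 / 2)) * ((t / (3 / 2)) ^+ d)^-1.
have c10 : 0 <= c1 by rewrite mulr_ge0// invr_ge0 exprn_ge0// divr_ge0// ltW.
have mw2 : measurable_fun setT (fun y => (W (enorm (y - z) / (2 * t)))%:E).
  apply/measurable_EFinP; apply: (measurableT_comp mW); apply: (measurable_funM (mdist z)).
  exact: measurable_cst.
have mw3 : measurable_fun setT (fun y => c1%:E * (W (enorm (y - z) / (2 * t)))%:E)%E.
  by apply: emeasurable_funM => //; exact: measurable_cst.
have w20 y : (0 <= (W (enorm (y - z) / (2 * t)))%:E)%E by rewrite lee_fin.
have -> : ((3 ^+ d * CW * rho (t / (3 / 2)))%:E = \int[mu]_y (c1%:E * (W (enorm (y - z) / (2 * t)))%:E))%E.
  rewrite (ge0_integralcM mw2 w20); last by rewrite lee_fin.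
  rewrite (integral_scaled z t2 mW W_ge0) W_mass -!EFinM; congr (_%:E).
  (* The ratio 3 of the scale of [W] to the argument of [rho] is the origin of the factor
     [3 ^+ d]. *)
  have -> : 2 * t = 3 * (t / (3 / 2)) by field.
  have t3 : (t / (3 / 2)) ^+ d != 0 by rewrite expf_neq0// gt_eqF// divr_gt0.
  rewrite /c1 (exprMn d 3); move: t3; set q := (t / (3 / 2)) ^+ d => q0.
  by rewrite (mulrC (3 ^+ d) q) -!mulrA mulKf// mulrA mulrC.
rewrite -(@ge0_integralD _ _ _ mu _ measurableT _ _ _ (mp _) _ mw3)//; last first.
  by move=> y _; rewrite mule_ge0// lee_fin.
apply: (le_ge0_integral mp2 (emeasurable_funD (mp _) mw3)) => // y.
by rewrite -EFinM -EFinD lee_fin; exact: kpart_split.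
Qed.

(** The three parts are radially decreasing profiles in [x - z] dilated by 1, 3 and 3/2; the maximal
    function controls each with the power [d] of its dilation. *)
Lemma Qrn_maximal (w : V -> \bar R) z : measurable_fun setT w -> (forall x, 0 <= w x)%E ->
  (\int[mu]_x (w x * Qrn x z) <=
   (2 ^+ d * (1 + 3 ^+ d + 3 ^+ d * (3 / 2) ^+ d) * (CW * A))%:E * maximal_rV w z)%E.
Proof.
move=> mw w0; have M0 := maximal_ge0 w z.
have A0 : 0 <= A by rewrite -lee_fin -rho_mass; apply: integral_ge0 => x _; rewrite lee_fin.
pose J s x := (\int[mu]_y (kpart (enorm (x - z) / s) (enorm (x - y)))%:E)%E.
have J0 s x : (0 <= J s x)%E by apply: integral_ge0 => y _; rewrite lee_fin kpart_ge0.
have mJ s : measurable_fun setT (J s).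
  apply: (@measurable_integral _ _ _ _ (fun x y => (kpart (enorm (x - z) / s) (enorm (x - y)))%:E)%E).
    apply/measurable_EFinP; apply: measurable_kpart; last exact: measurable_dist.
    apply: measurable_funM; last exact: measurable_cst.
    exact: (measurableT_comp (mdist z) measurable_fst).
  by move=> x y; rewrite lee_fin kpart_ge0.
pose c := 3 ^+ d * CW; have c0 : 0 <= c by rewrite mulr_ge0// exprn_ge0.
have mu3 : measurable_fun setT (fun t : R => rho (t / (3 / 2))).
  by apply: (measurableT_comp mrho); apply: measurable_funM => //; exact: measurable_cst.
pose H x := (rho (enorm (x - z) / (3 / 2)))%:E.
have H0 x : (0 <= H x)%E by rewrite lee_fin.
have mH : measurable_fun setT H.
  by apply/measurable_EFinP; exact: (measurableT_comp mu3 (mdist z)).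
have mwJ s : measurable_fun setT (fun x => w x * J s x)%E by exact: emeasurable_funM.
have wJ0 s x : (0 <= w x * J s x)%E by rewrite mule_ge0.
have mwH : measurable_fun setT (fun x => w x * H x)%E by exact: emeasurable_funM.
have wH0 x : (0 <= w x * H x)%E by rewrite mule_ge0.
have mcH : measurable_fun setT (fun x => c%:E * (w x * H x))%E.
  by apply: emeasurable_funM => //; exact: measurable_cst.
have cH0 x : (0 <= c%:E * (w x * H x))%E by rewrite mule_ge0.
have mQz : measurable_fun setT (Qrn ^~ z).
  by apply: measurable_Qrn => //; exact: measurable_cst.
apply: (@le_trans _ _ (\int[mu]_x (w x * J 1%R x + w x * J 3%R x + c%:E * (w x * H x))%E)%E).
  apply: ae_ge0_le_integral => //.
  - by move=> x _; rewrite mule_ge0// Qrn_ge0.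
  - exact: emeasurable_funM.
  - by move=> x _; rewrite !adde_ge0.
  - by apply: emeasurable_funD => //; exact: emeasurable_funD.
  have := ae_neq z; apply: filterS => x xz _.
  have cH : (0 <= c%:E * H x)%E by rewrite mule_ge0.
  have -> : (w x * J 1%R x + w x * J 3%R x + c%:E * (w x * H x) =
      w x * (J 1%R x + J 3%R x + c%:E * H x))%E.
    by rewrite muleCA (ge0_muleDr _ (adde_ge0 (J0 _ x) (J0 _ x)) cH) (ge0_muleDr _ (J0 _ x) (J0 _ x)).
  apply: lee_wpmul2l => //.
  by rewrite /H -EFinM; exact: Qrn_split.
rewrite (ge0_integral_add (emeasurable_funD (mwJ 1) (mwJ 3)) mcH) => [|x|//]; last exact: adde_ge0.
rewrite (ge0_integral_add (mwJ 1) (mwJ 3))//.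
have ce0 : (0 <= c%:E)%E by rewrite lee_fin.
rewrite (ge0_integralcM mwH wH0 ce0).
apply: (@le_trans _ _ ((2 ^+ d)%:E * maximal_rV w z * (1 ^+ d * (CW * A))%:E +
   (2 ^+ d)%:E * maximal_rV w z * (3 ^+ d * (CW * A))%:E +
   c%:E * ((2 ^+ d)%:E * maximal_rV w z * ((3 / 2) ^+ d * A)%:E))%E); last first.
  rewrite !(muleC (_%:E) (maximal_rV w z)) -!muleA (muleCA c%:E) -!EFinM.
  have p2 : (0 : R) <= 2 ^+ d by rewrite exprn_ge0.
  have p3 : (0 : R) <= 3 ^+ d by rewrite exprn_ge0.
  have p32 : (0 : R) <= (3 / 2) ^+ d by rewrite exprn_ge0.
  rewrite -!ge0_muleDr ?adde_ge0 ?lee_fin ?mulr_ge0// ?expr1n//.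
  rewrite -!EFinD le_eqVlt; apply/orP; left; apply/eqP; congr (_ * _%:E)%E.
  by rewrite /c; ring.
apply: leeD; first by apply: leeD; exact: kpart_maximal.
apply: lee_wpmul2l => //.
apply: le_trans (radial_maximal_le z mw w0 mu3 _ _ _) _ => //.
- by move=> t t0; rewrite rho_le0// pmulr_lle0.
- by move=> a b a0 ab; rewrite rho_decr ?divr_gt0// ler_pM2r.
rewrite EFinM -rho_mass -(@integral_scaled R n rho 0 (3 / 2))//.
by under [X in (_ <= _ * X)%E]eq_integral do rewrite subr0.
Qed.

End kernel.

(** * Lattice properties of a ball Banach norm *)

Section norm_lattice.
Context (R : realType) (n : nat).
Local Notation V := 'rV[R]_n.+1.
Local Notation mu := (@lebesgue_rV R n).
Variable Y : (V -> \bar R) -> \bar R.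
Hypothesis bY : ball_Banach Y.
Local Open Scope ereal_scope.

Let qY := ball_Banach_quasi bY.

Lemma norm_le f g : measurable_fun setT f -> measurable_fun setT g ->
  (forall x, `|g x| <= `|f x|) -> Y g <= Y f.
Proof. by move=> mf mg gf; apply: (qnorm_lattice qY mf mg); exact: nearW. Qed.

Lemma norm_ae_le f g : measurable_fun setT f -> measurable_fun setT g ->
  (forall x, 0 <= g x) -> {ae mu, forall x, g x <= f x} -> Y g <= Y f.
Proof.
move=> mf mg g0 gf; apply: (qnorm_lattice qY mf mg); apply: filterS gf => x gf.
by rewrite !gee0_abs// (le_trans (g0 x)).
Qed.

Lemma norm_zero : Y (fun=> 0) = 0.
Proof.
have h := qnorm_ball qY (0 : V)%R (@ltr01 R).
have := qnorm_homogeneous qY 0 h; rewrite normr0 mul0e.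
by under [X in Y X]eq_fun do rewrite mul0e.
Qed.

Lemma norm_ge0 f : measurable_fun setT f -> 0 <= Y f.
Proof. exact: qnorm_ge0. Qed.

Lemma norm_scale (c : R) f : (0 <= c)%R -> measurable_fun setT f -> Y f < +oo ->
  Y (fun x => c%:E * f x) = c%:E * Y f.
Proof. by move=> c0 mf Yf; rewrite (qnorm_homogeneous qY c (conj mf Yf)) ger0_norm. Qed.

(** Homogeneity is assumed for finite norms; an infinite norm forces the bound [K] to be infinite
    too. *)
Lemma norm_scale_le (c : R) (K : \bar R) f : (0 < c)%R -> measurable_fun setT f -> Y f <= K ->
  Y (fun x => c%:E * f x) <= c%:E * K.
Proof.
move=> c0 mf Yf; have [Yo|Yo] := ltP (Y f) +oo.
  by rewrite (norm_scale (ltW c0) mf Yo) lee_wpmul2l// lee_fin ltW.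
have -> : K = +oo by apply/eqP; rewrite -leye_eq (le_trans Yo).
by rewrite gt0_muley ?leey// lte_fin.
Qed.

Lemma norm_add f g : measurable_fun setT f -> measurable_fun setT g ->
  Y (fun x => f x + g x) <= Y f + Y g.
Proof.
move=> mf mg; have [Yf|Yf] := ltP (Y f) +oo; last first.
  by rewrite (_ : Y f = +oo) ?addye ?leey//; [rewrite -ltNye (lt_le_trans _ (norm_ge0 mg))|apply/eqP; rewrite -leye_eq].
have [Yg|Yg] := ltP (Y g) +oo; last first.
  by rewrite (_ : Y g = +oo) ?addey ?leey//; [rewrite -ltNye (lt_le_trans _ (norm_ge0 mf))|apply/eqP; rewrite -leye_eq].
exact: (norm_triangle bY).
Qed.

Lemma norm_sup_le (f_ : nat -> V -> \bar R) (f : V -> \bar R) (K : \bar R) :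
  (forall k, measurable_fun setT (f_ k)) -> measurable_fun setT f ->
  (forall k x, 0 <= f_ k x) -> (forall x, nondecreasing_seq (f_ ^~ x)) ->
  (forall x, f_ k x @[k --> \oo] --> f x) -> (forall k, Y (f_ k) <= K) -> Y f <= K.
Proof.
move=> mf_ mf f0 nd cv YK.
have hF : {ae mu, forall x, [/\ forall k, 0 <= f_ k x, nondecreasing_seq (f_ ^~ x) &
    f_ k x @[k --> \oo] --> f x]} by exact: nearW.
have [_ lim] := qnorm_Fatou qY mf_ mf hF.
rewrite -(cvg_lim (@ereal_hausdorff R) lim); apply: lime_le; first exact: cvgP lim.
exact: nearW.
Qed.

(** Fatou's lemma for the norm: the infima of the tails increase to the lower limit and stay below
    the sequence. *)
Lemma norm_einf_le (f_ : nat -> V -> \bar R) (K : \bar R) :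
  (forall k, measurable_fun setT (f_ k)) -> (forall k x, 0 <= f_ k x) ->
  (forall k, Y (f_ k) <= K) -> Y (fun x => limn_einf (f_ ^~ x)) <= K.
Proof.
move=> mf_ f0 YK; pose i_ k x := einfs (f_ ^~ x) k.
have i0 k x : 0 <= i_ k x by apply: le_ereal_inf_tmp => _ [j _ <-].
have mi k : measurable_fun setT (i_ k) by exact: measurable_fun_einfs.
have il k x : i_ k x <= f_ k x by apply: ereal_inf_lbound; exists k => /=.
have cv x : i_ k x @[k --> \oo] --> limn_einf (f_ ^~ x).
  by rewrite limn_einf_lim; exact: is_cvg_einfs.
apply: (@norm_sup_le i_) => //; last 2 first.
- by move=> x; exact: nondecreasing_einfs.
- by move=> k; apply: le_trans (YK k); apply: norm_le => // x; rewrite !gee0_abs.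
apply: (emeasurable_fun_cvg i_) => // x _; exact: cv.
Qed.

End norm_lattice.

(** * Bounded functions on a set of finite measure *)

Section bounded_support.
Context (R : realType) (n : nat).
Local Notation V := 'rV[R]_n.+1.
Local Notation mu := (@lebesgue_rV R n).
Variable B : set V.
Hypotheses (mB : measurable B) (finB : (mu B < +oo)%E).

Definition bounded_on (f : V -> R) : Prop :=
  measurable_fun setT f /\ exists M, forall x, `|f x| <= M * \1_B x.

Lemma indic_le1 (A : set V) x : (\1_A x : R) <= 1.
Proof. by rewrite indicE; case: (_ \in _). Qed.

Lemma indic_sqr (A : set V) x : (\1_A x : R) * \1_A x = \1_A x.
Proof. by rewrite indicE; case: (_ \in _); rewrite ?mul1r ?mul0r. Qed.

Lemma bounded_on_integrable f : bounded_on f -> mu.-integrable setT (EFin \o f).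
Proof.
move=> [mf [M fM]].
have iB : mu.-integrable setT (EFin \o (fun x => M * \1_B x)).
  apply: integrable_scaler => //; apply/integrableP; split.
    by apply/measurable_EFinP; exact: measurable_indic.
  rewrite (eq_integral (fun x => (\1_B x)%:E)) => [|x _]; last by rewrite gee0_abs// lee_fin.
  by rewrite integral_indic// setIT.
apply: (le_integrable measurableT _ _ iB); first exact/measurable_EFinP.
by move=> x _ /=; rewrite lee_fin (le_trans (fM x))// ler_norm.
Qed.

Lemma bounded_onD f g : bounded_on f -> bounded_on g -> bounded_on (fun x => f x + g x).
Proof.
move=> [mf [M fM]] [mg [N gN]]; split; first exact: measurable_funD.
by exists (M + N) => x; rewrite mulrDl (le_trans (ler_normD _ _))// lerD.
Qed.

Lemma bounded_onM f g : bounded_on f -> bounded_on g -> bounded_on (fun x => f x * g x).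
Proof.
move=> [mf [M fM]] [mg [N gN]]; split; first exact: measurable_funM.
by exists (M * N) => x; rewrite normrM -(indic_sqr B x) mulrACA ler_pM.
Qed.

Lemma bounded_onZ c f : bounded_on f -> bounded_on (fun x => c * f x).
Proof.
move=> [mf [M fM]]; split; first by apply: measurable_funM => //; exact: measurable_cst.
by exists (`|c| * M) => x; rewrite normrM -mulrA ler_wpM2l.
Qed.

Lemma bounded_onB f g : bounded_on f -> bounded_on g -> bounded_on (fun x => f x - g x).
Proof.
move=> bf bg; have := bounded_onD bf (bounded_onZ (-1) bg).
by under eq_fun do rewrite mulN1r.
Qed.

Lemma bounded_on_le f (g : V -> R) : measurable_fun setT g -> bounded_on f -> (forall x, `|g x| <= `|f x|) ->
  bounded_on g.
Proof. by move=> mg [_ [M fM]] gf; split => //; exists M => x; exact: le_trans (gf x) _. Qed.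

Lemma bounded_on_out f x : bounded_on f -> ~ B x -> f x = 0.
Proof.
move=> [_ [M /(_ x)]] fM Bx; apply/eqP; rewrite -normr_le0 (le_trans fM)//.
by rewrite indicE memNset// mulr0.
Qed.

Local Notation I f := (\int[mu]_x f x).

Lemma bounded_intD f g : bounded_on f -> bounded_on g -> I (fun x => f x + g x) = I f + I g.
Proof. by move=> bf bg; rewrite RintegralD//; exact: bounded_on_integrable. Qed.

Lemma bounded_intZ c f : bounded_on f -> I (fun x => c * f x) = c * I f.
Proof. by move=> bf; rewrite RintegralZl//; exact: bounded_on_integrable. Qed.

Lemma bounded_intB f g : bounded_on f -> bounded_on g -> I (fun x => f x - g x) = I f - I g.
Proof. by move=> bf bg; rewrite RintegralB//; exact: bounded_on_integrable. Qed.

Lemma le_bounded_int f g : bounded_on f -> bounded_on g -> (forall x, f x <= g x) -> I f <= I g.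
Proof.
by move=> bf bg fg; apply: le_Rintegral => //; exact: bounded_on_integrable.
Qed.

Lemma bounded_int_ge0 f : (forall x, 0 <= f x) -> 0 <= I f.
Proof. by move=> f0; apply: Rintegral_ge0. Qed.

Lemma EFin_bounded_int f : bounded_on f -> (\int[mu]_x (f x)%:E)%E = (I f)%:E.
Proof. by move=> bf; apply: EFin_Rintegral => //; exact: bounded_on_integrable. Qed.

End bounded_support.

(** Absolute convergence of the telescoping series. *)
Lemma summable_increments_cvg (R : realType) (a : nat -> R) :
  (\sum_(k <oo) `|a k - a k.+1|%:E < +oo)%E -> cvgn a.
Proof.
move=> fin; have s0 : (0 <= \sum_(k <oo) `|a k - a k.+1|%:E)%E.
  by apply: nneseries_ge0 => k _ _; rewrite lee_fin.
have cs : cvgn [normed series (telescope a)].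
  apply: nondecreasing_is_cvgn.
    by apply: nondecreasing_series => k _ _ /=; exact: normr_ge0.
  exists (fine (\sum_(k <oo) `|a k - a k.+1|%:E)%E) => _ [N _ <-].
  rewrite -lee_fin fineK ?ge0_fin_numE// /series/= -sumEFin.
  under eq_bigr do rewrite /telescope distrC.
  by apply: nneseries_lim_ge => k _; rewrite lee_fin.
have := normed_cvg cs; rewrite telescopeK => ca.
have -> : a = (fun k => (a k - a 0%N) + a 0%N) by apply/funext => k; rewrite subrK.
by apply: is_cvgD => //; exact: is_cvg_cst.
Qed.

(** * Least-squares projection onto a ball of the norm *)

Section projection.
Context (R : realType) (n : nat).
Local Notation V := 'rV[R]_n.+1.
Local Notation mu := (@lebesgue_rV R n).
Variable Y : (V -> \bar R) -> \bar R.
Hypothesis bY : ball_Banach Y.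
Variable B : set V.
Hypotheses (mB : measurable B) (finB : (mu B < +oo)%E).
Variables (g : V -> R) (K : R).
Hypotheses (bg : bounded_on B g) (g0 : forall x, 0 <= g x) (K0 : 0 < K).
Local Notation I f := (\int[mu]_x f x).

(** The order bound keeps all competitors bounded and supported in [B], so that squares are
    integrable; the norm bound survives almost everywhere limits by the Fatou property. *)
Definition admissible (u : V -> R) : Prop :=
  [/\ measurable_fun setT u, forall x, 0 <= u x <= g x & (Y (EFin \o u) <= K%:E)%E].

Definition sqdist (u : V -> R) : R := I (fun x => (g x - u x) * (g x - u x)).

Lemma admissible_bounded u : admissible u -> bounded_on B u.
Proof.
move=> [mu_ ug _]; apply: (bounded_on_le mu_ bg) => x.
by have /andP[u0 ux] := ug x; rewrite !ger0_norm.
Qed.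

Lemma admissible0 : admissible (fun=> 0).
Proof.
split=> [|x|]; [exact: measurable_cst|by rewrite lexx g0|].
by rewrite (_ : _ \o _ = fun=> 0%E)// (norm_zero bY) lee_fin ltW.
Qed.

Lemma admissible_mid u v : admissible u -> admissible v ->
  admissible (fun x => 2^-1 * (u x + v x)).
Proof.
move=> [mu_ ug Yu] [mv vg Yv].
have muv : measurable_fun setT (fun x => u x + v x) by exact: measurable_funD.
split=> [|x|]; first by apply: (measurable_funM (measurable_cst _)).
  by have /andP[u0 ux] := ug x; have /andP[v0 vx] := vg x; apply/andP; split; lra.
have h := norm_scale_le bY (c := 2^-1) (K := (K + K)%:E) (f := fun x => ((u x)%:E + (v x)%:E)%E).
apply: le_trans (h _ _ _) _ => //.
- by apply: emeasurable_funD; exact/measurable_EFinP.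
- rewrite EFinD; apply: le_trans (norm_add bY _ _) _; try exact/measurable_EFinP.
  exact: leeD.
by rewrite -EFinM lee_fin; lra.
Qed.

Lemma bounded_sqdist u : admissible u -> bounded_on B (fun x => (g x - u x) * (g x - u x)).
Proof. by move=> /admissible_bounded bu; apply: bounded_onM => //; exact: bounded_onB. Qed.

Lemma sqdist_ge0 u : 0 <= sqdist u.
Proof. by apply: bounded_int_ge0 => x; rewrite -expr2 sqr_ge0. Qed.

(** Two functions whose distances to [g] are nearly minimal are close to each other, since their
    midpoint is admissible and cannot do better than the minimum. *)
Lemma parallelogram u v : admissible u -> admissible v ->
  I (fun x => (u x - v x) * (u x - v x)) =
  2 * (sqdist u + sqdist v) - 4 * sqdist (fun x => 2^-1 * (u x + v x)).
Proof.
move=> au av; have bu := bounded_sqdist au; have bv := bounded_sqdist av.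
have bw := bounded_sqdist (admissible_mid au av).
have buv := bounded_onD bu bv.
rewrite /sqdist -(bounded_intD mB finB bu bv) -(bounded_intZ mB finB 2 buv).
rewrite -(bounded_intZ mB finB 4 bw).
rewrite -(bounded_intB mB finB (bounded_onZ 2 buv) (bounded_onZ 4 bw)).
by congr Rintegral; apply/funext => x; field.
Qed.

(** The parallelogram law makes a minimizing sequence Cauchy in mean square. With excesses
    [4^-(k + 1)] the increments are summable in the integral norm, so the sequence converges almost
    everywhere; Fatou's lemma, for the norm and for the integral, passes to the limit. *)
Lemma minimizing_sequence (m : R) : (forall u, admissible u -> m <= sqdist u) ->
  (forall e, 0 < e -> exists2 u, admissible u & sqdist u <= m + e) ->
  exists2 u0, admissible u0 & sqdist u0 <= m.
Proof.
move=> lbm ex; pose q k : R := 1 / (2 ^ k.+1)%:R.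
have q0 k : 0 < q k by rewrite divr_gt0// ltr0n expn_gt0.
have qS k : q k.+1 <= q k.
  by rewrite /q ler_pM2l// lef_pV2 ?posrE ?ltr0n ?expn_gt0// ler_nat leq_exp2l.
have /choice[u hu] : forall k, exists u, admissible u /\ sqdist u <= m + q k * q k.
  by move=> k; have [u au su] := ex _ (mulr_gt0 (q0 k) (q0 k)); exists u.
have au k := (hu k).1; have bu k := admissible_bounded (au k).
have mu_ k : measurable_fun setT (u k) by case: (au k).
have u0 k x : 0 <= u k x by case: (au k) => _ /(_ x)/andP[].
have ug k x : u k x <= g x by case: (au k) => _ /(_ x)/andP[].
have bdif k : bounded_on B (fun x => u k x - u k.+1 x) by exact: bounded_onB.
have sq k : I (fun x => (u k x - u k.+1 x) * (u k x - u k.+1 x)) <= 4 * (q k * q k).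
  rewrite (parallelogram (au k) (au k.+1)).
  have h1 := (hu k).2; have h2 := (hu k.+1).2.
  have h3 := lbm _ (admissible_mid (au k) (au k.+1)).
  have h4 : q k.+1 * q k.+1 <= q k * q k by rewrite ler_pM// ltW.
  by move: h1 h2 h3 h4; set a := sqdist _; set b := sqdist _; set c := sqdist _; lra.
have b1 : bounded_on B (\1_B : V -> R).
  by split; [exact: measurable_indic|exists 1 => x; rewrite mul1r ger0_norm].
pose c : R := (I (\1_B : V -> R) + 4) / 2.
have c0 : 0 <= c by rewrite divr_ge0// addr_ge0// bounded_int_ge0.
have mabs k : measurable_fun setT (fun x => `|u k x - u k.+1 x|).
  by apply: measurableT_comp => //; exact: measurable_funB.
have babs k : bounded_on B (fun x => `|u k x - u k.+1 x|).
  by apply: (bounded_on_le (mabs k) (bdif k)) => x; rewrite normr_id.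
(* On [B] the inequality [t <= q / 2 + t^2 / (2 q)] turns the mean-square bound into a bound on the
   integral. *)
have small k : I (fun x => `|u k x - u k.+1 x|) <= c * q k.
  have bs := bounded_onM (bdif k) (bdif k).
  have b2 := bounded_onD (bounded_onZ (q k / 2) b1) (bounded_onZ ((q k)^-1 / 2) bs).
  apply: le_trans (le_bounded_int mB finB (babs k) b2 _) _.
    move=> x; have [Bx|Bx] := pselect (B x); last first.
      by rewrite !(bounded_on_out (bu _) Bx) subr0 normr0 indicE memNset// !mulr0 addr0.
    rewrite indicE mem_set// mulr1 -[X in _ + _ * X]real_normK ?num_real//.
    set t := `| _ |; have t0 : 0 <= t := normr_ge0 _.
    have : 0 <= (q k)^-1 / 2 * (t - q k) ^+ 2.
      by rewrite mulr_ge0 ?sqr_ge0// divr_ge0// invr_ge0 ltW.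
    suff -> : (q k)^-1 / 2 * (t - q k) ^+ 2 = q k / 2 + (q k)^-1 / 2 * t ^+ 2 - t by rewrite subr_ge0.
    by field; rewrite gt_eqF.
  rewrite (bounded_intD mB finB (bounded_onZ _ b1) (bounded_onZ _ bs)).
  rewrite (bounded_intZ mB finB _ b1) (bounded_intZ mB finB _ bs).
  have -> : c * q k = q k / 2 * I (\1_B : V -> R) + (q k)^-1 / 2 * (4 * (q k * q k)).
    by rewrite /c; field; rewrite gt_eqF.
  by rewrite lerD2l ler_wpM2l// divr_ge0// invr_ge0 ltW.
have ae_cvg : {ae mu, forall x, cvgn (u ^~ x)}.
  have mf k : measurable_fun setT (fun x => `|u k x - u k.+1 x|%:E) by exact/measurable_EFinP.
  have f0 k x : (0 <= `|u k x - u k.+1 x|%:E)%E by rewrite lee_fin.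
  have fin : (\sum_(k <oo) \int[mu]_x `|u k x - u k.+1 x|%:E < +oo)%E.
    apply: (@le_lt_trans _ _ (\sum_(k <oo) (c / (2 ^ k.+1)%:R)%:E)%E); last first.
      by apply: le_lt_trans (epsilon_trick0 xpredT c0) _; rewrite ltry.
    apply: lee_nneseries => [k _ _|k _]; first exact: integral_ge0.
    rewrite (EFin_bounded_int mB finB (babs k)) lee_fin; apply: le_trans (small k) _.
    by rewrite /q div1r.
  apply: filterS (summable_integral_ae mf f0 fin) => x [h _].
  exact: summable_increments_cvg.
(* The lower limit is defined and measurable everywhere and lies between 0 and [g]; almost
   everywhere it is the limit. *)
pose L x : \bar R := limn_einf (fun k => (u k x)%:E).
have L0 x : (0 <= L x)%E.
  rewrite /L limn_einf_lim; apply: lime_ge; first exact: is_cvg_einfs.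
  by apply: nearW => k; apply: le_ereal_inf_tmp => _ [j _ <-]; rewrite lee_fin.
have Lg x : (L x <= (g x)%:E)%E.
  rewrite /L limn_einf_lim; apply: lime_le; first exact: is_cvg_einfs.
  apply: nearW => k; apply: (@le_trans _ _ (u k x)%:E); last by rewrite lee_fin.
  by apply: ereal_inf_lbound; exists k => /=.
have mL : measurable_fun setT L.
  apply: (emeasurable_fun_cvg (fun k x => einfs (fun j => (u j x)%:E) k)).
    by move=> k; apply: measurable_fun_einfs => j; exact/measurable_EFinP.
  by move=> x _; rewrite /L limn_einf_lim; exact: is_cvg_einfs.
pose u0_ x := fine (L x).
have LE x : L x = (u0_ x)%:E.
  by rewrite fineK// ge0_fin_numE// (le_lt_trans (Lg x))// ltry.
have LE' : EFin \o u0_ = L by apply/funext => x /=.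
have mu0 : measurable_fun setT u0_ by apply/measurable_EFinP; rewrite LE'.
have a0 : admissible u0_.
  split=> // [x|]; first by rewrite -!lee_fin -LE L0 Lg.
  rewrite LE'; apply: (norm_einf_le bY (f_ := fun k x => (u k x)%:E)) => [k|k x|k].
  - exact/measurable_EFinP.
  - by rewrite lee_fin.
  - by case: (au k).
exists u0_ => //; rewrite -lee_fin -(EFin_bounded_int mB finB (bounded_sqdist a0)).
pose h k x : \bar R := ((g x - u k x) * (g x - u k x))%:E.
have mg : measurable_fun setT g by case: bg.
have mh k : measurable_fun setT (h k).
  by apply/measurable_EFinP; apply: measurable_funM; exact: measurable_funB.
have h0 k x : (0 <= h k x)%E by rewrite lee_fin -expr2 sqr_ge0.
have e1 : (\int[mu]_x ((g x - u0_ x) * (g x - u0_ x))%:E = \int[mu]_x limn_einf (h ^~ x))%E.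
  apply: ae_eq_integral => //.
  - by apply/measurable_EFinP; apply: measurable_funM; exact: measurable_funB.
  - apply: (emeasurable_fun_cvg (fun k x => einfs (h ^~ x) k)).
      by move=> k; exact: measurable_fun_einfs.
    by move=> x _; rewrite limn_einf_lim; exact: is_cvg_einfs.
  apply: filterS ae_cvg => x cx _.
  have cE : (u k x)%:E @[k --> \oo] --> (limn (u ^~ x))%:E by apply: cvg_EFin; [exact: nearW|exact: cx].
  have uE : u0_ x = limn (u ^~ x).
    by rewrite /u0_ /L is_cvg_limn_einfE ?(cvg_lim _ cE)//; exact: cvgP cE.
  rewrite uE; have ch : h k x @[k --> \oo] --> ((g x - limn (u ^~ x)) * (g x - limn (u ^~ x)))%:E.
    apply: cvg_EFin; first exact: nearW.
    by apply: cvgM; apply: cvgB => //; exact: cvg_cst.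
  by rewrite is_cvg_limn_einfE ?(cvg_lim _ ch)//; exact: cvgP ch.
have h0' k x : [set: V] x -> (0 <= h k x)%E by [].
rewrite e1; apply: (@le_trans _ _ (limn_einf (fun k => \int[mu]_x h k x)%E)).
  exact: (@fatou _ _ _ mu setT measurableT h mh h0').
apply/lee_addgt0Pr => e e0; have [N hN] := harm_small e0.
rewrite limn_einf_lim; apply: lime_le; first exact: is_cvg_einfs.
apply: nearW => k; apply: (@le_trans _ _ (\int[mu]_x h (maxn k N) x)%E).
  by apply: ereal_inf_lbound; exists (maxn k N) => //=; exact: leq_maxl.
rewrite (EFin_bounded_int mB finB (bounded_sqdist (au _))) -EFinD lee_fin.
apply: le_trans (hu _).2 _; rewrite lerD2l; apply: le_trans (hN _ (leq_maxr k N)).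
have q1 l : q l <= harm R l.
  by rewrite /q div1r lef_pV2 ?posrE ?ltr0n ?expn_gt0// ler_nat ltnW// ltn_expl.
apply: le_trans (q1 _); rewrite ger_pMl//; apply: le_trans (q1 _) _; exact: harm_le1.
Qed.

Lemma exists_projection : exists2 u0, admissible u0 &
  forall v, admissible v -> sqdist u0 <= sqdist v.
Proof.
pose S := [set sqdist u | u in admissible].
have hS : has_inf S.
  split; first by exists (sqdist (fun=> 0)), (fun=> 0) => //; exact: admissible0.
  by exists 0 => _ [u _ <-]; exact: sqdist_ge0.
have lbm u : admissible u -> inf S <= sqdist u.
  by move=> au; apply: ge_inf; [exact: hS.2|exists u].
have [u0 au0 hu0] : exists2 u0, admissible u0 & sqdist u0 <= inf S.
  apply: minimizing_sequence => // e e0.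
  by have [_ [u au <-] /ltW h] := inf_adherent e0 hS; exists u.
by exists u0 => // v av; exact: le_trans hu0 (lbm _ av).
Qed.

(** First-order optimality. The competitor moves from [u0] towards [v] and is capped by [g]: the cap
    keeps it admissible and only brings it closer to [g]. *)
Lemma projection_variation u0 v : admissible u0 ->
  (forall v, admissible v -> sqdist u0 <= sqdist v) ->
  bounded_on B v -> (forall x, 0 <= v x) -> (Y (EFin \o v) <= K%:E)%E ->
  I (fun x => (g x - u0 x) * v x) <= I (fun x => (g x - u0 x) * u0 x).
Proof.
move=> au0 min bv v0 Yv; have bu0 := admissible_bounded au0.
have bh := bounded_onB bg bu0; have bd := bounded_onB bv bu0.
have [mu0 u0g Yu0] := au0; have [mv _] := bv; have [mg _] := bg.
have hv := bounded_onM bh bv; have hu := bounded_onM bh bu0; have hd := bounded_onM bh bd.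
have hh := bounded_onM bh bh; have dd := bounded_onM bd bd.
set M := I (fun x => (v x - u0 x) * (v x - u0 x)).
have M0 : 0 <= M by apply: bounded_int_ge0 => x; rewrite -expr2 sqr_ge0.
suff key t : 0 < t -> t <= 1 -> 2 * I (fun x => (g x - u0 x) * (v x - u0 x)) <= t * M.
  rewrite -subr_le0 -(bounded_intB mB finB hv hu).
  have -> : (fun x => (g x - u0 x) * v x - (g x - u0 x) * u0 x) =
    (fun x => (g x - u0 x) * (v x - u0 x)) by apply/funext => x; rewrite mulrBr.
  pose i := I (fun x => (g x - u0 x) * (v x - u0 x)).
  rewrite -/i in key *; rewrite leNgt; apply/negP => i0.
  (* A step so short that [t * M <= i], against [2 * i <= t * M] with [i] positive. *)
  have t0 : 0 < Num.min 1 (i / (M + 1)) by rewrite lt_min ltr01 divr_gt0// ltr_wpDl.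
  have t1 : Num.min 1 (i / (M + 1)) <= 1 by rewrite ge_min lexx.
  have := key _ t0 t1.
  have h : Num.min 1 (i / (M + 1)) * M <= i / (M + 1) * M by rewrite ler_wpM2r// ge_min lexx orbT.
  have h2 : i / (M + 1) * M <= i.
    by rewrite -mulrA ger_pMr// mulrC ler_pdivrMr ?mul1r ?lerDl// ltr_wpDl.
  by lra.
move=> t0 t1; pose w x := Num.min (g x) (u0 x + t * (v x - u0 x)).
have mw : measurable_fun setT w.
  apply: measurable_minr => //; apply: measurable_funD => //.
  by apply: (measurable_funM (measurable_cst _)); exact: measurable_funB.
have w0 x : 0 <= w x.
  rewrite le_min g0/=; have /andP[ux _] := u0g x; have := v0 x => vx.
  have h1 : 0 <= t * v x by rewrite mulr_ge0// ltW.
  have h2 : 0 <= (1 - t) * u0 x by rewrite mulr_ge0// subr_ge0.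
  by lra.
have aw : admissible w.
  split=> // [x|]; first by rewrite w0 ge_min lexx.
  have := t1; rewrite le_eqVlt => /orP[/eqP tE|t1'].
    apply: le_trans Yv; apply: (norm_le bY); [exact/measurable_EFinP|exact/measurable_EFinP|].
    move=> x /=; rewrite lee_fin !ger0_norm// /w tE mul1r ge_min; apply/orP; right.
    by rewrite addrC subrK.
  have c1 : 0 < 1 - t by rewrite subr_gt0.
  have e1 : measurable_fun setT (fun x => (1 - t)%:E * (u0 x)%:E)%E.
    by apply: emeasurable_funM; [exact: measurable_cst|exact/measurable_EFinP].
  have e2 : measurable_fun setT (fun x => t%:E * (v x)%:E)%E.
    by apply: emeasurable_funM; [exact: measurable_cst|exact/measurable_EFinP].
  apply: (@le_trans _ _ (Y (fun x => (1 - t)%:E * (u0 x)%:E + t%:E * (v x)%:E)%E)).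
    apply: (norm_le bY); [exact: emeasurable_funD|exact/measurable_EFinP|].
    move=> x; rewrite -!EFinM -EFinD /= lee_fin (ger0_norm (w0 x)).
    apply: le_trans (ler_norm _); rewrite ge_min; apply/orP; right.
    by rewrite le_eqVlt; apply/orP; left; apply/eqP; ring.
  apply: le_trans (norm_add bY e1 e2) _.
  apply: (@le_trans _ _ ((1 - t)%:E * K%:E + t%:E * K%:E)%E); last first.
    by rewrite -!EFinM -EFinD lee_fin; lra.
  apply: leeD; apply: (norm_scale_le bY) => //; exact/measurable_EFinP.
have bq := bounded_onD (bounded_onB hh (bounded_onZ (2 * t) hd)) (bounded_onZ (t * t) dd).
have : sqdist u0 <= sqdist u0 - 2 * t * I (fun x => (g x - u0 x) * (v x - u0 x)) + t * t * M.
  apply: le_trans (min _ aw) _.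
  rewrite /M /sqdist -(bounded_intZ mB finB _ hd) -(bounded_intZ mB finB _ dd).
  rewrite -(bounded_intB mB finB hh (bounded_onZ _ hd)).
  rewrite -(bounded_intD mB finB (bounded_onB hh (bounded_onZ _ hd)) (bounded_onZ _ dd)).
  apply: (le_bounded_int mB finB (bounded_sqdist aw) bq) => x.
  rewrite /w; have [h|/ltW h] := leP (g x) (u0 x + t * (v x - u0 x)).
    by rewrite subrr mul0r; have := sqr_ge0 (g x - u0 x - t * (v x - u0 x)); rewrite expr2; lra.
  by rewrite le_eqVlt; apply/orP; left; apply/eqP; ring.
move=> h; rewrite -(ler_pM2l t0); move: h; lra.
Qed.

End projection.

(** * Duality: recovering the norm from its associate *)

Section second_associate.
Context (R : realType) (n : nat).
Local Notation V := 'rV[R]_n.+1.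
Local Notation mu := (@lebesgue_rV R n).
Variable Y : (V -> \bar R) -> \bar R.
Hypothesis bY : ball_Banach Y.
Local Open Scope ereal_scope.

Lemma cvg_truncation (a : \bar R) : 0 <= a -> mine a m%:R%:E @[m --> \oo] --> a.
Proof.
case: a => [r||//]; last first.
  by under eq_fun do rewrite min_r ?leey//; move=> _; apply/cvgeryP; exact: cvgr_idn.
move=> _; apply: cvg_near_cst; near=> m; rewrite min_l// lee_fin.
by near: m; exact: nbhs_infty_ger.
Unshelve. all: by end_near. Qed.

Lemma truncation_fin (a : \bar R) m : 0 <= a -> mine a m%:R%:E \is a fin_num.
Proof. by case: a => [r||]// _; rewrite minEle; case: ifP => //; rewrite leye_eq. Qed.

Lemma nondecreasing_truncation (a : \bar R) : nondecreasing_seq (fun m => mine a (m%:R%:E : \bar R)).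
Proof.
move=> i j ij; rewrite le_min ge_min lexx/= ge_min lee_fin ler_nat ij orbT//.
Qed.

(** The associate norm tests functions of norm 1, so [A] is normalised; if its norm is 0 it vanishes
    almost everywhere. *)
Lemma holder_associate (A w : V -> \bar R) : measurable_fun setT A -> measurable_fun setT w ->
  Y A < +oo -> \int[mu]_x `|w x * A x| <= Y A * associate Y w.
Proof.
move=> mA mw YA; have YA0 := norm_ge0 bY mA.
have assoc0 : Y A = 0 -> \int[mu]_x `|w x * A x| <= Y A * associate Y w.
  move=> Y0; have A0 := qnorm_eq0 (ball_Banach_quasi bY) mA Y0.
  rewrite Y0 mul0e (_ : \int[mu]_x _ = 0)//; apply/ae_eq_integral_abs => //.
    exact: emeasurable_funM.
  by apply: filterS A0 => x -> _; rewrite mule0.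
have [/assoc0//|/eqP Yn0] := pselect (Y A = 0).
have Yf : Y A \is a fin_num by rewrite ge0_fin_numE.
have y0 : (0 < fine (Y A))%R by rewrite fine_gt0// YA andbT lt0e Yn0.
have ci0 : (0 <= (fine (Y A))^-1)%R by rewrite invr_ge0 ltW.
have mc : measurable_fun setT (fun x => ((fine (Y A))^-1)%:E * A x).
  by apply: emeasurable_funM => //; exact: measurable_cst.
have mwA : measurable_fun setT (fun x => `|w x * A x|).
  by apply: measurableT_comp => //; exact: emeasurable_funM.
have : ((fine (Y A))^-1)%:E * \int[mu]_x `|w x * A x| <= associate Y w.
  apply: ereal_sup_ubound; exists (fun x => ((fine (Y A))^-1)%:E * A x).
    split => //; rewrite norm_scale//.
    by rewrite -[X in _ * X](fineK Yf) -EFinM mulVf// gt_eqF.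
  rewrite -ge0_integralcM//; apply: eq_integral => x _.
  by rewrite muleCA abseM gee0_abs.
move=> h; rewrite -[X in X * _](fineK Yf) -lee_pdivrMl//.
Qed.

(** The supremum is over a nonempty set: the indicator of a ball has a finite nonzero norm and can
    be normalised. *)
Lemma associate_ge0 (w : V -> \bar R) : 0 <= associate Y w.
Proof.
pose b x : \bar R := (\1_(eball (0 : V) 1) x)%:E.
have mb : measurable_fun setT b.
  by apply/measurable_EFinP; apply: measurable_indic; exact: measurable_eball.
have [_ Yb] := qnorm_ball (ball_Banach_quasi bY) (0 : V)%R (@ltr01 R).
have Yb0 : 0 <= Y b := norm_ge0 bY mb.
have Yn0 : Y b != 0.
  apply/eqP => /(qnorm_eq0 (ball_Banach_quasi bY) mb) b0.
  have : \int[mu]_x `|b x| = 0 by apply/ae_eq_integral_abs => //; apply: filterS b0 => x.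
  rewrite (eq_integral b) => [|x _]; last by rewrite gee0_abs// lee_fin.
  rewrite integral_indic ?setIT//; last exact: measurable_eball.
  by move=> h; have := eball_gt0 (0 : V) (@ltr01 R); rewrite h ltxx.
have Yf : Y b \is a fin_num by rewrite ge0_fin_numE.
have y0 : (0 < fine (Y b))%R by rewrite fine_gt0// Yb andbT lt0e Yn0.
apply: (@le_trans _ _ (\int[mu]_x `|w x * ((fine (Y b))^-1%:E * b x)|)); first exact: integral_ge0.
apply: ereal_sup_ubound; exists (fun x => (fine (Y b))^-1%:E * b x) => //; split.
  by apply: emeasurable_funM => //; exact: measurable_cst.
rewrite norm_scale ?invr_ge0 ?ltW//.
by rewrite -[X in _ * X](fineK Yf) -EFinM mulVf// gt_eqF.
Qed.

Variables (B : set V).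
Hypotheses (mB : measurable B) (finB : mu B < +oo).

(** The projection takes the place of Hahn-Banach. With [u0] the projection of [g] and [h = g - u0],
    first-order optimality bounds the associate norm of [h] by the integral of [h * u0] divided by
    [K]. The hypothesis tested with [h] then makes the integral of [h * h] nonpositive, so [g = u0]
    almost everywhere. *)
Lemma second_associate_bounded (g : V -> R) (K : R) : bounded_on B g -> (forall x, 0 <= g x)%R ->
  (0 < K)%R ->
  (forall w : V -> R, measurable_fun setT w -> (forall x, 0 <= w x)%R ->
     associate Y (EFin \o w) < +oo ->
     \int[mu]_x ((g x)%:E * (w x)%:E) <= K%:E * associate Y (EFin \o w)) ->
  Y (EFin \o g) <= K%:E.
Proof.
move=> bg g0 K0 hyp; have [u0 au0 min] := exists_projection bY mB finB bg g0 K0.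
have [mu0 u0g Yu0] := au0; have [mg _] := bg.
have bu0 := admissible_bounded bg g0 au0.
pose h x := (g x - u0 x)%R.
have h0 x : (0 <= h x)%R by rewrite subr_ge0; have /andP[] := u0g x.
have bh : bounded_on B h by exact: bounded_onB.
have mh : measurable_fun setT h by case: bh.
pose kp := (\int[mu]_x (h x * u0 x))%R.
have hy : associate Y (EFin \o h) <= (kp / K)%:E.
  apply: ge_ereal_sup => _ [q [mq Yq] <-].
  (* A function [q] of norm 1 is replaced by truncations of [|q|] to bounded functions on [B], to
     which optimality applies; nothing is lost, since [h] vanishes outside [B]. *)
  pose t m x := (fine (mine `|q x|%E m%:R%:E) * \1_B x)%R.
  have fm m x : mine `|q x| m%:R%:E \is a fin_num.
    by apply: truncation_fin; exact: abse_ge0.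
  have f0 m x : (0 <= fine (mine `|q x|%E m%:R%:E))%R.
    by rewrite fine_ge0// le_min abse_ge0 lee_fin/=.
  have tE m x : (t m x)%:E = mine `|q x| m%:R%:E * (\1_B x)%:E by rewrite EFinM fineK.
  have t0 m x : (0 <= t m x)%R by rewrite mulr_ge0.
  have mt m : measurable_fun setT (t m).
    apply/measurable_EFinP; rewrite (_ : _ \o _ = fun x => mine `|q x| m%:R%:E * (\1_B x)%:E); last first.
      by apply/funext => x /=.
    apply: emeasurable_funM; last by apply/measurable_EFinP; exact: measurable_indic.
    by apply: measurable_mine; [exact: measurableT_comp|exact: measurable_cst].
  have bt m : bounded_on B (t m).
    split => //; exists m%:R => x; rewrite ger0_norm// ler_wpM2r//.
    by rewrite -lee_fin fineK// ge_min lexx orbT.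
  have Yt m : Y (EFin \o (fun x => K * t m x)%R) <= K%:E.
    rewrite -[leRHS]mule1; apply: (norm_scale_le bY (f := EFin \o t m)); [by []|exact/measurable_EFinP|].
    rewrite -Yq; apply: (norm_le bY); [by []|exact/measurable_EFinP|].
    move=> x; rewrite (_ : (EFin \o t m) x = (t m x)%:E)// tE.
    have m0 : 0 <= mine `|q x| m%:R%:E by rewrite le_min abse_ge0 lee_fin/=.
    rewrite gee0_abs; last by rewrite mule_ge0// lee_fin.
    apply: (@le_trans _ _ (`|q x| * 1)); last by rewrite mule1.
    by apply: lee_pmul => //; [rewrite ge_min lexx|rewrite lee_fin indic_le1].
  have Kt m : bounded_on B (fun x => K * t m x)%R by exact: bounded_onZ.
  have bd m : \int[mu]_x (h x * t m x)%:E <= (kp / K)%:E.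
    have bht := bounded_onM bh (bt m).
    rewrite (EFin_bounded_int mB finB bht) lee_fin ler_pdivlMr// mulrC -(bounded_intZ mB finB _ bht).
    under [leLHS]eq_Rintegral do rewrite mulrCA.
    have Kt0 x : (0 <= K * t m x)%R by rewrite mulr_ge0// ltW.
    exact: (projection_variation bY mB finB bg g0 au0 min (Kt m) Kt0 (Yt m)).
  have mF m : measurable_fun setT (fun x => (h x * t m x)%:E).
    by apply/measurable_EFinP; exact: measurable_funM.
  have F0 m x : 0 <= (h x * t m x)%:E by rewrite lee_fin mulr_ge0.
  have cv x : (h x * t m x)%:E @[m --> \oo] --> `|(EFin \o h) x * q x|.
    rewrite /= abseM (gee0_abs (_ : 0 <= (h x)%:E)) ?lee_fin//.
    have [Bx|Bx] := pselect (B x); last first.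
      by rewrite (bounded_on_out bh Bx) mul0e; under eq_fun do rewrite mul0r; exact: cvg_cst.
    under eq_fun do rewrite EFinM tE indicE mem_set// mule1.
    by apply: cvgeZl => //; apply: cvg_truncation; exact: abse_ge0.
  have nd x : nondecreasing_seq (fun m => (h x * t m x)%:E).
    move=> i j ij; rewrite lee_fin ler_wpM2l// ler_wpM2r// fine_le//.
    exact: nondecreasing_truncation.
  have := @cvg_monotone_convergence _ _ _ mu setT measurableT (fun m x => (h x * t m x)%:E) mF
    (fun m x _ => F0 m x) (fun x _ => nd x).
  have -> : (fun x => limn (fun m => (h x * t m x)%:E)) = (fun x => `|(EFin \o h) x * q x|).
    by apply/funext => x; exact: cvg_lim (cv x).
  move=> cI; rewrite -(cvg_lim (@ereal_hausdorff R) cI); apply: lime_le; first exact: cvgP cI.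
  exact: nearW.
have kp0 : (0 <= kp)%R by apply: bounded_int_ge0 => x; rewrite mulr_ge0//; have /andP[] := u0g x.
have := hyp h mh h0 (le_lt_trans hy (ltry _)).
have bgh := bounded_onM bg bh; have bhu := bounded_onM bh bu0; have bhh := bounded_onM bh bh.
have -> : \int[mu]_x ((g x)%:E * (h x)%:E) = (\int[mu]_x (g x * h x)%R)%R%:E.
  by rewrite -(EFin_bounded_int mB finB bgh).
move=> /le_trans/(_ (lee_wpmul2l _ hy)); rewrite lee_fin => /(_ (ltW K0)).
rewrite -EFinM lee_fin mulrCA mulfV ?gt_eqF// mulr1 => gk.
have hz : ae_eq mu setT (fun x => (h x * h x)%:E) (cst 0).
  apply/ae_eq_integral_abs => //; first by apply/measurable_EFinP; exact: measurable_funM.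
  rewrite (eq_integral (fun x => (h x * h x)%:E)); last by move=> x _; rewrite gee0_abs// lee_fin mulr_ge0.
  rewrite (EFin_bounded_int mB finB bhh); congr (_%:E); apply/eqP; rewrite eq_le; apply/andP; split; last first.
    by apply: bounded_int_ge0 => x; rewrite mulr_ge0.
  have -> : (fun x => h x * h x)%R = (fun x => g x * h x - h x * u0 x)%R.
    by apply/funext => x; rewrite /h; ring.
  by rewrite (bounded_intB mB finB bgh bhu) subr_le0.
apply: le_trans Yu0; apply: (norm_ae_le bY); [exact/measurable_EFinP|exact/measurable_EFinP| |].
  by move=> x; rewrite lee_fin.
apply: filterS hz => x /(_ I) /= [/eqP]; rewrite mulf_eq0 orbb subr_eq0 => /eqP -> //.
Qed.

End second_associate.

(** Truncation in height and to balls reduces to bounded functions, and the Fatou property returns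
    to [F]. The margin [e] makes the bound positive. *)
Lemma norm_le_associate (R : realType) (n : nat) (Y : ('rV[R]_n.+1 -> \bar R) -> \bar R)
    (F : 'rV[R]_n.+1 -> \bar R) (K : R) : ball_Banach Y ->
  measurable_fun setT F -> (forall x, 0 <= F x)%E -> 0 <= K ->
  (forall w : 'rV[R]_n.+1 -> R, measurable_fun setT w -> (forall x, 0 <= w x) ->
     (associate Y (EFin \o w) < +oo)%E ->
     (\int[@lebesgue_rV R n]_x (F x * (w x)%:E) <= K%:E * associate Y (EFin \o w))%E) ->
  (Y F <= K%:E)%E.
Proof.
move=> bY mF F0 K0 hyp; apply/lee_addgt0Pr => e e0; rewrite -EFinD.
pose T N x : R := fine (mine (F x) N%:R%:E) * \1_(eball 0 N.+1%:R) x.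
have fm N x : mine (F x) N%:R%:E \is a fin_num.
  by apply: truncation_fin.
have f0 N x : 0 <= fine (mine (F x) N%:R%:E) by rewrite fine_ge0// le_min F0 lee_fin/=.
have TE N x : ((T N x)%:E = mine (F x) N%:R%:E * (\1_(eball 0 N.+1%:R) x)%:E)%E by rewrite EFinM fineK.
have T0 N x : 0 <= T N x by rewrite mulr_ge0.
have mT N : measurable_fun setT (T N).
  apply/measurable_EFinP; rewrite (_ : _ \o _ = fun x => mine (F x) N%:R%:E * (\1_(eball 0 N.+1%:R) x)%:E)%E; last first.
    by apply/funext => x /=.
  apply: emeasurable_funM; last by apply/measurable_EFinP; apply: measurable_indic; exact: measurable_eball.
  by apply: measurable_mine => //; exact: measurable_cst.
have TF N x : ((T N x)%:E <= F x)%E.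
  rewrite TE; apply: (@le_trans _ _ (F x * 1)%E); last by rewrite mule1.
  by apply: lee_pmul => //; [rewrite le_min F0 lee_fin/=|rewrite ge_min lexx|rewrite lee_fin indic_le1].
apply: (norm_sup_le bY (f_ := fun N x => (T N x)%:E)) => //.
- by move=> N; exact/measurable_EFinP.
- move=> x i j ij; rewrite lee_fin ler_pM//.
    by rewrite fine_le//; exact: nondecreasing_truncation.
  rewrite !indicE; case: (boolP (x \in eball 0 i.+1%:R)) => //; rewrite inE => xi.
  by rewrite mem_set//; move: xi; rewrite /eball/= => /lt_le_trans; apply; rewrite ler_nat.
- move=> x; have [N hN] : exists N, forall k, (N <= k)%N -> eball 0 k.+1%:R x.
    exists (Num.bound (enorm x)) => k Nk; rewrite /eball/= subr0.
    by apply: lt_le_trans (archi_boundP (enorm_ge0 _)) _; rewrite ler_nat leqW.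
  apply: cvg_trans (cvg_truncation (F0 x)); apply: near_eq_cvg; near=> k.
  rewrite TE indicE mem_set ?mule1//; apply: hN; near: k; exact: nbhs_infty_ge.
move=> N; have fb := eball_fin (0 : 'rV[R]_n.+1) N.+1%:R.
apply: (second_associate_bounded bY (measurable_eball _ _) fb).
- split => //; exists N%:R => x; rewrite ger0_norm// ler_wpM2r//.
  by rewrite -lee_fin fineK// ge_min lexx orbT.
- by move=> x.
- by rewrite ltr_wpDl.
move=> w mw w0 aw; have a0 : (0 <= associate Y (EFin \o w))%E.
  exact: associate_ge0.
apply: le_trans (_ : _ <= K%:E * associate Y (EFin \o w))%E _; last first.
  by rewrite lee_wpmul2r// lee_fin lerDl ltW.
apply: le_trans (hyp w mw w0 aw); apply: le_ge0_integral.
- by apply: emeasurable_funM; exact/measurable_EFinP.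
- by apply: emeasurable_funM => //; exact/measurable_EFinP.
- by move=> x; rewrite mule_ge0// lee_fin.
- by move=> x; rewrite lee_wpmul2r// lee_fin.
Unshelve. all: by end_near. Qed.

(** * Inequalities for powers, and Jensen's inequality for a kernel *)

Section powers.
Context (R : realType) (n : nat).
Local Notation V := 'rV[R]_n.+1.
Local Notation mu := (@lebesgue_rV R n).
Variable p : R.
Hypothesis p1 : 1 <= p.

Let p0 : 0 < p. Proof. exact: lt_le_trans ltr01 p1. Qed.

Lemma powR_le (a b : R) : 0 <= a -> a <= b -> a `^ p <= b `^ p.
Proof. by move=> a0 ab; apply: ge0_ler_powR; rewrite ?nnegrE ?(ltW p0)// (le_trans a0). Qed.

(* One of the two summands dominates: compare b with t * a. *)
Lemma powR_add_le (t a b : R) : 0 < t -> 0 <= a -> 0 <= b ->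
  (a + b) `^ p <= (1 + t) `^ p * a `^ p + (1 + t^-1) `^ p * b `^ p.
Proof.
move=> t0 a0 b0; have t1 : 0 < 1 + t by rewrite addr_gt0.
have ti : 0 < 1 + t^-1 by rewrite addr_gt0// invr_gt0.
rewrite -!powRM ?(ltW t1) ?(ltW ti)//.
have [bt|/ltW bt] := leP b (t * a).
  by apply: ler_wpDr; [exact: powR_ge0|apply: powR_le; [exact: addr_ge0|lra]].
apply: ler_wpDl; [exact: powR_ge0|apply: powR_le; first exact: addr_ge0].
have : a <= t^-1 * b by rewrite ler_pdivlMl// mulrC; rewrite mulrC in bt.
lra.
Qed.

(** Two applications of [powR_add_le] at [t = 1], each costing a factor [2^p]. *)
Lemma powR_add3_le (a b c : R) : 0 <= a -> 0 <= b -> 0 <= c ->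
  (a + b + c) `^ p <= 4 `^ p * (a `^ p + b `^ p + c `^ p).
Proof.
move=> a0 b0 c0; have h1 := powR_add_le ltr01 (addr_ge0 a0 b0) c0.
have h2 := powR_add_le ltr01 a0 b0.
rewrite invr1 in h1 h2; have -> : (4 : R) = (1 + 1) * (1 + 1) by ring.
rewrite powRM//; set q := (1 + 1) `^ p in h1 h2 *.
have h12 : (1 : R) <= 1 + 1 by rewrite lerDl.
have q1 : 1 <= q by have := powR_le ler01 h12; rewrite powR1.
have c2 : q * c `^ p <= q * q * c `^ p.
  by rewrite -mulrA ler_wpM2l ?(le_trans ler01 q1)// ler_peMl// powR_ge0.
have h3 : q * (a + b) `^ p <= q * (q * a `^ p + q * b `^ p) by rewrite ler_wpM2l// (le_trans ler01 q1).
lra.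
Qed.

(* Split g at the level s = a / 2K, where s is at most half of the average. *)
Lemma jensen_powR (g k : V -> R) (a K : R) : measurable_fun setT g -> measurable_fun setT k ->
  (forall z, 0 <= g z) -> (forall z, 0 <= k z) -> 0 < K -> 0 <= a ->
  (\int[mu]_z (k z)%:E <= K%:E)%E -> (a%:E <= \int[mu]_z (g z * k z)%:E)%E ->
  ((a `^ p)%:E <= (2 * (2 * K) `^ (p - 1))%:E * \int[mu]_z ((g z) `^ p * k z)%:E)%E.
Proof.
move=> mg mk g0 k0 K0 a0 kK ag; set J := (X in (_ <= _ * X)%E).
have c0 : 0 <= 2 * (2 * K) `^ (p - 1) by rewrite mulr_ge0// powR_ge0.
have J0 : (0 <= J)%E by apply: integral_ge0 => z _; rewrite lee_fin mulr_ge0// powR_ge0.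
have [->|an0] := eqVneq a 0; first by rewrite powR0 ?gt_eqF// mule_ge0.
have {}a0 : 0 < a by rewrite lt_neqAle eq_sym an0.
pose s := a / (2 * K); have s0 : 0 < s by rewrite divr_gt0// mulr_gt0.
have gs z : g z <= s + s `^ (1 - p) * (g z) `^ p.
  have [gz|/ltW gz] := leP (g z) s; first by apply: ler_wpDr => //; rewrite mulr_ge0// powR_ge0.
  apply: ler_wpDl; first exact: ltW.
  have gz0 : 0 < g z := lt_le_trans s0 gz.
  rewrite -[leLHS](powRr1 (g0 z)) -{1}[1](subrK p) powRD; last by rewrite (gt_eqF gz0) implybT.
  rewrite ler_wpM2r ?powR_ge0// -[1 - p]opprB !powRN lef_pV2 ?posrE ?powR_gt0//.
  by apply: ge0_ler_powR; rewrite ?nnegrE ?subr_ge0// ltW.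
have mgp : measurable_fun setT (fun z => g z `^ p) by exact: (measurableT_comp (measurable_powR p)).
have mkE : measurable_fun setT (fun z => (k z)%:E) by exact/measurable_EFinP.
have mgk : measurable_fun setT (fun z => (g z `^ p * k z)%:E) by apply/measurable_EFinP; exact: measurable_funM.
have kE0 z : (0 <= (k z)%:E)%E by rewrite lee_fin.
have gk0 z : (0 <= (g z `^ p * k z)%:E)%E by rewrite lee_fin mulr_ge0// powR_ge0.
have sE : (0 <= s%:E)%E by rewrite lee_fin ltW.
have spE : (0 <= (s `^ (1 - p))%:E)%E by rewrite lee_fin powR_ge0.
have : (a%:E <= (a / 2)%:E + (s `^ (1 - p))%:E * J)%E.
  apply: le_trans ag _.
  apply: (@le_trans _ _ (\int[mu]_z (s%:E * (k z)%:E + (s `^ (1 - p))%:E * (g z `^ p * k z)%:E))%E).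
    apply: le_ge0_integral.
    - by apply/measurable_EFinP; exact: measurable_funM.
    - by apply: emeasurable_funD; apply: emeasurable_funM => //; exact: measurable_cst.
    - by move=> z; rewrite lee_fin mulr_ge0.
    by move=> z; rewrite -!EFinM -EFinD lee_fin mulrA -mulrDl ler_wpM2r.
  rewrite ge0_integral_add; last 4 first.
  - by apply: emeasurable_funM => //; exact: measurable_cst.
  - by apply: emeasurable_funM => //; exact: measurable_cst.
  - by move=> z; rewrite mule_ge0.
  - by move=> z; rewrite mule_ge0.
  rewrite (ge0_integralcM mkE kE0 sE) (ge0_integralcM mgk gk0 spE) leeD2r//.
  apply: le_trans (lee_wpmul2l sE kK) _; rewrite -EFinM lee_fin /s.
  by rewrite le_eqVlt; apply/orP; left; apply/eqP; field; rewrite gt_eqF.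
move: J J0 => [j| |]// J0.
  rewrite -!EFinM -EFinD !lee_fin => h.
  have h2 : a / 2 <= s `^ (1 - p) * j by lra.
  have -> : a `^ p = a * a `^ (p - 1).
    rewrite -{2}(powRr1 (ltW a0)) -powRD; last by rewrite (gt_eqF a0) implybT.
    by rewrite addrC subrK.
  have -> : a `^ (p - 1) = s `^ (p - 1) * (2 * K) `^ (p - 1).
    by rewrite -powRM ?(ltW s0) ?mulr_ge0 ?(ltW K0)// /s divfK// gt_eqF// mulr_gt0.
  have h3 : a * s `^ (p - 1) <= 2 * j.
    have : a / 2 * s `^ (p - 1) <= s `^ (1 - p) * j * s `^ (p - 1) by rewrite ler_wpM2r// powR_ge0.
    rewrite [X in _ <= X]mulrAC -powRD; last by rewrite (gt_eqF s0) implybT.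
    by rewrite addrA subrK subrr powRr0 mul1r; lra.
  rewrite mulrA -mulrA [leRHS]mulrAC; rewrite mulrA ler_wpM2r ?powR_ge0//.
by move=> _; rewrite gt0_muley ?leey// lte_fin mulr_gt0// powR_gt0// mulr_gt0.
Qed.

End powers.

(** * The remainder after subtraction of the linear part *)

Section affine_good_points.
Context (R : realType) (n : nat).
Local Notation d := n.+1.
Local Notation V := 'rV[R]_d.
Local Notation mu := (@lebesgue_rV R n).
Variables (P eta : R -> R) (c : R).
Hypothesis mP : mollifier P eta c.

Lemma dotvBr (e x y : V) : dotv e (x - y) = dotv e x - dotv e y.
Proof. by rewrite /dotv -sumrB; apply: eq_bigr => i _; rewrite !mxE mulrBr. Qed.

(** The exceptional set must not depend on [e], which will be [G x]. A scale good for [u] also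
    serves the linear function, whose average differs from its value at [x] by at most
    [enorm e * (2 d H)]. *)
Lemma good_point_sub_affine (Om : set V) (u : V -> R) (e x : V) : open Om ->
  locally_integrable_rV Om u -> Om x -> good_point eta Om u x ->
  good_point eta Om (fun z => u z - dotv e z) x.
Proof.
move=> oOm lu Ox gx t t0; have mOm := measurable_open oOm.
have [rho rho0 rhoO] := open_eball oOm Ox.
have d0 : (0 : R) < d%:R by rewrite ltr0n.
pose E := enorm e + 1; have E0 : 0 < E by rewrite ltr_wpDl ?enorm_ge0.
have t1 : 0 < Num.min (t / 2) (Num.min (rho / (4 * d%:R)) (t / (4 * d%:R * E))).
  by rewrite !lt_min !divr_gt0// !mulr_gt0.
have [H /andP[H0 Ht] hu] := gx _ t1; move: Ht; rewrite !lt_min => /and3P[Ht2 Hr Hs].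
have {}Hr : 2 * d%:R * H < rho.
  move: Hr; rewrite ltr_pdivlMr ?mulr_gt0// => h.
  have -> : 2 * d%:R * H = H * (4 * d%:R) / 2 by field.
  lra.
have {}Hs : enorm e * (2 * d%:R * H) <= t / 2.
  move: Hs; rewrite ltr_pdivlMr ?mulr_gt0// => h.
  have h2 : enorm e * (2 * d%:R * H) <= E * (2 * d%:R * H).
    by rewrite ler_wpM2r ?mulr_ge0 ?(ltW H0)// lerDl.
  have hE : H * (4 * d%:R * E) = 2 * (E * (2 * d%:R * H)) by ring.
  by apply: le_trans h2 _; move: h; rewrite hE; move: (E * _) => q; lra.
have {}hu : `|smooth_avg eta Om u H (x - const_mx H) - u x| <= t / 2.
  by apply: le_trans hu _; rewrite ge_min lexx.
exists H; first by rewrite H0/= (lt_trans Ht2)//; lra.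
move: hu; set a := x - const_mx H; set F := phi eta H a => hu.
have cF : continuous F := continuous_phi mP (h := H) (a := a).
have F0 z : 0 <= F z := phi_ge0 mP a z H0.
have box_near z : cube (a - const_mx H) (a + const_mx H) z -> enorm (z - x) <= 2 * d%:R * H.
  move=> zc; apply: le_trans (enorm_le_sum _) _; apply: (@le_trans _ _ (\sum_(i < d) 2 * H)).
    by apply: ler_sum => i _; have := zc i; rewrite !mxE ler_norml; lra.
  by rewrite sumr_const card_ord mulrAC mulr_natr.
have supF : supp_in (fun i => mol eta H (a 0 i)) (a - const_mx H) (a + const_mx H).
  exact: (supp_mol mP).
have F_out z : ~ cube (a - const_mx H) (a + const_mx H) z -> F z = 0 := prodfun_out supF.
have cO : cube (a - const_mx H) (a + const_mx H) `<=` Om.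
  by apply: subset_trans rhoO => z zc; rewrite /eball/= (le_lt_trans (box_near _ zc)).
have cm i : continuous (mol eta H (a 0 i)) by exact: (continuous_mol mP).
have iu : mu.-integrable Om (EFin \o (fun z => u z * F z)).
  exact: (integrable_prodfun mOm lu cm supF cO).
have le_ : locally_integrable_rV Om (dotv e : V -> R).
  by apply: locally_integrable_continuous => //; exact: continuous_dotv.
have ie : mu.-integrable Om (EFin \o (fun z => dotv e z * F z)).
  exact: (integrable_prodfun mOm le_ cm supF cO).
have lc (q : R) : locally_integrable_rV Om (fun _ : V => q).
  by apply: locally_integrable_continuous => z; exact: cst_continuous.
have ic q : mu.-integrable Om (EFin \o (fun z => q * F z)).
  exact: (integrable_prodfun mOm (lc q) cm supF cO).
have int_cst q : (\int[mu]_(z in Om) (q * F z))%R = q.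
  rewrite (Rintegral_support (fun=> q) cO F_out) RintegralZl//; last first.
    have l1 : locally_integrable_rV setT (fun _ : V => 1 : R).
      by apply: locally_integrable_continuous => z; exact: cst_continuous.
    have := integrable_prodfun measurableT l1 cm supF (fun=> fun=> I).
    by apply: eq_integrable => // z _; rewrite /= mul1r.
  by rewrite /Rintegral (integral_phi mP a H0)/= mulr1.
have avg_affine : `|smooth_avg eta Om (dotv e) H a - dotv e x| <= t / 2.
  rewrite /smooth_avg -/F -{1}(int_cst (dotv e x)) -(RintegralB mOm ie (ic _)).
  have ib := integrable_subr mOm ie (ic (dotv e x)).
  apply: le_trans (le_normr_Rintegral mOm ib) _.
  apply: le_trans Hs; rewrite -(int_cst (enorm e * _)).
  apply: le_Rintegral => //.
    by have := integrable_norm ib; apply.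
  move=> z _; rewrite -mulrBl normrM (ger0_norm (F0 z)).
  have [zc|zc] := pselect (cube (a - const_mx H) (a + const_mx H) z); last by rewrite F_out// !mulr0.
  rewrite ler_wpM2r// -dotvBr; apply: le_trans (norm_dotv_le _ _) _.
  by rewrite ler_wpM2l ?enorm_ge0// box_near.
have -> : smooth_avg eta Om (fun z => u z - dotv e z) H a =
    smooth_avg eta Om u H a - smooth_avg eta Om (dotv e) H a.
  rewrite /smooth_avg -(RintegralB mOm iu ie); congr Rintegral.
  by apply/funext => z; rewrite mulrBl.
have := ler_normB (smooth_avg eta Om u H a - u x) (smooth_avg eta Om (dotv e) H a - dotv e x).
rewrite [X in `|X|](_ : _ = smooth_avg eta Om u H a - smooth_avg eta Om (dotv e) H a - (u x - dotv e x)).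
  by move=> /le_trans; apply; lra.
by ring.
Qed.

End affine_good_points.

Lemma scaled_sum (F : fieldType) (n : nat) (g s t r : F) : r != 0 ->
  g * ((r ^+ n)^-1 * s) + g * ((r ^+ n)^-1 * t) = r * (g * ((r * r ^+ n)^-1 * (s + t))).
Proof. by move=> r0; field; rewrite expf_neq0 r0. Qed.

Lemma weighted_sum (F : comPzRingType) (g q s t r : F) :
  g * (r * (q * s) + r * (q * t)) = r * (g * (q * (s + t))).
Proof. by ring. Qed.

Section gradient_deviation.
Context (R : realType) (n : nat).
Local Notation V := 'rV[R]_n.+1.
Variables (Om : set V) (G : V -> V).
Hypotheses (mOm : measurable Om) (mG : mcoord G).

(** Extended by 0 outside the domain, so that integrals run over the whole space. *)
Definition gdev (e z : V) : R := \1_Om z * gsum (fun z => G z - e) z.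

Lemma gdev_ge0 e z : 0 <= gdev e z.
Proof. by rewrite mulr_ge0// gsum_ge0. Qed.

Lemma measurable_gdev dT (T : measurableType dT) (a b : T -> V) :
  measurable_fun setT a -> mcoord b -> measurable_fun setT (fun t => gdev (b t) (a t)).
Proof.
move=> ma mb; apply: measurable_funM.
  by apply: (measurableT_comp _ ma); exact: measurable_indic.
apply: measurable_sum => i; apply: measurableT_comp => //.
under eq_fun do rewrite !mxE; apply: measurable_funB; last exact: mb.
exact: (measurableT_comp (mG i) ma).
Qed.

End gradient_deviation.

Section remainder.
Context (R : realType) (n : nat).
Local Notation d := n.+1.
Local Notation V := 'rV[R]_d.
Local Notation mu := (@lebesgue_rV R n).
Variables (P eta : R -> R) (c : R).
Hypothesis mP : mollifier P eta c.
Variables (Om : set V) (eps : R).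
Hypotheses (heps : 0 < eps <= 1) (bOm : bounded_set Om) (dom : eps_infty_domain eps Om).
Variables (f : V -> R) (G : V -> V).
Hypotheses (mf : measurable_fun setT f) (mG : mcoord G).
Hypotheses (lf : locally_integrable_rV Om f)
  (lG : forall i, locally_integrable_rV Om (fun z => G z 0 i)) (wp : weak_pair Om f G).
Variables (rho : R -> R) (p CW : R).
Hypotheses (mrho : measurable_fun setT rho) (rho_ge0 : forall t, 0 <= rho t)
  (rho_le0 : forall t, t <= 0 -> rho t = 0) (p1 : 1 <= p).
Local Notation Lam := (chain_Lam n eps).
Local Notation W := (wfun n Lam).
Hypothesis W_mass : (\int[mu]_x (W (enorm x))%:E = CW%:E)%E.

(** Increased by 1 to be positive, as it is used as a divisor. *)
Definition chain_D : R := 2 * chain_C n c eps + 1.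
(** The constant of [jensen_powR] for a kernel of mass at most [2 * CW + 1], times the power [p] of
    [chain_D]. *)
Definition remainder_C : R := chain_D `^ p * (2 * (2 * (2 * CW + 1)) `^ (p - 1)).

Let oOm : open Om. Proof. by case: dom. Qed.
Let mOm : measurable Om. Proof. exact: measurable_open. Qed.
Let L0 : 0 < Lam. Proof. exact: chain_Lam_gt0. Qed.
Let mW : measurable_fun setT W. Proof. exact: measurable_wfun. Qed.
Let W0 t : 0 <= W t. Proof. exact: wfun_ge0. Qed.
Let CW0 : 0 <= CW.
Proof. by rewrite -lee_fin -W_mass; apply: integral_ge0 => z _; rewrite lee_fin. Qed.
Let D0 : 0 < chain_D.
Proof. by rewrite ltr_wpDl// mulr_ge0// (chain_C_ge0 n mP heps). Qed.
Let C0 : 0 <= remainder_C. Proof. by rewrite !mulr_ge0// powR_ge0. Qed.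

Local Notation gdev := (gdev Om G).

Definition remainder (x y : V) : R := `|f x - f y - dotv (G x) (x - y)| `^ p / enorm (x - y) `^ p.

(** The potential estimate is applied to [f] minus the linear function with slope [G x], whose weak
    gradient is [G - G x]. A factor [r] is split off the potential to cancel the denominator; the
    kernel left over has bounded mass, and Jensen's inequality moves the power [p] inside. *)
Lemma remainder_pointwise (x y : V) : Om x -> Om y -> x != y ->
  good_point eta Om f x -> good_point eta Om f y ->
  ((remainder x y * rho (enorm (x - y)))%:E <=
   remainder_C%:E * \int[mu]_z ((gdev (G x) z `^ p)%:E * krn rho W x z y))%E.
Proof.
move=> Ox Oy xy gx gy; set r := enorm (x - y).
have r0 : 0 < r by rewrite enorm_gt0 subr_eq0.
pose u z := f z - dotv (G x) z; pose H z := G z - G x.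
have lc i : locally_integrable_rV Om (fun _ : V => G x 0 i).
  by apply: locally_integrable_continuous => z; exact: cst_continuous.
have ld : locally_integrable_rV Om (dotv (G x) : V -> R).
  by apply: locally_integrable_continuous => //; exact: continuous_dotv.
have lu : locally_integrable_rV Om u by exact: locally_integrable_rVB.
have lH i : locally_integrable_rV Om (fun z => H z 0 i).
  have := locally_integrable_rVB mOm (lG i) (lc i).
  by rewrite (_ : (fun z => H z 0 i) = (fun z => G z 0 i - G x 0 i))//; apply/funext => z; rewrite !mxE.
have wu : weak_pair Om u H := weak_pairB mOm lf ld lG lc wp (weak_pair_affine (G x)).
have pe := potential_estimate mP heps dom lu lH wu Ox Oy xy
  (good_point_sub_affine mP (G x) oOm lf Ox gx) (good_point_sub_affine mP (G x) oOm lf Oy gy).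
have uE : u x - u y = f x - f y - dotv (G x) (x - y) by rewrite dotvBr /u; ring.
rewrite uE -/r in pe; set q := f x - f y - dotv (G x) (x - y) in pe *.
(* Normalised so that the potential estimate reads: [a] is at most the integral of [gdev (G x)]
   against [k]. *)
pose a := `|q| / (chain_D * r).
pose k z := (r ^+ d)^-1 * (W (enorm (z - x) / r) + W (enorm (z - y) / r)).
have rd0 : 0 <= (r ^+ d)^-1 by rewrite invr_ge0 exprn_ge0// ltW.
have k0 z : 0 <= k z by rewrite mulr_ge0// addr_ge0.
have mWz w : measurable_fun setT (fun z : V => W (enorm (z - w) / r)).
  apply: (measurableT_comp mW); apply: measurable_funM; last exact: measurable_cst.
  by apply: measurable_dist => //; exact: measurable_cst.
have mk : measurable_fun setT k.
  by apply: (measurable_funM (measurable_cst _)); exact: measurable_funD.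
have mg : measurable_fun setT (gdev (G x)).
  by apply: (@measurable_gdev _ _ _ _ mOm mG _ _ id (fun=> G x)) => //; exact: mcoord_cst.
have a0 : 0 <= a by rewrite divr_ge0// mulr_ge0 ?ltW.
have K0 : 0 < 2 * CW + 1 by rewrite ltr_wpDl// mulr_ge0.
have kK : (\int[mu]_z (k z)%:E <= (2 * CW + 1)%:E)%E.
  have mWE w : measurable_fun setT (fun z : V => (W (enorm (z - w) / r))%:E) by exact/measurable_EFinP.
  have WE0 w (z : V) : (0 <= (W (enorm (z - w) / r))%:E)%E by rewrite lee_fin.
  under eq_integral do rewrite EFinM EFinD.
  rewrite ge0_integralcM; last 3 first.
  - exact: emeasurable_funD.
  - by move=> z; rewrite adde_ge0.
  - by rewrite lee_fin.
  have IW w : (\int[mu]_z (W (enorm (z - w) / r))%:E = (r ^+ d * CW)%:E)%E.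
    by rewrite (integral_scaled w r0 mW W0) W_mass -EFinM.
  have := ge0_integral_add (mWE x) (mWE y) (WE0 x) (WE0 y); rewrite (IW x) (IW y) => ->.
  rewrite -EFinD -EFinM lee_fin.
  have rd : r ^+ d != 0 by rewrite expf_neq0// gt_eqF.
  rewrite -mulrDl mulrA; have -> : (r ^+ d)^-1 * (r ^+ d + r ^+ d) = 2 by field.
  by rewrite lerDl.
have aI : (a%:E <= \int[mu]_z (gdev (G x) z * k z)%:E)%E.
  have mgo : measurable_fun Om (gsum H) := measurable_gsum oOm lH (@subset_refl _ Om).
  have mp w : measurable_fun setT (fun z : V => (gdev (G x) z * ((r ^+ n)^-1 * W (enorm (z - w) / r)))%:E).
    by apply/measurable_EFinP; apply: (measurable_funM mg); apply: (measurable_funM (measurable_cst _)).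
  have p0 w (z : V) : (0 <= (gdev (G x) z * ((r ^+ n)^-1 * W (enorm (z - w) / r)))%:E)%E.
    by rewrite lee_fin mulr_ge0 ?gdev_ge0// mulr_ge0 ?W0// invr_ge0 exprn_ge0// ltW.
  have potE w : potential Om eps H r w =
      (\int[mu]_z (gdev (G x) z * ((r ^+ n)^-1 * W (enorm (z - w) / r)))%:E)%E.
    rewrite /potential integral_mkcond; apply: eq_integral => z _.
    rewrite patchE /gdev indicE; case: ifPn => zO; last by rewrite !mul0r.
    by rewrite mul1r.
  rewrite !potE -(ge0_integral_add (mp x) (mp y) (p0 x) (p0 y)) in pe.
  have mS : measurable_fun setT (fun z => (gdev (G x) z * k z)%:E).
    by apply/measurable_EFinP; exact: measurable_funM.
  have S0 z : (0 <= (gdev (G x) z * k z)%:E)%E by rewrite lee_fin mulr_ge0// gdev_ge0.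
  have sumE : (\int[mu]_z ((gdev (G x) z * ((r ^+ n)^-1 * W (enorm (z - x) / r)))%:E +
      (gdev (G x) z * ((r ^+ n)^-1 * W (enorm (z - y) / r)))%:E) =
      r%:E * \int[mu]_z (gdev (G x) z * k z)%:E)%E.
    have rE0 : (0 <= r%:E)%E by rewrite lee_fin ltW.
    rewrite -(ge0_integralcM mS S0 rE0); apply: eq_integral => z _.
    rewrite -EFinM -EFinD /k; congr (_%:E); rewrite exprS.
    exact: (scaled_sum n _ _ _ (lt0r_neq0 r0)).
  rewrite {}sumE in pe.
  have I0 : (0 <= \int[mu]_z (gdev (G x) z * k z)%:E)%E by exact: integral_ge0.
  have : (`|q|%:E <= (chain_D * r)%:E * \int[mu]_z (gdev (G x) z * k z)%:E)%E.
    apply: le_trans pe _; rewrite muleA -EFinM lee_wpmul2r// lee_fin ler_wpM2r ?(ltW r0)//.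
    by rewrite /chain_D lerDl.
  rewrite -lee_pdivrMl ?mulr_gt0//; apply: le_trans.
  by rewrite -EFinM lee_fin /a mulrC.
have jn := jensen_powR p1 mg mk (gdev_ge0 Om G (G x)) k0 K0 a0 kK aI.
have qE : remainder x y * rho r = chain_D `^ p * rho r * a `^ p.
  have Dr : 0 <= chain_D * r by rewrite mulr_ge0 ?ltW.
  have iv : (chain_D * r)^-1 `^ p = (chain_D `^ p * r `^ p)^-1.
    by rewrite -(powR_inv1 Dr) powRAC powR_inv1 ?powR_ge0// powRM ?ltW.
  rewrite /remainder -/q -/r /a powRM ?invr_ge0// iv.
  have h1 : chain_D `^ p != 0 by rewrite gt_eqF// powR_gt0.
  have h2 : r `^ p != 0 by rewrite gt_eqF// powR_gt0.
  by field; rewrite h1 h2.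
have DR0 : 0 <= chain_D `^ p * rho r by rewrite mulr_ge0// powR_ge0.
rewrite qE EFinM; apply: le_trans (lee_wpmul2l _ jn) _; first by rewrite lee_fin.
have mS : measurable_fun setT (fun z => ((gdev (G x) z) `^ p * k z)%:E).
  by apply/measurable_EFinP; apply: measurable_funM => //; exact: (measurableT_comp (measurable_powR p)).
have S0 z : (0 <= ((gdev (G x) z) `^ p * k z)%:E)%E by rewrite lee_fin mulr_ge0// powR_ge0.
have -> : (\int[mu]_z ((gdev (G x) z `^ p)%:E * krn rho W x z y) =
    (rho r)%:E * \int[mu]_z ((gdev (G x) z) `^ p * k z)%:E)%E.
  have rhoE : (0 <= (rho r)%:E)%E by rewrite lee_fin.
  rewrite -(ge0_integralcM mS S0 rhoE); apply: eq_integral => z _.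
  by rewrite /krn /kpart -/r -EFinD -!EFinM /k; congr (_%:E); exact: weighted_sum.
rewrite !muleA -!EFinM le_eqVlt; apply/orP; left; apply/eqP; congr (_%:E * _)%E.
by rewrite /remainder_C; ring.
Qed.

Lemma measurable_remainder dT (T : measurableType dT) (a b : T -> V) :
  measurable_fun setT a -> measurable_fun setT b ->
  measurable_fun setT (fun t => remainder (a t) (b t)).
Proof.
move=> ma mb; have mab : mcoord (fun t => a t - b t) by apply: mcoordB; exact: mcoord_comp.
have mpw (h : T -> R) : measurable_fun setT h -> measurable_fun setT (fun t => h t `^ p).
  by move=> mh; exact: (measurableT_comp (measurable_powR p) mh).
apply: measurable_funM; last first.
  apply: (measurableT_comp (@measurable_invr R)); apply: mpw.
  exact: measurable_enorm.
apply: mpw; apply: measurableT_comp => //; apply: measurable_funB.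
  by apply: measurable_funB; [exact: (measurableT_comp mf ma)|exact: (measurableT_comp mf mb)].
by apply: measurable_dotv => // i; exact: (measurableT_comp (mG i) ma).
Qed.

Lemma remainder_ge0 x y : 0 <= remainder x y.
Proof. by rewrite divr_ge0// powR_ge0. Qed.

Lemma measurable_gdev_krn (x : V) :
  measurable_fun setT (fun w : V * V => (gdev (G x) w.2 `^ p)%:E * krn rho W x w.2 w.1)%E.
Proof.
apply: emeasurable_funM; last by apply: measurable_krn => //; exact: measurable_cst.
apply/measurable_EFinP; apply: (measurableT_comp (measurable_powR p)).
by apply: (measurable_gdev mOm mG) => //; exact: mcoord_cst.
Qed.

(** The pointwise bound is integrated in [y], the bad points [y] and [y = x] forming a null set;
    Tonelli brings the integral in [y] onto the kernel. *)
Lemma remainder_le : {ae mu, forall x, Om x ->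
  (\int[mu]_y (\1_Om y * (remainder x y * rho (enorm (x - y))))%:E <=
   remainder_C%:E * \int[mu]_z ((gdev (G x) z `^ p)%:E * Qrn rho W x z))%E}.
Proof.
have good := ae_good_point mP oOm bOm lf.
apply: filterS (good) => x gx Ox; have {}gx := gx Ox.
have k0 y z : (0 <= (gdev (G x) z `^ p)%:E * krn rho W x z y)%E.
  by rewrite mule_ge0 ?krn_ge0// lee_fin powR_ge0.
have mk := measurable_gdev_krn x.
have mI : measurable_fun setT (fun y => \int[mu]_z ((gdev (G x) z `^ p)%:E * krn rho W x z y))%E.
  exact: (@measurable_integral _ _ _ _ (fun y z => (gdev (G x) z `^ p)%:E * krn rho W x z y)%E).
have I0 y : (0 <= \int[mu]_z ((gdev (G x) z `^ p)%:E * krn rho W x z y))%E by exact: integral_ge0.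
have -> : (\int[mu]_z ((gdev (G x) z `^ p)%:E * Qrn rho W x z) =
    \int[mu]_y \int[mu]_z ((gdev (G x) z `^ p)%:E * krn rho W x z y))%E.
  rewrite (integral_swap mk k0); apply: eq_integral => z _.
  rewrite ge0_integralcM ?lee_fin ?powR_ge0//; last by move=> y; exact: krn_ge0.
  by apply: measurable_krn => //; exact: measurable_cst.
rewrite -ge0_integralcM//.
have mr : measurable_fun setT (fun y => (\1_Om y * (remainder x y * rho (enorm (x - y))))%:E).
  apply/measurable_EFinP; apply: measurable_funM; first exact: measurable_indic.
  apply: measurable_funM; first by apply: measurable_remainder => //; exact: measurable_cst.
  by apply: (measurableT_comp mrho); apply: measurable_dist => //; exact: measurable_cst.
have mC : measurable_fun setT (fun y => remainder_C%:E *
    \int[mu]_z ((gdev (G x) z `^ p)%:E * krn rho W x z y))%E.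
  by apply: emeasurable_funM => //; exact: measurable_cst.
apply: (ae_ge0_le_integral measurableT _ mr _ mC).
- by move=> y _; rewrite lee_fin mulr_ge0// mulr_ge0// remainder_ge0.
- by move=> y _; rewrite mule_ge0// lee_fin.
move: good (ae_neq x); apply: filterS2 => y gy yx _.
have [Oy|Oy] := pselect (Om y); last by rewrite indicE memNset// mul0r mule_ge0// lee_fin.
rewrite indicE mem_set// mul1r; apply: remainder_pointwise => //; first by rewrite eq_sym.
exact: gy.
Qed.

End remainder.

(** * The norm of the potential *)

Section norm_potential.
Context (R : realType) (n : nat).
Local Notation d := n.+1.
Local Notation V := 'rV[R]_d.
Local Notation mu := (@lebesgue_rV R n).
Variables (rho W : R -> R) (Lam CW A : R).
Hypotheses (mrho : measurable_fun setT rho) (rho_ge0 : forall t, 0 <= rho t)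
  (rho_le0 : forall t, t <= 0 -> rho t = 0)
  (rho_decr : forall s t, 0 < s -> s <= t -> rho t <= rho s)
  (rho_mass : (\int[mu]_x (rho (enorm x))%:E = A%:E)%E).
Hypotheses (mW : measurable_fun setT W) (W_ge0 : forall t, 0 <= W t)
  (W_le0 : forall t, t <= 0 -> W t = 0)
  (W_decr : forall s t, 0 < s -> s <= t -> W t <= W s)
  (W_mass : (\int[mu]_x (W (enorm x))%:E = CW%:E)%E).
Variable Y : (V -> \bar R) -> \bar R.
Hypothesis bY : ball_Banach Y.
Variable CM : R.
Hypotheses (CM0 : 0 <= CM) (maxY : forall w : V -> \bar R, in_space (associate Y) w ->
  (associate Y (maximal_rV w) <= CM%:E * associate Y w)%E).

Definition potential_C : R := 2 ^+ d * (1 + 3 ^+ d + 3 ^+ d * (3 / 2) ^+ d) * (CW * A).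

(** In the pairing with [w] the two integrations are exchanged; [Qrn_maximal] then leaves [B]
    against the maximal function of [w], to which Holder's inequality and the bound on the associate
    norm apply. *)
Lemma norm_potential_le (B : V -> \bar R) (b : R) : measurable_fun setT B -> (forall z, 0 <= B z)%E ->
  Y B = b%:E ->
  (Y (fun x => \int[mu]_z (B z * Qrn rho W x z)) <= (potential_C * CM * b)%:E)%E.
Proof.
move=> mB B0 YB; have b0 : 0 <= b by rewrite -lee_fin -YB (norm_ge0 bY).
have CW0 : 0 <= CW by rewrite -lee_fin -W_mass; apply: integral_ge0 => z _; rewrite lee_fin.
have A0 : 0 <= A by rewrite -lee_fin -rho_mass; apply: integral_ge0 => z _; rewrite lee_fin.
have K0 : 0 <= potential_C by rewrite /potential_C !mulr_ge0// !addr_ge0// ?mulr_ge0 ?exprn_ge0.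
have Q0 x z : (0 <= Qrn rho W x z)%E by exact: Qrn_ge0.
have mQ : measurable_fun setT (fun v : V * V => Qrn rho W v.1 v.2).
  exact: (measurable_Qrn mrho rho_ge0 rho_le0 mW W_ge0 measurable_fst measurable_snd).
have mBQ : measurable_fun setT (fun v : V * V => B v.2 * Qrn rho W v.1 v.2)%E.
  by apply: emeasurable_funM => //; exact: (measurableT_comp mB measurable_snd).
apply: (norm_le_associate bY).
- by apply: (@measurable_integral _ _ _ _ (fun x z => B z * Qrn rho W x z)%E) => // x z; rewrite mule_ge0.
- by move=> x; apply: integral_ge0 => z _; rewrite mule_ge0.
- by rewrite !mulr_ge0.
move=> w mw w0 aw; have wE0 x : (0 <= (w x)%:E)%E by rewrite lee_fin.
have mwE : measurable_fun setT (EFin \o w) by exact/measurable_EFinP.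
have mM := measurable_maximal (EFin \o w).
have M0 := maximal_ge0 (EFin \o w).
have F0 x z : (0 <= B z * Qrn rho W x z * (w x)%:E)%E by rewrite !mule_ge0.
have mF : measurable_fun setT (fun v : V * V => B v.2 * Qrn rho W v.1 v.2 * (w v.1)%:E)%E.
  by apply: emeasurable_funM => //; exact: (measurableT_comp mwE measurable_fst).
have swapped : (\int[mu]_x (\int[mu]_z (B z * Qrn rho W x z) * (w x)%:E) =
    \int[mu]_z (B z * \int[mu]_x ((w x)%:E * Qrn rho W x z)))%E.
  have mBQx x : measurable_fun setT (fun z => B z * Qrn rho W x z)%E.
    exact: (@measurable_slice _ _ _ _ (fun x z => B z * Qrn rho W x z)%E).
  have BQ0 x z : (0 <= B z * Qrn rho W x z)%E by rewrite mule_ge0.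
  have mwQ z : measurable_fun setT (fun x => (w x)%:E * Qrn rho W x z)%E.
    apply: (emeasurable_funM mwE).
    exact: (measurable_Qrn mrho rho_ge0 rho_le0 mW W_ge0 (@measurable_id _ _ _) (measurable_cst z)).
  have wQ0 z x : (0 <= (w x)%:E * Qrn rho W x z)%E by rewrite mule_ge0.
  transitivity (\int[mu]_x \int[mu]_z (B z * Qrn rho W x z * (w x)%:E))%E.
    apply: eq_integral => x _; rewrite muleC -(ge0_integralcM (mBQx x) (BQ0 x) (wE0 x)).
    by apply: eq_integral => z _; rewrite muleC.
  rewrite (integral_swap mF F0); apply: eq_integral => z _.
  rewrite -(ge0_integralcM (mwQ z) (wQ0 z) (B0 z)).
  by apply: eq_integral => x _; rewrite -muleA (muleC (Qrn _ _ _ _)).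
have mK : measurable_fun setT (fun z => potential_C%:E * (maximal_rV (EFin \o w) z * B z))%E.
  by apply: emeasurable_funM; [exact: measurable_cst|exact: emeasurable_funM].
rewrite swapped; apply: (@le_trans _ _ (\int[mu]_z (potential_C%:E * (maximal_rV (EFin \o w) z * B z)))%E).
  apply: (le_ge0_integral _ mK).
  - apply: (emeasurable_funM mB).
    apply: (@measurable_integral _ _ _ _ (fun z x => (w x)%:E * Qrn rho W x z)%E) => [|z x]; last by rewrite mule_ge0.
    apply: emeasurable_funM; first exact: (measurableT_comp mwE measurable_snd).
    exact: (measurable_Qrn mrho rho_ge0 rho_le0 mW W_ge0 measurable_snd measurable_fst).
  - by move=> z; rewrite mule_ge0// integral_ge0// => x _; rewrite mule_ge0.
  move=> z; rewrite muleA muleC lee_wpmul2r//.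
  exact: (Qrn_maximal mrho rho_ge0 rho_le0 rho_decr rho_mass mW W_ge0 W_le0 W_decr W_mass z mwE wE0).
have mMB := emeasurable_funM mM mB.
have MB0 z : (0 <= maximal_rV (EFin \o w) z * B z)%E by rewrite mule_ge0.
have KE0 : (0 <= potential_C%:E)%E by rewrite lee_fin.
rewrite (ge0_integralcM mMB MB0 KE0) -(mulrA potential_C) (EFinM potential_C (CM * b)) -muleA.
apply: (lee_wpmul2l KE0).
have YBo : (Y B < +oo)%E by rewrite YB ltry.
have := holder_associate bY mB mM YBo.
rewrite (eq_integral (fun z => maximal_rV (EFin \o w) z * B z)%E); last first.
  by move=> z _; rewrite gee0_abs// mule_ge0.
move=> /le_trans; apply; rewrite YB (mulrC CM) (EFinM b CM) -muleA.
by rewrite lee_wpmul2l ?lee_fin//; apply: maxY.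
Qed.

End norm_potential.

(** * Radial weights, their heads and tails *)

Section radial_kernel.
Context (R : realType) (n : nat).
Local Notation d := n.+1.
Local Notation V := 'rV[R]_d.
Local Notation mu := (@lebesgue_rV R n).
Local Notation lam := (@lebesgue_measure R).

(** Surface area of the unit sphere, as the dimension times the volume of the punctured unit
    ball. *)
Definition area : R := d%:R * fine (mu (@annulus R n false 1)).

Lemma area_ge0 : 0 <= area.
Proof. by rewrite mulr_ge0// fine_ge0. Qed.

(** The polar formula for the constant weight, homogeneous of degree 0. *)
Lemma radial_integral (u : R -> R) :
  measurable_fun setT u -> (forall t, 0 <= u t) -> (forall t, t <= 0 -> u t = 0) ->
  (forall s t, 0 < s -> s <= t -> u t <= u s) ->
  (\int[mu]_x (u (enorm x))%:E = area%:E * \int[lam]_r (u r * r ^+ n)%:E)%E.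
Proof.
move=> mu_ u0 un ud.
have hom (c : R) (x : V) : 0 < c -> (1 : R) = c `^ 0 * 1 by rewrite powRr0 mulr1.
have m1 : measurable_fun setT (fun _ : V => 1 : R) by exact: measurable_cst.
have annE : (\int[mu]_(x in annulus false 1) 1%:E = (fine (mu (@annulus R n false 1)))%:E)%E.
  rewrite integral_cst ?mul1e; last exact: measurable_annulus.
  by rewrite fineK// ge0_fin_numE// annulus_fin.
have := @polar R n (fun=> 1) 0 m1 (fun=> ler01) hom _ u (lexx _) annE mu_ u0 un ud.
under eq_integral do rewrite mul1e.
move=> ->; rewrite add0r; congr (_ * _)%E; apply: eq_integral => r _.
have [r0|r0] := leP r 0; first by rewrite (un _ r0) mul0r mule0.
by rewrite add0r -EFinM powR_mulrn ?(ltW r0)// mulrC.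
Qed.

Variable rho : R -> R.
Hypotheses (mrho : measurable_fun setT rho) (rho_ge0 : forall t, 0 <= rho t)
  (rho_le0 : forall t, t <= 0 -> rho t = 0)
  (rho_decr : forall s t, 0 < s -> s <= t -> rho t <= rho s)
  (rho_mass1 : (\int[lam]_(r in `]0%R, +oo[) (rho r * r ^+ n)%:E = 1)%E).

(** The head of a decreasing weight is decreasing, so the polar formulas apply to it; the tail
    vanishes near 0, is not decreasing, and is reached by subtraction. *)
Definition head (dl t : R) : R := rho t * \1_(`]-oo, dl]%classic) t.

Lemma head_decr dl s t : 0 < s -> s <= t -> head dl t <= head dl s.
Proof.
move=> s0 st; rewrite /head !indicE !mem_setE !in_itv/=.
have [tl|_] := leP t dl; last by rewrite mulr0 mulr_ge0.
by rewrite (le_trans st tl) !mulr1 rho_decr.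
Qed.

Lemma measurable_head dl : measurable_fun setT (head dl).
Proof. by apply: (measurable_funM mrho); exact: measurable_indic. Qed.

Lemma head_ge0 dl t : 0 <= head dl t.
Proof. by rewrite mulr_ge0. Qed.

Lemma head_le0 dl t : t <= 0 -> head dl t = 0.
Proof. by move=> t0; rewrite /head rho_le0// mul0r. Qed.

Let mr (D : set R) : measurable_fun D (fun r : R => (rho r * r ^+ n)%:E).
Proof.
apply/measurable_EFinP; apply: measurable_funM; first exact: measurable_funTS.
exact: measurable_funX.
Qed.

Let r0 (r : R) : (0 <= (rho r * r ^+ n)%:E)%E.
Proof.
rewrite lee_fin; have [r0|r0] := leP r 0; first by rewrite rho_le0// mul0r.
by rewrite mulr_ge0// exprn_ge0// ltW.
Qed.

Lemma radial_mass : (\int[mu]_x (rho (enorm x))%:E = area%:E)%E.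
Proof.
rewrite radial_integral// -[RHS]mule1; congr (_ * _)%E; rewrite -rho_mass1 [RHS]integral_mkcond.
apply: eq_integral => r _; rewrite patchE; case: ifPn => // rn.
rewrite rho_le0 ?mul0r// leNgt; apply/negP => rp; move: rn.
by rewrite mem_set//= in_itv/= rp.
Qed.

Lemma head_tail_mass dl : 0 < dl ->
  (\int[lam]_r (head dl r * r ^+ n)%:E + \int[lam]_(r in `]dl, +oo[) (rho r * r ^+ n)%:E = 1)%E.
Proof.
move=> d0; rewrite -rho_mass1.
have -> : (`]0, +oo[%classic : set R) = `]0, dl]%classic `|` `]dl, +oo[%classic.
  by apply/seteqP; split => r /=; rewrite !in_itv/= ?andbT; case: (ltP 0 r) => h1; case: (leP r dl) => h2; rewrite /= ?andbT ?andbF; tauto || (move=> [] //; lra).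
rewrite ge0_integral_setU//; last first.
- apply/disj_set2P; apply/seteqP; split => // r [] /=; rewrite !in_itv/= andbT => /andP[_ h1] h2.
  by move: (le_lt_trans h1 h2); rewrite ltxx.
- exact: mr.
congr (_ + _)%E; rewrite [RHS]integral_mkcond; apply: eq_integral => r _.
rewrite patchE /head indicE mem_setE; case: ifPn => [|rn].
  by rewrite inE/= !in_itv/= => /andP[_ ->]; rewrite mulr1.
have [rp|rp] := leP r 0; first by rewrite rho_le0// !mul0r.
rewrite (_ : (r \in `]-oo, dl]) = false) ?mulr0 ?mul0r//.
by apply/negbTE; apply: contra rn; rewrite inE/= !in_itv/= rp.
Qed.

Lemma head_mass dl : 0 < dl -> (\int[lam]_r (head dl r * r ^+ n)%:E =
  1 - \int[lam]_(r in `]dl, +oo[) (rho r * r ^+ n)%:E)%E.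
Proof.
move=> d0; rewrite -(head_tail_mass d0) addeK// ge0_fin_numE; last exact: integral_ge0.
apply: (@le_lt_trans _ _ 1%E); last exact: ltry.
by rewrite -(head_tail_mass d0) leeDr// integral_ge0// => r _; rewrite lee_fin /head; have := r0 r; rewrite lee_fin mulrAC => h; rewrite mulr_ge0.
Qed.

Lemma tail_mass dl : 0 < dl -> (\int[mu]_x (rho (enorm x) * (dl < enorm x)%R%:R)%:E =
  area%:E * \int[lam]_(r in `]dl, +oo[) (rho r * r ^+ n)%:E)%E.
Proof.
move=> d0; set t := (X in (_ = _ * X)%E).
have t0 : (0 <= t)%E by apply: integral_ge0.
have h0 : (0 <= \int[lam]_r (head dl r * r ^+ n)%:E)%E.
  apply: integral_ge0 => r _; have := r0 r; rewrite !lee_fin /head mulrAC => h.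
  by rewrite mulr_ge0.
have ht := head_tail_mass d0; rewrite -/t in ht.
have tf : t \is a fin_num.
  by rewrite ge0_fin_numE// (@le_lt_trans _ _ 1%E) ?ltry// -ht leeDr.
have hf : (\int[lam]_r (head dl r * r ^+ n)%:E)%E \is a fin_num.
  by rewrite ge0_fin_numE// (@le_lt_trans _ _ 1%E) ?ltry// -ht leeDl.
have me := @measurable_enorm_id R n.
have mh : measurable_fun setT (fun x : V => (head dl (enorm x))%:E).
  by apply/measurable_EFinP; exact: (measurableT_comp (measurable_head dl) me).
have split_ x : rho (enorm x) * (dl < enorm x)%R%:R = rho (enorm x) - head dl (enorm x) :> R.
  by rewrite /head indicE mem_setE in_itv/= ltNge; case: (_ <= dl)%R; rewrite ?mulr0 ?mulr1 ?subrr ?subr0.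
have mt : measurable_fun setT (fun x : V => (rho (enorm x) * (dl < enorm x)%R%:R)%:E).
  under eq_fun do rewrite split_.
  apply/measurable_EFinP; apply: measurable_funB; first exact: (measurableT_comp mrho me).
  exact: (measurableT_comp (measurable_head dl) me).
have sum : (\int[mu]_x (head dl (enorm x))%:E +
    \int[mu]_x (rho (enorm (x : V)) * (dl < enorm x)%R%:R)%:E = area%:E)%E.
  rewrite -radial_mass -(ge0_integral_add mh mt) => [|x|x]; last 2 first.
  - by rewrite lee_fin head_ge0.
  - by rewrite lee_fin mulr_ge0.
  by apply: eq_integral => x _; rewrite split_ -EFinD addrC subrK.
rewrite (radial_integral (measurable_head dl) (head_ge0 dl) (head_le0 dl)) in sum; last exact: head_decr.
move: sum; rewrite -[X in _ = X -> _]mule1 -ht.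
rewrite -(fineK tf) -(fineK hf) -EFinD -!EFinM mulrDr EFinD.
set a := (area * _)%:E => h; have af : a \is a fin_num by [].
by rewrite -[LHS](addeK _ af) (addeC _ a) h (addeC a) addeK.
Qed.

End radial_kernel.

(** * The linear part in polar coordinates *)

Section directional_kernel.
Context (R : realType) (n : nat).
Local Notation d := n.+1.
Local Notation V := 'rV[R]_d.
Local Notation mu := (@lebesgue_rV R n).
Local Notation lam := (@lebesgue_measure R).
Variables (p : R) (e1 : V).
Hypotheses (p1 : 1 <= p) (unit_e1 : enorm e1 = 1).
Local Notation k := (fine (kappa p e1)).

Let p0 : 0 < p. Proof. exact: lt_le_trans ltr01 p1. Qed.

(** Independence of the direction is read off the closed formula. *)
Lemma kappa_unit (e : V) : enorm e = 1 -> kappa p e = k%:E.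
Proof. by move=> e_1; rewrite (kappa_formula p1 e_1) (kappa_formula p1 unit_e1). Qed.

Lemma kappa_ge0 : 0 <= k.
Proof.
apply: fine_ge0; rewrite kappaE mule_ge0 ?lee_fin//.
by apply: integral_ge0 => x _; rewrite lee_fin dirw_ge0.
Qed.

(** Homogeneity in [e] reduces to a unit vector, the case [e = 0] being separate. *)
Lemma dir_integral (e : V) (u : R -> R) :
  measurable_fun setT u -> (forall t, 0 <= u t) -> (forall t, t <= 0 -> u t = 0) ->
  (forall s t, 0 < s -> s <= t -> u t <= u s) ->
  (\int[mu]_x (dirw p e x * u (enorm x))%:E =
   (enorm e `^ p * k)%:E * \int[lam]_r (u r * r ^+ n)%:E)%E.
Proof.
move=> mu_ u0 un ud; have [->|en0] := eqVneq e 0.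
  rewrite enorm0 powR0 ?gt_eqF// mul0r mul0e integral0_eq// => x _.
  by rewrite /dirw (_ : dotv 0 x = 0) ?normr0 ?powR0 ?mul0r ?gt_eqF// /dotv big1// => i _; rewrite mxE mul0r.
have e0 : 0 < enorm e by rewrite enorm_gt0.
pose e' := (enorm e)^-1 *: e.
have u' : enorm e' = 1 by rewrite enormZ gtr0_norm ?invr_gt0// mulVf// gt_eqF.
have m' : measurable_fun setT (fun x : V => (dirw p e' x)%:E * (u (enorm x))%:E)%E.
  apply: emeasurable_funM; apply/measurable_EFinP; first exact: dirw_measurable.
  exact: (measurableT_comp mu_ (@measurable_enorm_id R n)).
have n' x : (0 <= (dirw p e' x)%:E * (u (enorm x))%:E)%E.
  by rewrite mule_ge0 ?lee_fin ?dirw_ge0 ?u0.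
have ep : (0 <= (enorm e `^ p)%:E)%E by rewrite lee_fin powR_ge0.
transitivity ((enorm e `^ p)%:E * \int[mu]_x ((dirw p e' x)%:E * (u (enorm x))%:E))%E.
  rewrite -(ge0_integralcM m' n' ep); apply: eq_integral => x _.
  rewrite -!EFinM mulrA; congr (_ * _)%:E.
  rewrite /dirw mulrA -powRM ?enorm_ge0// /e' dotvZl normrM gtr0_norm ?invr_gt0//.
  by rewrite mulrA mulfV ?mul1r// gt_eqF.
rewrite (polar_kappa p1 e' mu_ u0 un ud) (kappa_unit u') EFinM -muleA; congr (_ * (_ * _))%E.
apply: eq_integral => r _; have [r0|r0] := leP r 0; first by rewrite (un _ r0) mul0r mule0.
by rewrite -EFinM powR_mulrn ?(ltW r0)// mulrC.
Qed.

Lemma dir_integral_rev (e x : V) (u : R -> R) :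
  measurable_fun setT u -> (forall t, 0 <= u t) ->
  (\int[mu]_y (dirw p e (x - y) * u (enorm (x - y)))%:E =
   \int[mu]_y (dirw p e y * u (enorm y))%:E)%E.
Proof.
move=> mu_ u0.
have m' : measurable_fun setT (fun y : V => (dirw p e y * u (enorm y))%:E).
  apply/measurable_EFinP; apply: measurable_funM; first exact: dirw_measurable.
  exact: (measurableT_comp mu_ (@measurable_enorm_id R n)).
rewrite -(integral_translate (- x) m'); apply: eq_integral => y _.
by rewrite /dirw -[x - y]opprB enormN -scaleN1r dotvZr mulN1r normrN.
Qed.

Definition linear_part (e x y : V) : R := `|dotv e (x - y)| `^ p / enorm (x - y) `^ p.

Variables (Om : set V) (rho : R -> R).
Hypothesis mOm : measurable Om.
Hypotheses (mrho : measurable_fun setT rho) (rho_ge0 : forall t, 0 <= rho t)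
  (rho_le0 : forall t, t <= 0 -> rho t = 0)
  (rho_decr : forall s t, 0 < s -> s <= t -> rho t <= rho s)
  (rho_mass1 : (\int[lam]_(r in `]0%R, +oo[) (rho r * r ^+ n)%:E = 1)%E).

Let mdir (e x : V) (u : R -> R) : measurable_fun setT u ->
  measurable_fun setT (fun y : V => (dirw p e (x - y) * u (enorm (x - y)))%:E).
Proof.
move=> mu_; have mc : mcoord (fun y : V => x - y) by apply: mcoordB; [exact: mcoord_cst|exact: mcoord_id].
apply/measurable_EFinP; apply: measurable_funM; last first.
  by apply: (measurableT_comp mu_); exact: measurable_enorm.
apply: measurable_funM.
  apply: (measurableT_comp (measurable_powR p)); apply: measurableT_comp => //.
  by apply: measurable_dotv => //; exact: mcoord_cst.
apply: (measurableT_comp (@measurable_invr R)); apply: (measurableT_comp (measurable_powR p)).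
exact: measurable_enorm.
Qed.

Let mdirO (e x : V) : measurable_fun setT
  (fun y : V => (\1_Om y * (linear_part e x y * rho (enorm (x - y))))%:E).
Proof.
apply/measurable_EFinP; apply: measurable_funM; first exact: measurable_indic.
exact/measurable_EFinP/mdir.
Qed.

Lemma linear_part_le (e x : V) :
  (\int[mu]_y (\1_Om y * (linear_part e x y * rho (enorm (x - y))))%:E <= (enorm e `^ p * k)%:E)%E.
Proof.
have h := dir_integral e mrho rho_ge0 rho_le0 rho_decr.
have r1 : (\int[lam]_r (rho r * r ^+ n)%:E = 1)%E.
  rewrite -rho_mass1 [RHS]integral_mkcond; apply: eq_integral => r _.
  rewrite patchE; case: ifPn => // rn; rewrite rho_le0 ?mul0r// leNgt; apply/negP => rp; move: rn.
  by rewrite mem_set//= in_itv/= rp.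
rewrite r1 mule1 in h; rewrite -h -(dir_integral_rev e x mrho rho_ge0).
apply: (le_ge0_integral (mdirO e x) (mdir e x mrho)) => y.
  by rewrite lee_fin !mulr_ge0// ?invr_ge0 powR_ge0.
by rewrite lee_fin ler_piMl ?indic_le1// mulr_ge0// dirw_ge0.
Qed.

(** Only the head of the weight is kept: its support about [x] lies in the ball, hence in the
    domain, so the polar formula for the whole space is exact for it. *)
Lemma le_linear_part (e x : V) (r dl : R) : 0 < dl -> dl < r -> eball x r `<=` Om ->
  ((enorm e `^ p * k)%:E * (1 - \int[lam]_(r in `]dl, +oo[) (rho r * r ^+ n)%:E) <=
   \int[mu]_y (\1_Om y * (linear_part e x y * rho (enorm (x - y))))%:E)%E.
Proof.
move=> d0 dr xO; have mh := measurable_head mrho dl.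
rewrite -(head_mass mrho rho_ge0 rho_le0 rho_mass1 d0).
rewrite -(dir_integral e mh (head_ge0 rho_ge0 dl) (head_le0 rho_le0 dl)); last first.
  by move=> s t; exact: head_decr.
rewrite -(dir_integral_rev e x mh (head_ge0 rho_ge0 dl)).
apply: (le_ge0_integral (mdir e x mh) (mdirO e x)) => y.
  by rewrite lee_fin mulr_ge0 ?dirw_ge0// head_ge0.
rewrite lee_fin /head mulrA [leLHS]mulrC indicE mem_setE in_itv/=.
have [yd|_] := leP (enorm (x - y)) dl; last by rewrite mul0r !mulr_ge0// ?invr_ge0 powR_ge0.
by rewrite mul1r indicE mem_set ?mul1r//; apply: xO; rewrite /eball/= enorm_distC (le_lt_trans yd).
Qed.

End directional_kernel.

(** * The norm of X, its restriction and its convexification *)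

Section convexified_norm.
Context (R : realType) (n : nat).
Local Notation V := 'rV[R]_n.+1.
Local Notation mu := (@lebesgue_rV R n).
Variables (X : (V -> \bar R) -> \bar R) (p : R) (Om : set V).
Hypotheses (bX : ball_Banach X) (acn : absolutely_continuous_norm X) (p1 : 1 <= p) (mOm : measurable Om).
Local Notation Y := (convexification p^-1 X).
Local Open Scope ereal_scope.

Let p0 : (0 < p)%R. Proof. exact: lt_le_trans ltr01 p1. Qed.
Let pi0 : (0 < p^-1)%R. Proof. by rewrite invr_gt0. Qed.

Lemma poweRK (x : \bar R) : 0 <= x -> (x `^ p) `^ p^-1 = x.
Proof. by move=> x0; rewrite -poweRrM mulfV ?gt_eqF// poweRe1. Qed.

Lemma poweRVK (x : \bar R) : 0 <= x -> (x `^ p^-1) `^ p = x.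
Proof. by move=> x0; rewrite -poweRrM mulVf ?gt_eqF// poweRe1. Qed.

Lemma measurable_poweRf (q : R) (F : V -> \bar R) : measurable_fun setT F ->
  measurable_fun setT (fun x => F x `^ q).
Proof. by move=> mF; exact: (measurableT_comp (measurable_poweR q)). Qed.

Lemma norm_convexification (F : V -> \bar R) : measurable_fun setT F -> (forall x, 0 <= F x) ->
  X F = (Y (fun x => F x `^ p)) `^ p^-1.
Proof.
move=> mF F0; rewrite /convexification invrK poweRK; last first.
  apply: (norm_ge0 bX); apply: measurable_poweRf; apply: measurableT_comp => //.
  exact: measurable_poweRf.
by congr X; apply/funext => x; rewrite gee0_abs ?poweR_ge0// poweRK.
Qed.

(** By the lattice property no extension has a smaller norm than the extension by 0. *)
Lemma restrict_normE (F : V -> \bar R) : measurable_fun setT (fun x => F x * (\1_Om x)%:E) ->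
  (forall x, 0 <= F x) -> restrict_norm X Om F = X (fun x => F x * (\1_Om x)%:E).
Proof.
move=> mF F0; apply/eqP; rewrite eq_le; apply/andP; split.
  have [Xo|Xo] := ltP (X (fun x => F x * (\1_Om x)%:E)) +oo; last first.
    by rewrite (le_trans _ Xo)// leey.
  apply: ereal_inf_lbound; exists (fun x => F x * (\1_Om x)%:E) => //; split => //.
  by apply: nearW => x Ox; rewrite /= indicE mem_set// mule1.
apply: le_ereal_inf_tmp => _ [g [[mg _] Fg] <-].
apply: (qnorm_lattice (ball_Banach_quasi bX) mg mF); apply: filterS Fg => x Fg.
have [Ox|Ox] := pselect (Om x); first by rewrite indicE mem_set// mule1 Fg.
by rewrite indicE memNset// mule0 abse0 abse_ge0.
Qed.

Lemma convexification_fin (g : V -> \bar R) : in_space X g -> Y (fun x => `|g x| `^ p) < +oo.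
Proof.
move=> [mg Xg]; rewrite /convexification invrK; apply: poweR_lty.
apply: le_lt_trans Xg; apply: (norm_le bX) => //.
  apply: measurable_poweRf; apply: measurableT_comp => //; apply: measurable_poweRf.
  exact: measurableT_comp.
by move=> x; rewrite (gee0_abs (poweR_ge0 `|g x| p)) poweRK ?abse_ge0// abse_id.
Qed.

(** Absolute continuity in [X], applied to the power [1/p] of [B]; an indicator is its own power. *)
Lemma convexification_acn (B : V -> \bar R) (E : nat -> set V) :
  measurable_fun setT B -> (forall x, 0 <= B x) -> Y B < +oo ->
  (forall j, measurable (E j)) ->
  {ae mu, forall x, (\1_(E j) x : R) @[j --> \oo] --> (0 : R)%R} ->
  forall eta : R, (0 < eta)%R -> exists N, forall j, (N <= j)%N ->
    Y (fun x => B x * (\1_(E j) x)%:E) <= eta%:E.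
Proof.
move=> mB B0 YB mE cE eta eta0; pose g x := B x `^ p^-1.
have mg : measurable_fun setT g by exact: measurable_poweRf.
have Xg : X g < +oo.
  apply: (@lty_poweRy _ _ p); first by rewrite gt_eqF.
  move: YB; rewrite /convexification invrK.
  have -> : (fun x => `|B x| `^ p^-1) = g by apply/funext => x; rewrite gee0_abs.
  by [].
have cv := acn (conj mg Xg) mE cE.
have e1 : (0 < eta `^ p^-1)%R by rewrite powR_gt0.
have /fine_cvgP[[N1 _ finN] /cvgrPdist_le /(_ _ e1) [N2 _ hN]] := cv.
exists (maxn N1 N2) => j; rewrite geq_max => /andP[j1 j2].
have mgE : measurable_fun setT (fun x => g x * (\1_(E j) x)%:E).
  by apply: emeasurable_funM => //; apply/measurable_EFinP; exact: measurable_indic.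
have Xge : 0 <= X (fun x => g x * (\1_(E j) x)%:E) by exact: (norm_ge0 bX).
have Xle : X (fun x => g x * (\1_(E j) x)%:E) <= (eta `^ p^-1)%:E.
  rewrite -(fineK (finN j j1)) lee_fin.
  by have := hN j j2; rewrite /= sub0r normrN ger0_norm// fine_ge0.
rewrite /convexification invrK.
have -> : eta%:E = (eta `^ p^-1)%:E `^ p by rewrite -poweR_EFin poweRVK// lee_fin ltW.
apply: gt0_ler_poweR; rewrite ?(ltW p0)// ?in_itv/= ?leey ?andbT//.
- apply: (norm_ge0 bX); apply: measurable_poweRf; apply: measurableT_comp => //.
  by apply: emeasurable_funM => //; apply/measurable_EFinP; exact: measurable_indic.
- by rewrite lee_fin powR_ge0.
apply: le_trans Xle; rewrite le_eqVlt; apply/orP; left; apply/eqP; congr X; apply/funext => x.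
rewrite /g indicE; case: (_ \in _); first by rewrite !mule1 gee0_abs.
by rewrite !mule0 abse0 poweR0r// gt_eqF.
Qed.

End convexified_norm.

(** * Lipschitz mollifications of bounded functions *)

Section lipschitz_mollification.
Context (R : realType) (n : nat).
Local Notation d := n.+1.
Local Notation V := 'rV[R]_d.
Local Notation mu := (@lebesgue_rV R n).
Variables (P eta : R -> R) (c : R).
Hypothesis mP : mollifier P eta c.

(** Factors are exchanged one at a time, the others being at most [M]; as [M >= 1], one power of it
    serves for every term. *)
Lemma norm_prod_diff_le (I : Type) (s : seq I) (A B : I -> R) (M : R) : 1 <= M ->
  (forall i, `|A i| <= M) -> (forall i, `|B i| <= M) ->
  `|\prod_(i <- s) A i - \prod_(i <- s) B i| <= M ^+ size s * \sum_(i <- s) `|A i - B i|.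
Proof.
move=> M1 AM BM; have M0 : 0 <= M := le_trans ler01 M1.
elim: s => [|i s IH]; first by rewrite !big_nil subrr normr0 mulr0.
have PA : `|\prod_(i <- s) A i| <= M ^+ size s.
  elim: (s) => [|j t IHt]; first by rewrite big_nil normr1.
  by rewrite big_cons normrM exprS ler_pM.
rewrite !big_cons /=; set pa := \prod_(_ <- _) _ in PA IH *; set pb := \prod_(_ <- _) _ in IH *.
have -> : A i * pa - B i * pb = (A i - B i) * pa + B i * (pa - pb) by ring.
apply: le_trans (ler_normD _ _) _; rewrite !normrM mulrDr; apply: lerD.
  rewrite mulrC ler_wpM2r//; apply: le_trans PA _; rewrite exprS ler_peMl// exprn_ge0//.
by rewrite exprS -mulrA ler_pM.
Qed.

Lemma mollifier_lipschitz : exists2 K, 0 <= K & forall s t, `|eta s - eta t| <= K * `|s - t|.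
Proof.
have se : smooth1 eta := smooth1_derive (moll_smooth mP) (moll_derive mP).
have ce := smooth1_continuous se.
have [U U0 dU] := se; have de (t : R) : is_derive t 1 eta (U 1%N t) by rewrite -U0; exact: dU.
have se' := smooth1_derive se de.
have e0 t : ~~ (-1 <= t <= 1) -> eta t = 0.
  move=> h; apply: (moll_supp mP); rewrite leNgt; apply: contra h; rewrite ltr_norml => /andP[h1 h2].
  by rewrite !ltW.
have [K K0 hK] := smooth1_bounded (smooth1_continuous se') (derive_out de e0).
exists K => // s t; wlog st : s t / s <= t.
  by move=> h; case: (leP s t) => [|/ltW] /h//; rewrite distrC [X in _ <= _ * X]distrC.
have [r _ hr] := MVT_segment st (fun x _ => de x) (continuous_subspaceT ce).
by rewrite distrC [X in _ <= _ * X]distrC hr normrM ler_wpM2r.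
Qed.

Definition mollified (h : R) (g : V -> R) (x : V) : R :=
  (\int[mu]_z (g z * phi eta h (x - const_mx h) z))%R.

Variables (B : set V) (g : V -> R) (N h : R).
Hypotheses (mB : measurable B) (finB : (mu B < +oo)%E) (mg : measurable_fun setT g)
  (gN : forall z, `|g z| <= N * \1_B z) (N0 : 0 <= N) (h0 : 0 < h) (h1 : h <= 1).

Let F (x : V) : V -> R := phi eta h (x - const_mx h).
Let F0 x z : 0 <= F x z. Proof. exact: (phi_ge0 mP). Qed.
Let cm (x : V) i : continuous (mol eta h ((x - const_mx h) 0 i)). Proof. exact: (continuous_mol mP). Qed.
Let supF (x : V) : supp_in (fun i => mol eta h ((x - const_mx h) 0 i))
  (x - const_mx h - const_mx h) (x - const_mx h + const_mx h). Proof. exact: (supp_mol mP). Qed.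
Let gN' z : `|g z| <= N.
Proof. by apply: le_trans (gN z) _; rewrite ler_piMr ?indic_le1. Qed.

Let lc (q : R) : locally_integrable_rV setT (fun _ : V => q).
Proof. by apply: locally_integrable_continuous => z; exact: cst_continuous. Qed.

Let iF (x : V) (q : R) : mu.-integrable setT (EFin \o (fun z => q * F x z)).
Proof.
have := integrable_prodfun measurableT (lc q) (fun i => @cm x i) (supF (x := x)).
by apply.
Qed.

Let mF (x : V) : measurable_fun setT (F x).
Proof. by apply: continuous_measurable_rV; exact: (continuous_phi mP). Qed.

Let igF (x : V) : mu.-integrable setT (EFin \o (fun z => g z * F x z)).
Proof.
apply: (le_integrable measurableT _ _ (iF x N)).
  by apply/measurable_EFinP; exact: measurable_funM.
by move=> z _; rewrite /= lee_fin !normrM (ger0_norm N0) ler_wpM2r.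
Qed.

Let intF x (q : R) : (\int[mu]_z (q * F x z))%R = q.
Proof.
have i1 : mu.-integrable setT (EFin \o F x).
  by have := iF x 1; apply: eq_integrable => // z _; rewrite /= mul1r.
by rewrite RintegralZl// /Rintegral (integral_phi mP _ h0)/= mulr1.
Qed.

Lemma mollified_le x : `|mollified h g x| <= N.
Proof.
apply: le_trans (le_normr_Rintegral measurableT (igF x)) _; rewrite -[leRHS](intF x).
apply: (le_Rintegral measurableT _ (iF x N)); first by have := integrable_norm (igF x); apply.
by move=> z _; rewrite normrM (ger0_norm (F0 x z)) ler_wpM2r.
Qed.

Lemma mollified_dev x : (`|mollified h g x - g x|%:E <= \int[mu]_z dev eta h g (x, z))%E.
Proof.
rewrite -[X in `|_ - X|](intF x) /mollified -(RintegralB measurableT (igF x) (iF x (g x))).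
have ib := integrable_subr measurableT (igF x) (iF x (g x)).
have := le_normr_Rintegral measurableT ib; rewrite -lee_fin => /le_trans; apply.
rewrite -EFin_Rintegral//; last by have := integrable_norm ib; apply.
rewrite le_eqVlt; apply/orP; left; apply/eqP; apply: eq_integral => z _.
by rewrite /dev -mulrBl normrM (ger0_norm (F0 x z)).
Qed.

(** The kernel is Lipschitz in its centre, and [g] is bounded and lives on a set of finite
    measure. *)
Lemma mollified_lipschitz : exists2 L, 0 <= L &
  forall x y, `|mollified h g x - mollified h g y| <= L * enorm (x - y).
Proof.
have [K K0 lipK] := mollifier_lipschitz; have c1 : 1 <= c := moll_c mP; have c0 : 0 <= c := le_trans ler01 c1.
pose M := c / h; have M1 : 1 <= M by rewrite ler_pdivlMr// mul1r (le_trans h1).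
have M0 : 0 <= M := le_trans ler01 M1.
have Fdiff x y z : `|F x z - F y z| <= M ^+ d * (d%:R * (K / (h * h))) * enorm (x - y).
  have bnd (w : V) i : `|mol eta h ((w - const_mx h) 0 i) (z 0 i)| <= M.
    rewrite /mol normrM ger0_norm ?invr_ge0 ?(ltW h0)// ger0_norm ?(moll_ge0 mP)//.
    by rewrite mulrC /M ler_wpM2r ?invr_ge0 ?(ltW h0)// (moll_le mP).
  apply: le_trans (norm_prod_diff_le _ M1 (bnd x) (bnd y)) _.
  rewrite -mulrA; have -> : size (index_enum 'I_d) = d by rewrite -[RHS]card_ord cardT enumT.
  rewrite ler_wpM2l ?exprn_ge0//; apply: (@le_trans _ _ (\sum_(i < d) K / (h * h) * enorm (x - y))).
    apply: ler_sum => i _; rewrite /mol -mulrBr normrM ger0_norm ?invr_ge0 ?(ltW h0)//.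
    have := lipK ((z 0 i - (x - const_mx h) 0 i) / h) ((z 0 i - (y - const_mx h) 0 i) / h).
    rewrite -mulrBl !mxE => hl; apply: (@le_trans _ _ (h^-1 * (K * (`|x 0 i - y 0 i| / h)))).
      rewrite ler_wpM2l ?invr_ge0 ?(ltW h0)//; apply: le_trans hl _.
      rewrite normrM (ger0_norm (_ : 0 <= h^-1)) ?invr_ge0 ?(ltW h0)// -normrN.
      by have -> : - (z 0 i - (x 0 i - h) - (z 0 i - (y 0 i - h))) = x 0 i - y 0 i by ring.
    have := coord_le_enorm (x - y) i; rewrite !mxE => hc.
    have -> : h^-1 * (K * (`|x 0 i - y 0 i| / h)) = K / (h * h) * `|x 0 i - y 0 i|.
      by rewrite invfM; ring.
    by rewrite ler_wpM2l// divr_ge0// mulr_ge0// ltW.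
  by rewrite sumr_const card_ord -[leLHS]mulr_natl mulrA.
have iB : mu.-integrable setT (EFin \o (\1_B : V -> R)).
  apply: (bounded_on_integrable mB finB); split; first exact: measurable_indic.
  by exists 1 => x; rewrite mul1r ger0_norm.
set C := M ^+ d * (d%:R * (K / (h * h))) in Fdiff.
have C0 : 0 <= C by rewrite mulr_ge0 ?exprn_ge0// mulr_ge0// divr_ge0// mulr_ge0// ltW.
have b0 : 0 <= (\int[mu]_z (\1_B z : R))%R by apply: Rintegral_ge0.
exists (N * C * (\int[mu]_z (\1_B z : R))%R); first by apply: mulr_ge0 => //; exact: mulr_ge0.
move=> x y; rewrite /mollified -(RintegralB measurableT (igF x) (igF y)).
have ib := integrable_subr measurableT (igF x) (igF y).
apply: le_trans (le_normr_Rintegral measurableT ib) _.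
rewrite mulrAC -(RintegralZl _ measurableT iB); apply: le_Rintegral => //.
- by have := integrable_norm ib; apply.
- exact: integrable_scaler.
move=> z _; rewrite -mulrBr normrM mulrAC [leRHS](_ : _ = N * \1_B z * (C * enorm (x - y))); last by ring.
by apply: ler_pM.
Qed.

End lipschitz_mollification.

Lemma measurable_superlevel (R : realType) (n : nat) (u : 'rV[R]_n.+1 -> R) (a : R) :
  measurable_fun setT u -> measurable [set x | a < u x].
Proof.
move=> mu_; rewrite (_ : [set x | _] = u @^-1` `]a, +oo[%classic).
  by rewrite -[X in measurable X]setTI; exact: (mu_ measurableT _ (measurable_itv _)).
by apply/seteqP; split => z /=; rewrite in_itv/= andbT.
Qed.

Lemma continuous_scaled_dist (R : realType) (n : nat) (L : R) (x : 'rV[R]_n.+1) :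
  continuous (fun y : 'rV[R]_n.+1 => L * enorm (x - y)).
Proof.
move=> y; apply: (@continuous_comp _ _ _ (fun y : 'rV[R]_n.+1 => enorm (x - y))); last first.
  exact: mulrl_continuous.
apply: (@continuous_comp _ _ _ (fun v : 'rV[R]_n.+1 => x - v)); last exact: continuous_enorm.
exact: (cvgB (cvg_cst _) cvg_id).
Qed.

Lemma lipschitz_continuous (R : realType) (n : nat) (L : R) (u : 'rV[R]_n.+1 -> R) :
  (forall x y, `|u x - u y| <= L * enorm (x - y)) -> continuous u.
Proof.
move=> hu x A /nbhs_ballP[e /= e0 eA]; rewrite nbhs_simpl/= nbhsE.
exists [set y | `|L| * enorm (x - y) < e].
  split; last by rewrite /= subrr enorm0 mulr0.
  rewrite (_ : [set y | _] = (fun y => `|L| * enorm (x - y)) @^-1` [set t | t < e]) //.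
  by apply: open_comp; [move=> y _; exact: continuous_scaled_dist|exact: open_lt].
move=> y /= ye; apply: eA; rewrite /ball/=; apply: le_lt_trans (hu x y) _; apply: le_lt_trans ye.
by rewrite ler_wpM2r ?enorm_ge0// ler_norm.
Qed.

(** * Lipschitz fields close to the gradient *)

Section approximants.
Context (R : realType) (n : nat).
Local Notation d := n.+1.
Local Notation V := 'rV[R]_d.
Local Notation mu := (@lebesgue_rV R n).
Variables (P eta : R -> R) (c : R).
Hypothesis mP : mollifier P eta c.
Variables (Y : (V -> \bar R) -> \bar R) (p : R) (Om : set V) (G : V -> V).
Hypotheses (bY : ball_Banach Y) (p1 : 1 <= p) (oOm : open Om) (bOm : bounded_set Om) (mG : mcoord G).
Hypothesis acnY : forall (B : V -> \bar R) (E : nat -> set V),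
  measurable_fun setT B -> (forall x, 0 <= B x)%E -> (Y B < +oo)%E ->
  (forall j, measurable (E j)) ->
  {ae mu, forall x, (\1_(E j) x : R) @[j --> \oo] --> (0 : R)%R} ->
  forall t : R, 0 < t -> exists N, forall j, (N <= j)%N ->
    (Y (fun x => B x * (\1_(E j) x)%:E) <= t%:E)%E.
Hypothesis YG : (Y (fun z => (\1_Om z * gsum G z `^ p)%:E) < +oo)%E.

Let mOm : measurable Om. Proof. exact: measurable_open. Qed.
Let p0 : 0 < p. Proof. exact: lt_le_trans ltr01 p1. Qed.

Lemma bounded_sub_eball : exists2 r, 0 < r & Om `<=` eball 0 r.
Proof.
have [M hM] := bounded_sub_cube bOm; exists (d%:R * `|M| + 1); first by rewrite ltr_wpDl ?mulr_ge0.
move=> z Oz; rewrite /eball/= subr0; apply: (@le_lt_trans _ _ (d%:R * `|M|)); last by rewrite ltrDl.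
apply: le_trans (enorm_le_sum _) _; apply: (@le_trans _ _ (\sum_(i < d) `|M|)).
  apply: ler_sum => i _; have := hM z Oz i; rewrite !mxE -ler_norml => /le_trans; apply; exact: ler_norm.
by rewrite sumr_const card_ord mulr_natl.
Qed.

Lemma bounded_measure_fin : (mu Om < +oo)%E.
Proof.
have [r r0 Or] := bounded_sub_eball; apply: le_lt_trans (eball_fin 0 r).
by apply: le_measure; rewrite ?inE //; exact: measurable_eball.
Qed.

Lemma norm_indic_fin : (Y (fun z => (\1_Om z : R)%:E) < +oo)%E.
Proof.
have [r r0 Or] := bounded_sub_eball.
have [mb Yb] := qnorm_ball (ball_Banach_quasi bY) 0 r0.
apply: le_lt_trans Yb; apply: (norm_le bY mb).
  by apply/measurable_EFinP; exact: measurable_indic.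
move=> x; rewrite !gee0_abs ?lee_fin// !indicE; case: (boolP (x \in Om)) => // xO.
by rewrite mem_set//; apply: Or; rewrite inE in xO.
Qed.

Let mOmE : measurable_fun setT (fun z : V => (\1_Om z : R)%:E).
Proof. by apply/measurable_EFinP; exact: measurable_indic. Qed.

Let mgs : measurable_fun setT (gsum G).
Proof. by apply: measurable_sum => i; apply: measurableT_comp => //; exact: mG. Qed.

Definition clip (N t : R) : R := Num.max (- N) (Num.min N t).

Lemma clip_le N t : 0 <= N -> `|clip N t| <= N.
Proof.
move=> N0; rewrite ler_norml /clip le_max lexx/= ge_max ge_min lexx/= andbT; lra.
Qed.

Lemma clip_id N t : `|t| <= N -> clip N t = t.
Proof. by rewrite ler_norml => /andP[h1 h2]; rewrite /clip min_r// max_r. Qed.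

Lemma clip_diff_le N t : 0 <= N -> `|t - clip N t| <= `|t|.
Proof.
move=> N0; have [tN|tN] := leP `|t| N; first by rewrite clip_id// subrr normr0.
rewrite /clip; have [t0|t0] := ltP t 0.
  rewrite ltr0_norm// in tN; rewrite min_r ?max_l; [|lra|lra].
  by rewrite (ltr0_norm t0) ler0_norm; lra.
rewrite ger0_norm// in tN; rewrite min_l ?max_r; [|lra|lra].
by rewrite (ger0_norm t0) ger0_norm; lra.
Qed.

Definition truncated (N : R) (i : 'I_d) (z : V) : R := \1_Om z * clip N (G z 0 i).

Lemma measurable_truncated N i : measurable_fun setT (truncated N i).
Proof.
apply: measurable_funM; first exact: measurable_indic.
apply: measurable_maxr; first exact: measurable_cst.
by apply: measurable_minr; [exact: measurable_cst|exact: mG].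
Qed.

Lemma truncated_le N i z : 0 <= N -> `|truncated N i z| <= N * \1_Om z.
Proof. by move=> N0; rewrite normrM ger0_norm// mulrC ler_wpM2r// clip_le. Qed.

Definition high (N : nat) : set V := [set z | N%:R < gsum G z].

Lemma measurable_high N : measurable (high N).
Proof. exact: (measurable_superlevel _ mgs). Qed.

Definition mollified_field (N h : R) (z : V) : V := \row_i mollified eta h (truncated N i) z.

(** Truncation errs only on [high N], and there by at most the gradient itself; the rest is the
    mollification error. *)
Lemma field_dev_le (N : nat) (h : R) (z : V) : gdev Om G (mollified_field N%:R h z) z <=
  \1_Om z * (gsum G z * \1_(high N) z) + \1_Om z * \sum_i `|mollified eta h (truncated N%:R i) z - truncated N%:R i z|.
Proof.
rewrite /gdev -mulrDr; have [Oz|Oz] := pselect (Om z); last by rewrite indicE memNset// !mul0r.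
rewrite ler_wpM2l// /gsum mulr_suml -big_split/=; apply: ler_sum => i _.
rewrite !mxE; set m := mollified _ _ _ _; have tE : truncated N%:R i z = clip N%:R (G z 0 i).
  by rewrite /truncated indicE mem_set// mul1r.
have -> : G z 0 i - m = (G z 0 i - truncated N%:R i z) - (m - truncated N%:R i z) by ring.
apply: le_trans (ler_normB _ _) _; rewrite lerD2r tE.
have [hz|hz] := pselect (high N z); first by rewrite [X in _ <= _ * X]indicE mem_set// mulr1 clip_diff_le.
rewrite [X in _ <= _ * X]indicE memNset// mulr0 clip_id ?subrr ?normr0//.
rewrite leNgt; apply/negP => h1; apply: hz; apply: (lt_le_trans h1).
by rewrite /gsum (bigD1 i)//= lerDl sumr_ge0.
Qed.

(** Absolute continuity is used twice: on the sets [high N], which shrink to the empty set, for the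
    truncation; and on the sets where the mollification error exceeds [dl], which every point
    outside a null set eventually leaves along a subsequence, and on which the error is still at
    most [M]. *)
Lemma exists_approximant (t : R) : 0 < t -> exists v M L,
  [/\ 0 <= M, 0 <= L,
      mcoord v, forall x z, gsum (fun w => v w - v x) z <= M /\ gsum (fun w => v w - v x) z <= L * enorm (z - x)
    & (Y (fun z => (gdev Om G (v z) z `^ p)%:E) <= t%:E)%E].
Proof.
move=> t0; pose q : R := (1 + 1) `^ p; have q0 : 0 < q by rewrite powR_gt0.
have m1 : measurable_fun setT (fun z => (\1_Om z * gsum G z `^ p)%:E).
  apply/measurable_EFinP; apply: measurable_funM; first exact: measurable_indic.
  exact: (measurableT_comp (measurable_powR p)).
have B10 z : (0 <= (\1_Om z * gsum G z `^ p)%:E)%E by rewrite lee_fin mulr_ge0// powR_ge0.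
have high0 : {ae mu, forall x, (\1_(high j) x : R) @[j --> \oo] --> (0 : R)%R}.
  apply: nearW => x; apply: cvg_near_cst; near=> j; rewrite indicE memNset//.
  rewrite /high/=; apply/negP; rewrite -leNgt; near: j; exact: nbhs_infty_ger.
(* A third of [t] for each of the three terms of the majorant [H]; the factor [q = 2^p] is lost when
   the power of a sum is split. *)
have t1 : 0 < t / (3 * q) by rewrite divr_gt0// mulr_gt0.
have [N hN] := acnY m1 B10 YG measurable_high high0 t1; have {}hN := hN N (leqnn _).
have N0 : (0 : R) <= N%:R by [].
pose g i := truncated N%:R i.
have mg i : measurable_fun setT (g i) by exact: measurable_truncated.
have gle i z : `|g i z| <= N%:R * \1_Om z by exact: truncated_le.
have finO := bounded_measure_fin.
have ag i : approximable eta (g i).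
  apply: (approximable_integrable mP); apply: (bounded_on_integrable mOm finO).
  by split; [exact: mg|exists N%:R].
pose f k x : \bar R := (\sum_(i < d) \int[mu]_z dev eta (harm R k) (g i) (x, z))%E.
have h0 k : 0 < harm R k := harm_gt0 R k.
have dv0 k i w : (0 <= dev eta (harm R k) (g i) w)%E by exact: (dev_ge0 mP).
have mI k i : measurable_fun setT (fun x => \int[mu]_z dev eta (harm R k) (g i) (x, z))%E.
  apply: (measurable_fun_fubini_tonelli_F (dev eta (harm R k) (g i))) => //.
  exact: (measurable_dev mP).
have I0 k i x : (0 <= \int[mu]_z dev eta (harm R k) (g i) (x, z))%E by exact: integral_ge0.
have [s _ hs] : exists2 s : nat -> nat, (forall j, j <= s j)%N &
    {ae mu, forall x, f (s j) x @[j --> \oo] --> 0%E}.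
  apply: ae_subsequence => [k|k x|e e0].
  - exact: emeasurable_sum.
  - by apply: sume_ge0 => i _.
  have ed : 0 < e / d%:R by rewrite divr_gt0// ltr0n.
  have /choice[K hK] : forall i, exists K, forall k, (K <= k)%N -> (total_dev eta (harm R k) (g i) <= (e / d%:R)%:E)%E.
    by move=> i; have [_ h] := ag i; exact: h.
  exists (\max_i K i)%N => k hk; rewrite /f ge0_integral_sum//.
  apply: (@le_trans _ _ (\sum_(i < d) (e / d%:R)%:E)%E).
    apply: lee_sum => i _; rewrite -(total_devE mP)//; apply: hK.
    by apply: leq_trans hk; exact: leq_bigmax.
  by rewrite sumEFin lee_fin sumr_const card_ord -[leLHS]mulr_natr divfK// pnatr_eq0.
pose D j x : R := \sum_(i < d) `|mollified eta (harm R (s j)) (g i) x - g i x|.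
have D0 j x : 0 <= D j x by exact: sumr_ge0.
have lip j i := mollified_lipschitz mP mOm finO (mg i) (gle i) N0 (h0 (s j)) (harm_le1 R (s j)).
have mmol j i : measurable_fun setT (mollified eta (harm R (s j)) (g i)).
  by have [L _ hL] := lip j i; apply: continuous_measurable_rV; exact: lipschitz_continuous hL.
have mD j : measurable_fun setT (D j).
  by apply: measurable_sum => i; apply: measurableT_comp => //; exact: measurable_funB.
pose M := d%:R * (2 * N%:R) : R; have M0 : 0 <= M by rewrite !mulr_ge0.
have molN j i x : `|mollified eta (harm R (s j)) (g i) x| <= N%:R.
  exact: (mollified_le mP (mg i) (gle i) N0 (h0 (s j))).
have DM j x : D j x <= M.
  apply: (@le_trans _ _ (\sum_(i < d) (2 * N%:R))); last by rewrite sumr_const card_ord -[leLHS]mulr_natl.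
  apply: ler_sum => i _; apply: le_trans (ler_normB _ _) _.
  have := molN j i x; have := gle i x; have : N%:R * (\1_Om x : R) <= N%:R by rewrite ler_piMr// indic_le1.
  by move: `|_| `|_| => a b; lra.
have Dcvg : {ae mu, forall x, D j x @[j --> \oo] --> (0 : R)}.
  apply: filterS hs => x hx; apply/cvgrPdist_le => e e0.
  have /fine_cvgP[[N1 _ finN] /cvgrPdist_le /(_ _ e0) [N2 _ h2]] := hx.
  exists (maxn N1 N2) => // j /=; rewrite geq_max => /andP[j1 j2].
  rewrite sub0r normrN ger0_norm// -lee_fin; apply: (@le_trans _ _ (f (s j) x)).
    rewrite /D -sumEFin; apply: lee_sum => i _.
    exact: (mollified_dev mP (mg i) (gle i) N0 (h0 (s j))).
  rewrite -(fineK (finN j j1)) lee_fin; have := h2 j j2; rewrite /= sub0r normrN ger0_norm// fine_ge0//.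
  by apply: sume_ge0 => i _.
have Y1 := norm_indic_fin; have Y10 : (0 <= Y (fun z => (\1_Om z : R)%:E))%E by exact: (norm_ge0 bY).
pose y := fine (Y (fun z => (\1_Om z : R)%:E)); have y0 : 0 <= y by exact: fine_ge0.
have yE : Y (fun z => (\1_Om z : R)%:E) = y%:E by rewrite fineK// ge0_fin_numE.
(* Chosen so that [q] times the power [p] of [dl] times the norm [y] of the indicator of the domain
   is at most [t / 3]. *)
pose dl := (t / (3 * q * (y + 1))) `^ p^-1.
have dl0 : 0 < dl by rewrite powR_gt0// divr_gt0// !mulr_gt0// ltr_wpDl.
have dlp : dl `^ p = t / (3 * q * (y + 1)).
  rewrite /dl -powRrM mulVf ?gt_eqF// powRr1// divr_ge0 ?(ltW t0)// !mulr_ge0 ?(ltW q0)// addr_ge0//.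
pose E j := [set x | dl < D j x].
have mE j : measurable (E j).
  exact: (measurable_superlevel _ (mD j)).
have Ecvg : {ae mu, forall x, (\1_(E j) x : R) @[j --> \oo] --> (0 : R)%R}.
  apply: filterS Dcvg => x /cvgrPdist_le /(_ _ dl0) hx; apply: cvg_near_cst.
  apply: filterS hx => j; rewrite sub0r normrN ger0_norm// => h; rewrite indicE memNset// /E/=.
  by apply/negP; rewrite -leNgt.
have O0 z : (0 <= (\1_Om z : R)%:E)%E by rewrite lee_fin.
have t2 : 0 < t / (3 * q * (M `^ p + 1)) by rewrite divr_gt0// !mulr_gt0// ltr_wpDl ?powR_ge0.
have [J hJ] := acnY mOmE O0 Y1 mE Ecvg t2; have {}hJ := hJ J (leqnn _).
pose v := mollified_field N%:R (harm R (s J)).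
have /choice[L hL] : forall i, exists L, 0 <= L /\ forall x z,
    `|mollified eta (harm R (s J)) (g i) x - mollified eta (harm R (s J)) (g i) z| <= L * enorm (x - z).
  by move=> i; have [L ? ?] := lip J i; exists L.
exists v, M, (\sum_i L i); split; first by [].
- by apply: sumr_ge0 => i _; exact: (hL i).1.
- move=> i; rewrite (_ : (fun z => v z 0 i) = mollified eta (harm R (s J)) (g i)); first exact: mmol.
  by apply/funext => z; rewrite /v !mxE.
- move=> x z; split.
    apply: (@le_trans _ _ (\sum_(i < d) (2 * N%:R))); last by rewrite sumr_const card_ord -[leLHS]mulr_natl.
    apply: ler_sum => i _; rewrite !mxE; apply: le_trans (ler_normB _ _) _.
    by have := molN J i x; have := molN J i z; rewrite /g; move: `|_| `|_| => a b; lra.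
  rewrite mulr_suml; apply: ler_sum => i _; rewrite !mxE; exact: (hL i).2.
pose F1 z : \bar R := ((\1_Om z * gsum G z `^ p)%:E * (\1_(high N) z)%:E)%E.
pose F3 z : \bar R := ((\1_Om z)%:E * (\1_(E J) z)%:E)%E.
have mi (A : set V) : measurable A -> measurable_fun setT (fun z : V => (\1_A z : R)%:E).
  by move=> mA; apply/measurable_EFinP; exact: measurable_indic.
have mF1 : measurable_fun setT F1 by apply: emeasurable_funM => //; exact/mi/measurable_high.
have mF3 : measurable_fun setT F3 by apply: emeasurable_funM => //; exact: mi.
have mZ (a : R) F : measurable_fun setT F -> measurable_fun setT (fun z : V => a%:E * F z)%E.
  by move=> mF; apply: emeasurable_funM => //; exact: measurable_cst.
have c2 : 0 < q * dl `^ p by rewrite mulr_gt0// powR_gt0.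
have c3 : 0 < q * (M `^ p + 1) by rewrite mulr_gt0// ltr_wpDl ?powR_ge0.
pose H z : \bar R := (q%:E * F1 z + ((q * dl `^ p)%:E * (\1_Om z)%:E + (q * (M `^ p + 1))%:E * F3 z))%E.
apply: (@le_trans _ _ (Y H)).
  apply: (norm_le bY).
  - by apply: emeasurable_funD; [exact: mZ|apply: emeasurable_funD; exact: mZ].
  - apply/measurable_EFinP; apply: (measurableT_comp (measurable_powR p)).
    apply: (measurable_gdev mOm mG (@measurable_id _ _ _)) => i.
    rewrite (_ : (fun z => v z 0 i) = mollified eta (harm R (s J)) (g i)); first exact: mmol.
    by apply/funext => z; rewrite /v !mxE.
  move=> z; rewrite /H /F1 /F3 -!EFinM -!EFinD !gee0_abs ?lee_fin ?powR_ge0//; last first.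
    by rewrite !addr_ge0// !mulr_ge0// ?powR_ge0 ?addr_ge0 ?powR_ge0 ?ltW.
  have [Oz|Oz] := pselect (Om z); last first.
    by rewrite /gdev indicE memNset// !mul0r powR0 ?gt_eqF// !(mul0r, mulr0, addr0).
  have := field_dev_le N (harm R (s J)) z; rewrite -/v -/(D J z) => hz.
  apply: le_trans (powR_le p1 (gdev_ge0 _ _ _ _) hz) _.
  have i1 : (\1_Om z : R) = 1 by rewrite indicE mem_set.
  rewrite i1 !mul1r mulr1; apply: le_trans (powR_add_le p1 ltr01 _ (D0 J z)) _.
    by rewrite mulr_ge0// gsum_ge0.
  rewrite invr1 -/q; apply: lerD.
    rewrite ler_wpM2l ?(ltW q0)// powRM ?gsum_ge0// ler_wpM2l ?powR_ge0// indicE.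
    by case: (_ \in _); rewrite ?powR1 ?powR0 ?gt_eqF.
  rewrite -!mulrA -mulrDr ler_wpM2l ?(ltW q0)// indicE.
  have [zE|zE] := pselect (E J z).
    rewrite mem_set// mulr1; apply: (@le_trans _ _ (M `^ p)); first exact: powR_le.
    by have := powR_ge0 dl p; lra.
  rewrite memNset// mulr0 addr0; apply: powR_le => //.
  by rewrite leNgt; apply/negP.
have step1 := norm_add bY (mZ q _ mF1) (emeasurable_funD (mZ (q * dl `^ p) _ mOmE) (mZ (q * (M `^ p + 1)) _ mF3)).
apply: le_trans step1 _.
apply: (@le_trans _ _ (q%:E * (t / (3 * q))%:E + ((q * dl `^ p)%:E * y%:E + (q * (M `^ p + 1))%:E * (t / (3 * q * (M `^ p + 1)))%:E))%E).
  apply: leeD; first exact: (norm_scale_le bY).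
  apply: le_trans (norm_add bY (mZ _ _ mOmE) (mZ _ _ mF3)) _.
  apply: leeD; first by apply: (norm_scale_le bY) => //; rewrite yE.
  exact: (norm_scale_le bY).
rewrite -!EFinM -!EFinD lee_fin dlp.
have qn : q != 0 by rewrite gt_eqF.
have Mn : M `^ p + 1 != 0 by rewrite gt_eqF// ltr_wpDl ?powR_ge0.
have yn : y + 1 != 0 by rewrite gt_eqF// ltr_wpDl.
have e1 : q * (t / (3 * q)) = t / 3 by field.
have e2 : q * (t / (3 * q * (y + 1))) * y = t / 3 * (y / (y + 1)) by field; rewrite yn qn.
have e3 : q * (M `^ p + 1) * (t / (3 * q * (M `^ p + 1))) = t / 3 by field; rewrite Mn qn.
rewrite e1 e2 e3; have : t / 3 * (y / (y + 1)) <= t / 3.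
  by rewrite ler_piMr ?divr_ge0 ?(ltW t0)// ler_pdivrMr ?mul1r ?lerDl// ltr_wpDl.
lra.
Unshelve. all: by end_near. Qed.

End approximants.

(** * The norm of the remainder for one weight *)

Lemma muleDl4 (R : realType) (a l m i b : R) (q : \bar R) : 0 <= a -> 0 <= l -> 0 <= m ->
  0 <= i -> 0 <= b ->
  ((a + (l + m * i) + b)%:E * q = a%:E * q + l%:E * q + m%:E * (i%:E * q) + b%:E * q)%E.
Proof.
move=> a0 l0 m0 i0 b0; have mi0 : 0 <= m * i by exact: mulr_ge0.
rewrite EFinD ge0_muleDl ?lee_fin ?addr_ge0// EFinD ge0_muleDl ?lee_fin ?addr_ge0//.
by rewrite EFinD ge0_muleDl ?lee_fin// (EFinM m) -muleA addeA.
Qed.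

Lemma integral_combination_le (R : realType) (n : nat) (F Q : 'rV[R]_n.+1 -> \bar R)
    (I : 'rV[R]_n.+1 -> R) (l m b q t : R) :
  measurable_fun setT F -> (forall z, (0 <= F z)%E) ->
  measurable_fun setT Q -> (forall z, (0 <= Q z)%E) ->
  measurable_fun setT (EFin \o I) -> (forall z, 0 <= I z) -> 0 <= l -> 0 <= m -> 0 <= b ->
  (\int[@lebesgue_rV R n]_z Q z <= q%:E)%E ->
  (\int[@lebesgue_rV R n]_z ((I z)%:E * Q z) <= t%:E)%E ->
  (\int[@lebesgue_rV R n]_z (F z * Q z + l%:E * Q z + m%:E * ((I z)%:E * Q z) + b%:E * Q z)%E <=
   \int[@lebesgue_rV R n]_z (F z * Q z) + ((l * q + m * t)%:E + q%:E * b%:E))%E.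
Proof.
move=> mF F0 mQ Q0 mI I0 l0 m0 b0 Qq It.
have E0 (c : R) : 0 <= c -> (0 <= c%:E)%E by rewrite lee_fin.
have m1 := emeasurable_funM mF mQ.
have m2 (c : R) := emeasurable_funM (measurable_cst c%:E) mQ.
have m3 := emeasurable_funM mI mQ.
have m4 := emeasurable_funM (measurable_cst m%:E) m3.
have n1 z : (0 <= F z * Q z)%E by rewrite mule_ge0.
have n2 (c : R) (c0 : 0 <= c) z : (0 <= c%:E * Q z)%E by rewrite mule_ge0.
have n3 z : (0 <= (I z)%:E * Q z)%E by rewrite mule_ge0// E0.
have n4 z : (0 <= m%:E * ((I z)%:E * Q z))%E by rewrite mule_ge0// E0.
have m12 := emeasurable_funD m1 (m2 l).
have n12 z := adde_ge0 (n1 z) (n2 l l0 z).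
rewrite (ge0_integral_add (emeasurable_funD m12 m4) (m2 b) (fun z => adde_ge0 (n12 z) (n4 z)) (n2 b b0)).
rewrite (ge0_integral_add m12 m4 n12 n4) (ge0_integral_add m1 (m2 l) n1 (n2 l l0)).
rewrite (ge0_integralcM mQ Q0 (E0 _ l0)) (ge0_integralcM m3 n3 (E0 _ m0)) (ge0_integralcM mQ Q0 (E0 _ b0)).
have E (u v : \bar R) (k h : R) : (u + ((k + h)%:E + v) = u + k%:E + h%:E + v)%E by rewrite EFinD !addeA.
rewrite E; apply: leeD; last by rewrite muleC; apply: lee_wpmul2r; [exact: E0|].
apply: leeD; last by rewrite EFinM; apply: lee_wpmul2l; [exact: E0|].
apply: leeD; first exact: lexx.
by rewrite EFinM; apply: lee_wpmul2l; [exact: E0|].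
Qed.

Lemma norm_scale_real (R : realType) (n : nat) (Y : ('rV[R]_n.+1 -> \bar R) -> \bar R)
    (F : 'rV[R]_n.+1 -> \bar R) (k y : R) : ball_Banach Y -> 0 <= k ->
  measurable_fun setT F -> Y F = y%:E -> Y (fun x => k%:E * F x)%E = (k * y)%:E.
Proof. by move=> bY k0 mF YF; rewrite (norm_scale bY k0 mF) ?YF ?ltry// EFinM. Qed.

Lemma norm_scale_ler (R : realType) (n : nat) (Y : ('rV[R]_n.+1 -> \bar R) -> \bar R)
    (F : 'rV[R]_n.+1 -> \bar R) (k y : R) : ball_Banach Y -> 0 <= k ->
  measurable_fun setT F -> (Y F <= y%:E)%E -> (Y (fun x => k%:E * F x) <= (k * y)%:E)%E.
Proof.
move=> bY k0 mF YF; rewrite (norm_scale bY k0 mF) ?(le_lt_trans YF) ?ltry// EFinM.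
by apply: lee_wpmul2l; [rewrite lee_fin|].
Qed.

Section remainder_norm.
Context (R : realType) (n : nat).
Local Notation d := n.+1.
Local Notation V := 'rV[R]_d.
Local Notation mu := (@lebesgue_rV R n).
Local Notation lam := (@lebesgue_measure R).
Variables (P eta : R -> R) (c : R).
Hypothesis mP : mollifier P eta c.
Variables (Om : set V) (eps : R).
Hypotheses (heps : 0 < eps <= 1) (bOm : bounded_set Om) (dom : eps_infty_domain eps Om).
Variables (f : V -> R) (G : V -> V).
Hypotheses (mf : measurable_fun setT f) (mG : mcoord G).
Hypotheses (lf : locally_integrable_rV Om f)
  (lG : forall i, locally_integrable_rV Om (fun z => G z 0 i)) (wp : weak_pair Om f G).
Variables (p CW : R).
Hypothesis p1 : 1 <= p.
Local Notation Lam := (chain_Lam n eps).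
Local Notation W := (wfun n Lam).
Hypothesis W_mass : (\int[mu]_x (W (enorm x))%:E = CW%:E)%E.
Variable Y : (V -> \bar R) -> \bar R.
Hypothesis bY : ball_Banach Y.
Variable CM : R.
Hypotheses (CM0 : 0 <= CM) (maxY : forall w : V -> \bar R, in_space (associate Y) w ->
  (associate Y (maximal_rV w) <= CM%:E * associate Y w)%E).
Local Notation A := (area R n).
Local Notation C4 := (remainder_C n c eps p CW * 4 `^ p).
Local Notation y := (fine (Y (fun z => (\1_Om z : R)%:E))).

Let oOm : open Om. Proof. by case: dom. Qed.
Let mOm : measurable Om. Proof. exact: measurable_open. Qed.
Let L0 : 0 < Lam. Proof. exact: chain_Lam_gt0. Qed.
Let mW : measurable_fun setT W. Proof. exact: measurable_wfun. Qed.
Let W0 t : 0 <= W t. Proof. exact: wfun_ge0. Qed.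
Let Wle0 t : t <= 0 -> W t = 0. Proof. exact: wfun_le0. Qed.
Let Wdecr s t : 0 < s -> s <= t -> W t <= W s. Proof. exact: wfun_decr. Qed.
Let Wout t : Lam <= t -> W t = 0. Proof. exact: wfun_out. Qed.
Let CW0 : 0 <= CW.
Proof. by rewrite -lee_fin -W_mass; apply: integral_ge0 => z _; rewrite lee_fin. Qed.
Let A0 : 0 <= A. Proof. exact: area_ge0. Qed.
Let p0 : 0 < p. Proof. exact: lt_le_trans ltr01 p1. Qed.
Let C40 : 0 <= C4.
Proof.
rewrite mulr_ge0 ?powR_ge0// mulr_ge0 ?powR_ge0// mulr_ge0// powR_ge0//.
Qed.
Let yE : Y (fun z => (\1_Om z : R)%:E) = y%:E.
Proof.
rewrite fineK// ge0_fin_numE; first exact: norm_indic_fin.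
by apply: (norm_ge0 bY); apply/measurable_EFinP; exact: measurable_indic.
Qed.

Definition remainder_integral (rho : R -> R) (x : V) : \bar R :=
  ((\1_Om x : R)%:E * \int[mu]_y (\1_Om y * (remainder f G p x y * rho (enorm (x - y))))%:E)%E.

Lemma measurable_remainder_integral (rho : R -> R) : measurable_fun setT rho -> (forall t, 0 <= rho t) ->
  measurable_fun setT (remainder_integral rho).
Proof.
move=> mrho rho0; apply: emeasurable_funM; first by apply/measurable_EFinP; exact: measurable_indic.
apply: (@measurable_integral _ _ _ _ (fun x y => (\1_Om y * (remainder f G p x y * rho (enorm (x - y))))%:E)); last first.
  by move=> x z; rewrite lee_fin mulr_ge0// mulr_ge0// remainder_ge0.
apply/measurable_EFinP; apply: measurable_funM.
  by apply: (measurableT_comp _ measurable_snd); exact: measurable_indic.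
apply: measurable_funM; first exact: measurable_remainder.
by apply: (measurableT_comp mrho); exact: measurable_dist.
Qed.

Section one_weight.
Variable rho : R -> R.
Hypotheses (mrho : measurable_fun setT rho) (rho_ge0 : forall t, 0 <= rho t)
  (rho_le0 : forall t, t <= 0 -> rho t = 0)
  (rho_decr : forall s t, 0 < s -> s <= t -> rho t <= rho s)
  (rho_mass : (\int[mu]_x (rho (enorm x))%:E = A%:E)%E).
Local Notation Q := (Qrn rho W).

Variables (v : V -> V) (M L dl tl a : R).
Hypotheses (L_ge0 : 0 <= L) (mv : mcoord v)
  (vM : forall x z, gsum (fun w => v w - v x) z <= M)
  (vL : forall x z, gsum (fun w => v w - v x) z <= L * enorm (z - x))
  (tailE : (\int[mu]_h (rho (enorm h) * (dl <= (Lam + 1) * enorm h)%R%:R)%:E <= tl%:E)%E)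
  (va : Y (fun z => (gdev Om G (v z) z `^ p)%:E) = a%:E).

(** Contribution of [v z - v x]: within [dl] the Lipschitz bound against the full mass of the
    kernel, beyond [dl] the bound [M] against its tail. *)
Definition mid : R := (L * dl) `^ p * (2 * CW * A) + M `^ p * (2 * CW * tl).

Let S (x : V) : \bar R := (\int[mu]_z ((gdev Om G (v z) z `^ p)%:E * Q x z))%E.
Let D (x : V) : \bar R := ((gdev Om G (v x) x) `^ p)%:E.

Let mD : measurable_fun setT D.
Proof.
apply/measurable_EFinP; apply: (measurableT_comp (measurable_powR p)).
exact: (measurable_gdev mOm mG (@measurable_id _ _ _) mv).
Qed.

Let D0 (x : V) : (0 <= D x)%E. Proof. by rewrite lee_fin powR_ge0. Qed.
Let Q0 (x z : V) : (0 <= Q x z)%E. Proof. exact: Qrn_ge0. Qed.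
Let mQx (x : V) : measurable_fun setT (Q x).
Proof. exact: (measurable_Qrn mrho rho_ge0 rho_le0 mW W0 (measurable_cst x) (@measurable_id _ _ _)). Qed.

Let mS : measurable_fun setT S.
Proof.
apply: (@measurable_integral _ _ _ _ (fun x z => D z * Q x z)%E) => [|x z]; last exact: mule_ge0.
apply: emeasurable_funM; first exact: (measurableT_comp mD measurable_snd).
exact: (measurable_Qrn mrho rho_ge0 rho_le0 mW W0 measurable_fst measurable_snd).
Qed.

Let S0 (x : V) : (0 <= S x)%E.
Proof. by rewrite /S; apply: integral_ge0 => z _; apply: mule_ge0; [exact: D0|exact: Q0]. Qed.

Lemma tail_ge0 : 0 <= tl.
Proof.
rewrite -lee_fin; apply: le_trans tailE; apply: integral_ge0 => z _; rewrite lee_fin; apply: mulr_ge0; first exact: rho_ge0.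
by case: (dl <= _).
Qed.

Lemma mid_ge0 : 0 <= mid.
Proof.
have t0 := tail_ge0.
by rewrite addr_ge0// mulr_ge0 ?powR_ge0// mulr_ge0// mulr_ge0.
Qed.

(** [G z - G x] is split through [v], with the factor [4^p] of [powR_add3_le]; the difference at [x]
    does not depend on [z] and meets only the mass of the kernel. *)
Lemma gdev_integral_le (x : V) : Om x ->
  (\int[mu]_z ((gdev Om G (G x) z `^ p)%:E * Q x z) <=
   (4 `^ p)%:E * (S x + (mid%:E + (2 * CW * A)%:E * D x)))%E.
Proof.
move=> Ox; have E4 : (0 <= ((4 : R) `^ p)%:E)%E by rewrite lee_fin powR_ge0.
pose ind z : R := (dl <= enorm (z - x))%R%:R.
have mdist : measurable_fun setT (fun z : V => enorm (z - x)).
  by apply: measurable_dist => //; exact: measurable_cst.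
have mind : measurable_fun setT (fun z => (ind z)%:E).
  by apply/measurable_EFinP; exact: (measurableT_comp (measurable_step dl) mdist).
have b1 z : gdev Om G (G x) z `^ p <= 4 `^ p * (gdev Om G (v z) z `^ p +
    ((L * dl) `^ p + M `^ p * ind z) + gdev Om G (v x) x `^ p).
  have [Oz|Oz] := pselect (Om z); last first.
    rewrite /gdev [\1_Om z]indicE memNset// !mul0r powR0 ?gt_eqF//.
    by rewrite mulr_ge0 ?powR_ge0// !addr_ge0 ?mulr_ge0 ?powR_ge0.
  have gx0 := gdev_ge0 Om G (v x) x; have gz0 := gdev_ge0 Om G (v z) z.
  have gv0 : 0 <= gsum (fun w => v w - v x) z by exact: gsum_ge0.
  have h1 : gdev Om G (G x) z <= gdev Om G (v z) z + gsum (fun w => v w - v x) z + gdev Om G (v x) x.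
    rewrite /gdev !indicE !mem_set// !mul1r /gsum -!big_split/=; apply: ler_sum => i _.
    rewrite !mxE; have -> : G z 0 i - G x 0 i = (G z 0 i - v z 0 i) + (v z 0 i - v x 0 i) - (G x 0 i - v x 0 i) by ring.
    by apply: le_trans (ler_normB _ _) _; rewrite lerD2r; exact: ler_normD.
  apply: le_trans (powR_le p1 (gdev_ge0 _ _ _ _) h1) _.
  apply: le_trans (powR_add3_le p1 gz0 gv0 gx0) _; rewrite ler_wpM2l ?powR_ge0//.
  rewrite lerD2r lerD2l /ind; have [hd|/ltW hd] := leP dl (enorm (z - x)).
    by rewrite mulr1 ler_wpDl ?powR_ge0//; exact: powR_le.
  rewrite (_ : false%:R = 0) // mulr0 addr0; apply: powR_le => //; apply: le_trans (vL x z) _.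
  by rewrite ler_wpM2l.
pose T z : \bar R := (D z * Q x z + ((L * dl) `^ p)%:E * Q x z + (M `^ p)%:E * ((ind z)%:E * Q x z) + D x * Q x z)%E.
have m1 : measurable_fun setT (fun z => D z * Q x z)%E := emeasurable_funM mD (mQx x).
have m2 (q : R) : measurable_fun setT (fun z => q%:E * Q x z)%E.
  exact: (emeasurable_funM (measurable_cst _) (mQx x)).
have m3 : measurable_fun setT (fun z => (ind z)%:E * Q x z)%E := emeasurable_funM mind (mQx x).
have m4 : measurable_fun setT (fun z => (M `^ p)%:E * ((ind z)%:E * Q x z))%E.
  exact: (emeasurable_funM (measurable_cst _) m3).
have m12 := emeasurable_funD m1 (m2 ((L * dl) `^ p)).
have m124 := emeasurable_funD m12 m4.
have mT : measurable_fun setT T by exact: (emeasurable_funD m124 (m2 _)).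
have n1 z : (0 <= D z * Q x z)%E by apply: mule_ge0; [exact: D0|exact: Q0].
have n2 (q : R) z : 0 <= q -> (0 <= q%:E * Q x z)%E by move=> q0; apply: mule_ge0; [by rewrite lee_fin|exact: Q0].
have n3 z : (0 <= (ind z)%:E * Q x z)%E by apply: mule_ge0; [rewrite lee_fin|exact: Q0].
have n4 z : (0 <= (M `^ p)%:E * ((ind z)%:E * Q x z))%E by apply: mule_ge0; [rewrite lee_fin powR_ge0|exact: n3].
have n5 z : (0 <= D x * Q x z)%E by apply: mule_ge0; [exact: D0|exact: Q0].
have nL z := n2 _ z (powR_ge0 (L * dl) p).
have n12 z := adde_ge0 (n1 z) (nL z).
have n124 z := adde_ge0 (n12 z) (n4 z).
have T0 z : (0 <= T z)%E by exact: (adde_ge0 (n124 z) (n5 z)).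
have mL : measurable_fun setT (fun z => (gdev Om G (G x) z `^ p)%:E * Q x z)%E.
  apply: emeasurable_funM (mQx x); apply/measurable_EFinP; apply: (measurableT_comp (measurable_powR p)).
  exact: (measurable_gdev mOm mG (@measurable_id _ _ _) (mcoord_cst _)).
have m4T : measurable_fun setT (fun z => ((4 : R) `^ p)%:E * T z)%E.
  exact: (emeasurable_funM (measurable_cst _) mT).
apply: (@le_trans _ _ (\int[mu]_z (((4 : R) `^ p)%:E * T z))%E).
  apply: (le_ge0_integral mL m4T) => z; first by apply: mule_ge0; [rewrite lee_fin powR_ge0|exact: Q0].
  have TE : T z = ((gdev Om G (v z) z `^ p + ((L * dl) `^ p + M `^ p * ind z) + gdev Om G (v x) x `^ p)%:E * Q x z)%E.
    by rewrite muleDl4// ?powR_ge0.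
  by rewrite TE muleA -EFinM; apply: lee_wpmul2r; [exact: Q0|rewrite lee_fin].
rewrite (ge0_integralcM mT T0 E4); apply: (lee_wpmul2l E4).
have Qm := Qrn_mass mrho rho_ge0 rho_le0 rho_mass mW W0 Wout W_mass L0 x.
have Qt := Qrn_tail mrho rho_ge0 rho_le0 mW W0 Wout W_mass dl x.
have QT : (\int[mu]_z ((ind z)%:E * Q x z) <= (2 * CW * tl)%:E)%E.
  apply: le_trans Qt _; rewrite EFinM; apply: lee_wpmul2l tailE.
  by rewrite lee_fin mulr_ge0.
exact: (integral_combination_le mD D0 (mQx x) (Q0 x) mind (fun z => ler0n _ _) (powR_ge0 _ _) (powR_ge0 _ _) (powR_ge0 _ _) Qm QT).
Qed.

(** Only the term in [G z - v z] goes through duality; the other two are multiples of the indicator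
    of the domain and of the power of [|G - v|] itself. *)
Lemma remainder_norm_le :
  (Y (remainder_integral rho) <= (C4 * (potential_C n CW A * CM * a + (mid * y + 2 * CW * A * a)))%:E)%E.
Proof.
have mI := measurable_remainder_integral mrho rho_ge0.
have mO : measurable_fun setT (fun z : V => (\1_Om z : R)%:E).
  by apply/measurable_EFinP; exact: measurable_indic.
have mZ (q : R) (F : V -> \bar R) : measurable_fun setT F -> measurable_fun setT (fun z : V => q%:E * F z)%E.
  by move=> mF; apply: emeasurable_funM => //; exact: measurable_cst.
have k0 : 0 <= 2 * CW * A by rewrite mulr_ge0// mulr_ge0.
pose H x : \bar R := (S x + (mid%:E * (\1_Om x)%:E + (2 * CW * A)%:E * D x))%E.
have H2 x : (0 <= mid%:E * (\1_Om x : R)%:E + (2 * CW * A)%:E * D x)%E.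
  by rewrite adde_ge0// mule_ge0// lee_fin// mid_ge0.
have H0 x : (0 <= H x)%E by rewrite adde_ge0.
have m2 := emeasurable_funD (mZ mid _ mO) (mZ (2 * CW * A) _ mD).
have mH : measurable_fun setT H := emeasurable_funD mS m2.
apply: (@le_trans _ _ (Y (fun x => C4%:E * H x)%E)).
  apply: (norm_ae_le bY (mZ _ _ mH) mI).
    move=> x; rewrite mule_ge0 ?lee_fin// integral_ge0// => z _.
    by rewrite lee_fin mulr_ge0// mulr_ge0// remainder_ge0.
  have := remainder_le mP heps bOm dom mf mG lf lG wp mrho rho_ge0 rho_le0 p1 W_mass.
  apply: filterS => x hx; have [Ox|Ox] := pselect (Om x); last first.
    by rewrite /remainder_integral indicE memNset// mul0e mule_ge0// lee_fin.
  rewrite /remainder_integral indicE mem_set// mul1e; apply: le_trans (hx Ox) _.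
  rewrite (EFinM (remainder_C n c eps p CW)) -muleA; apply: lee_wpmul2l.
    by rewrite lee_fin mulr_ge0 ?powR_ge0// mulr_ge0 ?powR_ge0.
  apply: le_trans (gdev_integral_le Ox) _; apply: lee_wpmul2l; first by rewrite lee_fin powR_ge0.
  by rewrite /H indicE mem_set// mule1.
have Dfin : (Y D < +oo)%E by rewrite /D va ltry.
have step : (Y H <= (potential_C n CW A * CM * a + (mid * y + 2 * CW * A * a))%:E)%E.
  apply: le_trans (norm_add bY mS m2) _; rewrite (EFinD (potential_C n CW A * CM * a)); apply: leeD.
    exact: (norm_potential_le mrho rho_ge0 rho_le0 rho_decr rho_mass mW W0 Wle0 Wdecr W_mass bY CM0 maxY mD D0 va).
  apply: le_trans (norm_add bY (mZ mid _ mO) (mZ (2 * CW * A) _ mD)) _.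
  by rewrite (norm_scale_real bY mid_ge0 mO yE) (norm_scale_real bY k0 mD va) EFinD.
exact: (norm_scale_ler bY C40 mH step).
Qed.

End one_weight.

End remainder_norm.

(** The shape required by the polar formulas: defined on the whole line, zero at nonpositive
    arguments and decreasing beyond. *)
Record radial_weight (R : realType) (n : nat) (rho : R -> R) : Prop := {
  weight_measurable : measurable_fun setT rho ;
  weight_ge0 : forall t, 0 <= rho t ;
  weight_le0 : forall t, t <= 0 -> rho t = 0 ;
  weight_decr : forall s t, 0 < s -> s <= t -> rho t <= rho s ;
  weight_mass : (\int[@lebesgue_measure R]_(r in `]0%R, +oo[) (rho r * r ^+ n)%:E = 1)%E }.

(** Halving the radius turns the weak inequality into the strict one of [tail_mass]. *)
Lemma weight_tail_le (R : realType) (n : nat) (rho : R -> R) (L dl t : R) :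
  radial_weight n rho -> 0 < L -> 0 < dl ->
  (\int[@lebesgue_measure R]_(r in `](dl / (2 * L))%R, +oo[) (rho r * r ^+ n)%:E <= (t / (area R n + 1))%:E)%E ->
  (\int[@lebesgue_rV R n]_h (rho (enorm h) * (dl <= L * enorm h)%R%:R)%:E <= t%:E)%E.
Proof.
move=> [mr r0 rl rd r1] L0 d0 ht; have d'0 : 0 < dl / (2 * L) by rewrite divr_gt0// mulr_gt0.
have A0 := area_ge0 R n; have me := @measurable_enorm_id R n.
have t0 : 0 <= t.
  have : (0 <= (t / (area R n + 1))%:E)%E.
    by apply: le_trans ht; apply: integral_ge0 => r /=; rewrite in_itv/= andbT => hr; rewrite lee_fin mulr_ge0// exprn_ge0// ltW// (lt_trans d'0).
  by rewrite lee_fin pmulr_lge0// invr_gt0 ltr_wpDl.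
apply: (@le_trans _ _ (\int[@lebesgue_rV R n]_h (rho (enorm h) * ((dl / (2 * L)) < enorm h)%R%:R)%:E)%E).
  apply: le_ge0_integral.
  - apply/measurable_EFinP; apply: measurable_funM; first exact: (measurableT_comp mr me).
    apply: (measurableT_comp (measurable_step dl)).
    by apply: measurable_funM => //; exact: measurable_cst.
  - apply/measurable_EFinP; apply: measurable_funM; first exact: (measurableT_comp mr me).
    rewrite (_ : (fun _ => _) = \1_[set h : 'rV[R]_n.+1 | dl / (2 * L) < enorm h]).
      by apply: measurable_indic; exact: measurable_superlevel.
    by apply/funext => h; rewrite indicE mem_setE.
  - by move=> h; rewrite lee_fin mulr_ge0.
  - move=> h; rewrite lee_fin ler_wpM2l//; have [hd|] := leP dl (L * enorm h) => //.
    suff -> : dl / (2 * L) < enorm h by [].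
    by rewrite ltr_pdivrMr ?mulr_gt0//; lra.
rewrite (tail_mass mr r0 rl rd r1 d'0).
apply: (@le_trans _ _ ((area R n)%:E * (t / (area R n + 1))%:E)%E).
  by apply: lee_wpmul2l => //; rewrite lee_fin.
rewrite -EFinM lee_fin mulrCA ler_piMr// ler_pdivrMr ?mul1r ?lerDl//.
by rewrite ltr_wpDl.
Qed.

(** Dividing by [a + 1] rather than [a] spares the case [a = 0]. *)
Lemma small_factor (R : realType) (a t : R) : 0 <= a -> 0 < t ->
  0 < t / (a + 1) /\ a * (t / (a + 1)) <= t.
Proof.
move=> a0 t0; have a1 : 0 < a + 1 by rewrite ltr_wpDl.
split; first by rewrite divr_gt0.
by rewrite mulrCA ler_piMr ?(ltW t0)// ler_pdivrMr// mul1r lerDl.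
Qed.

(** * Passage to the limit in the convexified norm *)

Section limit.
Context (R : realType) (n : nat).
Local Notation d := n.+1.
Local Notation V := 'rV[R]_d.
Local Notation mu := (@lebesgue_rV R n).
Local Notation lam := (@lebesgue_measure R).
Variables (Om : set V) (eps : R).
Hypotheses (heps : 0 < eps <= 1) (bOm : bounded_set Om) (dom : eps_infty_domain eps Om).
Variables (f : V -> R) (G : V -> V).
Hypotheses (mf : measurable_fun setT f) (mG : mcoord G).
Hypotheses (lf : locally_integrable_rV Om f)
  (lG : forall i, locally_integrable_rV Om (fun z => G z 0 i)) (wp : weak_pair Om f G).
Variable p : R.
Hypothesis p1 : 1 <= p.
Variable Y : (V -> \bar R) -> \bar R.
Hypothesis bY : ball_Banach Y.
Variable CM : R.
Hypotheses (CM0 : 0 <= CM) (maxY : forall w : V -> \bar R, in_space (associate Y) w ->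
  (associate Y (maximal_rV w) <= CM%:E * associate Y w)%E).
Hypothesis acnY : forall (B : V -> \bar R) (E : nat -> set V),
  measurable_fun setT B -> (forall x, 0 <= B x)%E -> (Y B < +oo)%E ->
  (forall j, measurable (E j)) ->
  {ae mu, forall x, (\1_(E j) x : R) @[j --> \oo] --> (0 : R)%R} ->
  forall eta : R, (0 < eta)%R -> exists N, forall j, (N <= j)%N ->
    (Y (fun x => B x * (\1_(E j) x)%:E) <= eta%:E)%E.
Hypothesis YG : (Y (fun z => (\1_Om z * gsum G z `^ p)%:E) < +oo)%E.
Variable rho : R -> R -> R.
Hypothesis rhoW : \forall nu \near 0^'+, radial_weight n (rho nu).
Hypothesis rhoC : forall dl t : R, 0 < dl -> 0 < t -> \forall nu \near 0^'+,
  (\int[lam]_(r in `]dl, +oo[) (rho nu r * r ^+ n)%:E <= t%:E)%E.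

Let oOm : open Om. Proof. by case: dom. Qed.
Let mOm : measurable Om. Proof. exact: measurable_open. Qed.

(** The order of the choices matters: the accuracy [t1] fixes the field [v] and with it [M] and [L];
    these fix the radius [dl] and the admissible tail [tl]; only then is [nu] taken small. *)
Lemma small_remainder (t : R) : 0 < t ->
  \forall nu \near 0^'+, (Y (remainder_integral Om f G p (rho nu)) <= t%:E)%E.
Proof.
move=> t0; have [P [eta [c mP]]] := exists_mollifier R.
have L0 := chain_Lam_gt0 n heps; have [CW CW0 W_mass] := wfun_integrable n L0.
have t3 : 0 < t / 3 by rewrite divr_gt0.
pose K0 := remainder_C n c eps p CW * 4 `^ p.
pose y := fine (Y (fun z => (\1_Om z : R)%:E)).
(* [K1], [K2] and [K3] are the coefficients of [a], of the power of [L * dl] and of [tl] in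
   [remainder_norm_le]; absolute values spare a discussion of signs. *)
pose K1 := `|K0 * (potential_C n CW (area R n) * CM + 2 * CW * area R n)|.
have [t1 K1t] := small_factor (normr_ge0 (K0 * (potential_C n CW (area R n) * CM + 2 * CW * area R n))) t3.
have [v [M [L [M0 L_ge0 mv vML va]]]] := exists_approximant mP bY p1 oOm bOm mG acnY YG t1.
have mg : measurable_fun setT (fun z => (gdev Om G (v z) z `^ p)%:E).
  apply/measurable_EFinP; apply: (measurableT_comp (measurable_powR p)).
  exact: (measurable_gdev mOm mG (@measurable_id _ _ _) mv).
have Y0 := norm_ge0 bY mg.
have [a a0 [Ya at1]] : exists2 a, 0 <= a & Y (fun z => (gdev Om G (v z) z `^ p)%:E) = a%:E /\ a <= t / 3 / (K1 + 1).
  move: Y0 va; case: (Y _) => [a| |]//; rewrite !lee_fin => a0 at_; by exists a.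
pose K2 := `|K0 * y * (2 * CW * area R n)|.
have [s1 K2s] := small_factor (normr_ge0 (K0 * y * (2 * CW * area R n))) t3.
pose K3 := `|K0 * y * (M `^ p * (2 * CW))|.
have [tl0 K3t] := small_factor (normr_ge0 (K0 * y * (M `^ p * (2 * CW)))) t3.
set tl := t / 3 / (_ + 1) in tl0 K3t; set s := t / 3 / (_ + 1) in s1 K2s.
(* Makes the power [p] of [L * dl] at most [s]; the [+ 1] covers [L = 0]. *)
pose dl := s `^ p^-1 / (L + 1).
have Lp : 0 < L + 1 by rewrite ltr_wpDl.
have dl0 : 0 < dl by rewrite divr_gt0// powR_gt0.
have p0 : 0 < p := lt_le_trans ltr01 p1.
have Ldl : (L * dl) `^ p <= s.
  rewrite -[leRHS](powRr1 (ltW s1)) -(mulVf (lt0r_neq0 p0)) powRrM ge0_ler_powR ?nnegrE ?(ltW p0)//.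
  - by rewrite mulr_ge0// ltW.
  - exact: powR_ge0.
  - rewrite /dl mulrCA ler_piMr ?powR_ge0// ler_pdivrMr// mul1r lerDl//.
have Lam1 : 0 < chain_Lam n eps + 1 by rewrite addr_gt0.
have A1 : 0 < area R n + 1 by rewrite ltr_wpDl// area_ge0.
have two0 : (0 : R) < 2 by rewrite ltr0n.
have h1 := rhoC (divr_gt0 dl0 (mulr_gt0 two0 Lam1)) (divr_gt0 tl0 A1).
move: rhoW h1; apply: filterS2 => nu rw tailnu.
have [mr r0 rl rd r1] := rw.
have rm := radial_mass mr r0 rl rd r1.
have tE := weight_tail_le rw Lam1 dl0 tailnu.
have vM x z : gsum (fun w => v w - v x) z <= M by have [] := vML x z.
have vL x z : gsum (fun w => v w - v x) z <= L * enorm (z - x) by have [] := vML x z.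
have := remainder_norm_le mP heps bOm dom mf mG lf lG wp p1 W_mass bY CM0 maxY mr r0 rl rd rm L_ge0 mv vM vL tE Ya.
move=> /le_trans; apply; rewrite lee_fin /mid -/K0 -/y.
have {K1t} e1 : K0 * (potential_C n CW (area R n) * CM + 2 * CW * area R n) * a <= t / 3.
  apply: le_trans K1t; apply: (@le_trans _ _ (K1 * a)); first by rewrite ler_wpM2r// ler_norm.
  by rewrite ler_wpM2l// normr_ge0.
have e2 : K0 * y * (2 * CW * area R n) * (L * dl) `^ p <= t / 3.
  apply: le_trans K2s; apply: (@le_trans _ _ (K2 * (L * dl) `^ p)).
    by rewrite ler_wpM2r ?powR_ge0// ler_norm.
  by rewrite ler_wpM2l// normr_ge0.
have e3 : K0 * y * (M `^ p * (2 * CW)) * tl <= t / 3.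
  by apply: le_trans K3t; rewrite ler_wpM2r ?ler_norm// ltW.
apply: (@le_trans _ _ (t / 3 + t / 3 + t / 3)); last by lra.
apply: le_trans (lerD (lerD e1 e2) e3); rewrite le_eqVlt; apply/orP; left; apply/eqP; ring.
Qed.

(** The power [p] of the nonlocal gradient, with both variables confined to the domain by
    indicators, so that integrals run over the whole space. *)
Definition nonlocal_integral (rho : R -> R) (x : V) : \bar R :=
  ((\1_Om x : R)%:E * \int[mu]_y
     (\1_Om y * (`|f x - f y| `^ p / enorm (x - y) `^ p * rho (enorm (x - y))))%:E)%E.

Definition linear_integral (rho : R -> R) (x : V) : \bar R :=
  ((\1_Om x : R)%:E * \int[mu]_y (\1_Om y * (linear_part p (G x) x y * rho (enorm (x - y))))%:E)%E.

Let gp (x : V) : \bar R := (\1_Om x * enorm (G x) `^ p)%:E.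

Section one_weight.
Variable rh : R -> R.
Hypothesis rw : radial_weight n rh.
Let mr := weight_measurable rw.
Let r0 := weight_ge0 rw.

Let kern (T : V -> V -> R) (x y : V) : R :=
  \1_Om y * (`|T x y| `^ p / enorm (x - y) `^ p * rh (enorm (x - y))).

Let kern_ge0 T x y : 0 <= kern T x y.
Proof. by rewrite mulr_ge0// mulr_ge0// mulr_ge0 ?powR_ge0// invr_ge0 powR_ge0. Qed.

Let measurable_kern (T : V -> V -> R) : measurable_fun setT (fun z : V * V => T z.1 z.2) ->
  measurable_fun setT (fun z : V * V => (kern T z.1 z.2)%:E).
Proof.
move=> mT; apply/measurable_EFinP; apply: measurable_funM.
  by apply: (measurableT_comp _ measurable_snd); exact: measurable_indic.
have md := measurable_dist (@measurable_fst _ _ V V) (@measurable_snd _ _ V V).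
apply: measurable_funM; last exact: (measurableT_comp mr md).
apply: measurable_funM; first by apply: (measurableT_comp (measurable_powR p)); exact: measurableT_comp.
apply: (measurableT_comp (@measurable_invr R)).
exact: (measurableT_comp (measurable_powR p) md).
Qed.

Let kint (T : V -> V -> R) (x : V) : \bar R := ((\1_Om x : R)%:E * \int[mu]_y (kern T x y)%:E)%E.

Let measurable_kint T : measurable_fun setT (fun z : V * V => T z.1 z.2) -> measurable_fun setT (kint T).
Proof.
move=> mT; apply: emeasurable_funM; first by apply/measurable_EFinP; exact: measurable_indic.
apply: (@measurable_integral _ _ _ _ (fun x y => (kern T x y)%:E)) => [|x y].
  exact: measurable_kern.
by rewrite lee_fin kern_ge0.
Qed.

Let kint_ge0 T x : (0 <= kint T x)%E.
Proof. by apply: mule_ge0; [rewrite lee_fin|apply: integral_ge0 => y _; rewrite lee_fin kern_ge0]. Qed.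

(** In place of Minkowski's inequality: the main term gets the factor [(1 + tau)^p], as close to 1
    as desired, and the large factor falls on the term that will tend to 0. *)
Let kint_split (T1 T2 T3 : V -> V -> R) (tau : R) (x : V) : 0 < tau ->
  measurable_fun setT (fun z : V * V => T1 z.1 z.2) ->
  measurable_fun setT (fun z : V * V => T2 z.1 z.2) ->
  measurable_fun setT (fun z : V * V => T3 z.1 z.2) ->
  (forall y, `|T1 x y| <= `|T2 x y| + `|T3 x y|) ->
  (kint T1 x <= ((1 + tau) `^ p)%:E * kint T2 x + ((1 + tau^-1) `^ p)%:E * kint T3 x)%E.
Proof.
move=> tau0 m1 m2 m3 h; rewrite /kint !(muleCA _ (\1_Om x)%:E).
have i0 : (0 <= (\1_Om x : R)%:E)%E by rewrite lee_fin.
have c1 : (0 <= (((1 + tau) `^ p))%:E)%E by rewrite lee_fin powR_ge0.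
have c2 : (0 <= (((1 + tau^-1) `^ p))%:E)%E by rewrite lee_fin powR_ge0.
have sl T : measurable_fun setT (fun z : V * V => T z.1 z.2) -> measurable_fun setT (fun y => (kern T x y)%:E).
  by move=> /measurable_kern mT; exact: (measurableT_comp mT (measurable_pair1 x)).
have k0 T y : (0 <= (kern T x y)%:E)%E by rewrite lee_fin kern_ge0.
have I0 T : (0 <= \int[mu]_y (kern T x y)%:E)%E by exact: integral_ge0.
rewrite -ge0_muleDr; [|by rewrite mule_ge0|by rewrite mule_ge0].
apply: (lee_wpmul2l i0).
have a1 := emeasurable_funM (measurable_cst (((1 + tau) `^ p))%:E) (sl _ m2).
have a2 := emeasurable_funM (measurable_cst (((1 + tau^-1) `^ p))%:E) (sl _ m3).
rewrite -(ge0_integralcM (sl _ m2) (k0 T2) c1) -(ge0_integralcM (sl _ m3) (k0 T3) c2).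
rewrite -(ge0_integral_add a1 a2 (fun y => mule_ge0 c1 (k0 T2 y)) (fun y => mule_ge0 c2 (k0 T3 y))).
apply: (le_ge0_integral (sl _ m1) (emeasurable_funD a1 a2) (k0 T1)) => y.
rewrite -!EFinM -EFinD lee_fin /kern !(mulrCA _ (\1_Om y)) -mulrDr ler_wpM2l// !mulrA -mulrDl.
rewrite ler_wpM2r// -mulrDl ler_wpM2r ?invr_ge0 ?powR_ge0//.
apply: le_trans (powR_add_le p1 tau0 (normr_ge0 (T2 x y)) (normr_ge0 (T3 x y))).
exact: powR_le.
Qed.

Let T1 (x y : V) : R := f x - f y.
Let T2 (x y : V) : R := dotv (G x) (x - y).
Let T3 (x y : V) : R := f x - f y - dotv (G x) (x - y).

Let m1 : measurable_fun setT (fun z : V * V => T1 z.1 z.2).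
Proof. by apply: measurable_funB; [exact: (measurableT_comp mf measurable_fst)|exact: (measurableT_comp mf measurable_snd)]. Qed.

Let m2 : measurable_fun setT (fun z : V * V => T2 z.1 z.2).
Proof.
rewrite /T2 /dotv; apply: measurable_sum => i; apply: measurable_funM.
  exact: (measurableT_comp (mG i) measurable_fst).
have := mcoordB (mcoord_comp (@measurable_fst _ _ V V)) (mcoord_comp (@measurable_snd _ _ V V)).
exact.
Qed.

Let m3 : measurable_fun setT (fun z : V * V => T3 z.1 z.2).
Proof. exact: measurable_funB. Qed.

Lemma measurable_nonlocal_integral : measurable_fun setT (nonlocal_integral rh).
Proof. exact: measurable_kint m1. Qed.

Lemma nonlocal_integral_ge0 x : (0 <= nonlocal_integral rh x)%E.
Proof. exact: (kint_ge0 T1). Qed.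

Lemma nonlocal_integral_le (tau : R) x : 0 < tau ->
  (nonlocal_integral rh x <= ((1 + tau) `^ p)%:E * linear_integral rh x +
     ((1 + tau^-1) `^ p)%:E * remainder_integral Om f G p rh x)%E.
Proof.
move=> tau0; apply: (kint_split tau0 m1 m2 m3) => y.
by rewrite /T3 -/(T1 x y) -/(T2 x y) addrC -{1}(subrK (T2 x y) (T1 x y)); exact: ler_normD.
Qed.

Lemma linear_integral_le (tau : R) x : 0 < tau ->
  (linear_integral rh x <= ((1 + tau) `^ p)%:E * nonlocal_integral rh x +
     ((1 + tau^-1) `^ p)%:E * remainder_integral Om f G p rh x)%E.
Proof.
move=> tau0; apply: (kint_split tau0 m2 m1 m3) => y.
rewrite /T3 -/(T1 x y) -/(T2 x y) -(normrN (_ - T2 x y)) opprB.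
by rewrite -{1}(subrKC (T1 x y) (T2 x y)); exact: ler_normD.
Qed.

Lemma measurable_linear_integral : measurable_fun setT (linear_integral rh).
Proof. exact: measurable_kint m2. Qed.

Lemma linear_integral_ge0 x : (0 <= linear_integral rh x)%E.
Proof. exact: (kint_ge0 T2). Qed.

Variables (e1 : V) (g tau t : R).
Hypotheses (unit_e1 : enorm e1 = 1) (Yg : Y gp = g%:E) (tau0 : 0 < tau)
  (Yrem : (Y (remainder_integral Om f G p rh) <= t%:E)%E).
Local Notation k := (fine (kappa p e1)).

Let k0 : 0 <= k. Proof. exact: kappa_ge0. Qed.

Let mgp : measurable_fun setT gp.
Proof.
apply/measurable_EFinP; apply: measurable_funM; first exact: measurable_indic.
by apply: (measurableT_comp (measurable_powR p)); exact: measurable_enorm.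
Qed.

Let gp0 x : (0 <= gp x)%E. Proof. by rewrite lee_fin mulr_ge0// powR_ge0. Qed.

Let mrem : measurable_fun setT (remainder_integral Om f G p rh).
Proof. by apply: (measurable_remainder_integral (eps := eps)) => //; exact: lt_le_trans ltr01 p1. Qed.

Let mZ (q : R) (F : V -> \bar R) : measurable_fun setT F -> measurable_fun setT (fun x => q%:E * F x)%E.
Proof. by move=> mF; exact: (emeasurable_funM (measurable_cst _) mF). Qed.

Lemma norm_nonlocal_le :
  (Y (nonlocal_integral rh) <= ((1 + tau) `^ p * (k * g) + (1 + tau^-1) `^ p * t)%:E)%E.
Proof.
have ml := measurable_linear_integral.
apply: le_trans (norm_ae_le bY (emeasurable_funD (mZ ((1 + tau) `^ p) ml) (mZ ((1 + tau^-1) `^ p) mrem))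
  measurable_nonlocal_integral nonlocal_integral_ge0 _) _.
  by apply: nearW => x; exact: nonlocal_integral_le.
apply: le_trans (norm_add bY (mZ _ ml) (mZ _ mrem)) _; rewrite EFinD; apply: leeD; last first.
  exact: (norm_scale_ler bY (powR_ge0 _ _) mrem Yrem).
apply: (norm_scale_ler bY (powR_ge0 _ _) ml).
rewrite -(norm_scale_real bY k0 mgp Yg).
apply: (norm_ae_le bY (mZ _ mgp) ml linear_integral_ge0); apply: nearW => x.
rewrite /linear_integral /gp -EFinM mulrCA EFinM; apply: lee_wpmul2l; first by rewrite lee_fin.
rewrite mulrC; have [_ _ rl rd r1] := rw; exact: (linear_part_le p1 unit_e1 mOm mr r0 rl rd r1).
Qed.

(** The polar lower bound holds at the points of [inner Om m]. The part of the gradient outside is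
    added as the term in [t2], and the mass lost in the tail of the weight as the term in [th]. *)
Lemma le_norm_nonlocal (m : nat) (dl th t2 u : R) : 0 < dl -> dl < harm R m ->
  (\int[lam]_(r in `]dl, +oo[) (rh r * r ^+ n)%:E <= th%:E)%E ->
  (Y (fun x => gp x * (\1_(~` inner Om m) x : R)%:E) <= t2%:E)%E ->
  Y (nonlocal_integral rh) = u%:E ->
  k * g <= (1 + tau) `^ p * u + (1 + tau^-1) `^ p * t + (k * th * g + k * t2).
Proof.
move=> dl0 dlm hth Y2 Yu.
have th0 : 0 <= th.
  rewrite -lee_fin; apply: le_trans hth; apply: integral_ge0 => r /=; rewrite in_itv/= andbT => hr.
  by rewrite lee_fin mulr_ge0// exprn_ge0// ltW// (lt_trans dl0).
have ml := measurable_linear_integral; have mn := measurable_nonlocal_integral.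
have kth0 : 0 <= k * th by rewrite mulr_ge0.
have mi : measurable_fun setT (fun x => gp x * (\1_(~` inner Om m) x : R)%:E)%E.
  apply: (emeasurable_funM mgp); apply/measurable_EFinP; apply: measurable_indic.
  by apply: measurable_open; apply: closed_openC; exact: closed_inner.
have mgi := emeasurable_funD (mZ (k * th) mgp) (mZ k mi).
rewrite -lee_fin -(norm_scale_real bY k0 mgp Yg).
apply: le_trans (norm_ae_le bY (emeasurable_funD ml mgi) (mZ _ mgp) _ _) _.
- by move=> x; rewrite mule_ge0// lee_fin.
- apply: nearW => x; have gx0 : 0 <= enorm (G x) `^ p by exact: powR_ge0.
  have q1 : (0 <= (k * th)%:E * gp x)%E by apply: mule_ge0; [rewrite lee_fin|exact: gp0].
  have q2 : (0 <= k%:E * (gp x * (\1_(~` inner Om m) x : R)%:E))%E.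
    by apply: mule_ge0; [rewrite lee_fin|apply: mule_ge0; [exact: gp0|rewrite lee_fin]].
  have q12 := adde_ge0 q1 q2; have l0 := linear_integral_ge0 x.
  have [Ox|Ox] := pselect (Om x); last first.
    have gz : gp x = 0%E by rewrite /gp indicE memNset// mul0r.
    by rewrite {1}gz mule0; exact: adde_ge0.
  have [ix|ix] := pselect (inner Om m x); last first.
    have -> : (\1_(~` inner Om m) x : R) = 1 by rewrite indicE mem_set.
    by rewrite mule1 addeA leeDr//; exact: adde_ge0.
  have [_ _ rl rd r1] := rw.
  have h := le_linear_part p1 unit_e1 mOm mr r0 rl rd r1 (G x) dl0 dlm ix.
  have -> : (\1_(~` inner Om m) x : R) = 0 by rewrite indicE memNset// => /(_ ix).
  rewrite mule0 mule0 adde0 /linear_integral /gp indicE mem_set// mul1r mul1e.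
  apply: le_trans (leeD2r _ h).
  apply: (@le_trans _ _ ((enorm (G x) `^ p * k)%:E * (1 - th%:E) + (k * th)%:E * (enorm (G x) `^ p)%:E)%E).
    by rewrite (_ : (1 - th%:E = (1 - th)%:E)%E)// -!EFinM -EFinD lee_fin; lra.
  apply: leeD2r; apply: lee_wpmul2l; first by rewrite lee_fin mulr_ge0.
  exact: leeB.
apply: le_trans (norm_add bY ml mgi) _; rewrite EFinD; apply: leeD; last first.
  apply: le_trans (norm_add bY (mZ _ mgp) (mZ _ mi)) _; rewrite EFinD; apply: leeD.
    by rewrite (norm_scale_real bY kth0 mgp Yg).
  exact: (norm_scale_ler bY k0 mi Y2).
apply: le_trans (norm_ae_le bY (emeasurable_funD (mZ ((1 + tau) `^ p) mn) (mZ ((1 + tau^-1) `^ p) mrem))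
  ml linear_integral_ge0 _) _.
  by apply: nearW => x; exact: linear_integral_le.
apply: le_trans (norm_add bY (mZ _ mn) (mZ _ mrem)) _; rewrite EFinD; apply: leeD; last first.
  exact: (norm_scale_ler bY (powR_ge0 _ _) mrem Yrem).
by rewrite (norm_scale_real bY (powR_ge0 _ _) mn Yu).
Qed.

End one_weight.

(** Four errors of at most [s / 4] each: the factor [1 + sg], the remainder, the tail of the weight
    and the boundary layer. In the lower estimate the error [sg * u] is controlled by the upper
    estimate already obtained for [u]. *)
Lemma norm_nonlocal_near (e1 : V) (g s : R) : enorm e1 = 1 -> Y gp = g%:E -> 0 <= g -> 0 < s ->
  \forall nu \near 0^'+, exists2 u, Y (nonlocal_integral (rho nu)) = u%:E &
    fine (kappa p e1) * g - s <= u <= fine (kappa p e1) * g + s.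
Proof.
move=> ue Yg g0 s0; have k0 := kappa_ge0 p e1; set k := fine _ in k0 *.
have kg0 : 0 <= k * g by exact: mulr_ge0.
have s4 : 0 < s / 4 by rewrite divr_gt0.
have kgs0 : 0 <= k * g + s by lra.
have [] := small_factor kgs0 s4; set sg := s / 4 / (_ + 1) => sg0 hsg.
have p0 : 0 < p := lt_le_trans ltr01 p1.
(* So that the power [p] of [1 + tau] is exactly [1 + sg]. *)
pose tau := (1 + sg) `^ p^-1 - 1.
have tau0 : 0 < tau.
  have : (1 : R) `^ p^-1 < (1 + sg) `^ p^-1.
    by apply: gt0_ltr_powR; rewrite ?invr_gt0 ?nnegrE//; lra.
  by rewrite /tau subr_gt0 powR1.
have tauE : (1 + tau) `^ p = 1 + sg by rewrite subrKC -powRrM mulVf ?gt_eqF// powRr1//; lra.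
have [t0 ht] := small_factor (powR_ge0 (1 + tau^-1) p) s4.
have [th0 hth] := small_factor kg0 s4; have [t20 ht2] := small_factor k0 s4.
set t := s / 4 / ((1 + tau^-1) `^ p + 1) in t0 ht; set th := s / 4 / (k * g + 1) in th0 hth.
set t2 := s / 4 / (k + 1) in t20 ht2.
have mgp : measurable_fun setT gp.
  apply/measurable_EFinP; apply: measurable_funM; first exact: measurable_indic.
  by apply: (measurableT_comp (measurable_powR p)); exact: measurable_enorm.
have gp0 x : (0 <= gp x)%E by rewrite lee_fin mulr_ge0// powR_ge0.
have YgF : (Y gp < +oo)%E by rewrite Yg ltry.
(* Intersected with the domain, these sets have indicators tending to 0 everywhere; the product with
   [gp], which vanishes outside the domain, is unchanged. *)
have mE m : measurable (Om `&` ~` inner Om m).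
  by apply: measurableI => //; apply: measurable_open; apply: closed_openC; exact: closed_inner.
have E0 : {ae mu, forall x, (\1_(Om `&` ~` inner Om m) x : R) @[m --> \oo] --> (0 : R)}.
  apply: nearW => x; have [Ox|Ox] := pselect (Om x); last first.
    by apply: cvg_near_cst; exists 0%N => // m _; rewrite indicE memNset// => -[].
  have [r r_gt0 rO] := open_eball oOm Ox; have [N hN] := harm_lt r_gt0.
  apply: cvg_near_cst; exists N => // m /= Nm; rewrite indicE memNset// => -[_]; apply => y yx.
  apply: rO; rewrite /eball/=; apply: lt_trans hN; apply: lt_le_trans yx _.
  by rewrite /harm lef_pV2 ?posrE// ler_nat.
(* The boundary layer on which the gradient has norm at most [t2] is fixed before [nu]. *)
have [m hm] := acnY mgp gp0 YgF mE E0 t20.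
have YE : (Y (fun x => gp x * (\1_(~` inner Om m) x : R)%:E) <= t2%:E)%E.
  apply: le_trans (hm m (leqnn m)); rewrite le_eqVlt; apply/orP; left; apply/eqP; congr Y.
  apply/funext => x; rewrite indicI /gp; case: (pselect (Om x)) => Ox.
    by rewrite /= [\1_Om x]indicE mem_set// !mul1r.
  by rewrite [\1_Om x]indicE memNset// !mul0r !mul0e.
pose dl := harm R m / 2; have hm0 := harm_gt0 R m.
have dl0 : 0 < dl by rewrite divr_gt0.
have dlm : dl < harm R m by rewrite /dl; lra.
have n1 := small_remainder t0; have n2 := rhoC dl0 th0.
move: rhoW n1 n2; apply: filterS3 => nu rw Yrem Yth.
have up := norm_nonlocal_le rw ue Yg tau0 Yrem.
have u0 := norm_ge0 bY (measurable_nonlocal_integral rw).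
have [u Yu] : exists u, Y (nonlocal_integral (rho nu)) = u%:E.
  by move: u0 up; case: (Y _) => [u| |]//; exists u.
exists u => //; have lo := le_norm_nonlocal rw ue Yg tau0 Yrem dl0 dlm Yth YE Yu.
move: up; rewrite Yu lee_fin => up; rewrite -/k tauE in up lo.
have h1 : sg * (k * g) <= s / 4.
  by apply: le_trans hsg; rewrite mulrC ler_wpM2r ?(ltW sg0)//; lra.
have uu : u <= k * g + s by lra.
have h2 : sg * u <= s / 4 by apply: le_trans hsg; rewrite mulrC ler_wpM2r ?(ltW sg0).
have h3 : k * th * g <= s / 4 by rewrite mulrAC.
by apply/andP; split; lra.
Qed.

End limit.

(** Neighbourhoods of the limit are pulled back by the inverse power; when the limit minus [e] is
    nonpositive only the upper bound is at stake. *)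
Lemma cvg_poweR_near (R : realType) (F : R -> \bar R) (l q : R) : 0 <= l -> 0 < q ->
  (\forall nu \near 0^'+, (0 <= F nu)%E) ->
  (forall s, 0 < s -> \forall nu \near 0^'+, exists2 u, F nu = u%:E & l - s <= u <= l + s) ->
  (F nu `^ q @[nu --> 0^'+] --> (l `^ q)%:E)%E.
Proof.
move=> l0 q0 F0 Fl; have q1 : 0 < q^-1 by rewrite invr_gt0.
have up (a b : R) : 0 <= a -> 0 <= b -> a <= b -> a `^ q <= b `^ q.
  by move=> a0 b0 ab; apply: ge0_ler_powR; rewrite ?nnegrE ?(ltW q0).
have K (a : R) : 0 <= a -> (a `^ q^-1) `^ q = a.
  by move=> a0; rewrite -powRrM mulVf ?gt_eqF// powRr1.
have root_lt (a b : R) : 0 <= a -> a < b -> a `^ q^-1 < b `^ q^-1.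
  by move=> a0 ab; apply: gt0_ltr_powR; rewrite ?nnegrE// ltW// (le_lt_trans a0).
have lK : (l `^ q) `^ q^-1 = l by rewrite -powRrM mulfV ?gt_eqF// powRr1.
apply/fine_cvgP; split.
  move: (Fl _ ltr01); apply: filterS => nu [u -> _].
  by rewrite poweR_EFin.
apply/cvgrPdist_le => e e0.
have lq0 := powR_ge0 l q.
have hi : l < (l `^ q + e) `^ q^-1 by rewrite -{1}lK; apply: root_lt => //; lra.
have [lo|lo] := leP (l `^ q - e) 0.
  have s0 : 0 < (l `^ q + e) `^ q^-1 - l by rewrite subr_gt0.
  move: F0 (Fl _ s0); apply: filterS2 => nu /[swap] -[u Fu /andP[_ hu]].
  rewrite Fu lee_fin => u0; rewrite /= Fu poweR_EFin/= ler_distlC.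
  have : u `^ q <= l `^ q + e.
    rewrite -[leRHS]K ?addr_ge0 ?(ltW e0)//; apply: up => //; first exact: powR_ge0.
    by move: hu; rewrite subrKC.
  by have := powR_ge0 u q => h1 h2; apply/andP; split; lra.
have lol : (l `^ q - e) `^ q^-1 < l by rewrite -{2}lK; apply: root_lt; lra.
have s0 : 0 < Num.min ((l `^ q + e) `^ q^-1 - l) (l - (l `^ q - e) `^ q^-1).
  by rewrite lt_min !subr_gt0 hi lol.
move: F0 (Fl _ s0); apply: filterS2 => nu /[swap] -[u Fu /andP[hl hu]].
rewrite Fu lee_fin => u0; rewrite /= Fu poweR_EFin/= ler_distlC.
have h1 : u <= (l `^ q + e) `^ q^-1.
  by apply: le_trans hu _; rewrite -lerBrDl ge_min lexx.
have h2 : (l `^ q - e) `^ q^-1 <= u.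
  by apply: le_trans hl; rewrite lerBrDr -lerBrDl ge_min lexx orbT.
apply/andP; split.
  by rewrite -[leLHS]K ?(ltW lo)//; apply: up => //; exact: powR_ge0.
rewrite -[leRHS]K ?addr_ge0 ?(ltW e0)//; apply: up => //; exact: powR_ge0.
Qed.

(** * Weights extended to the line, and functions cut off to the domain *)

Lemma integral_eq_tail (R : realType) (n : nat) (a : R) (r1 r2 : R -> R) : 0 <= a ->
  (forall t, 0 < t -> r1 t = r2 t) ->
  (\int[@lebesgue_measure R]_(r in `]a, +oo[) (r1 r * r ^+ n)%:E =
   \int[@lebesgue_measure R]_(r in `]a, +oo[) (r2 r * r ^+ n)%:E)%E.
Proof.
move=> a0 h; apply: eq_integral => r; rewrite inE/= in_itv/= andbT => ar.
by rewrite h// (le_lt_trans a0).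
Qed.

Section patched_weight.
Context (R : realType) (n : nat) (nu0 : R) (rho : R -> R -> R).
Hypotheses (nu0_gt0 : 0 < nu0) (ap : radial_decreasing_approximation n.+1 nu0 rho).

(** The approximation of the identity is constrained at positive arguments only; the value 0
    elsewhere makes it a [radial_weight]. *)
Definition patched (nu t : R) : R := if 0 < t then rho nu t else 0.

Lemma patchedE nu t : 0 < t -> patched nu t = rho nu t.
Proof. by rewrite /patched => ->. Qed.

Lemma near_nu0 : \forall nu \near 0^'+, 0 < nu < nu0.
Proof.
near=> nu; apply/andP; split; near: nu; first exact: nbhs_right_gt.
exact: nbhs_right_lt.
Unshelve. all: by end_near.
Qed.

Lemma radial_weight_patched nu : 0 < nu < nu0 -> radial_weight n (patched nu).
Proof.
move=> nuI; split.
- have [mr _ _] := approx_loc ap nuI.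
  rewrite (_ : patched nu = (rho nu) \_ (`]0, +oo[%classic)).
    by apply/(measurable_restrictT _ _).1.
  apply/funext => t; rewrite /patched patchE; case: ifPn => t0.
    by rewrite mem_set//= in_itv/= t0.
  by rewrite memNset//= in_itv/= (negbTE t0).
- by move=> t; rewrite /patched; case: ifPn => // t0; exact: (approx_ge0 ap).
- by move=> t t0; rewrite /patched ltNge t0.
- move=> s t s0 st; rewrite !patchedE ?(lt_le_trans s0)//.
  exact: (approx_decreasing ap).
- by rewrite -(approx_mass ap nuI); apply: integral_eq_tail => // t; exact: patchedE.
Qed.

Lemma near_radial_weight : \forall nu \near 0^'+, radial_weight n (patched nu).
Proof. by apply: filterS near_nu0 => nu; exact: radial_weight_patched. Qed.

Lemma patched_tail (dl t : R) : 0 < dl -> 0 < t -> \forall nu \near 0^'+,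
  (\int[@lebesgue_measure R]_(r in `]dl, +oo[) (patched nu r * r ^+ n)%:E <= t%:E)%E.
Proof.
move=> dl0 t0; have /fine_cvgP[h1 /cvgrPdist_le/(_ _ t0) h2] := approx_concentration ap dl0.
move: h1 h2; apply: filterS2 => nu hf.
rewrite sub0r normrN => /(le_trans (ler_norm _)); rewrite -lee_fin/= fineK//.
by rewrite (integral_eq_tail n (ltW dl0) (@patchedE nu)).
Qed.

End patched_weight.

Section cutoff.
Context (R : realType) (n : nat).
Local Notation V := 'rV[R]_n.+1.
Local Notation mu := (@lebesgue_rV R n).
Variable Om : set V.
Hypothesis mOm : measurable Om.

Lemma measurable_cutoff (g : V -> R) : measurable_fun Om g ->
  measurable_fun setT (fun x => \1_Om x * g x).
Proof.
move=> mg; rewrite (_ : (fun _ => _) = g \_ Om); first by apply/(measurable_restrictT _ _).1.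
by apply/funext => x; rewrite patchE indicE; case: ifPn => _; rewrite ?mul1r ?mul0r.
Qed.

Lemma locally_integrable_eq (g h : V -> R) : (forall x, Om x -> g x = h x) ->
  locally_integrable_rV Om g -> locally_integrable_rV Om h.
Proof.
move=> gh [mg lg]; split.
  by apply: eq_measurable_fun mg => x; rewrite inE => /gh.
move=> K KO cK; apply: le_lt_trans (lg K KO cK); rewrite le_eqVlt; apply/orP; left; apply/eqP.
by apply: eq_integral => x; rewrite inE => /KO/gh ->.
Qed.

Lemma weak_pair_eq (f g : V -> R) (F G : V -> V) : (forall x, Om x -> f x = g x) ->
  (forall x, Om x -> F x = G x) -> weak_pair Om f F -> weak_pair Om g G.
Proof.
move=> fg FG wp i u u' a b su du u0 abO.
have := wp i u u' a b su du u0 abO; rewrite /Rintegral => h.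
transitivity (fine (\int[mu]_(z in Om) (f z * prodfun (subst u i u') z)%:E)).
  by congr fine; apply: eq_integral => z; rewrite inE => /fg ->.
rewrite h; congr (- fine _).
by apply: eq_integral => z; rewrite inE => /FG ->.
Qed.

Lemma norm_sum_fin (X : (V -> \bar R) -> \bar R) (I : Type) (s : seq I) (F : I -> V -> R) :
  ball_Banach X -> (forall i, measurable_fun setT (F i)) ->
  (forall i, (X (fun x => (F i x)%:E) < +oo)%E) ->
  (X (fun x => (\sum_(i <- s) F i x)%:E) < +oo)%E.
Proof.
move=> bX mF XF; elim: s => [|i s IH].
  rewrite (_ : (fun x => _) = (fun=> 0%E)); first by rewrite (norm_zero bX) ltry.
  by apply/funext => x; rewrite big_nil.
rewrite (_ : (fun x => _) = (fun x => (F i x)%:E + (\sum_(j <- s) F j x)%:E)%E); last first.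
  by apply/funext => x; rewrite big_cons EFinD.
apply: le_lt_trans (norm_add bX _ _) _; last by rewrite lte_add_pinfty.
- exact/measurable_EFinP.
- by apply/measurable_EFinP; apply: measurable_sum.
Qed.

End cutoff.

(** Membership in the Sobolev space provides some weak derivatives with extensions in [X];
    uniqueness of weak derivatives transfers this to the given [G]. *)
Lemma gradient_norm_fin (R : realType) (n : nat) (Om : set 'rV[R]_n.+1)
    (X : ('rV[R]_n.+1 -> \bar R) -> \bar R) (f : 'rV[R]_n.+1 -> R)
    (G : 'rV[R]_n.+1 -> 'rV[R]_n.+1) :
  open Om -> bounded_set Om -> ball_Banach X ->
  homogeneous_Sobolev X Om f -> weak_gradient Om f G ->
  in_space X (fun x => (\sum_i \1_Om x * `|G x 0 i|)%:E).
Proof.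
move=> oOm bOm bX [_ sf] wG; have [P [eta [c mP]]] := exists_mollifier R.
have mOm := measurable_open oOm.
have mi i : measurable_fun setT (fun x => \1_Om x * `|G x 0 i|).
  apply: (measurable_cutoff mOm); apply: (measurableT_comp _ (wG i).1.1).
  exact: normr_measurable.
split; first by apply/measurable_EFinP; apply: measurable_sum.
have := norm_sum_fin (index_enum _) (F := fun i x => \1_Om x * `|G x 0 i|) bX mi; apply => i.
have [g wg [_ [h [mh Xh] gh]]] := sf i.
apply: le_lt_trans Xh; apply: (qnorm_lattice (ball_Banach_quasi bX) mh).
  exact/measurable_EFinP.
move: gh (weak_partial_unique mP oOm bOm (wG i) wg); apply: filterS2 => x hx gx.
have [Ox|Ox] := pselect (Om x); last by rewrite indicE memNset// mul0r abse0.
by rewrite indicE mem_set// mul1r gx// -hx//= normr_id.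
Qed.

Theorem theorem4p2 (R : realType) (n : nat)
    (Omega : set 'rV[R]_n.+1) (eps nu0 p : R) (rho : R -> R -> R)
    (X : ('rV[R]_n.+1 -> \bar R) -> \bar R)
    (heps : 0 < eps <= 1) (hnu0 : 0 < nu0) (hp : 1 <= p)
    (bounded_Omega : bounded_set Omega)
    (domain_Omega : eps_infty_domain eps Omega)
    (approx_rho : radial_decreasing_approximation n.+1 nu0 rho)
    (banach_X : ball_Banach X)
    (acn_X : absolutely_continuous_norm X)
    (banach_Xp : ball_Banach (convexification p^-1 X))
    (maximal_Xp : maximal_bounded (associate (convexification p^-1 X)))
    (f : 'rV[R]_n.+1 -> R) (grad_f : 'rV[R]_n.+1 -> 'rV[R]_n.+1)
    (sobolev_f : homogeneous_Sobolev X Omega f)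
    (gradient_f : weak_gradient Omega f grad_f)
    (e : 'rV[R]_n.+1) (unit_e : enorm e = 1) :
  restrict_norm X Omega (nonlocal_gradient Omega p (rho nu) f)
      @[nu --> 0^'+] -->
    (kappa p e `^ p^-1 * restrict_norm X Omega (fun x => (enorm (grad_f x))%:E))%E
  /\
  kappa p e = (2 * pi `^ ((n.+1%:R - 1) / 2) * Gamma ((p + 1) / 2)
                 / Gamma ((p + n.+1%:R) / 2))%:E.
Proof.
split; last exact: kappa_formula.
have p0 : 0 < p := lt_le_trans ltr01 hp.
have oOm : open Omega by case: domain_Omega.
have mOm := measurable_open oOm.
pose Y := convexification p^-1 X.
(* Values outside [Omega] are arbitrary; the cut-offs are measurable on the whole space and agree
   with the data on [Omega]. *)
pose f' x := \1_Omega x * f x.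
pose G x := \1_Omega x *: grad_f x.
have fE x : Omega x -> f x = f' x by move=> Ox; rewrite /f' indicE mem_set// mul1r.
have GE x : Omega x -> grad_f x = G x by move=> Ox; rewrite /G indicE mem_set// scale1r.
have lf := sobolev_f.1.
have lG i : locally_integrable_rV Omega (fun x => grad_f x 0 i) := (gradient_f i).1.
have mf : measurable_fun setT f' := measurable_cutoff mOm lf.1.
have mG : mcoord G.
  move=> i; have h := measurable_cutoff mOm (lG i).1.
  rewrite (_ : (fun x => G x 0 i) = (fun x => \1_Omega x * grad_f x 0 i)); first exact: h.
  by apply/funext => x; rewrite mxE.
have lf' := locally_integrable_eq fE lf.
have lG' i : locally_integrable_rV Omega (fun x => G x 0 i).
  by apply: (locally_integrable_eq _ (lG i)) => x Ox; rewrite -GE.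
have wp := weak_pair_eq fE GE (weak_pair_gradient gradient_f).
have [C maxC] := maximal_Xp.
(* The constant of [maximal_Xp] carries no sign condition. *)
have CM0 : 0 <= Num.max C 0 by rewrite le_max lexx orbT.
have maxY w : in_space (associate Y) w -> (associate Y (maximal_rV w) <= (Num.max C 0)%:E * associate Y w)%E.
  move=> /maxC /le_trans; apply; apply: lee_wpmul2r; first exact: associate_ge0.
  by rewrite lee_fin le_max lexx.
have acnY := convexification_acn banach_X acn_X hp.
(* Finiteness is known for the sum of the absolute values of the partial derivatives, which
   dominates the Euclidean norm in [gp]. *)
pose gs x : R := \1_Omega x * gsum G x `^ p.
have gsE x : (gs x)%:E = (`|(\sum_i \1_Omega x * `|grad_f x 0 i|)%:E| `^ p)%E.
  rewrite abse_EFin poweR_EFin /gs; congr (_%:E).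
  have [Ox|Ox] := pselect (Omega x).
    rewrite [\1_Omega x]indicE mem_set// mul1r ger0_norm; last by apply: sumr_ge0 => i _; rewrite mul1r.
    by congr (_ `^ _); apply: eq_bigr => i _; rewrite -GE// mul1r.
  rewrite [\1_Omega x]indicE memNset// mul0r big1 ?normr0 ?powR0 ?gt_eqF// => i _.
  by rewrite mul0r.
have YG : (Y (fun x => (gs x)%:E) < +oo)%E.
  rewrite (_ : (fun _ => _) = fun x => (`|(\sum_i \1_Omega x * `|grad_f x 0 i|)%:E| `^ p)%E).
    exact: (convexification_fin banach_X hp (gradient_norm_fin oOm bounded_Omega banach_X sobolev_f gradient_f)).
  by apply/funext => x; exact: gsE.
pose gp x : R := \1_Omega x * enorm (G x) `^ p.
have mgp : measurable_fun setT (fun x => (gp x)%:E).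
  apply/measurable_EFinP; apply: measurable_funM; first exact: measurable_indic.
  by apply: (measurableT_comp (measurable_powR p)); exact: measurable_enorm.
have mgs : measurable_fun setT (fun x => (gs x)%:E).
  apply/measurable_EFinP; apply: measurable_funM; first exact: measurable_indic.
  apply: (measurableT_comp (measurable_powR p)); apply: measurable_sum => i.
  exact: measurableT_comp.
have gpgs : (Y (fun x => (gp x)%:E) <= Y (fun x => (gs x)%:E))%E.
  apply: (norm_ae_le banach_Xp mgs mgp) => [x|]; first by rewrite lee_fin mulr_ge0// powR_ge0.
  apply: nearW => x; rewrite lee_fin ler_wpM2l//; apply: powR_le => //; first exact: enorm_ge0.
  exact: enorm_le_sum.
have [g g0 Yg] : exists2 g, 0 <= g & Y (fun x => (gp x)%:E) = g%:E.
  have := norm_ge0 banach_Xp mgp; move: (le_lt_trans gpgs YG).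
  by rewrite -/Y; case: (Y _) => [g| |]// _ g0; exists g.
have near_lim s : 0 < s -> _ := fun s0 => norm_nonlocal_near heps bounded_Omega domain_Omega
  mf mG lf' lG' wp hp banach_Xp CM0 maxY acnY YG
  (near_radial_weight hnu0 approx_rho) (patched_tail approx_rho) unit_e Yg g0 s0.
have k0 := kappa_ge0 p e; set k := fine _ in k0 near_lim.
have RE : (kappa p e `^ p^-1 * restrict_norm X Omega (fun x => (enorm (grad_f x))%:E))%E =
    ((k * g) `^ p^-1)%:E.
  have E0 x : ((enorm (grad_f x))%:E * (\1_Omega x)%:E)%E = (\1_Omega x * enorm (G x))%:E.
    rewrite -EFinM mulrC indicE; have [/set_mem Ox|_] := boolP (x \in Omega); last by rewrite !mul0r.
    by rewrite GE.
  have mE : measurable_fun setT (fun x => (\1_Omega x * enorm (G x))%:E).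
    by apply/measurable_EFinP; apply: measurable_funM; [exact: measurable_indic|exact: measurable_enorm].
  rewrite (restrict_normE banach_X); last 2 first.
  - by under eq_fun do rewrite E0.
  - by move=> x; rewrite lee_fin enorm_ge0.
  under [F in X F]eq_fun do rewrite E0.
  rewrite (norm_convexification banach_X hp mE); last by move=> x; rewrite lee_fin mulr_ge0// enorm_ge0.
  rewrite (_ : (fun x => _ `^ p)%E = fun x => (gp x)%:E); last first.
    apply/funext => x; rewrite poweR_EFin /gp indicE; case: (_ \in _); rewrite ?mul1r//.
    by rewrite !mul0r powR0 ?gt_eqF.
  by rewrite -/Y Yg (kappa_unit hp unit_e unit_e) !poweR_EFin -EFinM -powRM.
rewrite RE.
apply: cvg_trans (cvg_poweR_near (F := fun nu => Y (nonlocal_integral Omega f' p (patched rho nu)))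
  (mulr_ge0 k0 g0) _ _ near_lim); last 2 first.
- by rewrite invr_gt0.
- apply: filterS (near_radial_weight hnu0 approx_rho) => nu rw.
  by apply: (norm_ge0 banach_Xp); exact: (measurable_nonlocal_integral domain_Omega mf p rw).
apply: near_eq_cvg; apply: filterS (near_nu0 hnu0) => nu /(radial_weight_patched approx_rho) rw.
have mN := measurable_nonlocal_integral domain_Omega mf p rw.
have N0 := nonlocal_integral_ge0 Omega f' p rw.
pose H x : \bar R := (nonlocal_integral Omega f' p (patched rho nu) x `^ p^-1)%E.
have mH : measurable_fun setT H := measurable_poweRf p^-1 mN.
have HE x : (nonlocal_gradient Omega p (rho nu) f x * (\1_Omega x)%:E)%E = H x.
  rewrite /H /nonlocal_integral /nonlocal_gradient indicE.
  have [/set_mem Ox|_] := boolP (x \in Omega); last by rewrite mule0 mul0e poweR_EFin powR0 ?invr_eq0 ?gt_eqF.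
  rewrite mule1 mul1e; congr (_ `^ _)%E; rewrite integral_mkcond; apply: eq_integral => y _.
  rewrite patchE indicE; have [/set_mem Oy|_] := boolP (y \in Omega); last by rewrite mul0r.
  rewrite mul1r -!fE//; congr (_%:E).
  (* On the diagonal the patched weight may differ from [rho nu], but the numerator vanishes
     there. *)
  have [->|xy] := eqVneq x y; first by rewrite subrr normr0 powR0 ?gt_eqF// !mul0r.
  by rewrite patchedE// enorm_gt0 subr_eq0.
rewrite (restrict_normE banach_X); last 2 first.
- by under eq_fun do rewrite HE.
- by move=> x; exact: poweR_ge0.
under [F in _ = X F]eq_fun do rewrite HE.
rewrite (norm_convexification banach_X hp mH); last by move=> x; exact: poweR_ge0.
congr (_ `^ _)%E; congr (Y _); apply/funext => x.
by rewrite /H (poweRVK hp)// N0.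
Qed.
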